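(* Let $N\in[1,\infty)$, let $(X,d,\mu)$ be an $RCD^\ast(0,N)$ space and let $p_t(x,y)$ be its heat kernel. Then for $\mu$-a.e. $x,y\in X$ and each $t>0$, $$|\nabla_x\log p_t(x,y)|^2-\frac{\partial}{\partial t}\log p_t(x,y)\le\frac{N}{2t}.$$
   Context: Standing assumptions: $(X,d)$ is a connected, complete and separable metric space and $\mu$ is a locally finite, $\sigma$-finite Borel measure on $X$ with $\operatorname{supp}\mu=X$. Sobolev spaces: $|\nabla f|$ denotes the minimal weak upper gradient of $f$ (in the sense of Cheeger, Shanmugalingam, Ambrosio–Gigli–Savaré), and $|\nabla_x \log p_t(x,y)|$ that of $x\mapsto \log p_t(x,y)$; $W^{1,2}(X)$ is the space of $f\in L^2(X)$ with $|\nabla f|\in L^2(X)$, with norm $(\|f\|_{L^2(X)}^2+\||\nabla f|\|_{L^2(X)}^2)^{1/2}$. $W^{1,2}_{\mathrm{loc}}(X)$ consists of $f$ with $\chi f\in W^{1,2}(X)$ for all compactly supported Lipschitz $\chi$; $W^{1,2}_c(X)$ consists of the compactly supported elements of $W^{1,2}(X)$. A proper space $(X,d,\mu)$ is infinitesimally Hilbertian if $W^{1,2}(X)$ is a Hilbert space; then $\langle\nabla f,\nabla g\rangle:=\inf_{\varepsilon>0}\frac{|\nabla(g+\varepsilon f)|^2-|\nabla g|^2}{2\varepsilon}$ ($\mu$-essential infimum). Laplacian: $f\in W^{1,2}_{\mathrm{loc}}(X)$ has $\Delta f=h\in L^1_{\mathrm{loc}}(X)$ if $\int_X\langle\nabla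 f,\nabla\psi\rangle\,d\mu=-\int_X h\psi\,d\mu$ for all $\psi\in W^{1,2}_c(X)$. Heat flow: $H_t=e^{t\Delta}$ is the (linear) heat semigroup generated by the Dirichlet form $\int_X\langle\nabla f,\nabla \psi\rangle\,d\mu$, with heat kernel $p_t(x,y)$ (continuous representative), i.e. $H_tf(x)=\int_X p_t(x,y)f(y)\,d\mu(y)$. $RCD^\ast(K,N)$ ($K\in\mathbb R$, $N\in[1,\infty)$): $(X,d,\mu)$ is infinitesimally Hilbertian and for all $f\in W^{1,2}(X)$, $t>0$, $$|\nabla H_tf|^2+\frac{4Kt^2}{N(e^{2Kt}-1)}|\Delta H_tf|^2\le e^{-2Kt}H_t(|\nabla f|^2)\quad\mu\text{-a.e.}$$ (the coefficient being $2t/N$ for $K=0$). *)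

(* Defs.v *)
From HB Require Import structures.
From mathcomp Require Import all_boot all_order all_algebra.
From mathcomp Require Import all_classical all_reals all_analysis.
Set Implicit Arguments.
Unset Strict Implicit.
Unset Printing Implicit Defensive.
Import Order.TTheory GRing.Theory Num.Theory.
Import numFieldNormedType.Exports.
Local Open Scope classical_set_scope.
Local Open Scope ring_scope.

HB.mixin Record Metric_isBorel (R : realType) (d : measure_display) X
    & Metric R X & Measurable d X := {
  borelE : @measurable d X = <<s [set U : set X | open U] >>
}.

#[short(type="borelMetricType")]
HB.structure Definition BorelMetric (R : realType) (d : measure_display) :=
  { X of Metric R X & Measurable d X & Metric_isBorel R d X }.

Section curves.
Context {R : realType} {d : measure_display} (X : borelMetricType R d).

(* Only the restriction of a curve to [0, 1] matters: neither the sigma-algebra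
   below nor any later definition depends on its values elsewhere. *)
Definition curve : Type :=
  {g : R -> X | {within `[0%R, 1%R], continuous g}}.

Definition curve_fun (g : curve) : R -> X := sval g.
Coercion curve_fun : curve >-> Funclass.

Lemma cst_curve_subproof :
  {within `[(0 : R), 1], continuous (fun _ : R => (point : X))}.
Proof. by move=> x; exact: cvg_cst. Qed.

HB.instance Definition _ := gen_eqMixin curve.
HB.instance Definition _ := gen_choiceMixin curve.
HB.instance Definition _ := isPointed.Build curve (exist _ _ cst_curve_subproof).

(* As X is separable, the sigma-algebra generated by the evaluations e_t is the
   Borel sigma-algebra of C([0, 1], X) with the supremum distance. *)
Definition evaluation_sets : set (set curve) :=
  [set E | exists t : R, exists A : set X,
     [/\ 0 <= t <= 1, measurable A & E = [set g : curve | A (g t)]]].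

Definition path_space := g_sigma_algebraType evaluation_sets.

(* AC^2([0, 1], X) *)
Definition abs_continuous2 (g : R -> X) : Prop :=
  exists f : R -> R, [/\ measurable_fun (`[0, 1] : set R) f,
    (\int[lebesgue_measure]_(r in `[0%R, 1%R]) ((f r ^+ 2)%:E) < +oo)%E &
    forall s t : R, 0 <= s -> s <= t -> t <= 1 ->
      ((mdist (g s) (g t))%:E
        <= \int[lebesgue_measure]_(r in `[s, t]) (f r)%:E)%E].

(* The metric derivative; for an absolutely continuous curve the limsup is a
   limit at almost every t. *)
Definition metric_speed (g : R -> X) (t : R) : \bar R :=
  limf_esup (fun h : R => (mdist (g (t + h)) (g t) / `|h|)%:E) 0^'.

Definition kinetic_energy (g : R -> X) : \bar R :=
  if `[< abs_continuous2 g >]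
  then (\int[lebesgue_measure]_(t in `[0%R, 1%R])
          (metric_speed g t * metric_speed g t))%E
  else +oo%E.

End curves.

Section sobolev.
Context {R : realType} {d : measure_display} {X : borelMetricType R d}.
Variable mu : {measure set X -> \bar R}.
Implicit Types (f g h k G : X -> R) (t : R).

Definition compactly_supported f : Prop :=
  compact (closure [set x | f x != 0]).

(* Compact support of a function that is defined up to mu-null sets. *)
Definition ae_compactly_supported f : Prop :=
  exists2 C : set X, compact C & {ae mu, forall x, ~ C x -> f x = 0}.

Definition metric_lipschitz f : Prop :=
  exists L : R, forall x y, `|f x - f y| <= L * mdist x y.

Definition L1loc f : Prop :=
  measurable_fun setT f /\
  forall x, \forall r \near 0^'+,
    (\int[mu]_(y in ball x r) `|f y|%:E < +oo)%E.

Definition L2loc f : Prop :=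
  measurable_fun setT f /\
  forall x, \forall r \near 0^'+,
    (\int[mu]_(y in ball x r) ((f y ^+ 2)%:E) < +oo)%E.

Definition test_plan (pi : probability (path_space X) R) : Prop :=
  (exists C : R, forall t (A : set X), 0 <= t <= 1 -> measurable A ->
     (pi [set g : curve X | A (g t)] <= C%:E * mu A)%E) /\
  (\int[pi]_(g in [set: path_space X])
     kinetic_energy (g : curve X) < +oo)%E.

(* Weak upper gradients through test plans (Ambrosio--Gigli--Savare); the
   condition only depends on the mu-a.e. classes of f and G. *)
Definition weak_upper_gradient f G : Prop :=
  [/\ measurable_fun setT f, measurable_fun setT G, (forall x, 0 <= G x) &
    forall pi : probability (path_space X) R, test_plan pi ->
      (\int[pi]_(g in [set: path_space X])
          `|f ((g : curve X) 1) - f ((g : curve X) 0)|%:E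
       <= \int[pi]_(g in [set: path_space X])
            \int[lebesgue_measure]_(t in `[0%R, 1%R])
              ((G ((g : curve X) t))%:E * metric_speed (g : curve X) t))%E].

Definition minimal_weak_upper_gradient f G : Prop :=
  [/\ L2loc G, weak_upper_gradient f G &
    forall G', L2loc G' -> weak_upper_gradient f G' ->
      {ae mu, forall x, G x <= G' x}].

(* |grad f|, a choice of representative; the default value is irrelevant as soon
   as f has a weak upper gradient in L^2_loc. *)
Definition norm_grad f : X -> R :=
  xget (fun _ => 0) [set G | minimal_weak_upper_gradient f G].

Definition W12 f : Prop :=
  f \in Lfun mu 2%:E /\
  exists G, G \in Lfun mu 2%:E /\ weak_upper_gradient f G.

Definition W12loc f : Prop :=
  forall chi : X -> R, metric_lipschitz chi -> compactly_supported chi ->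
    W12 (fun x => chi x * f x).

Definition W12c f : Prop := W12 f /\ ae_compactly_supported f.

Definition W12_norm f : R :=
  Num.sqrt (\int[mu]_x (f x ^+ 2) + \int[mu]_x (norm_grad f x ^+ 2)).

Definition W12_hilbert : Prop :=
  (exists ip : (X -> R) -> (X -> R) -> R,
     [/\ (forall f g, W12 f -> W12 g -> ip f g = ip g f),
         (forall (a : R) f g h, W12 f -> W12 g -> W12 h ->
            ip (fun x => a * f x + g x) h = a * ip f h + ip g h) &
         (forall f, W12 f -> ip f f = W12_norm f ^+ 2)]) /\
  (forall u : nat -> X -> R, (forall n, W12 (u n)) ->
     (forall e : R, 0 < e -> exists n0 : nat, forall m n : nat,
        (n0 <= m)%N -> (n0 <= n)%N ->
        W12_norm (fun x => u m x - u n x) < e) ->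
     exists f, W12 f /\
       (W12_norm (fun x => u n x - f x) @[n --> \oo] --> (0 : R))).

Definition proper_space : Prop :=
  forall (x : X) (r : R), compact [set y : X | mdist x y <= r].

Definition infinitesimally_hilbertian : Prop := proper_space /\ W12_hilbert.

(* The essential infimum of a family is a function (not a constant), determined
   up to mu-null sets. *)
Definition is_ess_inf_pos (F : R -> X -> R) h : Prop :=
  [/\ measurable_fun setT h,
      (forall eps : R, 0 < eps -> {ae mu, forall x, h x <= F eps x}) &
      (forall k, measurable_fun setT k ->
         (forall eps : R, 0 < eps -> {ae mu, forall x, k x <= F eps x}) ->
         {ae mu, forall x, k x <= h x})].

(* <grad f, grad g> *)
Definition grad_inner f g : X -> R :=
  xget (fun _ => 0) [set h | is_ess_inf_pos (fun eps x =>
    (norm_grad (fun z => g z + eps * f z) x ^+ 2 - norm_grad g x ^+ 2)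
      / (2 * eps)) h].

(* Delta f = h in the local sense. *)
Definition is_laplacian f h : Prop :=
  [/\ W12loc f, L1loc h & forall psi, W12c psi ->
    mu.-integrable setT (fun x => (h x * psi x)%:E) /\
    \int[mu]_x (grad_inner f psi x) = - \int[mu]_x (h x * psi x)].

(* The L^2 operator associated with the Dirichlet form. *)
Definition is_form_laplacian f h : Prop :=
  [/\ W12 f, h \in Lfun mu 2%:E & forall psi, W12 psi ->
    \int[mu]_x (grad_inner f psi x) = - \int[mu]_x (h x * psi x)].

(* H is (a choice of representatives of) the strongly continuous contraction
   semigroup on L^2 whose infinitesimal generator is is_form_laplacian.  Such a
   semigroup is unique up to mu-null sets, which is why it is quantified
   existentially in RCDstar and is_heat_kernel. *)
Definition is_heat_semigroup (H : R -> (X -> R) -> (X -> R)) : Prop :=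
  [/\ (forall t f, 0 <= t -> f \in Lfun mu 2%:E ->
         H t f \in Lfun mu 2%:E /\
         (Lnorm mu 2%:E (EFin \o H t f) <= Lnorm mu 2%:E (EFin \o f))%E),
      (forall t (a : R) f g, 0 <= t ->
         f \in Lfun mu 2%:E -> g \in Lfun mu 2%:E ->
         {ae mu, forall x,
            H t (fun z => a * f z + g z) x = a * H t f x + H t g x}),
      (forall f, f \in Lfun mu 2%:E ->
         {ae mu, forall x, H 0 f x = f x} /\
         forall s t, 0 <= s -> 0 <= t ->
           {ae mu, forall x, H (s + t) f x = H s (H t f) x}),
      (forall f, f \in Lfun mu 2%:E ->
         Lnorm mu 2%:E (EFin \o (fun x => H t f x - f x))
           @[t --> 0^'+] --> 0%E) &
      (forall f h, f \in Lfun mu 2%:E -> h \in Lfun mu 2%:E ->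
         (Lnorm mu 2%:E (EFin \o (fun x => (H t f x - f x) / t - h x))
            @[t --> 0^'+] --> 0%E)
         <-> is_form_laplacian f h)].

(* u = H_t g for g in L^1, where H_t is extended from L^1 /\ L^2 to L^1 by
   L^1-continuity (H_t is an L^1-contraction).  Needed since |grad f|^2 is only
   in L^1 for f in W^{1,2}. *)
Definition is_heat_L1 (H : R -> (X -> R) -> (X -> R)) t g u : Prop :=
  [/\ g \in Lfun mu 1%:E, u \in Lfun mu 1%:E &
    exists g_ : nat -> X -> R,
      [/\ (forall n, g_ n \in Lfun mu 1%:E /\ g_ n \in Lfun mu 2%:E),
          Lnorm mu 1%:E (EFin \o (fun x => g_ n x - g x))
            @[n --> \oo] --> 0%E &
          Lnorm mu 1%:E (EFin \o (fun x => H t (g_ n) x - u x))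
            @[n --> \oo] --> 0%E]].

Definition RCD_coef (K N t : R) : R :=
  if K == 0 then 2 * t / N
  else 4 * K * t ^+ 2 / (N * (expR (2 * K * t) - 1)).

(* h below is Delta H_t f and u is H_t(|grad f|^2); both are unique up to
   mu-null sets. *)
Definition RCDstar (K N : R) : Prop :=
  infinitesimally_hilbertian /\
  exists2 H, is_heat_semigroup H &
    forall f t, W12 f -> 0 < t ->
      exists h u, [/\ is_laplacian (H t f) h,
        is_heat_L1 H t (fun x => norm_grad f x ^+ 2) u &
        {ae mu, forall x,
          norm_grad (H t f) x ^+ 2 + RCD_coef K N t * h x ^+ 2
            <= expR (- (2 * K * t)) * u x}].

Definition is_heat_kernel (p : R -> X -> X -> R) : Prop :=
  (forall t, 0 < t -> continuous (fun z : X * X => p t z.1 z.2)) /\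
  exists2 H, is_heat_semigroup H &
    forall t f, 0 < t -> f \in Lfun mu 2%:E ->
      {ae mu, forall x,
        mu.-integrable setT (fun y => (p t x y * f y)%:E) /\
        H t f x = \int[mu]_y (p t x y * f y)}.

Definition complete_space : Prop :=
  forall F : set_system X, ProperFilter F -> cauchy F -> cvg F.

Definition separable_space : Prop :=
  exists2 D : set X, countable D & dense D.

Definition locally_finite : Prop :=
  forall x : X, exists2 U : set X, open U /\ U x & (mu U < +oo)%E.

Definition measure_support : set X :=
  [set x | forall U : set X, open U -> U x -> (0 < mu U)%E].

Definition metric_measure_space : Prop :=
  [/\ connected [set: X], complete_space & separable_space] /\
  [/\ locally_finite, sigma_finite setT mu & measure_support = setT].

End sobolev.

(* Main.v *)
Require Import Defs.
From HB Require Import structures.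
From mathcomp Require Import all_boot all_order all_algebra.
From mathcomp Require Import all_classical all_reals all_analysis measurable_realfun.
From mathcomp Require Import ring lra.
Set Implicit Arguments.
Unset Strict Implicit.
Unset Printing Implicit Defensive.
Import Order.TTheory GRing.Theory Num.Theory.
Import numFieldNormedType.Exports.
Local Open Scope classical_set_scope.
Local Open Scope ring_scope.

(** Under almost every curve of a test plan a function with a weak upper gradient satisfies the upper
gradient inequality on every rational subinterval; this gives chain rules, the minimal gradient and, with
infinitesimal hilbertianity, a bilinear carre du champ.  The heat semigroup is self-adjoint, unique and
Markovian, and the Bakry-Ledoux bound makes [u = P_s f] bounded with bounded gradient and Laplacian.
Applying that bound to [ln (1 + P_(t-s) f / dl)] over a short time shows that
[Y s = int P_(r+s) phi (|grad u|^2 / (u + dl) - Lap u)], where [u = P_(t-s) f], satisfies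
[Y' >= (2 / N M0) Y^2], so [Y 0 <= N M0 / (2 t)] by Riccati comparison; letting [r] and [dl] vanish,
[|grad u|^2 <= u Lap u + N / (2 t) u^2] for [u = P_t f].  With [f] tending to a Dirac mass this passes to the
kernel, which is positive: on the diagonal since [P_s phi >= phi - K sqrt s] for Lipschitz [phi], elsewhere
because [t |-> p t x y] is analytic and [X] is connected. *)

(** Only first-order calculus is set up, so [Y] is never differentiated by a formula. With
    [psi = P_(r+s) phi], the Bakry-Ledoux inequality over time [tau], tested against [psi (u + dl)],
    bounds the increment of [Y] from below by [tau] times a quantity with two terms that cancel in
    the limit: each is twice the integral of [|grad u|^2 / (u + dl)^2] against the divergence of
    [psi grad u]. What survives is the dimensional term. By Cauchy-Schwarz it is quadratic in [Y],
    and the mass in its denominator is bounded by [M0] uniformly in [s] because the semigroup is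
    self-adjoint. A lower Dini bound along sequences is then enough for the comparison. The shift
    [dl] keeps the logarithm smooth at zeros of [u], the delay [r] gives the test function a bounded
    Laplacian, and clamped representatives supply bounds at every point where the flow only has them
    almost everywhere. Analyticity in time enters through the smoothing bound [t |Lap P_t f| <= |f|]
    rather than through spectral theory. *)

Local Notation meas := (measurable_fun setT).
Local Notation m_itv := measurable_itv.
Local Notation mEFinP := measurable_EFinP.
Local Notation mT_comp := measurableT_comp.
Local Notation mfunM := measurable_funM.
Local Notation mfunTS := measurable_funTS.
Local Notation mfunB := measurable_funB.
Local Notation mfunX := measurable_funX.
Local Notation mfunD := measurable_funD.

Lemma eq_leW {disp : Order.disp_t} {T : porderType disp} (x y : T) : x = y -> (x <= y)%O.
Proof. by move=> ->. Qed.

(** * Almost everywhere statements and real integrals *)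

Section ae_tools.
Context d (T : measurableType d) (R : realType) (mu : {measure set T -> \bar R}).
Implicit Types P Q S : T -> Prop.
Lemma ae_imp P Q : {ae mu, forall x, P x} -> (forall x, P x -> Q x) ->
 {ae mu, forall x, Q x}.
Proof. by move=> p pq; move: p; apply: filterS; exact: pq. Qed.

Lemma ae_imp2 P Q S : {ae mu, forall x, P x} -> {ae mu, forall x, Q x} ->
 (forall x, P x -> Q x -> S x) -> {ae mu, forall x, S x}.
Proof. by move=> p q pqs; move: p q; apply: filterS2; exact: pqs. Qed.

Lemma ae_all (P : T -> Prop) : (forall x, P x) -> {ae mu, forall x, P x}.
Proof. by move=> h; exact: aeW. Qed.

End ae_tools.

Section integrable_real.
Context d (T : measurableType d) (R : realType) (mu : {measure set T -> \bar R}).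
Variables (D : set T) (mD : measurable D).
Implicit Types f g : T -> R.
Lemma integrD f g : mu.-integrable D (EFin \o f) ->
 mu.-integrable D (EFin \o g) -> mu.-integrable D (EFin \o (fun x => f x + g x)).
Proof. by move=> mf mg; exact: (integrableD mD mf mg). Qed.

Lemma integrB f g : mu.-integrable D (EFin \o f) ->
 mu.-integrable D (EFin \o g) -> mu.-integrable D (EFin \o (fun x => f x - g x)).
Proof. by move=> mf mg; exact: (integrableB mD mf mg). Qed.

Lemma integrZ (a : R) f : mu.-integrable D (EFin \o f) ->
 mu.-integrable D (EFin \o (fun x => a * f x)).
Proof. by move=> mf; exact: (integrableZl mD a mf). Qed.

Lemma integrable_dom f g : measurable_fun D f -> mu.-integrable D (EFin \o g) ->
 (forall x, D x -> `|f x| <= g x) -> mu.-integrable D (EFin \o f).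
Proof.
move=> mf ig fg; apply: le_integrable ig => //; first exact/mEFinP.
by move=> x Dx; rewrite lee_fin (le_trans (fg x Dx))// ler_norm.
Qed.

End integrable_real.

(** * Uniform partitions of the unit interval *)

Section partition.
Context {R : realType}.
Implicit Types (r : R) (n i : nat) (c : nat -> nat -> R).
Local Notation leb := (@lebesgue_measure R).
Definition cell n i : set R := `[i%:R / n.+1%:R, i.+1%:R / n.+1%:R[.

Lemma cellP n i r : 0 <= r -> (cell n i r <-> i = Num.trunc (r * n.+1%:R)).
Proof.
move=> r0; rewrite /cell /= in_itv /= ler_pdivrMr// ltr_pdivlMr//.
split=> [h|->]; first by rewrite (truncn_def h).
by apply: truncn_itv; rewrite mulr_ge0.
Qed.

Lemma cell_ex n r : 0 <= r < 1 -> exists2 i, (i < n.+1)%N & cell n i r.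
Proof.
move=> /andP[r0 r1]; exists (Num.trunc (r * n.+1%:R)); last exact/cellP.
by rewrite truncn_lt_nat ?mulr_ge0// gtr_pMl.
Qed.

Lemma cell_sub n i : (i < n.+1)%N -> cell n i `<=` `[0, 1[.
Proof.
move=> iN r; rewrite /cell /= !in_itv /= => /andP[r0 r1]; apply/andP; split.
 by apply: le_trans r0; rewrite divr_ge0.
by apply: (lt_le_trans r1); rewrite ler_pdivrMr// mul1r ler_nat.
Qed.

Lemma leb_cell n i : leb (cell n i) = (n.+1%:R^-1)%:E.
Proof.
rewrite lebesgue_measure_itv /= lte_fin ltr_pM2r ?invr_gt0// ltr_nat ltnSn.
by rewrite -EFinD -mulrBl -natrB// subSnn mul1r.
Qed.

Definition stepf c n r : R := \sum_(i < n.+1) c n i * \1_(cell n i) r.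

Lemma stepfE c n i r : (i < n.+1)%N -> cell n i r -> stepf c n r = c n i.
Proof.
move=> iN cr; have r0 : 0 <= r by have := cell_sub iN cr; rewrite /= => /andP[].
rewrite /stepf (bigD1 (Ordinal iN))//= indicE mem_set// mulr1 big1 ?addr0// => j ji.
rewrite indicE memNset ?mulr0// => /(cellP _ _ r0) jr.
by move/(cellP _ _ r0): cr => ir; move/eqP: ji; apply; apply: val_inj; rewrite /= jr.
Qed.

Lemma measurable_stepf c n : meas (stepf c n).
Proof.
apply: measurable_sum => i; apply: mfunM => //.
by apply: measurable_indic; exact: m_itv.
Qed.

Lemma integral_stepf c n : (forall i, 0 <= c n i) ->
 (\int[leb]_(r in `[0%R, 1%R[) (stepf c n r)%:E =
 (\sum_(i < n.+1) c n i / n.+1%:R)%:E)%E.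
Proof.
move=> c0; rewrite /stepf.
under eq_integral do rewrite -sumEFin.
rewrite ge0_integral_sum//=; last 2 first.
- move=> i; apply/mEFinP; apply: mfunTS.
 apply: mfunM => //.
 by apply: measurable_indic; exact: m_itv.
- by move=> i x _; rewrite lee_fin mulr_ge0.
rewrite -sumEFin; apply: eq_bigr => i _.
under eq_integral do rewrite EFinM.
rewrite ge0_integralZl_EFin//=; last first.
 apply/mEFinP; apply: mfunTS.
 by apply: measurable_indic; exact: m_itv.
rewrite integral_indic//; last exact: m_itv.
rewrite setIidl; last exact: cell_sub.
by rewrite EFinM; congr (_ * _)%E; exact: leb_cell.
Qed.

(** Fatou's lemma for the step functions with value [c n i] on [cell n i]: their lower limit
    dominates [k] almost everywhere, and the integral of the [n]-th one is the sum bounded by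
    [s]. *)
Lemma step_fatou c (k : R -> \bar R) (s : R) :
 (forall n i, 0 <= c n i) -> measurable_fun (`[0, 1[ : set R) k -> (forall r, 0 <= k r)%E ->
 {ae leb, forall r, 0 <= r < 1 -> forall e, 0 < e -> \forall n \near \oo,
  forall i, cell n i r -> (k r <= (c n i + e)%:E)%E} ->
 (forall n, \sum_(i < n.+1) c n i / n.+1%:R <= s) ->
 (\int[leb]_(r in `[0%R, 1%R[) k r <= s%:E)%E.
Proof.
move=> c0 mk k0 kc cs.
have mI : measurable (`[0, 1[ : set R) by exact: m_itv.
have mstep n : measurable_fun (`[0, 1[ : set R) (EFin \o stepf c n).
 by apply/mEFinP; apply: mfunTS; exact: measurable_stepf.
have step0 n r : 0 <= stepf c n r.
 by apply: sumr_ge0 => i _; rewrite mulr_ge0.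
have st n : (\int[leb]_(r in `[0%R, 1%R[) (stepf c n r)%:E <= s%:E)%E.
 by rewrite integral_stepf// lee_fin.
apply: (@le_trans _ _ (\int[leb]_(r in `[0%R, 1%R[)
  limn_einf (fun n => (stepf c n r)%:E)))%E; last first.
 apply: (le_trans (fatou leb mI mstep _)).
  by move=> n r _; rewrite lee_fin.
 rewrite limn_einf_lim; apply: lime_le; first exact: is_cvg_einfs.
 by apply: nearW => n; apply: le_trans (st n); apply: ereal_inf_lbound; exists n => /=.
apply: ae_ge0_le_integral => //.
- move=> r _; rewrite limn_einf_lim; apply: lime_ge; first exact: is_cvg_einfs.
 apply: nearW => n; apply: le_ereal_inf_tmp => _ [m _ <-]; by rewrite lee_fin.
- apply: (@emeasurable_fun_cvg _ _ _ _ (fun m x => einfs (fun n => (stepf c n x)%:E) m)).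
  by move=> m; exact: measurable_fun_einfs.
 by move=> x _; rewrite limn_einf_lim; exact: is_cvg_einfs.
apply: (ae_imp kc) => {}r {}kc; rewrite /= in_itv/= => rI.
apply/lee_addgt0Pr => e e0.
have [N _ HN] := kc rI e e0.
rewrite -leeBlDr// limn_einf_lim; apply: lime_ge; first exact: is_cvg_einfs.
exists N => // m /= Nm; apply: le_ereal_inf_tmp => _ [p /= mp <-].
have [i iN ci] := cell_ex p rI.
rewrite EFinN leeBlDr// (stepfE _ iN ci) -EFinD.
by apply: HN => //=; exact: leq_trans mp.
Qed.

(** The partition cell around [r], given by a floor so that it is defined for every real [r], as a
    nicely shrinking family has to be. *)
Definition cellZ n r : set R :=
 `[(Num.floor (r * n.+1%:R))%:~R / n.+1%:R, (Num.floor (r * n.+1%:R) + 1)%:~R / n.+1%:R[.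

Lemma cellZE n i r : 0 <= r -> cell n i r -> cellZ n r = cell n i.
Proof.
move=> r0 cr; rewrite /cellZ /cell; congr [set` _].
have -> : Num.floor (r * n.+1%:R) = i%:Z.
 apply: floor_def; move: cr; rewrite /cell/= in_itv/= ler_pdivrMr// ltr_pdivlMr//.
 by rewrite intrD natr1.
by rewrite intrD -!pmulrn natr1.
Qed.

Lemma nicely_shrinking_cellZ r : nicely_shrinking r (fun n => cellZ n r).
Proof.
split=> [n|]; first exact: m_itv.
have N0 n : 0 < 2 / n.+1%:R :> R by [].
(* The cell lies in the ball of radius [2 / (n + 1)], whose measure [4 / (n + 1)] is four times its
   own. *)
exists (4, fun n => PosNum (N0 n)); split => //=.
- rewrite -[X in _ --> X](mulr0 2); apply: cvgM; first exact: cvg_cst.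
 exact: cvg_harmonic.
- move=> n x; rewrite /cellZ/= in_itv/= => /andP[x0 x1].
 have /andP[h0 h1] := floor_itv (r * n.+1%:R).
 rewrite ler_pdivrMr// in x0; rewrite ltr_pdivlMr// in x1.
 rewrite /ball/= ltr_pdivlMr// -[n.+1%:R in X in X < _]gtr0_norm// -normrM ltr_norml.
 rewrite mulrBl; move: h0 h1 x0 x1; rewrite intrD => h0 h1 x0 x1.
 by apply/andP; split; lra.
- move=> n; rewrite lebesgue_measure_ball//.
 rewrite /cellZ lebesgue_measure_itv/= lte_fin ltr_pM2r ?invr_gt0// ltr_int ltrDl ltr01.
 rewrite -EFinD -mulrBl -intrB addrAC subrr mul1r lee_fin.
 by rewrite mulr2n -mulrDl ler_pM2r ?invr_gt0//; lra.
Qed.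

(** Cells shrink nicely to their points, so this is the Lebesgue differentiation theorem;
    quantifying over [i] spares naming the index that [r] determines. *)
Lemma cell_average (g : R -> R) : locally_integrable setT g ->
 {ae leb, forall r, 0 <= r -> forall e, 0 < e -> \forall n \near \oo,
  forall i, cell n i r -> `|n.+1%:R * \int[leb]_(x in cell n i) g x - g r| < e}.
Proof.
move=> lg; have := lebesgue_differentiation lg.
move=> /ae_imp; apply => r lr r0 e e0.
have := nice_lebesgue_differentiation nicely_shrinking_cellZ lg lr.
move=> /fine_cvgP[_] /cvgrPdist_lt /(_ e e0) [N _ HN]; exists N => // n /= Nn i ci.
have := HN n Nn; rewrite /= distrC (cellZE r0 ci).
have mc : lebesgue_measure (cell n i) = (n.+1%:R^-1)%:E by exact: leb_cell.
rewrite mc inver gt_eqF ?invr_gt0// invrK.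
rewrite /Rintegral; set I := (\int[_]_(_ in _) _)%E.
(* An infinite integral is sent to [0] by [fine] on both sides. *)
have -> : fine (n.+1%:R%:E * I) = n.+1%:R * fine I; last by [].
case: I => [x| |] //=; first by rewrite gt0_muley ?lte_fin// mulr0.
by rewrite gt0_muleNy ?lte_fin// mulr0.
Qed.

Lemma integral_partition (g : R -> R) n :
 leb.-integrable setT (EFin \o g) ->
 \sum_(i < n.+1) \int[leb]_(x in cell n i) g x = \int[leb]_(x in `[0%R, 1%R[) g x.
Proof.
move=> ig.
have igD (A : set R) : measurable A -> leb.-integrable A (EFin \o g).
 by move=> mA; exact: (integrableS measurableT).
have UE : `[0, 1[%classic = \big[setU/set0]_(i <- index_enum 'I_n.+1) cell n i.
 apply/seteqP; split => r /=; rewrite in_itv/= -bigcup_seq.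
  move=> /(cell_ex n)[i iN ci]; exists (Ordinal iN) => //=; exact: mem_index_enum.
 by move=> [i _ ci]; have := cell_sub (ltn_ord i) ci; rewrite /=.
rewrite /Rintegral UE integral_bigsetU_EFin//=; last 4 first.
- by move=> i; exact: m_itv.
- exact: index_enum_uniq.
- move=> i j _ _ [r [ci cj]].
 have r0 : 0 <= r by have := cell_sub (ltn_ord i) ci; rewrite /= => /andP[].
 by apply: val_inj => /=; move: ci cj => /(cellP _ _ r0) -> /(cellP _ _ r0) ->.
- rewrite -UE; apply: mfunTS; exact: measurable_int ig.
rewrite -[LHS]/(fine (_)%:E); congr fine.
rewrite -sumEFin; apply: eq_bigr => i _; rewrite fineK//.
apply: integrable_fin_num; first exact: m_itv.
by apply: igD; exact: m_itv.
Qed.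

(** A reverse Fatou lemma. The deficits [\int_cell g - D n i] are nonnegative, their averages are
    asymptotically at least [g - l], and they sum to at most [\int g - d01]; [step_fatou] applied to
    them gives [\int (g - l) <= \int g - d01]. *)
Lemma partition_bound_L1 (D : nat -> nat -> R) (d01 : R) (g l : R -> R) :
 leb.-integrable setT (EFin \o g) -> meas l ->
 (forall r, 0 <= l r <= g r) ->
 (forall n i, (i < n.+1)%N -> 0 <= D n i <= \int[leb]_(x in cell n i) g x) ->
 (forall n, d01 <= \sum_(i < n.+1) D n i) ->
 {ae leb, forall r, 0 <= r < 1 -> forall e, 0 < e -> \forall n \near \oo,
  forall i, (i < n.+1)%N -> cell n i r -> n.+1%:R * D n i <= l r + e} ->
 (d01%:E <= \int[leb]_(r in `[0%R, 1%R[) (l r)%:E)%E.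
Proof.
move=> ig ml lg Dg d01D Dl.
have mg : meas g by apply/mEFinP; exact: measurable_int ig.
have il : leb.-integrable setT (EFin \o l).
 apply: le_integrable ig => //; first exact/mEFinP.
 move=> r _ /=; have /andP[l0 l1] := lg r.
 by rewrite !ger0_norm//; exact: le_trans l1.
have igD (A : set R) f : leb.-integrable setT (EFin \o f) -> measurable A -> leb.-integrable A (EFin \o f).
 by move=> ? mA; exact: (integrableS measurableT).
pose c n i := if (i < n.+1)%N then n.+1%:R * (\int[leb]_(x in cell n i) g x - D n i) else 0.
have := @step_fatou c (fun r => (g r - l r)%:E) (\int[leb]_(x in `[0%R, 1%R[) g x - d01).
have lgi : locally_integrable setT g by apply: open_integrable_locally => //; exact: openT.
have H1 : (\int[leb]_(r in `[0%R, 1%R[) (g r - l r)%:E =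
 (\int[leb]_(x in `[0%R, 1%R[) g x - \int[leb]_(x in `[0%R, 1%R[) l x)%:E)%E.
 rewrite -RintegralB//; [|exact: igD|exact: igD].
 rewrite /Rintegral fineK//; apply: integrable_fin_num => //.
 by apply: integrB => //; exact: igD.
rewrite H1 lee_fin lerD2l lerN2 => main.
have <- : (\int[leb]_(x in `[0%R, 1%R[) l x)%:E = (\int[leb]_(x in `[0%R, 1%R[) (l x)%:E)%E.
 by rewrite /Rintegral fineK//; apply: integrable_fin_num => //; exact: igD.
rewrite lee_fin; apply: main.
- move=> n i; rewrite /c; case: ifP => // iN.
 by rewrite mulr_ge0// subr_ge0; have /andP[] := Dg _ _ iN.
- apply/mEFinP; apply: mfunTS; exact: mfunB.
- by move=> r; rewrite lee_fin subr_ge0; have /andP[] := lg r.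
- apply: (ae_imp2 Dl (cell_average lgi)) => r {}Dl avg r01 e e0.
 have e20 : 0 < e / 2 by rewrite divr_gt0.
 have /andP[r0 _] := r01.
 near=> n => i ci.
 have iN : (i < n.+1)%N.
  have [j jN cj] := cell_ex n r01.
  by move: ci cj jN => /(cellP _ _ r0) -> /(cellP _ _ r0) ->.
 rewrite /c iN lee_fin.
 have h1 : forall i, (i < n.+1)%N -> cell n i r -> n.+1%:R * D n i <= l r + e / 2.
  by near: n; exact: Dl.
 have h2 : forall i, cell n i r -> `|n.+1%:R * \int[leb]_(x in cell n i) g x - g r| < e / 2.
  by near: n; exact: avg.
 have := h1 i iN ci; have := h2 i ci; rewrite ltr_norml => /andP[]; lra.
- move=> n.
 rewrite (eq_bigr (fun i : 'I_n.+1 => \int[leb]_(x in cell n i) g x - D n i)); last first.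
  by move=> i _; rewrite /c ltn_ord mulrAC divff ?mul1r.
 by rewrite sumrB integral_partition// lerD2l lerN2; exact: d01D.
Unshelve. all: by end_near. Qed.

(** A quadratic bound replaces domination, for an [l] that may be infinite: truncating the
    increments at height [M] loses at most [C / M], because [x - min x M <= x^2 / M]. [step_fatou]
    is applied to [M] minus the truncated quantities, and [M] then tends to infinity. *)
Lemma partition_bound_L2 (D : nat -> nat -> R) (d01 C : R) (l : R -> \bar R) :
 measurable_fun (`[0, 1[ : set R) l -> (forall r, 0 <= l r)%E ->
 (forall n i, 0 <= D n i) ->
 (forall n, d01 <= \sum_(i < n.+1) D n i) ->
 (forall n, \sum_(i < n.+1) n.+1%:R * D n i ^+ 2 <= C) ->
 (forall r, 0 <= r < 1 -> forall e, 0 < e -> \forall n \near \oo,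
  forall i, cell n i r -> ((n.+1%:R * D n i)%:E <= l r + e%:E)%E) ->
 (d01%:E <= \int[leb]_(r in `[0%R, 1%R[) l r)%E.
Proof.
move=> ml l0 D0 d01D DC Dl.
have C0 : 0 <= C.
 by apply: le_trans (DC 0%N); apply: sumr_ge0 => i _; rewrite mulr_ge0// sqr_ge0.
have key (M : R) : 0 < M -> (d01%:E <= \int[leb]_(r in `[0%R, 1%R[) l r + (C / M)%:E)%E.
 move=> M0.
 pose k r := (M%:E - mine (l r) M%:E)%E.
 have mlk : measurable_fun (`[0, 1[ : set R) (fun r => mine (l r) M%:E).
  by apply: measurable_mine => //; exact: measurable_cst.
 have m0 r : (0 <= mine (l r) M%:E)%E by rewrite le_min l0 ltW.
 have mM r : (mine (l r) M%:E <= M%:E)%E by rewrite ge_min lexx orbT.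
 have mfin r : mine (l r) M%:E \is a fin_num.
  by rewrite ge0_fin_numE//; apply: le_lt_trans (mM r) _; rewrite ltry.
 have k0 r : (0 <= k r)%E by rewrite /k sube_ge0 ?mfin.
 have mk : measurable_fun (`[0, 1[ : set R) k.
  by apply: emeasurable_funB => //; exact: measurable_cst.
 pose c n i := M - Num.min (n.+1%:R * D n i) M.
 have := @step_fatou c k (M - (d01 - C / M)).
 have H : (\int[leb]_(r in `[0%R, 1%R[) k r + \int[leb]_(r in `[0%R, 1%R[) mine (l r) M%:E = M%:E)%E.
  rewrite -ge0_integralD//.
  under eq_integral do rewrite /k subeK//.
  rewrite integral_cst//= lebesgue_measure_itv/= lte01 -EFinB subr0 mule1//.
 have H2 : (\int[leb]_(r in `[0%R, 1%R[) mine (l r) M%:E <= \int[leb]_(r in `[0%R, 1%R[) l r)%E.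
  by apply: ge0_le_integral => // r _; rewrite ge_min lexx.
 move=> main.
 have {}main : (\int[leb]_(r in `[0%R, 1%R[) k r <= (M - (d01 - C / M))%:E)%E.
  apply: main => //.
  - by move=> n i; rewrite /c subr_ge0 ge_min lexx orbT.
  - apply: ae_all => r r01 e e0; near=> n => i ci.
   have : ((n.+1%:R * D n i)%:E <= l r + e%:E)%E.
    by move: i ci; near: n; exact: Dl.
   rewrite /k /c; move: (mfin r) (mM r) (l0 r).
   case: (l r) => [x| |] //=; rewrite ?lee_fin.
    rewrite -EFin_min !lee_fin => _ _ _ h.
    have [h1|h1] := leP (n.+1%:R * D n i) M; have [h2|h2] := leP x M; lra.
   move=> _ _ _ _.
   have [h1|h1] := leP (n.+1%:R * D n i) M; lra.
  - move=> n.
   have : \sum_(i < n.+1) D n i <= \sum_(i < n.+1)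
     (Num.min (n.+1%:R * D n i) M / n.+1%:R + n.+1%:R * D n i ^+ 2 / M).
    apply: ler_sum => i _.
    have Nn : n.+1%:R != 0 :> R by [].
    have [h|h] := leP (n.+1%:R * D n i) M.
     rewrite mulrAC divff// mul1r lerDl divr_ge0 ?(ltW M0)//.
     by rewrite mulr_ge0// sqr_ge0.
    rewrite -[X in X <= _]add0r lerD ?divr_ge0 ?(ltW M0)//.
    rewrite ler_pdivlMr// mulrA mulrC ler_wpM2r//.
    exact: ltW.
   rewrite big_split/= -[X in _ + X]mulr_suml => h.
   rewrite /c; under eq_bigr do rewrite mulrBl.
   rewrite sumrB sumr_const card_ord -[X in X - _]mulr_natr divfK ?pnatr_eq0//.
   have := d01D n; have := DC n; move: h.
   have : (\sum_(i < n.+1) n.+1%:R * D n i ^+ 2) / M <= C / M.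
    by rewrite ler_pM2r ?invr_gt0//; exact: DC.
   lra.
 have H3 : (M%:E <= (M - (d01 - C / M))%:E + \int[leb]_(r in `[0%R, 1%R[) l r)%E.
  by rewrite -[leLHS]H; apply: leeD.
 move: H3; case: (\int[leb]_(r in `[0%R, 1%R[) l r)%E => [x| |]//.
  by rewrite -!EFinD !lee_fin; lra.
 by move=> _; rewrite leey.
have I0 : (0 <= \int[leb]_(r in `[0%R, 1%R[) l r)%E by exact: integral_ge0.
move: key I0; move: (\int[_]_(_ in _) _)%E => -[x| |] // key; last by move=> _; rewrite leey.
move=> _; rewrite lee_fin; apply/ler_addgt0Pr => e e0.
(* At this height the truncation error [C / M] is at most [e]. *)
have := key (C / e + 1); rewrite lee_fin.
have Ce : 0 < C / e + 1 by rewrite ltr_wpDl// divr_ge0// ltW.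
move=> /(_ Ce) /le_trans; apply; rewrite lerD2l ler_pdivrMr// mulrDr mulr1.
by rewrite mulrCA divff ?gt_eqF// mulr1 lerDl ltW.
Unshelve. all: by end_near. Qed.

End partition.

(** * Conditioning, lower integrals and null sections *)

Section conditioning.
Context {R : realType} {d d' : measure_display} {T : measurableType d} {Y : measurableType d'}.
Variables (pi : probability T R) (E : set T) (phi : T -> Y).
Hypotheses (mE : measurable E) (mphi : meas phi) (E0 : (0 < pi E)%E).
Lemma integral_mrestr (F : T -> \bar R) : meas F -> (forall x, 0 <= F x)%E ->
 (\int[mrestr pi mE]_x F x = \int[pi]_(x in E) F x)%E.
Proof.
move=> mF F0; rewrite -(setUv E) ge0_integral_setU//; last 3 first.
- exact: measurableC.
- by rewrite setUv.
- by rewrite disj_set2E setICr.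
rewrite [X in (_ + X)%E](_ : _ = 0%E) ?adde0.
 by apply: eq_measure_integral => A mA AE; rewrite /= /mrestr setIidl.
rewrite (eq_measure_integral mzero) ?integral_measure_zero// => A mA AE.
rewrite /= /mrestr /mzero (_ : A `&` E = set0) ?measure0//.
by apply/seteqP; split => // x [/AE].
Qed.

(** The law of [phi] under [pi] conditioned on [E]; [p0] is the default measure that [mnormalize]
    asks for, and it is avoided since [pi E] is positive and finite. *)
Lemma plaw_prob (p0 : probability Y R) : exists2 q : probability Y R,
 (forall A, measurable A -> q A = pi (E `&` phi @^-1` A) * ((fine (pi E))^-1)%:E)%E &
 (forall F : Y -> \bar R, meas F -> (forall x, 0 <= F x)%E ->
  \int[q]_x F x = ((fine (pi E))^-1)%:E * \int[pi]_(x in E) F (phi x))%E.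
Proof.
pose m0 : {measure set Y -> \bar R} := pushforward (mrestr pi mE) phi.
pose m' := m0 mphi.
have m'T : m' setT = pi E by rewrite /m' /m0 /= /pushforward /mrestr setTI.
have piEfin : pi E \is a fin_num by exact: fin_num_measure.
have piE1 : (0 < fine (pi E)) by rewrite fine_gt0// E0/= ltey_eq piEfin.
have ci : 0 <= (fine (pi E))^-1 by rewrite invr_ge0 ltW.
have qE A : measurable A -> mnormalize m' p0 A = (pi (E `&` phi @^-1` A) * ((fine (pi E))^-1)%:E)%E.
 move=> mA; rewrite /mnormalize m'T gt_eqF//=.
 have -> : (pi E == +oo%E) = false by apply/negbTE; rewrite -ltey ltey_eq piEfin.
 by rewrite /m' /m0 /pushforward /mrestr setIC.
exists (mnormalize m' p0) => // F mF F0.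
rewrite (eq_measure_integral (mscale (NngNum ci) m')); last first.
 by move=> A mA _; apply: (etrans (qE A mA)); rewrite /mscale/= /m' /m0 /pushforward /mrestr/= setIC muleC.
rewrite ge0_integral_mscale//=; congr (_ * _)%E.
rewrite /m' /m0 ge0_integral_pushforward//= integral_mrestr//.
exact: mT_comp.
Qed.

End conditioning.

(** The integral of a nonnegative function is the supremum over the simple functions below it,
    measurable or not. Such lower integrals are what handles [kinetic_energy], whose measurability
    is not established. *)
Lemma lower_integral_le {d} {T : measurableType d} {R : realType}
  (m : {measure set T -> \bar R}) (f g : T -> \bar R) :
 (forall x, 0 <= f x)%E -> (forall x, f x <= g x)%E -> (\int[m]_x f x <= \int[m]_x g x)%E.
Proof.
move=> f0 fg; have g0 x : (0 <= g x)%E := le_trans (f0 x) (fg x).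
rewrite !ge0_integralTE//; apply: ub_ereal_sup => _ [h hf <-]; apply: ereal_sup_ubound; exists h => //.
by move=> x; exact: le_trans (hf x) (fg x).
Qed.

Section lower_integral.
Import HBNNSimple.
Lemma lower_integral_bound {d} {T : measurableType d} {R : realType}
  (m : {measure set T -> \bar R}) (f : T -> \bar R) (c : \bar R) :
 (forall x, 0 <= f x)%E ->
 (forall h : T -> R, meas h -> (forall x, 0 <= h x)%R ->
  (forall x, (h x)%:E <= f x) -> \int[m]_x (h x)%:E <= c)%E ->
 (\int[m]_x f x <= c)%E.
Proof.
move=> f0 H; rewrite ge0_integralTE//; apply: ub_ereal_sup => _ [h hf <-].
have := H h (measurable_funPT _) (fun x => fun_ge0 _) hf.
by rewrite integral_nnsfun// patch_setT.
Qed.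

End lower_integral.

Section ae_section.
Context {R : realType} {d1 d2 : measure_display} {T1 : measurableType d1} {T2 : measurableType d2}.
Variables (m1 : {sigma_finite_measure set T1 -> \bar R}) (m2 : {sigma_finite_measure set T2 -> \bar R}).
(** Tonelli for the indicator of [B]; it turns a property of almost every curve at each fixed time
    into one of almost every curve at almost every time. *)
Lemma ae_section_swap (B : set (T1 * T2)) : measurable B ->
 (forall y, m1 [set x | B (x, y)] = 0%E) -> {ae m1, forall x, m2 [set y | B (x, y)] = 0%E}.
Proof.
move=> mB B0.
have E := indic_fubini_tonelli m1 m2 mB.
have FE : fubini_F m2 (EFin \o \1_B) = fun x => m2 [set y | B (x, y)].
 rewrite indic_fubini_tonelli_FE//; apply/funext => x; congr (m2 _).
 by apply/seteqP; split => y; rewrite /xsection/= inE.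
have GE y : fubini_G m1 (EFin \o \1_B) y = 0%E.
 rewrite indic_fubini_tonelli_GE//= -(B0 y); congr (m1 _).
 by apply/seteqP; split => x; rewrite /ysection/= inE.
rewrite FE in E.
have mF : meas (fun x => m2 [set y | B (x, y)]).
 by rewrite -FE; exact: indic_measurable_fun_fubini_tonelli_F.
have : (\int[m1]_x `|m2 [set y | B (x, y)]| = 0)%E.
 under eq_integral do rewrite gee0_abs//.
 by rewrite E integral0_eq.
by move/(ae_eq_integral_abs _ measurableT mF) => /ae_imp; apply => x; exact.
Qed.

End ae_section.

Section fine_density.
Context {R : realType}.
Local Notation leb := (@lebesgue_measure R).
(** Differentiation along cells wants a real integrable function on the whole line: [g] is [h] cut
    off to the unit interval, with the null set of infinite values replaced by [0]. *)
Lemma fine_density (h : R -> \bar R) : meas h -> (forall r, 0 <= h r)%E ->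
 (\int[leb]_(r in `[0%R, 1%R]) h r < +oo)%E ->
 exists g : R -> R, [/\ meas g, (forall r, 0 <= g r),
  leb.-integrable setT (EFin \o g),
  (forall A : set R, measurable A -> A `<=` (`[0%R, 1%R] : set R) ->
   \int[leb]_(r in A) h r = (\int[leb]_(r in A) g r)%:E)%E &
  {ae leb, forall r, 0 <= r <= 1 -> h r = (g r)%:E}].
Proof.
move=> mh h0 hfin.
have m01 : measurable (`[0, 1] : set R) by exact: m_itv.
have ih : leb.-integrable (`[0, 1] : set R) h.
 apply/integrableP; split; first exact: mfunTS.
 by under eq_integral do rewrite gee0_abs//.
pose hD : R -> \bar R := h \_ (`[0, 1] : set R).
have hDE (r : R) : 0 <= r <= 1 -> hD r = h r.
 by move=> r01; rewrite /hD patchE mem_set.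
have ih' : leb.-integrable setT hD.
 by have [+ _] := @integrable_mkcond _ _ R leb `[0, 1]%classic h m01; apply.
pose g (r : R) : R := fine (hD r).
have p0 (r : R) : (0 <= hD r)%E by rewrite /hD patchE; case: ifP.
have g0 r : 0 <= g r by rewrite fine_ge0.
have hg : {ae leb, forall r, hD r = (g r)%:E}.
 have := integrable_ae measurableT ih'.
 by move=> /ae_imp; apply => r /(_ I) hf; rewrite /g/= fineK.
have mhD : meas hD by exact: (measurable_int _ ih').
have mg : meas g by exact: mT_comp.
have ig : leb.-integrable setT (EFin \o g).
 apply: le_integrable ih' => //; first exact/mEFinP.
 move=> r _ /=; rewrite (gee0_abs (p0 r)) ger0_norm ?g0// /g.
 by case: (hD r) (p0 r) => //= _; rewrite leey.
exists g; split => //.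
- move=> A mA A01.
 rewrite /Rintegral fineK; last first.
  by apply: integrable_fin_num => //; exact: (integrableS measurableT).
 apply: ge0_ae_eq_integral => //.
 + exact: mfunTS.
 + by apply/mEFinP; exact: mfunTS.
 + by move=> r _; rewrite lee_fin.
 + move: hg => /ae_imp; apply => r + Ar; rewrite hDE//.
  by have := A01 _ Ar; rewrite /=.
- by move: hg => /ae_imp; apply => r + r01; rewrite hDE.
Qed.

End fine_density.

Lemma ae_and {d} {T : measurableType d} {R : realType} (m : {measure set T -> \bar R})
  (P Q : T -> Prop) : {ae m, forall x, P x} -> {ae m, forall x, Q x} ->
 {ae m, forall x, P x /\ Q x}.
Proof. by move=> p q; apply: (ae_imp2 p q). Qed.

Section curves.
Context {R : realType} {d : measure_display} {X : borelMetricType R d}.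
Hypothesis sepX : @separable_space R d X.
Variable mu : {measure set X -> \bar R}.
Local Notation P := (path_space X).
Local Notation leb := (@lebesgue_measure R).

(** * Borel maps into a separable metric space *)

Section metric_measurability.
Lemma openMX (U : set X) : open U -> measurable U.
Proof. by move=> oU; rewrite borelE; apply: sub_sigma_algebra. Qed.

Lemma contMX (h : X -> R) : continuous h -> meas h.
Proof.
move=> ch; apply: (measurability _ (@RGenOpens.measurableE R)) => _ [U [a [b ->] <-]].
rewrite setTI; apply: openMX.
by apply: open_comp; [move=> x _; exact: ch | exact: interval_open].
Qed.

Lemma mdist_lip (x y z : X) : `|mdist x z - mdist y z| <= mdist x y.
Proof.
rewrite ler_norml; have := metric_triangle x y z; have := metric_triangle y x z.
by rewrite (metric_sym y x) => h1 h2; apply/andP; split; lra.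
Qed.

Lemma nbhs_mdist (x : X) (e : R) : 0 < e -> \forall y \near x, mdist x y < e.
Proof. by move=> e0; apply/metricType_numDomainType.nbhs_mdistP; exists e. Qed.

Lemma lip_contX (h : X -> R) (L : R) :
 (forall x y, `|h x - h y| <= L * mdist x y) -> continuous h.
Proof.
move=> hL x; apply/cvgrPdist_lt => e e0.
have L1 : 0 < `|L| + 1 by [].
have := nbhs_mdist x (divr_gt0 e0 L1); apply: filterS => y.
rewrite ltr_pdivlMr// => xy; apply: (le_lt_trans (hL x y)); apply: le_lt_trans xy.
rewrite mulrC ler_wpM2l ?mdist_ge0//; apply: (le_trans (ler_norm L)).
by rewrite lerDl.
Qed.

Lemma mdist_cont (z : X) : continuous (mdist^~ z : X -> R).
Proof.
by apply: (@lip_contX _ 1) => x y; rewrite mul1r; exact: mdist_lip.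
Qed.

Lemma open_mball (x : X) (e : R) : open [set y | mdist y x < e].
Proof.
rewrite (_ : [set _ | _] = (mdist^~ x : X -> R) @^-1` [set r | r < e])//.
by apply: open_comp; [move=> y _; exact: mdist_cont | exact: open_lt].
Qed.

Lemma dense_sequence : exists q : nat -> X, forall x (e : R), 0 < e -> exists n, mdist x (q n) < e.
Proof.
have [D cD dD] := sepX.
have := cD; rewrite /countable => /pfcard_geP[D0|[q]].
 have [] := dD setT; [by exists point | exact: openT | by rewrite D0 => x []].
exists q => x e e0.
have [|//|y [xy Dy]] := dD [set y | mdist y x < e].
- by exists x => /=; rewrite mdistxx.
- exact: open_mball.
by have [n _ yn] := @surj _ _ _ _ q _ Dy; exists n; rewrite yn metric_sym.
Qed.

Context {d' : measure_display} {T : measurableType d'}.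
(** Separability makes every open set a countable union of balls centred at the [q i] with radii
    [1 / (j + 1)], so measurable distances to fixed points suffice. *)
Lemma measurable_mapX (f : T -> X) :
 (forall q, meas (fun z => mdist (f z) q)) -> meas f.
Proof.
move=> mf; have [q Hq] := dense_sequence.
apply: (measurability _ borelE) => _ [U oU <-]; rewrite setTI.
pose B (i j : nat) := [set y : X | mdist y (q i) < j.+1%:R^-1].
have -> : f @^-1` U = \bigcup_i \bigcup_(j in [set j | B i j `<=` U]) f @^-1` (B i j).
 apply/seteqP; split => z /=; last by move=> [i _ [j + Bz]]; exact.
 move=> Uz; have := open_nbhs_nbhs (conj oU Uz).
 move=> /metricType_numDomainType.nbhs_mdistP[e /= e0 He].
 have [j jr] : exists j : nat, j.+1%:R^-1 < e / 2.
  exists (Num.trunc (e / 2)^-1); rewrite invf_plt ?posrE ?divr_gt0//.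
  exact: truncnS_gt.
 have [i Hi] := Hq (f z) j.+1%:R^-1 (ltac:(by rewrite invr_gt0)).
 exists i => //; exists j => //= y; rewrite /B /= => yi.
 apply: He => /=; apply: (le_lt_trans (metric_triangle _ (q i) _)).
 rewrite (metric_sym (q i)); apply: (lt_trans (ltrD Hi yi)).
 by move: (_^-1) jr => z0 ?; lra.
apply: bigcupT_measurable => i; apply: bigcup_measurable => j _.
have := mf (q i) measurableT [set r | r < j.+1%:R^-1].
rewrite setTI; apply; apply: open_measurable; exact: open_lt.
Qed.

(** By density the distance is the infimum over [n] of [mdist (f z) (q n) + mdist (g z) (q n)],
    which avoids the Borel sets of the product. *)
Lemma measurable_mdistX (f g : T -> X) : meas f -> meas g ->
 meas (fun z => mdist (f z) (g z)).
Proof.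
move=> mf mg; have [q Hq] := dense_sequence.
have mc (h : T -> X) k : meas h -> meas (fun z => mdist (h z) k).
 by move=> mh; apply: (mT_comp (f := fun x => mdist x k : R)) => //; apply: contMX; exact: mdist_cont.
apply/mEFinP.
pose u n z := (mdist (f z) (q n) + mdist (g z) (q n))%:E.
have -> : EFin \o (fun z => mdist (f z) (g z)) = (fun z => einfs (u^~ z) 0%N).
 apply/funext => z /=; apply/eqP; rewrite eq_le; apply/andP; split.
  apply: le_ereal_inf_tmp => _ [n _ <-]; rewrite lee_fin (metric_sym (g z)).
  exact: metric_triangle.
 apply/lee_addgt0Pr => e e0; have [n Hn] := Hq (g z) _ (divr_gt0 e0 (ltr0Sn _ 1)).
 apply: (@le_trans _ _ (u n z)); first by apply: ereal_inf_lbound; exists n.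
 rewrite /u lee_fin; have := metric_triangle (f z) (g z) (q n); lra.
apply: measurable_fun_einfs => n; apply/mEFinP.
by apply: mfunD; exact: mc.
Qed.

Lemma measurable_limX (f : nat -> T -> X) (g : T -> X) :
 (forall n, meas (f n)) -> (forall z, f n z @[n --> \oo] --> g z) ->
 meas g.
Proof.
move=> mf fg; apply: measurable_mapX => q.
apply: (@measurable_fun_cvg _ _ _ _ (fun n z => mdist (f n z) q : R) (fun z => mdist (g z) q : R)).
 by move=> n; apply: (mT_comp (f := fun x => mdist x q : R)) => //; apply: contMX; exact: mdist_cont.
move=> z _; have := @mdist_cont q (g z); exact: (cvg_comp _ _ (fg z)).
Qed.

Lemma measurable_caseX {d2} {Y : measurableType d2} (N : T -> nat) (F : nat -> T -> Y) :
 (forall n, measurable (N @^-1` [set n])) -> (forall n, meas (F n)) ->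
 meas (fun z => F (N z) z).
Proof.
move=> mN mF _ A mA; rewrite setTI.
have -> : (fun z => F (N z) z) @^-1` A = \bigcup_n (N @^-1` [set n] `&` F n @^-1` A).
 by apply/seteqP; split => z; [exists (N z)|move=> [n _ [/= ->]]].
apply: bigcupT_measurable => n; apply: measurableI => //.
by rewrite -[X in measurable X]setTI; exact: mF.
Qed.

End metric_measurability.

(** * Measurable evaluation of curves *)

Section curve_measurability.
Implicit Types (g : curve X) (r s t : R).
Definition clamp01 (r : R) : R := Num.max 0 (Num.min r 1).

Lemma clamp01_itv r : 0 <= clamp01 r <= 1.
Proof. by rewrite /clamp01 le_max lexx/= ge_max ler01 ge_min lexx orbT. Qed.

Lemma clamp01_id r : 0 <= r <= 1 -> clamp01 r = r.
Proof. by move=> /andP[r0 r1]; rewrite /clamp01 min_l// max_r. Qed.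

Lemma clamp01_lip r s : `|clamp01 r - clamp01 s| <= `|r - s|.
Proof.
rewrite /clamp01; have : `|r - s| <= `|r - s| by [].
rewrite {1}ler_norml; move: `|r - s| => a /andP[h1 h2]; rewrite ler_norml; apply/andP; split;
by case: (leP r 1) => ?; case: (leP s 1) => ?; rewrite ?(max_r ler01); try case: (leP 0 r) => ?; try case: (leP 0 s) => ?; lra.
Qed.

(** Clamping the parameter makes evaluation continuous on the whole line, whatever the curve does
    outside the unit interval. *)
Definition ev g r : X := g (clamp01 r).

Lemma evE g r : 0 <= r <= 1 -> ev g r = g r.
Proof. by move=> h; rewrite /ev clamp01_id. Qed.

Lemma ev_cont g : continuous (ev g : R -> X).
Proof.
move=> r; have /subspace_continuousP cg := svalP g.
have h : clamp01 r \in `[0, 1] by rewrite in_itv/= clamp01_itv.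
apply/metricType_numDomainType.cvgrPdist_lt => e e0.
have /metricType_numDomainType.cvgrPdist_lt/(_ e e0) := cg _ h.
rewrite near_withinE => /nbhs_ballP[dl /= dl0 Hdl].
near=> s; apply: (Hdl (clamp01 s)).
 rewrite /ball/=; apply: (le_lt_trans (clamp01_lip _ _)).
 near: s; apply/nbhs_ballP; exists dl => //.
by rewrite in_itv/= clamp01_itv.
Unshelve. all: by end_near. Qed.

Lemma m_eval t : meas (fun g : P => ev g t).
Proof.
move=> _ A mA; rewrite setTI; apply: sub_sigma_algebra.
by exists (clamp01 t), A; split => //; exact: clamp01_itv.
Qed.

(** Curves are continuous, so joint evaluation is the limit of evaluations at the nodes
    [k / (n + 1)]; each approximation uses countably many times and is measurable at each of
    them. *)
Lemma m_ev : meas (fun z : P * R => ev (z.1 : curve X) z.2).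
Proof.
pose N n (z : P * R) := Num.trunc (clamp01 z.2 * n.+1%:R).
pose F n k (z : P * R) := ev (z.1 : curve X) (k%:R / n.+1%:R).
apply: (@measurable_limX _ _ (fun n z => F n (N n z) z)).
 move=> n; apply: measurable_caseX => k.
  pose A := [set r : R | k%:R <= clamp01 r * n.+1%:R < k.+1%:R].
  have -> : N n @^-1` [set k] = setT `*` A.
   apply/seteqP; split => z /=.
    rewrite /N => Nk; split => //; rewrite /A -Nk; apply: truncn_itv.
    by rewrite mulr_ge0; have /andP[] := clamp01_itv z.2.
   by move=> [_ h]; exact: truncn_def.
  apply: measurableX => //.
  have mc : meas (fun r : R => clamp01 r * n.+1%:R).
   apply: mfunM => //; apply: continuous_measurable_fun => r.
   apply/cvgrPdist_lt => e e0; near=> s; apply: (le_lt_trans (clamp01_lip _ _)).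
   by near: s; apply: cvgr_dist_lt.
  rewrite (_ : A = (fun r : R => clamp01 r * n.+1%:R) @^-1` `[k%:R, k.+1%:R[).
   by rewrite -[X in measurable X]setTI; apply: mc => //; exact: m_itv.
  by []; split => r; rewrite /A.
 exact: (mT_comp (m_eval _) measurable_fst).
move=> [g r]; rewrite /F /N /=.
have := @ev_cont g (clamp01 r).
have e0 : ev g (clamp01 r) = ev g r by rewrite /ev (clamp01_id (clamp01_itv r)).
rewrite /continuous_at e0 => cg.
apply: (cvg_comp _ _ _ cg); apply/cvgrPdist_lt => e {}e0.
have [r0 r1] := andP (clamp01_itv r).
near=> n.
have /andP[h1 h2] : (Num.trunc (clamp01 r * n.+1%:R))%:R <= clamp01 r * n.+1%:R
  < (Num.trunc (clamp01 r * n.+1%:R)).+1%:R by apply: truncn_itv; rewrite mulr_ge0.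
rewrite ltr_norml; apply/andP; split.
 by apply: (@lt_le_trans _ _ 0); rewrite ?oppr_lt0// subr_ge0 ler_pdivrMr.
rewrite ltrBlDr -ltrBlDl ltr_pdivlMr// mulrBl.
have : 1 < e * n.+1%:R.
 rewrite -ltr_pdivrMl// mulr1; apply: (@lt_le_trans _ _ n%:R); last by rewrite ler_nat.
 by near: n; exact: nbhs_infty_gtr.
by move: h2; rewrite -natr1; lra.
Unshelve. all: by end_near. Qed.

End curve_measurability.

(** * Metric speed *)

Section speed.
Implicit Types (g : curve X) (r s t a b : R).
Definition rat_seq (k : nat) : R := if unpickle k is Some q then ratr q else 1.

Lemma rat_seq_dense a b : a < b -> exists k, a < rat_seq k < b.
Proof.
by move=> /rat_in_itvoo[q]; rewrite in_itv => qab; exists (pickle q); rewrite /rat_seq pickleK.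
Qed.

(* A countable description of the metric derivative, which makes its joint
 measurability apparent. *)
Definition speed_quot n k g r : \bar R :=
 if 0 < `|rat_seq k| < n.+1%:R^-1 then
  (mdist (ev g (r + rat_seq k)) (ev g r) / `|rat_seq k|)%:E else 0%E.

Definition speed g r : \bar R := einfs (fun n => esups (fun k => speed_quot n k g r) 0) 0.

Lemma speed_quot_ge0 n k g r : (0 <= speed_quot n k g r)%E.
Proof. by rewrite /speed_quot; case: ifP => // _; rewrite lee_fin divr_ge0 ?mdist_ge0. Qed.

Lemma speed_ge0 g r : (0 <= speed g r)%E.
Proof.
apply: le_ereal_inf_tmp => _ [n _ <-]; apply: (le_trans (speed_quot_ge0 n 0%N g r)).
by apply: ereal_sup_ubound; exists 0%N.
Qed.

Lemma m_speed :
 meas (fun z : P * R => speed (z.1 : curve X) z.2).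
Proof.
apply: measurable_fun_einfs => n; apply: measurable_fun_esups => k.
rewrite /speed_quot; case: (0 < `|rat_seq k| < n.+1%:R^-1) => //.
apply/mEFinP; apply: mfunM => //.
apply: measurable_mdistX; last exact: m_ev.
have -> : (fun z : P * R => ev (z.1 : curve X) (z.2 + rat_seq k)) =
 (fun z : P * R => ev (z.1 : curve X) z.2) \o (fun z => (z.1, z.2 + rat_seq k)) by [].
apply: mT_comp; first exact: m_ev.
apply: measurable_fun_pair; first exact: measurable_fst.
by apply: mfunD => //; exact: measurable_snd.
Qed.

(** Away from [0] the difference quotient is continuous in the increment, so rational increments
    give the same upper limit; the strict bounds on [r] keep [r + h] where [ev] is the curve
    itself. *)
Lemma metric_speedE g r : 0 < r < 1 -> metric_speed g r = speed g r.
Proof.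
move=> /andP[r0 r1].
have evin h : `|h| < r -> `|h| < 1 - r -> ev g (r + h) = g (r + h).
 by rewrite !ltr_norml => /andP[? ?] /andP[? ?]; rewrite evE//; apply/andP; split; lra.
have ev0 : ev g r = g r by rewrite evE// (ltW r0) ltW.
apply/eqP; rewrite eq_le; apply/andP; split.
 apply: le_ereal_inf_tmp => _ [n _ <-].
 pose m := Num.min n.+1%:R^-1 (Num.min r (1 - r)).
 have m0 : 0 < m by rewrite /m !lt_min invr_gt0 r0 subr_gt0 ltr0Sn.
 apply: (@le_trans _ _ (ereal_sup ((fun h : R => (mdist (g (r + h)) (g r) / `|h|)%:E) @` [set h | 0 < `|h| < m]))).
  apply: ereal_inf_lbound; exists [set h | 0 < `|h| < m] => //.
  exists m => //= h; rewrite /ball_/= sub0r normrN => hm; by rewrite hm andbT normr_gt0.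
 apply: ub_ereal_sup => _ [h /andP[h0 hm] <-].
 move: hm; rewrite /m !lt_min => /and3P[hn hr h1r].
 apply/lee_addgt0Pr => e e0.
 pose F (q : R) := mdist (ev g (r + q)) (ev g r) / `|q|.
 have cF : {for h, continuous F}.
  apply: cvgM.
   have : continuous ((mdist^~ (ev g r) : X -> R) \o ev g \o (fun q => r + q)).
    move=> q; apply: continuous_comp.
     by apply: cvgD; [exact: cvg_cst | exact: cvg_id].
    by apply: continuous_comp; [exact: ev_cont | exact: mdist_cont].
   by move=> /(_ h) ch; exact: ch.
  apply: cvgV; first by rewrite gt_eqF.
  exact: norm_continuous.
 have : \forall q \near h, F h - e < F q /\ 0 < `|q| < n.+1%:R^-1.
  have nh := @norm_continuous _ R h.
  near=> q; split.
   by near: q; apply: (cvgr_gt _ cF); lra.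
  apply/andP; split; near: q.
   exact: (cvgr_gt _ nh).
  exact: (cvgr_lt _ nh).
 move=> /nbhs_ballP[dl /= dl0 Hdl].
 have [k /andP[k1 k2]] : exists k, h - dl < rat_seq k < h + dl by apply: rat_seq_dense; lra.
 have [] := Hdl (rat_seq k); first by rewrite /ball/= ltr_norml; apply/andP; split; lra.
 move=> Fk qn.
 apply: (@le_trans _ _ ((F (rat_seq k))%:E + e%:E)%E).
  by rewrite lee_fin -evin// -ev0; rewrite /F in Fk *; lra.
 rewrite leeD2r// /F; apply: ereal_sup_ubound; exists k => //.
 by rewrite /speed_quot qn.
apply: le_ereal_inf_tmp => _ [V [dl /= dl0 Vdl] <-].
have [n Hn] : exists n : nat, n.+1%:R^-1 < Num.min dl (Num.min r (1 - r)).
 set m := Num.min _ _; have m0 : 0 < m by rewrite /m !lt_min dl0 r0 subr_gt0.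
 exists (Num.trunc m^-1); rewrite invf_plt ?posrE//; exact: truncnS_gt.
move: Hn; rewrite !lt_min => /and3P[n1 n2 n3].
have Vin h : 0 < `|h| < n.+1%:R^-1 -> V h.
 move=> /andP[h0 hn]; apply: Vdl => /=; first by rewrite sub0r normrN; apply: lt_trans n1.
 by rewrite -normr_gt0.
apply: (@le_trans _ _ (esups (fun k => speed_quot n k g r) 0)).
 by apply: ereal_inf_lbound; exists n.
apply: ub_ereal_sup => _ [k _ <-]; rewrite /speed_quot; case: ifP => [qn|_].
 apply: ereal_sup_ubound; exists (rat_seq k); first exact: Vin.
 have /andP[_ qn2] := qn.
 by rewrite evin ?ev0//; [exact: lt_trans n2|exact: lt_trans n3].
(* Indices outside the range contribute [0]; the quotient at any admissible increment is nonnegative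
   and dominates them. *)
have h2 : 0 < n.+1%:R^-1 / 2 :> R by [].
apply: (@le_trans _ _ (mdist (g (r + n.+1%:R^-1 / 2)) (g r) / `|n.+1%:R^-1 / 2|)%:E).
 by rewrite lee_fin divr_ge0 ?mdist_ge0.
apply: ereal_sup_ubound; exists (n.+1%:R^-1 / 2) => //; apply: Vin.
rewrite gtr0_norm///=; move: h2; set z := _^-1; lra.
Unshelve. all: by end_near. Qed.

End speed.

(** * Curves stopped outside a subinterval *)

Section clamped_curves.
Implicit Types (g : curve X) (r s t a b : R) (G : X -> R).
Lemma clamp_curve_subproof a b g :
 {within `[(0 : R), 1], continuous (fun r => ev g (Num.max a (Num.min r b)))}.
Proof.
apply: continuous_subspaceT => r.
apply: (@continuous_comp _ _ _ (fun r => Num.max a (Num.min r b)) (ev g)); last exact: ev_cont.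
apply: (@continuous_max _ R (fun=> a) (fun r => Num.min r b)); first exact: cvg_cst.
by apply: (@continuous_min _ R id (fun=> b)); [exact: cvg_id | exact: cvg_cst].
Qed.

(** The curve held constant before [a] and after [b]. Keeping the time scale, instead of rescaling
    [[a, b]] to the unit interval, leaves the speed unchanged inside and makes it zero outside. *)
Definition clamp_curve a b g : curve X := exist _ _ (@clamp_curve_subproof a b g).

Lemma clamp_curveE a b g r : clamp_curve a b g r = ev g (Num.max a (Num.min r b)).
Proof. by []. Qed.

Lemma m_clamp_curve a b :
 meas (clamp_curve a b : P -> P).
Proof.
apply: (@measurability _ _ P P setT (clamp_curve a b : P -> P) (@evaluation_sets R d X) erefl) => _ [E [t [A [t01 mA ->]]] <-].
exact: (m_eval _ measurableT mA).
Qed.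

Lemma metric_speed_congr (g g' : curve X) r :
 (\forall h \near 0^', mdist (g (r + h)) (g r) = mdist (g' (r + h)) (g' r)) ->
 metric_speed g r = metric_speed g' r.
Proof.
suff main (g1 g2 : curve X) :
  (\forall h \near 0^', mdist (g1 (r + h)) (g1 r) = mdist (g2 (r + h)) (g2 r)) ->
  (metric_speed g1 r <= metric_speed g2 r)%E.
 move=> H; apply/eqP; rewrite eq_le !main//.
 by apply: filterS H => h ->.
move=> H; apply: le_ereal_inf_tmp => _ [V FV <-].
pose V' := V `&` [set h | mdist (g1 (r + h)) (g1 r) = mdist (g2 (r + h)) (g2 r)].
apply: (@le_trans _ _ (ereal_sup [set (mdist (g1 (r + h)) (g1 r) / `|h|)%:E | h in V'])).
 by apply: ereal_inf_lbound; exists V' => //; exact: filterI.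
by apply: ub_ereal_sup => _ [h [Vh ->] <-]; apply: ereal_sup_ubound; exists h.
Qed.

Lemma metric_speed_ge0 g r : (0 <= metric_speed g r)%E.
Proof.
apply: limf_esup_ge0 => [|h]; last by rewrite lee_fin divr_ge0 ?mdist_ge0.
exact: filter_not_empty.
Qed.

Lemma clamp_curve_speed_in a b g r : 0 <= a -> b <= 1 -> a < r < b ->
 metric_speed (clamp_curve a b g) r = metric_speed g r.
Proof.
move=> a0 b1 /andP[ar rb]; apply: metric_speed_congr.
have E s : a < s < b -> ev g (Num.max a (Num.min s b)) = g s.
 move=> /andP[as_ sb]; rewrite min_l ?(ltW)// max_r ?(ltW)// evE//.
 by rewrite (le_trans a0 (ltW as_)) (le_trans (ltW sb)).
exists (Num.min (r - a) (b - r)); first by rewrite /= lt_min !subr_gt0 ar.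
move=> h /=; rewrite sub0r normrN lt_min !ltr_norml => /andP[/andP[? ?] /andP[? ?]] _.
by rewrite !E ?ar//; apply/andP; split; lra.
Qed.

Lemma clamp_curve_speed_out a b g r : (r < a) || (b < r) -> a <= b ->
 metric_speed (clamp_curve a b g) r = 0%E.
Proof.
move=> rab ab.
have [e e0 He] : exists2 e, 0 < e & forall h, `|h| < e ->
  clamp_curve a b g (r + h) = clamp_curve a b g r.
 case/orP: rab => [ra|br].
  exists (a - r); rewrite ?subr_gt0// => h; rewrite ltr_norml => /andP[? ?].
  rewrite !clamp_curveE; congr ev; rewrite !max_l// ge_min; apply/orP; left; lra.
 exists (r - b); rewrite ?subr_gt0// => h; rewrite ltr_norml => /andP[? ?].
 by rewrite !clamp_curveE !min_r//; lra.
apply/eqP; rewrite eq_le; apply/andP; split; last first.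
 exact: metric_speed_ge0.
apply: (@le_trans _ _ (ereal_sup [set (mdist (clamp_curve a b g (r + h)) (clamp_curve a b g r) / `|h|)%:E | h in [set h : R | `|h| < e]])).
 apply: ereal_inf_lbound; exists [set h : R | `|h| < e] => //.
 by exists e => //= h; rewrite /ball_/= sub0r normrN.
by apply: ub_ereal_sup => _ [h he <-]; rewrite (He h he) mdistxx.
Qed.

Lemma m_speed1 g : meas (speed g).
Proof. exact: (mT_comp (m_speed) (measurable_pair1 (g : P))). Qed.

End clamped_curves.
Arguments clamp_curve : simpl never.
Arguments ev : simpl never.

(** * Weighted length and energy of curves *)

Section curve_length.
Implicit Types (g : curve X) (r s t a b : R) (G : X -> R).
Definition wlen G a b g : \bar R :=
 (\int[leb]_(r in `[a, b]) ((G (ev g r))%:E * speed g r))%E.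

(** A measurable minorant of [kinetic_energy]: it ignores the value [+oo] given to curves that are
    not absolutely continuous. *)
Definition energy g : \bar R := (\int[leb]_(r in `[0%R, 1%R]) (speed g r * speed g r))%E.

Lemma m_wspeed G : meas G ->
 meas (fun z : P * R => (G (ev (z.1 : curve X) z.2))%:E * speed (z.1 : curve X) z.2)%E.
Proof.
move=> mG; apply: emeasurable_funM; last exact: m_speed.
by apply/mEFinP; apply: mT_comp => //; exact: m_ev.
Qed.

Lemma m_wspeed1 G g : meas G ->
 meas (fun r => (G (ev g r))%:E * speed g r)%E.
Proof.
by move=> mG; exact: (mT_comp (m_wspeed mG) (measurable_pair1 (g : P))).
Qed.

Lemma wspeed_ge0 G g r : (forall x, 0 <= G x) -> (0 <= (G (ev g r))%:E * speed g r)%E.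
Proof. by move=> G0; rewrite mule_ge0 ?lee_fin// speed_ge0. Qed.

Lemma wlen_ge0 G a b g : (forall x, 0 <= G x) -> (0 <= wlen G a b g)%E.
Proof. by move=> G0; apply: integral_ge0 => r _; exact: wspeed_ge0. Qed.

Lemma integral_section_measurable (F : P * R -> \bar R) a b :
 meas F -> (forall z, 0 <= F z)%E ->
 meas (fun g : P => \int[leb]_(r in `[a, b]) F (g, r))%E.
Proof.
move=> mF F0.
pose F' (z : P * R) := (F z * (\1_(`[a, b] : set R) z.2)%:E)%E.
have mF' : meas F'.
 apply: emeasurable_funM => //; apply/mEFinP.
 apply: mT_comp; last exact: measurable_snd.
 by []; exact: m_itv.
have F'0 z : (0 <= F' z)%E by rewrite mule_ge0.
have := measurable_fun_fubini_tonelli_F (m2 := leb) F' mF' F'0.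
apply: eq_measurable_fun => g _; rewrite /fubini_F [RHS]integral_mkcond.
apply: eq_integral => r _; rewrite /F' patchE /= indicE.
by case: (r \in _); rewrite ?mule1 ?mule0.
Qed.

Lemma m_wlen G a b : meas G -> (forall x, 0 <= G x) ->
 meas (wlen G a b : P -> \bar R).
Proof.
move=> mG G0; have := integral_section_measurable a b (m_wspeed mG).
by apply => z; exact: wspeed_ge0.
Qed.

Lemma measurable_energy : meas (energy : P -> \bar R).
Proof.
have ms := m_speed.
have := integral_section_measurable 0 1 (emeasurable_funM ms ms).
by apply => z; rewrite mule_ge0 ?speed_ge0.
Qed.

Lemma integral_metric_speed G g : meas G ->
 (\int[leb]_(t in `[0%R, 1%R]) ((G (g t))%:E * metric_speed g t) = wlen G 0 1 g)%E.
Proof.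
move=> mG; rewrite /wlen [RHS]integral_itv_bndoo; last first.
 exact: mfunTS (m_wspeed1 g mG).
rewrite [LHS]integral_itv_bndoo; last first.
 apply: (eq_measurable_fun (fun r => (G (ev g r))%:E * speed g r)%E).
  move=> r; rewrite inE/= in_itv/= => /andP[r0 r1].
  by rewrite metric_speedE ?r0// evE// !ltW.
 exact: mfunTS (m_wspeed1 g mG).
apply: eq_integral => r; rewrite inE/= in_itv/= => /andP[r0 r1].
by rewrite metric_speedE ?r0// evE// !ltW.
Qed.

Lemma energyE g :
 (\int[leb]_(t in `[0%R, 1%R]) (metric_speed g t * metric_speed g t) = energy g)%E.
Proof.
have ms := m_speed1 g; have mss := emeasurable_funM ms ms.
rewrite /energy [RHS]integral_itv_bndoo; last exact: mfunTS mss.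
rewrite [LHS]integral_itv_bndoo; last first.
 apply: (eq_measurable_fun (fun r => speed g r * speed g r)%E).
  by move=> r; rewrite inE/=/= => r01; rewrite metric_speedE.
 exact: mfunTS mss.
apply: eq_integral => r; rewrite inE/=/= => r01; by rewrite metric_speedE.
Qed.

Lemma energy_le_kinetic g : (energy g <= kinetic_energy g)%E.
Proof.
rewrite /kinetic_energy; case: asboolP => _; last by rewrite leey.
by rewrite energyE.
Qed.

Lemma clamp_speed a b g r : 0 <= a -> a <= b -> b <= 1 -> 0 < r < 1 -> r != a -> r != b ->
 speed (clamp_curve a b g) r = if a <= r <= b then speed g r else 0%E.
Proof.
move=> a0 ab b1 r01 ra rb; rewrite -!metric_speedE//.
case: ifPn => [/andP[ar rb']|].
 by rewrite clamp_curve_speed_in// !lt_neqAle ar rb' rb eq_sym ra.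
rewrite negb_and -!ltNge => h; apply: clamp_curve_speed_out => //.
Qed.

Lemma clamp_ev a b g r : 0 <= a -> a <= b -> b <= 1 ->
 ev (clamp_curve a b g) r = ev g (Num.max a (Num.min r b)).
Proof.
move=> a0 ab b1; rewrite {1}/ev; congr ev.
rewrite /clamp01; case: (leP r 1) => r1; case: (leP 0 r) => r0;
rewrite ?(max_r ler01)//.
- by rewrite (min_l (le_trans a0 ab)) (max_l a0) max_l// ge_min (le_trans (ltW r0)).
- by rewrite (min_r b1) min_r// (le_trans b1 (ltW r1)).
- by rewrite (min_r b1) min_r// (le_trans b1 (ltW r1)).
Qed.

Lemma two_points_null a b : leb.-negligible [set a; b].
Proof.
by apply: negligibleU; [exists [set a]|exists [set b]]; split => //; exact: lebesgue_measure_set1.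
Qed.

Lemma wlen_clamp G a b g : meas G -> (forall x, 0 <= G x) ->
 0 <= a -> a <= b -> b <= 1 ->
 wlen G 0 1 (clamp_curve a b g) = wlen G a b g.
Proof.
move=> mG G0 a0 ab b1; rewrite /wlen.
have ms c := m_wspeed1 c mG.
have -> : `[a, b]%classic = `[0, 1]%classic `&` `[a, b]%classic.
 apply/seteqP; split => r //=; last by case.
 rewrite !in_itv/= => /andP[? ?]; split; apply/andP; split=> //; lra.
rewrite integral_mkcondr integral_itv_bndoo; last exact: mfunTS (ms _).
have mp : meas ((fun r => (G (ev g r))%:E * speed g r) \_ `[a, b])%E.
 apply/(measurable_restrictT _ _).1; first exact: m_itv.
 exact: mfunTS (ms _).
rewrite [RHS]integral_itv_bndoo; last exact: mfunTS mp.
apply: ge0_ae_eq_integral => //.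
- exact: mfunTS (ms _).
- exact: mfunTS mp.
- by move=> r _; exact: wspeed_ge0.
- by move=> r _; rewrite patchE; case: ifP => // _; exact: wspeed_ge0.
have [N [mN N0 Nab]] := two_points_null a b.
exists N; split => // r /= h; apply: Nab => /=.
apply: contrapT => /not_orP[/eqP ra /eqP rb]; apply: h; rewrite in_itv/= => r01.
rewrite clamp_ev// clamp_speed// patchE mem_setE in_itv/=.
by case: ifP => [/andP[ar rb']|]; rewrite ?mule0// (min_l rb') (max_r).
Qed.

Lemma clamp_itv (s t a b : R) : s <= t -> a <= b -> a <= t -> s <= b ->
`[Num.max a (Num.min s b), Num.max a (Num.min t b)]%classic = `[s, t]%classic `&` `[a, b]%classic.
Proof.
move=> st ab at_ sb; rewrite (min_l sb) (max_r (y := Num.min t b)) ?le_min ?at_//.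
apply/seteqP; split => r /=; rewrite !in_itv/= ge_max le_min.
 by move=> /andP[/andP[-> ->] /andP[-> ->]].
by move=> [/andP[-> ->] /andP[-> ->]].
Qed.

(** The density [f], set to zero outside [[a, b]], serves the stopped curve. *)
Lemma abs_continuous2_clamp a b g : 0 <= a -> a <= b -> b <= 1 ->
 abs_continuous2 g -> abs_continuous2 (clamp_curve a b g).
Proof.
move=> a0 ab b1 [f [mf f2 fd]].
have sab : `[a, b] `<=` (`[0, 1] : set R).
 by move=> r /=; rewrite !in_itv/= => /andP[? ?]; apply/andP; split; lra.
have mf' : measurable_fun (`[0, 1] : set R) (f \_ `[a, b]).
 apply/(measurable_restrict _ _ _) => //.
 by apply: measurable_funS mf => //; exact: subIsetl.
exists (f \_ `[a, b]); split => //.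
- apply: le_lt_trans f2; apply: ge0_le_integral => //.
 + by move=> r _; rewrite lee_fin sqr_ge0.
 + by apply/mEFinP; exact: mfunX.
 + by apply/mEFinP; exact: mfunX.
 + by move=> r _; rewrite lee_fin patchE; case: ifP => // _; rewrite expr0n sqr_ge0.
- move=> s t s0 st t1; rewrite !clamp_curveE.
 pose s' := Num.max a (Num.min s b); pose t' := Num.max a (Num.min t b).
 have s't' : s' <= t' by rewrite /s' /t'; apply: le_max2 => //; apply: le_min2.
 have s'0 : 0 <= s' by rewrite le_max a0.
 have t'1 : t' <= 1 by rewrite ge_max (le_trans ab b1) ge_min b1 orbT.
 rewrite !evE; [|by rewrite (le_trans s'0)|by rewrite s'0 (le_trans s't')].
 have [ne|e] := boolP ((t < a) || (b < s)).
  have -> : Num.max a (Num.min s b) = Num.max a (Num.min t b).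
   case/orP: ne => h; last by rewrite !min_r; lra.
   by rewrite !max_l// ge_min; apply/orP; left; lra.
  rewrite mdistxx; apply: integral_ge0 => r /=; rewrite in_itv/= => /andP[sr rt].
  rewrite patchE mem_setE in_itv/= ifF//; apply/negP => /andP[ar rb].
  by case/orP: ne => h; lra.
 move: e; rewrite negb_or -!leNgt => /andP[at_ sb].
 apply: (le_trans (fd _ _ s'0 s't' t'1)).
 rewrite /s' /t' clamp_itv// integral_mkcondr le_eqVlt; apply/orP; left; apply/eqP.
 by apply: eq_integral => r _; rewrite !patchE; case: ifP.
Qed.

Lemma kinetic_energy_ge0 g : (0 <= kinetic_energy g)%E.
Proof.
rewrite /kinetic_energy; case: asboolP => // _.
by apply: integral_ge0 => r _; rewrite mule_ge0// metric_speed_ge0.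
Qed.

Lemma kinetic_clamp a b g : 0 <= a -> a <= b -> b <= 1 ->
 (kinetic_energy (clamp_curve a b g) <= kinetic_energy g)%E.
Proof.
move=> a0 ab b1; rewrite /kinetic_energy.
case: asboolP => [acc|nacc]; last first.
 case: asboolP => [acg|_]; last by [].
 by exfalso; apply: nacc; exact: abs_continuous2_clamp.
case: asboolP => [acg|_]; last by rewrite leey.
rewrite !energyE /energy.
have mss c := emeasurable_funM (m_speed1 c) (m_speed1 c).
have [N [mN N0 Nab]] := two_points_null a b.
apply: ae_ge0_le_integral => //.
- by move=> r _; rewrite mule_ge0// speed_ge0.
- exact: mfunTS (mss _).
- by move=> r _; rewrite mule_ge0// speed_ge0.
- exact: mfunTS (mss _).
have [N1 [mN1 N10 N1ab]] := two_points_null 0 1.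
exists (N `|` N1); split; first exact: measurableU.
 by apply: (etrans (measureU0 mN mN1 N10)).
move=> r /= h; apply: contrapT => /not_orP[nN nN1]; apply: h; rewrite in_itv/= => r01.
have /not_orP[/eqP ra /eqP rb] : ~ [set a; b] r by move=> /Nab.
have /not_orP[/eqP rz /eqP r1] : ~ [set 0; 1] r by move=> /N1ab.
have r01' : 0 < r < 1 by move: r01; rewrite !lt_neqAle eq_sym rz r1.
rewrite clamp_speed//; case: ifP => // _; rewrite mul0e.
by rewrite mule_ge0// speed_ge0.
Qed.

End curve_length.

(** * Restricting test plans to events and subintervals *)

Section plan_restriction.
Implicit Types (g : curve X) (r s t a b : R) (G f : X -> R).
(** Conditioning on [E] multiplies the compression constant and the energy by at most [1 / pi E].
    Stopping a curve only exchanges its time marginals for others of [pi] and does not raise its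
    energy. That energy is a lower integral, hence estimated through its measurable minorants. *)
Lemma plan_restrict (pi : probability P R) (E : set P) a b :
 test_plan mu pi -> measurable E -> (0 < pi E)%E -> 0 <= a -> a <= b -> b <= 1 ->
 exists2 q : probability P R, test_plan mu q &
 forall F : P -> \bar R, meas F -> (forall x, 0 <= F x)%E ->
  (\int[q]_x F x = ((fine (pi E))^-1)%:E * \int[pi]_(x in E) F (clamp_curve a b x))%E.
Proof.
move=> [[C piC] kin] mE E0 a0 ab b1.
have [q qA qF] := plaw_prob mE (m_clamp_curve a b) E0 pi.
exists q => //; split.
 have c0 : 0 <= (fine (pi E))^-1 by rewrite invr_ge0 fine_ge0.
 exists (C / fine (pi E)) => t A t01 mA.
 pose u := Num.max a (Num.min t b).
 have u01 : 0 <= u <= 1.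
  by rewrite le_max a0/= ge_max (le_trans ab b1)/= ge_min b1 orbT.
 have mA' s : 0 <= s <= 1 -> measurable [set g : P | A ((g : curve X) s)].
  move=> s01; rewrite -[X in measurable X]setTI.
  rewrite (_ : [set g : P | A ((g : curve X) s)] = (fun g : P => ev g s) @^-1` A).
   exact: (m_eval _ measurableT mA).
  by apply/seteqP; split => g /=; rewrite evE.
 rewrite qA; last exact: mA'.
 rewrite (EFinM) -muleA [(_%:E * mu A)%E]muleC muleA lee_wpmul2r ?lee_fin//.
 apply: le_trans (piC u A u01 mA); apply: le_measure; rewrite ?inE.
 - apply: measurableI => //.
  rewrite -[X in measurable X]setTI; apply: m_clamp_curve => //; exact: mA'.
 - exact: mA'.
 - move=> g [_ H]; have {H} : A (clamp_curve a b g t) := H.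
  by rewrite clamp_curveE evE.
apply: (@le_lt_trans _ _ (((fine (pi E))^-1)%:E * \int[pi]_(g in [set: P]) kinetic_energy (g : curve X))%E); last first.
 by rewrite lte_mul_pinfty// lee_fin invr_ge0 fine_ge0.
apply: lower_integral_bound => [g|h mh0 h0 hk]; first exact: kinetic_energy_ge0.
have mh : meas (EFin \o h) by apply/mEFinP.
rewrite qF//.
have mhc : meas (fun x : P => (h (clamp_curve a b x))%:E).
 exact: (mT_comp mh (m_clamp_curve a b)).
apply: lee_wpmul2l; first by rewrite lee_fin invr_ge0 fine_ge0.
apply: (@le_trans _ _ (\int[pi]_(x in setT) (h (clamp_curve a b x))%:E)%E).
 apply: ge0_subset_integral => //.
 by move=> x _; rewrite lee_fin.
apply: lower_integral_le => x; first by rewrite lee_fin.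
have := hk (clamp_curve a b x); move=> /le_trans; apply.
exact: kinetic_clamp.
Qed.

(** Otherwise some [E n] has positive measure; there [v] is bounded by [n], so its integral is
    finite and the gap [1 / (n + 1)] contradicts the integrated inequality. *)
Lemma ae_le_events d0 (T : measurableType d0) (m : probability T R) (u : T -> R) (v : T -> \bar R) :
 meas u -> meas v ->
 (forall x, 0 <= u x) -> (forall x, 0 <= v x)%E ->
 (forall E, measurable E -> (0 < m E)%E -> (\int[m]_(x in E) (u x)%:E <= \int[m]_(x in E) v x)%E) ->
 {ae m, forall x, ((u x)%:E <= v x)%E}.
Proof.
move=> mu_ mv u0 v0 H.
have meu : meas (EFin \o u) by apply/mEFinP.
pose E n := [set x | (v x + (n.+1%:R^-1)%:E <= (u x)%:E)%E] `&` [set x | (v x <= n%:R%:E)%E].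
have mE n : measurable (E n).
 apply: measurableI.
  rewrite -[X in measurable X]setTI; apply: measurable_lee => //.
  by apply: emeasurable_funD => //; exact: measurable_cst.
 by rewrite -[X in measurable X]setTI; exact: emeasurable_fun_infty_c.
have E0 n : m (E n) = 0%E.
 apply/eqP; rewrite eq_le measure_ge0 andbT leNgt; apply/negP => En.
 have := H _ (mE n) En; apply/negP; rewrite -ltNge.
 have mS (w : T -> \bar R) : meas w -> measurable_fun (E n) w by exact: mfunTS.
 have vfin : (\int[m]_(x in E n) v x \is a fin_num)%E.
  rewrite ge0_fin_numE; last by apply: integral_ge0.
  apply: (@le_lt_trans _ _ (\int[m]_(x in E n) n%:R%:E)%E).
   by apply: ge0_le_integral => //; [exact: mS | move=> x []].
  rewrite integral_cst// lte_mul_pinfty ?lee_fin//.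
  by rewrite (le_lt_trans (probability_le1 m (mE n)))// ltry.
 apply: (@lt_le_trans _ _ (\int[m]_(x in E n) v x + (n.+1%:R^-1)%:E * m (E n))%E).
  by rewrite lteDl// mule_gt0.
 rewrite -integral_cst// -ge0_integralD//; [|exact: mS|by move=> x _; rewrite lee_fin].
 apply: ge0_le_integral => //.
 - by move=> x _; rewrite adde_ge0// lee_fin.
 - by apply: mS; apply: emeasurable_funD => //; exact: measurable_cst.
 - exact: mS.
 - by move=> x [].
have NE : m.-negligible (\bigcup_n E n).
 by apply: negligible_bigcup => n; exists (E n); split; [exact: mE|exact: E0|].
apply: (negligibleS _ NE).
move=> x /negP; rewrite -ltNge => vu.
have vfin : v x \is a fin_num by rewrite ge0_fin_numE//; apply: lt_trans vu _; rewrite ltry.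
move: vu (v0 x); have := fineK vfin; move: (fine (v x)) => w vw; rewrite -vw lte_fin lee_fin => wu w0.
have uw : 0 < u x - w by rewrite subr_gt0.
exists (maxn (Num.trunc (u x - w)^-1) (Num.trunc w).+1); split; rewrite /= -vw -?EFinD lee_fin.
 rewrite -lerBrDl -[leRHS]invrK lef_pV2 ?posrE ?invr_gt0// ltW//.
 apply: (lt_le_trans (truncnS_gt _)); rewrite ler_nat ltnS leq_maxl//.
by apply: (le_trans (ltW (truncnS_gt _))); rewrite ler_nat leq_maxr.
Qed.

End plan_restriction.
Section curvewise_inequality.
Implicit Types (g : curve X) (r s t a b : R) (G f : X -> R).
(* Restricting a test plan to an arbitrary event turns the integral inequality
 defining weak upper gradients into one along almost every curve. *)
Lemma wug_ae_curve (pi : probability P R) f G a b :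
 test_plan mu pi -> weak_upper_gradient mu f G -> 0 <= a -> a <= b -> b <= 1 ->
 {ae pi, forall g, (`|f (ev g b) - f (ev g a)|%:E <= wlen G a b g)%E}.
Proof.
move=> tp [mf mG G0 wug] a0 ab b1.
have mDf s t : meas (fun g : P => `|f (ev g t) - f (ev g s)|).
 apply: mT_comp => //; apply: mfunB.
  exact: (mT_comp mf (m_eval t)).
 exact: (mT_comp mf (m_eval s)).
apply: ae_le_events.
- exact: mDf.
- exact: m_wlen.
- by move=> g; exact: normr_ge0.
- by move=> g; exact: wlen_ge0.
move=> E mE E0.
have [q tq qF] := plan_restrict tp mE E0 a0 ab b1.
have := wug q tq.
under eq_integral do rewrite -(@evE) ?lexx ?ler01// -(@evE) ?lexx ?ler01//.
under [leRHS]eq_integral do rewrite integral_metric_speed//.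
have c0 : 0 < (fine (pi E))^-1.
 by rewrite invr_gt0 fine_gt0// E0/= ltey_eq fin_num_measure.
rewrite !qF//; last 3 first.
- exact: m_wlen.
- by move=> g; exact: wlen_ge0.
- by apply/mEFinP; exact: mDf.
rewrite lee_pmul2l; [move=> H|by []|by []].
have E1 : (\int[pi]_(x in E) `|f (ev (x : curve X) b) - f (ev (x : curve X) a)|%:E =
  \int[pi]_(x in E) `|f (ev (clamp_curve a b x) 1) - f (ev (clamp_curve a b x) 0)|%:E)%E.
 apply: eq_integral => g _; rewrite !(clamp_ev _ _ a0 ab b1).
 by rewrite (min_r b1) (max_r ab) (min_l (le_trans a0 ab)) (max_l).
have E2 : (\int[pi]_(x in E) wlen G a b x = \int[pi]_(x in E) wlen G 0 1 (clamp_curve a b x))%E.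
 by apply: eq_integral => g _; rewrite wlen_clamp.
by rewrite E1 E2.
Qed.

Lemma test_plan_energy (pi : probability P R) : test_plan mu pi ->
 (\int[pi]_g energy (g : curve X) < +oo)%E.
Proof.
move=> [_]; apply: le_lt_trans; apply: lower_integral_le => g.
 by apply: integral_ge0 => r _; rewrite mule_ge0// speed_ge0.
exact: energy_le_kinetic.
Qed.

End curvewise_inequality.

(** * Good curves for a weak upper gradient *)

Section good_curves.
Implicit Types (g : curve X) (r s t a b : R) (G f : X -> R).
Section along.
Variable pi : probability P R.
Hypothesis tp : test_plan mu pi.
Lemma plan_null (N : set X) t : measurable N -> mu N = 0%E ->
 pi [set g : P | N (ev (g : curve X) t)] = 0%E.
Proof.
move=> mN N0; have [[C piC] _] := tp.
apply/eqP; rewrite eq_le measure_ge0 andbT.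
by have := piC (clamp01 t) N (clamp01_itv t) mN; rewrite N0 mule0.
Qed.

Lemma ae_endpoint (Q : X -> Prop) t : {ae mu, forall x, Q x} ->
 {ae pi, forall g, Q (ev (g : curve X) t)}.
Proof.
move=> [N [mN N0 QN]]; exists [set g : P | N (ev (g : curve X) t)]; split.
- by rewrite -[X in measurable X]setTI; exact: m_eval.
- exact: plan_null.
- by move=> g nQ; apply: QN.
Qed.

(** Bounded compression makes an exceptional null set negligible at each time; sections are then
    exchanged. *)
Lemma ae_along (Q : X -> Prop) : {ae mu, forall x, Q x} ->
 {ae pi, forall g, {ae leb, forall r, Q (ev (g : curve X) r)}}.
Proof.
move=> [N [mN N0 QN]].
pose B : set (P * R) := [set z | N (ev (z.1 : curve X) z.2)].
have mB : measurable B by rewrite -[X in measurable X]setTI; exact: m_ev.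
have := @ae_section_swap R _ _ _ _ pi leb B mB (fun t => plan_null t mN N0).
move=> /ae_imp; apply => g g0; exists [set r | N (ev (g : curve X) r)]; split => //.
 rewrite -[X in measurable X]setTI.
 exact: (mT_comp (m_ev) (measurable_pair1 (g : P))).
by move=> r nQ; apply: QN.
Qed.

End along.
Definition clen G n i g : \bar R :=
 (\int[leb]_(r in cell n i) ((G (ev g r))%:E * speed g r))%E.

Lemma clenE G n i g : meas G ->
 clen G n i g = wlen G (i%:R / n.+1%:R) (i.+1%:R / n.+1%:R) g.
Proof.
move=> mG; rewrite /clen /wlen integral_itv_bndo_bndc//.
exact: mfunTS (m_wspeed1 g mG).
Qed.

(** Countably many conditions, hence met by almost every curve, yet enough to control the increments
    of [f] in cells shrinking to a typical time. The second clause links the nodes to the value at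
    [r] itself, as [f] along a curve need not be continuous. *)
Definition good_curve f G g : Prop :=
 (forall n i, (i < n.+1)%N ->
  (`|f (ev g (i.+1%:R / n.+1%:R)) - f (ev g (i%:R / n.+1%:R))|%:E <= clen G n i g)%E) /\
 {ae leb, forall r, 0 <= r < 1 -> forall n i, cell n i r ->
  (`|f (ev g r) - f (ev g (i%:R / n.+1%:R))|%:E <= clen G n i g)%E}.

Lemma wug_good_curve (pi : probability P R) f G : test_plan mu pi ->
 weak_upper_gradient mu f G -> {ae pi, forall g, good_curve f G (g : curve X)}.
Proof.
move=> tp wug; have [mf mG G0 _] := wug.
have node n i : (i < n.+1)%N ->
  [/\ 0 <= i%:R / n.+1%:R :> R, i%:R / n.+1%:R <= i.+1%:R / n.+1%:R :> R & i.+1%:R / n.+1%:R <= 1 :> R].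
 move=> iN; split; first exact: divr_ge0.
  by rewrite ler_pM2r ?invr_gt0// ler_nat.
 by rewrite ler_pdivrMr// mul1r ler_nat.
have H1 : {ae pi, forall g : P, forall n i, (i < n.+1)%N ->
  (`|f (ev (g : curve X) (i.+1%:R / n.+1%:R)) - f (ev (g : curve X) (i%:R / n.+1%:R))|%:E <= clen G n i (g : curve X))%E}.
 apply/ae_foralln => n; apply/ae_foralln => i.
 have [iN|] := boolP (i < n.+1)%N; last by move=> _; apply: ae_all.
 have [h1 h2 h3] := node _ _ iN.
 move: (wug_ae_curve tp wug h1 h2 h3) => /ae_imp; apply => g Hg _.
 by rewrite clenE.
have H2 : {ae pi, forall g : P, forall n i, {ae leb, forall r, (i < n.+1)%N -> cell n i r ->
  (`|f (ev (g : curve X) r) - f (ev (g : curve X) (i%:R / n.+1%:R))|%:E <= clen G n i (g : curve X))%E}}.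
 apply/ae_foralln => n; apply/ae_foralln => i.
 have [iN|] := boolP (i < n.+1)%N; last first.
  by move=> _; apply: ae_all => g; apply: ae_all.
 have [h1 h2 h3] := node _ _ iN.
 pose a := i%:R / n.+1%:R : R; pose b := i.+1%:R / n.+1%:R : R.
 pose U (z : P * R) := `|f (ev (z.1 : curve X) z.2) - f (ev (z.1 : curve X) a)|%:E.
 pose V (z : P * R) := wlen G a b (z.1 : curve X).
 have mU : meas U.
  apply/mEFinP; apply: mT_comp => //; apply: mfunB.
   exact: (mT_comp mf (m_ev)).
  apply: (mT_comp mf).
  exact: (mT_comp (m_eval a) measurable_fst).
 have mV : meas V.
  exact: (mT_comp (m_wlen a b mG G0) measurable_fst).
 pose B : set (P * R) := (setT `*` cell n i) `&` [set z | (V z < U z)%E].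
 have mB : measurable B.
  apply: measurableI.
   by apply: measurableX => //; exact: m_itv.
  by rewrite -[X in measurable X]setTI; exact: measurable_lte.
 (* At a fixed time [r] of the cell, the exceptional curves violate the inequality between the left
    node and [r], since the length up to [r] is at most that over the cell. *)
 have B0 r : pi [set g : P | B (g, r)] = 0%E.
  have [cr|ncr] := pselect (cell n i r); last first.
   rewrite (_ : [set _ | _] = set0) ?measure0//.
   by apply/seteqP; split => g //= [[]].
  have /andP[ar rb] : a <= r <= b.
   by move: cr; rewrite /cell /= in_itv/= => /andP[-> /ltW ->].
  have [N [mN N0 HN]] := wug_ae_curve tp wug h1 ar (le_trans rb h3).
  have sBN : [set g : P | B (g, r)] `<=` N.
   move=> g [_ /= VU]; apply: HN => /=; apply/negP; rewrite -ltNge.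
   apply: le_lt_trans VU; rewrite /V/= /wlen.
   apply: ge0_subset_integral => //.
   - exact: mfunTS (m_wspeed1 g mG).
   - by move=> x _; exact: wspeed_ge0.
   - by move=> x /=; rewrite !in_itv/= => /andP[-> /le_trans ->].
  apply/eqP; rewrite eq_le measure_ge0 andbT -N0; apply: le_measure => //; rewrite inE//.
  rewrite -[X in measurable X]setTI.
  have := measurable_pair2 r measurableT mB; exact.
 have := @ae_section_swap R _ _ _ _ pi leb B mB B0.
 move=> /ae_imp; apply => g g0; exists [set r | B (g : P, r)]; split => //.
  rewrite -[X in measurable X]setTI; exact: (measurable_pair1 (g : P) measurableT mB).
 move=> r /not_implyP[_] /not_implyP[cr] /negP; rewrite -ltNge clenE// => h.
apply: (ae_imp2 H1 H2) => g h1 h2; split => //.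
have : {ae leb, forall r, forall n i, (i < n.+1)%N -> cell n i r ->
  (`|f (ev g r) - f (ev g (i%:R / n.+1%:R))|%:E <= clen G n i g)%E}.
 by apply/ae_foralln => n; apply/ae_foralln => i; exact: h2.
move=> /ae_imp; apply => r H r01 n i ci; apply: H => //.
have [j jN cj] := cell_ex n r01; have /andP[r0 _] := r01.
by move: ci cj jN => /(cellP _ _ r0) -> /(cellP _ _ r0) ->.
Qed.

End good_curves.

(** * Calculus of weak upper gradients *)

Section wug_calculus.
Implicit Types (g : curve X) (r s t a b : R) (G H f h : X -> R).
Local Notation wug := (weak_upper_gradient mu).
Lemma measurable_fdiff f s t : meas f ->
 meas (fun g : P => `|f (ev (g : curve X) t) - f (ev (g : curve X) s)|%:E).
Proof.
move=> mf; apply/mEFinP; apply: mT_comp => //; apply: mfunB.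
 exact: (mT_comp mf (m_eval t)).
exact: (mT_comp mf (m_eval s)).
Qed.

Lemma wug_cw f G : meas f -> meas G ->
 (forall x, 0 <= G x) ->
 (forall pi : probability P R, test_plan mu pi ->
  {ae pi, forall g, (`|f (ev (g : curve X) 1) - f (ev (g : curve X) 0)|%:E <= wlen G 0 1 g)%E}) ->
 wug f G.
Proof.
move=> mf mG G0 H; split => // pi tp.
under eq_integral do rewrite -(@evE) ?lexx ?ler01// -(@evE) ?lexx ?ler01//.
under [leRHS]eq_integral do rewrite integral_metric_speed//.
apply: (@ae_ge0_le_integral _ _ _ pi _ measurableT).
- by move=> g _; rewrite lee_fin.
- exact: (measurable_fdiff 0 1 mf).
- by move=> g _; exact: wlen_ge0.
- exact: m_wlen.
- by apply: (ae_imp (H pi tp)) => g.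
Qed.

Lemma wug01 (pi : probability P R) f G : test_plan mu pi -> wug f G ->
 {ae pi, forall g, (`|f (ev (g : curve X) 1) - f (ev (g : curve X) 0)|%:E <= wlen G 0 1 g)%E}.
Proof. by move=> tp w; apply: (wug_ae_curve tp w) => //; rewrite ler01. Qed.

Lemma wlen_le_ae G H g : meas G -> meas H ->
 (forall x, 0 <= G x) -> (forall x, 0 <= H x) ->
 {ae leb, forall r, G (ev g r) <= H (ev g r)} -> (wlen G 0 1 g <= wlen H 0 1 g)%E.
Proof.
move=> mG mH G0 H0 GH.
apply: (@ae_ge0_le_integral _ _ _ leb).
- exact: m_itv.
- by move=> r _; exact: wspeed_ge0.
- exact: mfunTS (m_wspeed1 g mG).
- by move=> r _; exact: wspeed_ge0.
- exact: mfunTS (m_wspeed1 g mH).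
- by apply: (ae_imp GH) => r h _; rewrite lee_wpmul2r ?speed_ge0.
Qed.

Lemma wug_ae f h G H : wug f G -> meas h -> meas H ->
 (forall x, 0 <= H x) -> {ae mu, forall x, f x = h x} -> {ae mu, forall x, G x <= H x} ->
 wug h H.
Proof.
move=> w mh mH H0 fh GH; have [mf mG G0 _] := w.
apply: wug_cw => // pi tp.
have E1 := ae_endpoint tp 1 fh; have E0 := ae_endpoint tp 0 fh.
apply: (ae_imp2 (ae_and (wug01 tp w) (ae_along tp GH)) (ae_and E1 E0)) => g [h1 h2] [<- <-].
exact: le_trans h1 (wlen_le_ae mG mH G0 H0 h2).
Qed.

Lemma wlenD G H g : meas G -> meas H ->
 (forall x, 0 <= G x) -> (forall x, 0 <= H x) ->
 wlen (fun x => G x + H x) 0 1 g = (wlen G 0 1 g + wlen H 0 1 g)%E.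
Proof.
move=> mG mH G0 H0; rewrite /wlen -ge0_integralD//.
- by apply: eq_integral => r _; rewrite EFinD ge0_muleDl// lee_fin.
- by move=> r _; exact: wspeed_ge0.
- exact: mfunTS (m_wspeed1 g mG).
- by move=> r _; exact: wspeed_ge0.
- exact: mfunTS (m_wspeed1 g mH).
Qed.

Lemma wlenZ a G g : 0 <= a -> meas G -> (forall x, 0 <= G x) ->
 wlen (fun x => a * G x) 0 1 g = (a%:E * wlen G 0 1 g)%E.
Proof.
move=> a0 mG G0; rewrite /wlen -ge0_integralZl//.
- by apply: eq_integral => r _; rewrite muleA.
- exact: mfunTS (m_wspeed1 g mG).
- by move=> r _; exact: wspeed_ge0.
Qed.

Lemma wug_lin a b f h G H : wug f G -> wug h H ->
 wug (fun x => a * f x + b * h x) (fun x => `|a| * G x + `|b| * H x).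
Proof.
move=> w1 w2; have [mf mG G0 _] := w1; have [mh mH H0 _] := w2.
have mZ c (u : X -> R) : meas u -> meas (fun x => c * u x).
 by move=> mu_; apply: mfunM.
apply: wug_cw.
- by apply: mfunD; exact: mZ.
- by apply: mfunD; exact: mZ.
- by move=> x; rewrite addr_ge0// mulr_ge0.
move=> pi tp; apply: (ae_imp2 (wug01 tp w1) (wug01 tp w2)) => g h1 h2.
rewrite wlenD; [|exact: mZ|exact: mZ|by move=> x; rewrite mulr_ge0|by move=> x; rewrite mulr_ge0].
rewrite !wlenZ//.
apply: (@le_trans _ _ (`|a|%:E * `|f (ev g 1) - f (ev g 0)|%:E + `|b|%:E * `|h (ev g 1) - h (ev g 0)|%:E)%E).
 rewrite -!EFinM -!normrM; apply: le_trans (ler_normD _ _).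
 by apply: eq_leW; congr `| _ |; ring.
by apply: leeD; rewrite lee_wpmul2l.
Qed.

Lemma wug_lim (f_ : nat -> X -> R) f G : (forall n, wug (f_ n) G) ->
 meas f -> (forall x, f_ n x @[n --> \oo] --> f x) -> wug f G.
Proof.
move=> w mf cf; have [_ mG G0 _] := w 0%N.
apply: wug_cw => // pi tp.
apply: (ae_imp (ae_foralln (fun n => wug01 tp (w n)))) => g h.
have [/eqP->|fin] := boolP (wlen G 0 1 (g : curve X) == +oo%E); first by rewrite leey.
have wf : wlen G 0 1 (g : curve X) \is a fin_num.
 by rewrite ge0_fin_numE ?wlen_ge0// ltey.
rewrite -(fineK wf) lee_fin.
have c : `|f_ n (ev (g : curve X) 1) - f_ n (ev (g : curve X) 0)| @[n --> \oo] -->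
  `|f (ev (g : curve X) 1) - f (ev (g : curve X) 0)|.
 by apply: cvg_norm; apply: cvgB; exact: cf.
rewrite -(cvg_lim (@Rhausdorff R) c); apply: limr_le; first by apply/cvg_ex; eexists; exact: c.
by near=> n; have := h n; rewrite -(fineK wf).
Unshelve. all: by end_near. Qed.

Lemma plan_marginal (pi : probability P R) : test_plan mu pi -> exists2 C : R, 0 <= C &
 forall (F : X -> \bar R) t, meas F -> (forall x, 0 <= F x)%E ->
  (\int[pi]_g F (ev (g : curve X) t) <= C%:E * \int[mu]_x F x)%E.
Proof.
move=> [[C HC] _]; exists (Num.max 0 C) => [|F t mF F0]; first by rewrite le_max lexx.
have C0 : 0 <= Num.max 0 C by rewrite le_max lexx.
pose C' := NngNum C0.
have -> : (\int[pi]_g F (ev (g : curve X) t) =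
 \int[pushforward pi (fun g : P => ev (g : curve X) t)]_x F x)%E.
 rewrite (ge0_integral_pushforward (m_eval t))//.
have -> : ((Num.max 0 C)%:E * \int[mu]_x F x = \int[mscale C' mu]_x F x)%E.
 by rewrite ge0_integral_mscale.
apply: ge0_le_measure_integral => //; first exact: m_eval.
move=> mev S mS; rewrite /mscale/= /pushforward.
have := HC (clamp01 t) S (clamp01_itv t) mS => /le_trans; apply.
by rewrite lee_wpmul2r// lee_fin le_max lexx orbT.
Qed.

(** With [s] the speed, [H s <= H^2 + s^2]: the first term is integrable by bounded compression and
    Tonelli, the second by the finite energy of the plan. *)
Lemma wlen_fin (pi : probability P R) H : test_plan mu pi -> meas H ->
 (forall x, 0 <= H x) -> (\int[mu]_x (H x ^+ 2)%:E < +oo)%E ->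
 {ae pi, forall g, (wlen H 0 1 (g : curve X) < +oo)%E}.
Proof.
move=> tp mH H0 H2; have [C C0 HC] := plan_marginal tp.
pose F (z : P * R) := ((H (ev (z.1 : curve X) z.2) ^+ 2)%:E * (\1_(`[0, 1] : set R) z.2)%:E)%E.
have mF : meas F.
 apply: emeasurable_funM; apply/mEFinP.
  by apply: mfunX; exact: (mT_comp mH (m_ev)).
 apply: mT_comp; last exact: measurable_snd.
 by []; exact: m_itv.
have F0 z : (0 <= F z)%E by rewrite mule_ge0 ?lee_fin ?sqr_ge0.
have fin1 : (\int[pi]_g \int[leb]_r F (g, r) < +oo)%E.
 rewrite fubini_tonelli//.
 apply: (@le_lt_trans _ _ (\int[leb]_r ((C%:E * \int[mu]_x (H x ^+ 2)%:E) * (\1_(`[0, 1] : set R) r)%:E))%E).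
  apply: ge0_le_integral => //.
  - by move=> r _; apply: integral_ge0.
  - exact: measurable_fun_fubini_tonelli_G.
  - apply: emeasurable_funM => //; apply/mEFinP.
   by []; exact: m_itv.
  move=> r _; rewrite /F /= ge0_integralZr//.
  - rewrite lee_wpmul2r ?indicE//; apply: (HC (fun x => (H x ^+ 2)%:E)).
    by apply/mEFinP; exact: mfunX.
   by move=> x; rewrite lee_fin sqr_ge0.
  - apply/mEFinP; apply: mfunX.
   exact: (mT_comp mH (m_eval r)).
  - by move=> g _; rewrite lee_fin sqr_ge0.
 have K0 : (0 <= C%:E * \int[mu]_x (H x ^+ 2)%:E)%E.
  by rewrite mule_ge0 ?lee_fin// integral_ge0// => x; rewrite lee_fin sqr_ge0.
 rewrite ge0_integralZl//; last first.
  by apply/mEFinP; apply: measurable_indic; exact: m_itv.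
 rewrite integral_indic//= setIT lebesgue_measure_itv/= lte_fin ltr01 oppr0 adde0 mule1.
 by rewrite lte_mul_pinfty.
have fin2 := test_plan_energy tp.
have mE : meas (energy : P -> \bar R) by exact: measurable_energy.
have mA : meas (fun g : P => \int[leb]_r F (g, r))%E.
 exact: measurable_fun_fubini_tonelli_F.
have mW := m_wlen 0 1 mH H0.
have fin3 : (\int[pi]_g wlen H 0 1 (g : curve X) < +oo)%E.
 apply: (@le_lt_trans _ _ (\int[pi]_g ((\int[leb]_r F (g, r)) + energy (g : curve X)))%E); last first.
  rewrite ge0_integralD//; [exact: lte_add_pinfty| by move=> g _; apply: integral_ge0|].
  by move=> g _; apply: integral_ge0 => r _; rewrite mule_ge0// speed_ge0.
 apply: ge0_le_integral => //.
 - by move=> g _; exact: wlen_ge0.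
 - exact: emeasurable_funD.
 move=> g _.
 have -> : (\int[leb]_r F (g, r) = \int[leb]_(r in `[0%R, 1%R]) (H (ev (g : curve X) r) ^+ 2)%:E)%E.
  rewrite [RHS]integral_mkcond; apply: eq_integral => r _; rewrite /F patchE /= indicE.
  by case: (r \in _); rewrite ?mule1 ?mule0.
 have ms := m_speed1 (g : curve X).
 have mHg : meas (fun r => (H (ev (g : curve X) r) ^+ 2)%:E).
  apply/mEFinP; apply: mfunX; apply: (mT_comp mH).
  exact: (mT_comp (m_ev) (measurable_pair1 (g : P))).
 rewrite -ge0_integralD; [|exact: m_itv|by move=> r _; rewrite lee_fin sqr_ge0
  |exact: mfunTS mHg|by move=> r _; rewrite mule_ge0// speed_ge0
  |exact: mfunTS (emeasurable_funM ms ms)].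
 apply: ge0_le_integral.
 - exact: m_itv.
 - by move=> r _; exact: wspeed_ge0.
 - exact: mfunTS (m_wspeed1 g mH).
 - apply: mfunTS; exact: emeasurable_funD mHg (emeasurable_funM ms ms).
 move=> r _; have := speed_ge0 (g : curve X) r; move: (speed _ r) => [s|_|//].
  rewrite lee_fin => s0; rewrite -!EFinM lee_fin.
  by have := H0 (ev (g : curve X) r); move: (H _) => a a0; nra.
 by rewrite leey.
have ip : pi.-integrable setT (wlen H 0 1 : P -> \bar R).
 apply/integrableP; split => //.
 by under eq_integral do rewrite gee0_abs ?wlen_ge0//.
apply: (ae_imp (integrable_ae measurableT ip)) => g; rewrite ge0_fin_numE ?wlen_ge0; exact.
Qed.

(** [c x] bounds the Lipschitz constant of [phi] near [x] within [D]. Both [y] and [z] vary, because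
    the increments to be estimated join two nodes neither of which is the point under
    consideration. *)
Definition strict_lip (D : set R) (phi c : R -> R) (L : R) : Prop :=
 [/\ forall x, D x -> 0 <= c x <= L,
   forall x y, D x -> D y -> `|phi x - phi y| <= L * `|x - y| &
   forall x, D x -> forall e, 0 < e -> exists2 rho, 0 < rho & forall y z, D y -> D z ->
    `|y - x| < rho -> `|z - x| < rho -> `|phi y - phi z| <= (c x + e) * `|y - z|].

Definition fin_len G := forall pi : probability P R, test_plan mu pi ->
 {ae pi, forall g, (wlen G 0 1 (g : curve X) < +oo)%E}.

Lemma telescope_norm (u : nat -> R) n :
 `|u n.+1 - u 0%N| <= \sum_(i < n.+1) `|u i.+1 - u i|.
Proof.
have -> : u n.+1 - u 0%N = \sum_(i < n.+1) (u i.+1 - u i).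
 by rewrite -(big_mkord xpredT (fun i => u i.+1 - u i)) telescope_sumr.
exact: ler_norm_sum.
Qed.

Lemma small_arith (N I A rho e1 : R) : 0 < N -> e1 <= 1 -> 0 < rho ->
 `|N * I - A| < e1 -> 2 * (A + 1) / rho < N -> 2 * I < rho.
Proof.
move=> N0 e11 rho0; rewrite ltr_norml => /andP[_ h]; rewrite ltr_pdivrMr// => h2.
by rewrite -(ltr_pM2l N0); lra.
Qed.

Lemma chain_arith (N I1 I2 A B cr e1 e v w : R) : 0 < N -> 0 <= cr -> 0 < e1 ->
 (cr + e1) * (Num.min A B + e1) <= e ->
 `|N * I1 - A| < e1 -> `|N * I2 - B| < e1 -> v <= I1 -> v <= I2 ->
 w <= (cr + e1) * v -> N * w <= e.
Proof.
move=> N0 c0 e10 he; rewrite !ltr_norml => /andP[_ h1] /andP[_ h2] v1 v2 wv.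
apply: le_trans he; apply: (@le_trans _ _ (N * ((cr + e1) * v))); first by rewrite ler_pM2l.
rewrite mulrCA ler_wpM2l//; first by rewrite addr_ge0// ltW.
have k1 : N * v <= N * I1 by rewrite ler_pM2l.
have k2 : N * v <= N * I2 by rewrite ler_pM2l.
by rewrite -lerBlDr le_min; apply/andP; split; lra.
Qed.

Lemma node1 n : n.+1%:R / n.+1%:R = 1 :> R.
Proof. by rewrite divff. Qed.

(** On the cell around [r] the increment of [f] is at most the integral of each density [g1], [g2],
    whose averages tend to [g1 r] and [g2 r]; the increment of [phi \o f] gains the factor [c] near
    [f (ev g r)]. These limits are integrated by [partition_bound_L1] with the dominating function
    [L * g1]. *)
Lemma good_curve_chain D phi c L f G1 G2 g : strict_lip D phi c L -> (forall x, D (f x)) ->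
 meas G1 -> meas G2 -> meas (c \o f) ->
 (forall x, 0 <= G1 x) -> (forall x, 0 <= G2 x) ->
 good_curve f G1 g -> good_curve f G2 g ->
 (wlen G1 0 1 g < +oo)%E -> (wlen G2 0 1 g < +oo)%E ->
 (`|phi (f (ev g 1)) - phi (f (ev g 0))|%:E
  <= wlen (fun x => (c (f x) * Num.min (G1 x) (G2 x))%R) 0 1 g)%E.
Proof.
move=> [cL Lip loc] Df mG1 mG2 mc G10 G20 [gc1 ae1] [gc2 _] w1 w2.
have [g1 [mg1 g10 ig1 ig1E g1E]] := fine_density (m_wspeed1 g mG1)
 (fun r => wspeed_ge0 g r G10) w1.
have [g2 [mg2 g20 ig2 ig2E g2E]] := fine_density (m_wspeed1 g mG2)
 (fun r => wspeed_ge0 g r G20) w2.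
have L0 : 0 <= L by have /andP[a b] := cL _ (Df point); exact: le_trans b.
have cellI n i : (i < n.+1)%N -> cell n i `<=` (`[0%R, 1%R] : set R).
 move=> iN r /(cell_sub iN); rewrite /= !in_itv/= => /andP[-> /ltW->]//.
have mcell n i : measurable (cell n i : set R) by exact: m_itv.
have clen1 n i : (i < n.+1)%N -> clen G1 n i g = (\int[leb]_(x in cell n i) g1 x)%:E.
 by move=> iN; rewrite /clen ig1E//; exact: cellI.
have clen2 n i : (i < n.+1)%N -> clen G2 n i g = (\int[leb]_(x in cell n i) g2 x)%:E.
 by move=> iN; rewrite /clen ig2E//; exact: cellI.
pose u n i := f (ev g (i%:R / n.+1%:R)).
have f1 n i : (i < n.+1)%N -> `|u n i.+1 - u n i| <= \int[leb]_(x in cell n i) g1 x.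
 by move=> iN; have := gc1 n i iN; rewrite clen1.
have f2 n i : (i < n.+1)%N -> `|u n i.+1 - u n i| <= \int[leb]_(x in cell n i) g2 x.
 by move=> iN; have := gc2 n i iN; rewrite clen2.
pose l r := c (f (ev g r)) * Num.min (g1 r) (g2 r).
have mev : meas (fun r : R => ev g r).
 exact: (mT_comp (m_ev) (measurable_pair1 (g : P))).
have ml : meas l.
 apply: mfunM; last exact: measurable_minr.
 exact: (mT_comp mc mev).
have l0 r : 0 <= l r.
 by rewrite mulr_ge0 ?le_min ?g10 ?g20; have /andP[] := cL _ (Df (ev g r)).
have lg r : 0 <= l r <= L * g1 r.
 rewrite l0/=; apply: ler_pM.
 - by have /andP[] := cL _ (Df (ev g r)).
 - by rewrite le_min g10 g20.
 - by have /andP[] := cL _ (Df (ev g r)).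
 - by rewrite ge_min lexx.
have lgi1 : locally_integrable setT g1 by apply: open_integrable_locally => //; exact: openT.
have lgi2 : locally_integrable setT g2 by apply: open_integrable_locally => //; exact: openT.
have main := @partition_bound_L1 R (fun n i => `|phi (u n i.+1) - phi (u n i)|)
 (`|phi (f (ev g 1)) - phi (f (ev g 0))|) (fun r => L * g1 r) l.
apply: (@le_trans _ _ (\int[leb]_(r in `[0%R, 1%R[) (l r)%:E)%E).
 apply: main => //.
 - exact: integrZ.
 - move=> n i iN; rewrite normr_ge0/= RintegralZl; [|exact: m_itv|by apply: (integrableS measurableT) => //; exact: m_itv].
  apply: le_trans (Lip _ _ (Df _) (Df _)) _; rewrite ler_wpM2l//; exact: f1.
 - move=> n; have := telescope_norm (fun i => phi (u n i)) n.
  by rewrite /u node1 mul0r.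
 apply: (ae_imp2 (ae_and (cell_average lgi1) (cell_average lgi2)) ae1) => r [a1 a2] {}ae1 r01 e e0.
 have /andP[r0 r1] := r01.
 have [c0 _] := andP (cL _ (Df (ev g r))).
 pose m := Num.min (g1 r) (g2 r); pose cr := c (f (ev g r)).
 have m0 : 0 <= m by rewrite le_min g10 g20.
 have den0 : 0 < cr + m + 1 by rewrite ltr_wpDl// addr_ge0.
 (* Small enough for [(cr + e1) * (m + e1) <= cr * m + e], the minimum with [1] absorbing the term
    [e1 ^ 2]. *)
 pose e1 := Num.min 1 (e / (cr + m + 1)).
 have e10 : 0 < e1 by rewrite lt_min ltr01 divr_gt0.
 have e1b : (cr + e1) * (m + e1) <= cr * m + e.
  have h1 : e1 <= 1 by rewrite ge_min lexx.
  have h2 : e1 * (cr + m + 1) <= e by rewrite -ler_pdivlMr// ge_min lexx orbT.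
  have : e1 * (cr + m + e1) <= e1 * (cr + m + 1) by rewrite ler_pM2l// lerD2l.
  by move=> h3; move: (le_trans h3 h2); rewrite mulrDl !mulrDr => h4; lra.
 have [rho rho0 Hrho] := loc _ (Df (ev g r)) _ e10.
 near=> n => i iN ci.
 have A1 : `|n.+1%:R * \int[leb]_(x in cell n i) g1 x - g1 r| < e1.
  by move: i iN ci; near: n; apply: filterS (a1 r0 _ e10) => n h i _; exact: h.
 have A2 : `|n.+1%:R * \int[leb]_(x in cell n i) g2 x - g2 r| < e1.
  by move: i iN ci {A1}; near: n; apply: filterS (a2 r0 _ e10) => n h i _; exact: h.
 have A3 : 2 * (g1 r + 1) / rho < n.+1%:R.
  near: n; apply: filterS (nbhs_infty_gtr (2 * (g1 r + 1) / rho)) => n h.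
  by apply: lt_trans h _; rewrite ltr_nat.
 have n0 : 0 < n.+1%:R :> R by [].
 have B1 : 2 * \int[leb]_(x in cell n i) g1 x < rho.
  by apply: (small_arith n0 _ rho0 A1 A3); rewrite ge_min lexx.
 have I0 := le_trans (normr_ge0 _) (f1 n i iN).
 have C1 : `|u n i - f (ev g r)| <= \int[leb]_(x in cell n i) g1 x.
  by rewrite distrC; have := ae1 r01 n i ci; rewrite (clen1).
 have C2 : `|u n i.+1 - f (ev g r)| <= 2 * \int[leb]_(x in cell n i) g1 x.
  rewrite mulr_natl mulr2n; apply: le_trans (ler_distD (u n i) _ _) _.
  by apply: lerD => //; exact: f1.
 have E : `|phi (u n i.+1) - phi (u n i)| <= (cr + e1) * `|u n i.+1 - u n i|.
  apply: (Hrho _ _ (Df _) (Df _) (le_lt_trans C2 B1)).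
  by apply: le_lt_trans C1 (le_lt_trans _ B1); rewrite mulr_natl lerDl.
 exact: (chain_arith n0 c0 e10 e1b A1 A2 (f1 n i iN) (f2 n i iN) E).
rewrite [leLHS]integral_itv_bndo_bndc; last first.
 by apply/mEFinP; exact: mfunTS.
apply: (@ae_ge0_le_integral _ _ _ leb).
- exact: m_itv.
- by move=> r _; rewrite lee_fin.
- by apply/mEFinP; exact: mfunTS.
- move=> r _; rewrite mule_ge0 ?speed_ge0// lee_fin mulr_ge0 ?le_min ?G10 ?G20//.
 by have /andP[] := cL _ (Df (ev g r)).
- have mcG : meas (fun x => c (f x) * Num.min (G1 x) (G2 x)).
  by apply: mfunM => //; exact: measurable_minr.
 exact: mfunTS (m_wspeed1 g mcG).
apply: (ae_imp2 g1E g2E) => r h1 h2 /=; rewrite in_itv/= => r01.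
rewrite /l EFinM EFinM -muleA lee_wpmul2l//.
 by rewrite lee_fin; have /andP[] := cL _ (Df (ev g r)).
have := h1 r01; have := h2 r01; have := speed_ge0 g r.
move: (G10 (ev g r)) (G20 (ev g r)); move: (speed g r) (G1 _) (G2 _) => s a b a0 b0 s0 E2 E1.
rewrite EFin_min -E1 -E2 EFin_min.
rewrite /Order.min; case: ifPn => h; case: ifPn => h'.
- by [].
- exact: ltW.
- by rewrite leNgt.
- by [].
Unshelve. all: by end_near. Qed.

(** Two gradients at once serve two purposes: with [phi] the identity, the minimum of two weak upper
    gradients is one; with [G1 = G2] this is the chain rule. *)
Lemma wug_chain_min D phi c L f G1 G2 : strict_lip D phi c L -> (forall x, D (f x)) ->
 meas (phi \o f) -> meas (c \o f) ->
 wug f G1 -> wug f G2 -> fin_len G1 -> fin_len G2 ->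
 wug (phi \o f) (fun x => c (f x) * Num.min (G1 x) (G2 x)).
Proof.
move=> sl Df mphi mc w1 w2 l1 l2; have [mf mG1 G10 _] := w1; have [_ mG2 G20 _] := w2.
apply: wug_cw => //.
- by apply: mfunM => //; exact: measurable_minr.
- move=> x; rewrite mulr_ge0 ?le_min ?G10 ?G20//.
 by case: sl => cL _ _; have /andP[] := cL _ (Df x).
move=> pi tp.
apply: (ae_imp2 (ae_and (wug_good_curve tp w1) (wug_good_curve tp w2))
 (ae_and (l1 _ tp) (l2 _ tp))) => g [h1 h2] [h3 h4].
exact: (good_curve_chain sl).
Qed.

End wug_calculus.
Lemma open_ballX (x : X) (r : R) :
 open (ball x r).
Proof.
rewrite (_ : ball x r = [set y | mdist y x < r]); first exact: open_mball.
by rewrite ballEmdist; apply/seteqP; split => y /=; rewrite metric_sym.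
Qed.

(** * Lipschitz functions and the minimal weak upper gradient *)

Section minimal_gradient.
Implicit Types (g : curve X) (r s t a b : R) (G H f h : X -> R).
Local Notation wug := (weak_upper_gradient mu).
Lemma integral_le_funepos (A : set R) (f : R -> \bar R) :
 (\int[leb]_(r in A) f r <= \int[leb]_(r in A) f^\+ r)%E.
Proof.
rewrite [leLHS]integralE -[leRHS]sube0; apply: leeB => //.
by apply: integral_ge0 => r _; exact: funeneg_ge0.
Qed.

(** The supremum defining [speed] runs over rational increments; continuity of the curve extends the
    bound to all small ones. *)
Lemma speed_bound g r s e : speed g r = s%:E -> 0 < e -> exists2 dl, 0 < dl &
 forall k : R, `|k| < dl -> mdist (ev g (r + k)) (ev g r) <= (s + e) * `|k|.
Proof.
move=> sE e0.
have : (speed g r < (s + e)%:E)%E by rewrite sE lte_fin ltrDl.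
move=> /ereal_inf_lt[_ [n _ <-]] Hn; exists n.+1%:R^-1; first by [].
move=> h hn; rewrite leNgt; apply/negP => lt1.
have [h0|hn0] := eqVneq h 0.
 by move: lt1; rewrite h0 addr0 mdistxx normr0 mulr0 ltxx.
pose u t := mdist (ev g (r + t)) (ev g r) - (s + e) * `|t|.
have cu : continuous u.
 move=> t; apply: cvgB.
  apply: (@continuous_comp _ _ _ (fun t => ev g (r + t)) (fun x => mdist x (ev g r))); last exact: mdist_cont.
  apply: (@continuous_comp _ _ _ (fun t => r + t) (ev g)); last exact: ev_cont.
  by apply: continuousD; [exact: cvg_cst|exact: cvg_id].
 apply: cvgM; [exact: cvg_cst|exact: norm_continuous].
have : \forall t \near h, (0 < u t) && (0 < `|t| < n.+1%:R^-1).
 have N1 : \forall t \near h, 0 < u t.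
  by apply: (cvgr_gt _ (cu h)); rewrite subr_gt0.
 have N2 : \forall t \near h, `|t| < n.+1%:R^-1.
  by apply: (cvgr_lt _ (@norm_continuous _ R h)).
 have N3 : \forall t \near h, 0 < `|t|.
  by apply: (cvgr_gt _ (@norm_continuous _ R h)); rewrite normr_gt0.
 by near=> t; apply/and3P; split; near: t.
move=> /nbhs_ballP[dd /= dd0 Hd].
have [k /andP[k1 k2]] : exists k, h - dd < rat_seq k < h + dd.
 by apply: rat_seq_dense; rewrite ltrBlDr -addrA ltrDl addr_gt0.
have : ball h dd (rat_seq k : R).
 by rewrite /ball/= ltr_norml; apply/andP; split; lra.
move=> /Hd /andP[uk kn].
have : (speed_quot n k g r < (s + e)%:E)%E.
 by apply: le_lt_trans Hn; apply: ereal_sup_ubound; exists k.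
rewrite /speed_quot kn lte_fin ltr_pdivrMr; last by have /andP[] := kn.
by move=> h1; move: uk; rewrite /u subr_gt0 => h2; move: (lt_trans h1 h2); rewrite ltxx.
Unshelve. all: by end_near. Qed.

Definition dyadic n (i : nat) g : R :=
 mdist (ev g (i.+1%:R / n.+1%:R)) (ev g (i%:R / n.+1%:R)).

(** Only countably many evaluations are involved, so this is measurable; its finiteness supplies the
    square bound wanted by [partition_bound_L2]. *)
Definition disc_energy g : \bar R :=
 esups (fun n => (\sum_(i < n.+1) n.+1%:R * dyadic n i g ^+ 2)%:E) 0.

Lemma measurable_disc_energy : meas (disc_energy : P -> \bar R).
Proof.
apply: (@measurable_fun_esups _ _ _ _ (fun n (g : P) => (\sum_(i < n.+1) n.+1%:R * dyadic n i (g : curve X) ^+ 2)%:E)) => n.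
apply/mEFinP; apply: measurable_sum => i; apply: mfunM => //.
apply: mfunX; apply: measurable_mdistX; exact: m_eval.
Qed.

(** Cauchy-Schwarz bounds [(n + 1) d^2] by the integral of [f^2] over the cell, [d] being the
    increment there; the cells are disjoint, so the sum is bounded independently of [n]. *)
Lemma disc_energy_fin g : abs_continuous2 g -> (disc_energy g < +oo)%E.
Proof.
move=> [f [mf f2 fd]].
pose hh r := ((f r ^+ 2)%:E * (\1_(`[0, 1] : set R) r)%:E)%E.
have hhE : hh = (fun r => (f r ^+ 2)%:E) \_ (`[0%R, 1%R] : set R).
 apply/funext => r; rewrite /hh patchE indicE; by case: (r \in _); rewrite ?mule1 ?mule0.
have mhh : meas hh.
 rewrite hhE; apply/(measurable_restrictT _ _).1 => //.
 by apply/mEFinP; exact: mfunX.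
have hh0 r : (0 <= hh r)%E by rewrite /hh mule_ge0// lee_fin ?sqr_ge0.
have hhfin : (\int[leb]_(r in `[0%R, 1%R]) hh r < +oo)%E.
 have -> : (\int[leb]_(r in `[0%R, 1%R]) hh r = \int[leb]_(r in `[0%R, 1%R]) (f r ^+ 2)%:E)%E.
  by apply: eq_integral => r r01; rewrite hhE patchE r01.
 by [].
have [q [mq q0 iq iqE _]] := fine_density mhh hh0 hhfin.
have key n i : (i < n.+1)%N -> n.+1%:R * dyadic n i g ^+ 2 <= \int[leb]_(x in cell n i) q x.
 move=> iN; pose D := dyadic n i g; have D0 : 0 <= D by exact: mdist_ge0.
 pose a : R := i%:R / n.+1%:R; pose b : R := i.+1%:R / n.+1%:R.
 have n0 : 0 < n.+1%:R :> R by [].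
 have a0 : 0 <= a by exact: divr_ge0.
 have ab : a <= b by rewrite ler_pM2r ?invr_gt0// ler_nat.
 have b1 : b <= 1 by rewrite ler_pdivrMr// mul1r ler_nat.
 have ba : n.+1%:R * (b - a) = 1 by rewrite /a /b -mulrBl -natrB// subSnn mulrCA divff ?mulr1.
 have sub : (`[a, b] : set R) `<=` (`[0%R, 1%R] : set R).
  by move=> r /=; rewrite !in_itv/= => /andP[h1 h2]; rewrite (le_trans a0 h1) (le_trans h2).
 pose J := \int[leb]_(x in `[a, b]) q x.
 have J0 : 0 <= J by apply: Rintegral_ge0.
 have Jcell : J = \int[leb]_(x in cell n i) q x.
  rewrite /J /Rintegral; congr fine; rewrite -[LHS]integral_itv_bndo_bndc//.
  by apply/mEFinP; exact: mfunTS.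
 rewrite -Jcell -/D.
 have [->|Dn0] := eqVneq D 0; first by rewrite expr0n/= mulr0.
 have Dp : 0 < D by rewrite lt_neqAle eq_sym Dn0.
 have mIab : measurable (`[a, b] : set R) by exact: m_itv.
 (* with [l = (b - a) / D], [2 f <= l f^2 + 1 / l] *)
 pose l := (b - a) / D.
 have ba0 : 0 < b - a by rewrite -(pmulr_rgt0 _ n0) ba.
 have l0 : 0 < l by rewrite divr_gt0.
 have E1 : (\int[leb]_(r in `[a, b]) (f r)%:E <= \int[leb]_(r in `[a, b]) ((l / 2 * f r ^+ 2 + l^-1 / 2)%:E))%E.

  have pw r : `|f r| <= l / 2 * f r ^+ 2 + l^-1 / 2.
   rewrite -[f r ^+ 2]real_normK ?num_real//; move: `|f r| (normr_ge0 (f r)) => y y0.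
   have li : l * l^-1 = 1 by rewrite divff// gt_eqF.
   have l'0 : 0 < l^-1 by rewrite invr_gt0.
   rewrite -(ler_pM2l l0) mulrDr; have := sqr_ge0 (l * y - 1); rewrite sqrrB1 => h.
   by rewrite [l * (l^-1 / 2)]mulrA li; move: h; rewrite exprMn expr2; lra.
  have mfab : measurable_fun (`[a, b] : set R) f by apply: measurable_funS mf.
  apply: le_trans (integral_le_funepos _ _) _; apply: ge0_le_integral.
  - exact: m_itv.
  - by move=> r _; exact: funepos_ge0.
  - by apply: measurable_funepos; exact/mEFinP.
  - apply/mEFinP; apply: mfunD; apply: mfunM => //.
   exact: mfunX.
  move=> r _; rewrite funeposE ge_max !lee_fin; apply/andP; split.
   by apply: le_trans (pw r); exact: ler_norm.
  by apply: le_trans (pw r); exact: normr_ge0.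
 have E2 : (\int[leb]_(r in `[a, b]) ((l / 2 * f r ^+ 2 + l^-1 / 2)%:E) = (l / 2 * J + l^-1 / 2 * (b - a))%:E)%E.
  have -> : (\int[leb]_(r in `[a, b]) ((l / 2 * f r ^+ 2 + l^-1 / 2)%:E) =
    \int[leb]_(r in `[a, b]) ((l / 2)%:E * hh r + (l^-1 / 2)%:E))%E.
   apply: eq_integral => r rab; rewrite hhE patchE mem_set ?EFinM//.
   by apply: sub; exact: set_mem.
  have l20 : 0 <= l / 2 by rewrite divr_ge0// ltW.
  have mlhh : measurable_fun (`[a, b] : set R) (fun r => (l / 2)%:E * hh r)%E.
   by apply: mfunTS; apply: emeasurable_funM => //; exact: measurable_cst.
  rewrite ge0_integralD; [|exact: m_itv|by move=> r _; rewrite mule_ge0// lee_fin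
   |exact: mlhh|by move=> r _; rewrite lee_fin divr_ge0// invr_ge0 ltW|exact: measurable_cst].
  rewrite ge0_integralZl; [|exact: m_itv|exact: mfunTS mhh
   |by move=> r _; exact: hh0|by rewrite lee_fin].
  rewrite (iqE _ mIab sub) integral_cst//= lebesgue_measure_itv/= lte_fin.
  by rewrite -subr_gt0 ba0 -!EFinM.
 have : D <= l / 2 * J + l^-1 / 2 * (b - a).
  rewrite -lee_fin -E2; apply: le_trans E1; rewrite /D /dyadic metric_sym.
  have ha : 0 <= a <= 1 by rewrite a0 (le_trans ab).
  have hb : 0 <= b <= 1 by rewrite (le_trans a0).
  by rewrite -/a -/b (evE g ha) (evE g hb); exact: fd.
 have -> : l^-1 / 2 * (b - a) = D / 2.
  by rewrite /l invf_div; field; rewrite gt_eqF.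
 move=> h; have {}h : D <= l * J by lra.
 move: h; rewrite /l mulrAC ler_pdivlMr// -expr2 => h.
 apply: (@le_trans _ _ (n.+1%:R * ((b - a) * J))); first by rewrite ler_pM2l.
 by rewrite mulrA ba mul1r.
apply: (@le_lt_trans _ _ (\int[leb]_(x in `[0%R, 1%R[) q x)%:E); last by rewrite ltry.
apply: ub_ereal_sup => _ [n _ <-]; rewrite lee_fin -(integral_partition n iq).
by apply: ler_sum => i _; exact: key.
Qed.

(** Where [disc_energy] is infinite so is [kinetic_energy]; hence [+oo] times the indicator of that
    measurable set lies below the energy, whose lower integral is finite. *)
Lemma ae_disc_energy (pi : probability P R) : test_plan mu pi ->
 {ae pi, forall g, (disc_energy (g : curve X) < +oo)%E}.
Proof.
move=> [_ fin]; pose E := [set g : P | disc_energy (g : curve X) = +oo%E].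
have mE : measurable E.
 by rewrite /E -[X in measurable X]setTI; exact: (measurable_disc_energy measurableT (emeasurable_set1 +oo%E)).
exists E; split => //; last first.
 by move=> g /negP; rewrite -leNgt leye_eq => /eqP.
have H : (\int[pi]_g (+oo * (\1_E g)%:E) < +oo)%E.
 apply: le_lt_trans fin; apply: lower_integral_le => g.
  by [].
 rewrite indicE; case: (boolP (g \in E)) => [|_]; last by rewrite mule0 kinetic_energy_ge0.
 move=> /set_mem /= gE; rewrite /kinetic_energy; case: asboolP => [ac|_]; last by rewrite leey.
 by have := disc_energy_fin ac; rewrite gE.
apply/eqP; rewrite eq_le measure_ge0 andbT leNgt; apply/negP => E0; move: H.
have -> : (\int[pi]_g (+oo * (\1_E g)%:E) = +oo * pi E)%E.
 by rewrite ge0_integralZl ?integral_indic ?setIT//; first by apply/mEFinP; exact: measurable_indic.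
by rewrite gt0_mulye.
Qed.

(** Outside the closed set [K] the function vanishes near the current point; inside, its increments
    are at most [L] times those of the curve, whose quotients are asymptotically at most the speed.
    The increments of the curve are controlled through their squares, whence
    [partition_bound_L2]. *)
Lemma wug_lipschitz (chi : X -> R) L (K : set X) : 0 < L -> closed K ->
 (forall x y, `|chi x - chi y| <= L * mdist x y) -> (forall x, ~ K x -> chi x = 0) ->
 wug chi (fun x => L * \1_K x).
Proof.
move=> L0 cK Lip chi0.
have mK : measurable K by rewrite -[K]setCK; apply: measurableC; apply: openMX; exact: closed_openC.
have mchi : meas chi.
 by apply: contMX; exact: lip_contX Lip.
have mG : meas (fun x => L * \1_K x) by apply: mfunM.
have G0 x : 0 <= L * \1_K x by apply: mulr_ge0; [exact: ltW|rewrite ler0n].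
apply: wug_cw => // pi tp; apply: (ae_imp (ae_disc_energy tp)) => g0 +.
move: (g0 : curve X) => g {g0} Kfin.
have K0 : (0 <= disc_energy g)%E.
 apply: (@le_trans _ _ (\sum_(i < 1) 1%:R * dyadic 0 i g ^+ 2)%:E).
  by rewrite lee_fin big_ord1 mul1r sqr_ge0.
 by apply: ereal_sup_ubound; exists 0%N.
have Kf : disc_energy g \is a fin_num by rewrite ge0_fin_numE.
pose u n i := chi (ev g (i%:R / n.+1%:R)).
have main := @partition_bound_L2 R (fun n i => `|u n i.+1 - u n i|) (`|chi (ev g 1) - chi (ev g 0)|)
 (L ^+ 2 * fine (disc_energy g)) (fun r => ((L * \1_K (ev g r))%:E * speed g r)%E).
have uL n i : `|u n i.+1 - u n i| <= L * dyadic n i g by exact: Lip.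
rewrite /wlen -[leRHS]integral_itv_bndo_bndc; last exact: mfunTS (m_wspeed1 g mG).
apply: main.
- exact: mfunTS (m_wspeed1 g mG).
- by move=> r; exact: (wspeed_ge0 g r G0).
- by [].
- by move=> n; have := telescope_norm (u n) n; rewrite /u node1 mul0r.
- move=> n; apply: (@le_trans _ _ (L ^+ 2 * \sum_(i < n.+1) n.+1%:R * dyadic n i g ^+ 2)).
  rewrite mulr_sumr; apply: ler_sum => i _; rewrite [leRHS]mulrCA ler_wpM2l// -exprMn.
  by rewrite lerXn2r// ?nnegrE mulr_ge0 ?mdist_ge0// ltW.
 rewrite ler_wpM2l ?sqr_ge0// -lee_fin fineK//.
 by apply: ereal_sup_ubound; exists n.
move=> r r01 e e0; have /andP[r0 r1] := r01.
have small rho : 0 < rho -> \forall n \near \oo, forall i, cell n i r ->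
  `|i%:R / n.+1%:R - r| < rho /\ `|i.+1%:R / n.+1%:R - r| < rho.
 move=> rho0; near=> n => i; rewrite /cell /= in_itv/= => /andP[h1 h2].
 have h3 : n.+1%:R^-1 < rho.
  rewrite invf_plt ?posrE//; near: n; apply: filterS (nbhs_infty_gtr rho^-1) => n h.
  by apply: lt_trans h _; rewrite ltr_nat.
 have h4 : i.+1%:R / n.+1%:R = i%:R / n.+1%:R + n.+1%:R^-1 :> R.
  by rewrite -natr1 mulrDl mul1r.
 have aux (x y q p : R) : x <= q -> q < x + y -> y < p -> `|x - q| < p /\ `|x + y - q| < p.
  by move=> k1 k2 k3; rewrite !ltr_norml; split; apply/andP; split; lra.
 by rewrite h4 in h2 *; exact: aux.
have [Kr|nKr] := pselect (K (ev g r)); last first.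
 have : \forall s \near r, ~ K (ev g s).
  have cg := @ev_cont g r.
  by apply: (cg (~` K)); apply: open_nbhs_nbhs; split => //; exact: closed_openC.
 move=> /nbhs_ballP[rho /= rho0 Hrho].
 apply: filterS (small rho rho0) => n h i ci; have [h1 h2] := h i ci.
 rewrite /u !chi0 ?subrr ?normr0 ?mulr0; last 2 first.
 - by apply: Hrho; rewrite /ball/= distrC.
 - by apply: Hrho; rewrite /ball/= distrC.
 by apply: adde_ge0; [exact: (wspeed_ge0 g r G0)|rewrite ltW].
case E : (speed g r) => [s||].
- have eL : 0 < e / L by rewrite divr_gt0.
 have [rho rho0 Hrho] := speed_bound E eL.
 apply: filterS (small rho rho0) => n h i ci; have [h1 h2] := h i ci.
 have := Hrho _ h1; have := Hrho _ h2; rewrite !(addrCA r) !subrr !addr0 => k1 k2.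
 rewrite indicE mem_set// mulr1 lee_fin.
 have k3 := metric_triangle (ev g (i.+1%:R / n.+1%:R)) (ev g r) (ev g (i%:R / n.+1%:R)).
 move: ci; rewrite /cell /= in_itv/= => /andP[c1 c2].
 rewrite (ger0_norm (x := i.+1%:R / n.+1%:R - r)) ?subr_ge0 ?(ltW c2)// in k1.
 rewrite (ler0_norm (x := i%:R / n.+1%:R - r)) ?subr_le0// opprB in k2.
 have k4 : dyadic n i g <= (s + e / L) / n.+1%:R.
  rewrite (metric_sym (ev g r)) in k3; apply: le_trans k3 _.
  have : (s + e / L) / n.+1%:R = (s + e / L) * (i.+1%:R / n.+1%:R - r) + (s + e / L) * (r - i%:R / n.+1%:R).
   by rewrite -mulrDr addrA subrK -mulrBl -natrB// subSnn mul1r.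
  by move=> ->; exact: lerD.
 apply: (@le_trans _ _ (n.+1%:R * (L * ((s + e / L) / n.+1%:R)))).
  by rewrite ler_pM2l//; apply: le_trans (uL n i) _; rewrite ler_pM2l.
 apply: eq_leW; field.
 by rewrite !gt_eqF.
- by apply: nearW => n i ci; rewrite indicE mem_set// mulr1 gt0_muley// leey.
- by have := speed_ge0 g r; rewrite E.
Unshelve. all: by end_near. Qed.

Lemma wug_lim_G f (G_ : nat -> X -> R) H : (forall n, wug f (G_ n)) -> meas H ->
 (forall x, 0 <= H x) -> (forall n x, G_ n x <= G_ 0%N x) ->
 (forall x, G_ n x @[n --> \oo] --> H x) -> fin_len (G_ 0%N) -> wug f H.
Proof.
move=> w mH H0 G_le cG fl; have [mf _ _ _] := w 0%N.
have mG n : meas (G_ n) by case: (w n).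
have G0 n x : 0 <= G_ n x by case: (w n).
apply: wug_cw => // pi tp.
apply: (ae_imp2 (ae_foralln (fun n => wug01 tp (w n))) (fl _ tp)) => g0.
move: (g0 : curve X) => g {g0} h wfin.
have [g1 [mg1 g10 ig1 ig1E g1E]] := fine_density (m_wspeed1 g (mG 0%N))
 (fun r => wspeed_ge0 g r (G0 0%N)) wfin.
pose F n r := ((G_ n (ev g r))%:E * speed g r)%E.
pose F' r := ((H (ev g r))%:E * speed g r)%E.
have DC := @dominated_convergence _ _ R leb (`[0%R, 1%R] : set R) (m_itv _) F F' (EFin \o g1)
 (fun n => mfunTS (m_wspeed1 g (mG n)))
 (mfunTS (m_wspeed1 g mH)).
have HG x : H x <= G_ 0%N x.
 rewrite -(cvg_lim (@Rhausdorff R) (cG x)); apply: limr_le; first by apply/cvg_ex; exists (H x).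
 by near=> n; exact: G_le.
have [|||_ _ c] := DC; last by apply: (cvge_to_ge c); near=> n; exact: h.
- apply: (ae_imp g1E) => r +; rewrite/= => /[apply] E.
 move: (speed_ge0 g r) E; rewrite /F /F'; case: (speed g r) => [s|_ E|//].
  move=> _ _; apply/fine_cvgP; split; first exact: nearW.
  by apply: cvgM; [exact: cG|exact: cvg_cst].
 (* The product with the speed is finite, so an infinite speed forces [G_ 0] to vanish there, and
    with it every [G_ n] and [H]. *)
 have z : G_ 0%N (ev g r) = 0.
  apply/eqP; rewrite eq_le G0 andbT leNgt; apply/negP => p.
  by move: E; rewrite gt0_muley.
 have -> : H (ev g r) = 0 by apply/eqP; rewrite eq_le H0 -z HG.
 rewrite (_ : (fun n => _) = (fun=> (0%:E * +oo)%E)); first exact: cvg_cst.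
 apply/funext => n; congr (_%:E * _)%E.
 by apply/eqP; rewrite eq_le G0 -z G_le.
- by apply: (integrableS measurableT) => //; exact: m_itv.
- apply: (ae_imp g1E) => r + n; rewrite/= => /[apply] <-.
 by rewrite gee0_abs ?wspeed_ge0// lee_wpmul2r ?speed_ge0// lee_fin.
Unshelve. all: by end_near. Qed.

Local Notation sq f := (fun x => f x ^+ 2).
Local Notation sqint f := (mu.-integrable setT (EFin \o sq f)).
Hypothesis propX : @proper_space R d X.
Lemma L2loc_compact G (K : set X) : L2loc mu G -> compact K ->
 exists2 U : set X, open U /\ K `<=` U & (\int[mu]_(x in U) (G x ^+ 2)%:E < +oo)%E.
Proof.
move=> [mG lG] cK.
have /choice[rad Hrad] x : exists r : R, 0 < r /\ (\int[mu]_(y in ball x r) (G y ^+ 2)%:E < +oo)%E.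
 have : \forall r \near 0^'+, 0 < r /\ (\int[mu]_(y in ball x r) (G y ^+ 2)%:E < +oo)%E.
  by near=> r; split; near: r; [exact: nbhs_right_gt|exact: lG].
 by move=> /filter_ex[r]; exists r.
pose B (x : X) : set X := ball x (rad x).
have oB x : open (B x) by exact: open_ballX.
have main (s : seq X) : (\int[mu]_(y in \bigcup_(x in [set` s]) B x) (G y ^+ 2)%:E < +oo)%E.
 elim: s => [|x s IH].
  by rewrite set_nil bigcup_set0 integral_set0.
 have oU : open (\bigcup_(x in [set` s]) B x) by exact: bigcup_open.
 have mB := openMX (oB x); have mU := openMX oU.
 have mG2 : meas (fun y => (G y ^+ 2)%:E).
  by apply/mEFinP; exact: mfunX.
 have -> : \bigcup_(z in [set` x :: s]) B z = B x `|` \bigcup_(z in [set` s]) B z.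
  apply/seteqP; split => y /=.
   by move=> [z /= + Bz]; rewrite in_cons => /orP[/eqP<-|zs]; [left|right; exists z].
  by move=> [By|[z zs Bz]]; [exists x => //=; exact: mem_head|exists z => //=; rewrite in_cons zs orbT].
 apply: (@le_lt_trans _ _ (\int[mu]_(y in B x) (G y ^+ 2)%:E +
  \int[mu]_(y in \bigcup_(x in [set` s]) B x) (G y ^+ 2)%:E)%E); last first.
  by apply: lte_add_pinfty => //; exact: (Hrad x).2.
 rewrite integral_mkcond [X in (_ <= X + _)%E]integral_mkcond [X in (_ <= _ + X)%E]integral_mkcond.
 have p0 (A : set X) y : (0 <= ((fun y => (G y ^+ 2)%:E) \_ A) y)%E.
  by rewrite patchE; case: ifP => // _; rewrite lee_fin sqr_ge0.
 have mp (A : set X) : measurable A -> meas ((fun y => (G y ^+ 2)%:E) \_ A).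
  by move=> mA; apply/(measurable_restrictT _ _).1 => //; exact: mfunTS.
 rewrite -ge0_integralD//; [|exact: mp|exact: mp].
 apply: ge0_le_integral => //; first by apply: mp; exact: measurableU.
  by apply: emeasurable_funD; exact: mp.
 move=> y _; rewrite !patchE in_setU.
 by case: (y \in B x) => /=; [rewrite leeDl//; case: ifP => // _; rewrite lee_fin sqr_ge0|rewrite add0e].
move: cK; rewrite compact_cover => /(_ X setT B) [].
- by move=> x _; exact: oB.
- by move=> x Kx; exists x => //; apply: ballxx; exact: (Hrad x).1.
move=> F _ KF; exists (\bigcup_(x in [set` finmap.enum_fset F]) B x); last exact: main.
by split; [exact: bigcup_open|move=> y /KF[x xF By]; exists x].
Unshelve. all: by end_near. Qed.

Lemma curve_bounded g (x0 : X) : exists n : nat, forall r, mdist (ev g r) x0 <= n%:R.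
Proof.
have c : {within `[0%R, 1%R], continuous (fun r : R => mdist (ev g r) x0)}.
 apply: continuous_subspaceT => r.
 apply: (@continuous_comp _ _ _ (ev g) (fun x => mdist x x0)); first exact: ev_cont.
 exact: mdist_cont.
have [m _ Hm] := EVT_max ler01 c.
exists (Num.trunc (mdist (ev g m) x0)).+1 => r.
apply: (@le_trans _ _ (mdist (ev g m) x0)); last by rewrite ltW// truncnS_gt.
have -> : ev g r = ev g (clamp01 r) by rewrite /ev [clamp01 (clamp01 r)]clamp01_id ?clamp01_itv.
by apply: Hm; rewrite in_itv/= clamp01_itv.
Qed.

(** A curve is bounded, so it stays in one closed ball, compact by properness, on which [G] is
    square integrable. *)
Lemma L2loc_finite_length G : L2loc mu G -> (forall x, 0 <= G x) -> fin_len G.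
Proof.
move=> lG G0 pi tp; have mG := lG.1; pose x0 : X := point.
pose B n := [set y : X | mdist x0 y <= n%:R].
have mB n : measurable (B n).
 rewrite -[B n]setTI; apply: (measurable_fun_le (f := fun y => mdist x0 y)) => //.
 rewrite (_ : (fun => _) = (fun y => mdist y x0)); last by apply/funext => y; rewrite metric_sym.
 by apply: contMX; exact: mdist_cont.
pose H n y := G y * \1_(B n) y.
have mH n : meas (H n) by apply: mfunM.
have H0 n y : 0 <= H n y by rewrite mulr_ge0.
have H2 n : (\int[mu]_x (H n x ^+ 2)%:E < +oo)%E.
 have [U [oU BU] fU] := L2loc_compact lG (@propX x0 n%:R).
 apply: le_lt_trans fU; rewrite [leRHS]integral_mkcond; apply: ge0_le_integral => //.
 - by move=> x _; rewrite lee_fin sqr_ge0.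
 - by apply/mEFinP; exact: mfunX.
 - apply/(measurable_restrictT _ _).1; first exact: openMX.
  by apply: mfunTS; apply/mEFinP; exact: mfunX.
 move=> x _; rewrite patchE /H indicE; case: (boolP (x \in B n)) => [xB|_].
  by rewrite mulr1 mem_set//; apply: BU; exact: set_mem.
 by rewrite mulr0 expr0n/=; case: ifP => // _; rewrite lee_fin sqr_ge0.
apply: (ae_imp (ae_foralln (fun n => wlen_fin tp (mH n) (H0 n) (H2 n)))) => g h.
have [n Hn] := curve_bounded (g : curve X) x0; apply: le_lt_trans (h n).
apply: eq_leW; rewrite /wlen; apply: eq_integral => r _.
by rewrite /H indicE mem_set ?mulr1// /B /= metric_sym.
Qed.

(* Minimise the integral of [G ^ 2]; since the pointwise minimum of two weak
 upper gradients is one, the minimiser is minimal almost everywhere. *)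
Lemma minimal_exists f G0 : wug f G0 -> sqint G0 ->
 exists G, sqint G /\ minimal_weak_upper_gradient mu f G.
Proof.
move=> w0 i0.
have fl G : wug f G -> sqint G -> fin_len G.
 move=> [_ mG G_ge0 _] iG pi tp; apply: (wlen_fin tp mG G_ge0).
 have /integrableP[_] := iG; apply: le_lt_trans.
 by under [leRHS]eq_integral do rewrite /= ger0_norm ?sqr_ge0//.
have minw G H : wug f G -> sqint G -> wug f H -> fin_len H ->
  wug f (fun x => Num.min (G x) (H x)).
 move=> wG iG wH fH; have [mf mG _ _] := wG; have [_ mH _ _] := wH.
 have sl : strict_lip setT (@id R) (fun=> 1) 1.
  split; [by move=> x _; rewrite ler01 lexx|by move=> x y _ _; rewrite mul1r|].
  move=> x _ e e0; exists 1 => // y z _ _ _ _; rewrite mulrDl mul1r lerDl mulr_ge0// ltW//.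
 have := wug_chain_min sl (fun=> I) mf (measurable_cst _) wG wH (fl _ wG iG) fH.
 have -> : (fun x => 1 * Num.min (G x) (H x)) = (fun x => Num.min (G x) (H x)).
  by apply/funext => x; rewrite mul1r.
 exact.
have mini G H : sqint G -> meas G -> meas H ->
 (forall x, 0 <= G x) -> (forall x, 0 <= H x) -> sqint (fun x => Num.min (G x) (H x)).
 move=> iG mG mH G_ge0 H0; apply: (integrable_dom measurableT _ iG).
  by apply: mfunX; exact: measurable_minr.
 by move=> x _; rewrite ger0_norm ?sqr_ge0//= ler_sqr ?nnegrE ?le_min ?G_ge0 ?H0// ge_min lexx.
pose S := [set v : R | exists G, [/\ wug f G, sqint G & v = \int[mu]_x (G x ^+ 2)]].
have S0 : S !=set0 by exists (\int[mu]_x (G0 x ^+ 2)); exists G0.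
have Slb : has_inf S.
 split => //; exists 0 => _ [G [_ _ ->]]; apply: Rintegral_ge0 => x _; exact: sqr_ge0.
have /choice[Gs HG] (n : nat) : exists G, [/\ wug f G, sqint G & \int[mu]_x (G x ^+ 2) < inf S + n.+1%:R^-1].
 have [_ [G [wG iG ->]] lt1] := inf_adherent (ltac:(by rewrite invr_gt0) : 0 < (n.+1%:R^-1 : R)) Slb.
 by exists G.
(* Running minima of the minimising sequence are weak upper gradients that decrease pointwise, so
   their limit exists everywhere. *)
pose Hs := fix Hs n := if n is k.+1 then (fun x => Num.min (Hs k x) (Gs k.+1 x)) else Gs 0%N.
have Hp n : wug f (Hs n) /\ sqint (Hs n).
 elim: n => [|n [w i]]; first by have [] := HG 0%N.
 have [wG iG _] := HG n.+1; have [_ m1 p1 _] := w; have [_ m2 p2 _] := wG.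
 by split; [exact: (minw _ _ w i wG (fl _ wG iG))|exact: (mini _ _ i m1 m2 p1 p2)].
have H_ge0 n x : 0 <= Hs n x by have [[_ _ p _] _] := Hp n.
have mHs n : meas (Hs n) by have [[_ p _ _] _] := Hp n.
have HsG n x : Hs n x <= Gs n x by case: n => [//|n]; rewrite ge_min lexx orbT.
have Hdec x : {homo (fun n => Hs n x) : n m / (n <= m)%N >-> m <= n}.
 apply: (@homo_leq _ (fun n => Hs n x) (fun a b => b <= a)) => //.
  by move=> a b c ab bc; exact: le_trans bc ab.
 by move=> n; rewrite ge_min lexx.
pose H x := lim (Hs n x @[n --> \oo]).
have cH x : Hs n x @[n --> \oo] --> H x.
 apply: nonincreasing_is_cvgn; first by move=> n m; exact: Hdec.
 by exists 0 => _ [n _ <-].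
have HH n x : H x <= Hs n x.
 by apply: limr_le; [exact: cH|near=> m; apply: Hdec; near: m; exact: nbhs_infty_ge].
have H0 x : 0 <= H x by apply: limr_ge; [exact: cH|near=> n; exact: H_ge0].
have mH : meas H.
 by apply: (measurable_fun_cvg mHs) => x _; exact: cH.
have [wHs iHs] := Hp 0%N.
have wH : wug f H.
 apply: (wug_lim_G (fun n => (Hp n).1) mH H0 _ cH (fl _ wHs iHs)) => n x.
 exact: Hdec.
have iH : sqint H.
 apply: (integrable_dom measurableT _ iHs); first exact: mfunX.
 move=> x _; have h0 := H_ge0 0%N x; have hh := HH 0%N x.
 by rewrite ger0_norm ?sqr_ge0// ler_sqr ?nnegrE.
have intH : \int[mu]_x (H x ^+ 2) <= inf S.
 apply/ler_addgt0Pr => e e0.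
 have [n ne] : exists n, n.+1%:R^-1 < e.
  exists (Num.trunc e^-1); rewrite invf_plt ?posrE//; exact: truncnS_gt.
 have [wG iG /ltW lt1] := HG n.
 apply: (@le_trans _ _ (\int[mu]_x (Gs n x ^+ 2))).
  have [_ _ p _] := wG; apply: le_Rintegral => // x _.
  by rewrite ler_sqr ?nnegrE ?p//; exact: le_trans (HH n x) (HsG n x).
 by apply: le_trans lt1 _; rewrite lerD2l ltW.
exists H; split => //; split => //.
 split => // x; near=> r; have /integrableP[_] := iH; apply: le_lt_trans.
 under [leRHS]eq_integral do rewrite /= ger0_norm ?sqr_ge0//.
 apply: ge0_subset_integral => //; first by apply: openMX; exact: open_ballX.
  by apply/mEFinP; exact: mfunX.
 by move=> y _; rewrite lee_fin sqr_ge0.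
move=> G' lG' wG'; have [_ mG' G'0 _] := wG'.
have fG' := L2loc_finite_length lG' G'0.
have wm := minw _ _ wH iH wG' fG'.
have im := mini _ _ iH mH mG' H0 G'0.
(* The minimum with [G'] competes in [S], so this nonnegative difference has integral zero. *)
pose D x := H x ^+ 2 - Num.min (H x) (G' x) ^+ 2.
have D0 x : 0 <= D x.
 by rewrite subr_ge0 ler_sqr ?nnegrE ?le_min ?H0 ?G'0// ge_min lexx.
have iD : mu.-integrable setT (EFin \o D) by exact: integrB.
have zD : \int[mu]_x D x = 0.
 apply/eqP; rewrite eq_le Rintegral_ge0// andbT /D RintegralB// subr_le0.
 by apply: le_trans intH _; apply: ge_inf; [case: Slb|exists (fun x => Num.min (H x) (G' x))].
have : {ae mu, forall x, setT x -> (EFin \o D) x = (cst 0) x}.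
 apply/(ae_eq_integral_abs mu measurableT); first exact: measurable_int iD.
 rewrite (eq_integral (EFin \o D)); last by move=> x _ /=; rewrite ger0_norm.
 by rewrite -(fineK (integrable_fin_num measurableT iD)); congr (_%:E).
move=> /ae_imp; apply => x /(_ I) [] /eqP; rewrite /D subr_eq0 => /eqP e.
have : H x <= Num.min (H x) (G' x).
 by rewrite -ler_sqr ?nnegrE ?le_min ?H0 ?G'0// e.
by rewrite le_min => /andP[].
Unshelve. all: by end_near. Qed.

End minimal_gradient.
End curves.

(** * The inner product space of square integrable functions *)

Section L2_space.
Context {d : measure_display} {X : measurableType d} {R : realType}.
Variable mu : {measure set X -> \bar R}.
Implicit Types (f g h k : X -> R) (a b c : R).
Definition L2 f : Prop :=
 meas f /\ mu.-integrable setT (EFin \o (fun x => f x ^+ 2)).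

Definition ip f g : R := \int[mu]_x (f x * g x).

Definition nn f : R := Num.sqrt (ip f f).

Lemma ipE f g : ip f g = \int[mu]_x (f x * g x). Proof. by []. Qed.

Lemma nnE f : nn f = Num.sqrt (ip f f). Proof. by []. Qed.

Local Notation integ f := (mu.-integrable setT (EFin \o f)).
Lemma integ_fin f : meas f -> (forall x, 0 <= f x) ->
 (\int[mu]_x (f x)%:E < +oo)%E -> integ f.
Proof.
move=> mf f0 fin; apply/integrableP; split; first exact/mEFinP.
by under eq_integral do rewrite /= ger0_norm ?f0//.
Qed.

Lemma integ_lt f : integ f -> (\int[mu]_x `|f x|%:E < +oo)%E.
Proof. by move=> /integrableP[_]; under eq_integral do rewrite abse_EFin. Qed.

Lemma integ_mfun f : integ f -> meas f.
Proof. by move=> i; apply/mEFinP; exact: measurable_int i. Qed.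

Lemma Rint_ae f g : meas f -> meas g ->
 {ae mu, forall x, f x = g x} -> \int[mu]_x f x = \int[mu]_x g x.
Proof.
move=> mf mg fg; rewrite /Rintegral; congr fine; apply: ae_eq_integral => //.
- exact/mEFinP.
- exact/mEFinP.
- by apply: (ae_imp fg) => x e _; rewrite e.
Qed.

Lemma integ_ae f g : meas g -> {ae mu, forall x, f x = g x} -> integ f -> integ g.
Proof.
move=> mg fg i; have mf := integ_mfun i.
apply/integrableP; split; first exact/mEFinP.
have /integrableP[_] := i; apply: le_lt_trans.
apply: eq_leW; apply: ae_eq_integral => //.
- by apply: mT_comp => //; exact/mEFinP.
- by apply: mT_comp => //; exact/mEFinP.
- by apply: (ae_imp fg) => x /= -> _.
Qed.

Lemma integ_dom_ae f g : meas f -> integ g ->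
 {ae mu, forall x, `|f x| <= g x} -> integ f.
Proof.
move=> mf ig fg; apply/integrableP; split; first exact/mEFinP.
apply: le_lt_trans (integ_lt ig); apply: ae_ge0_le_integral => //.
- by apply: mT_comp => //; exact/mEFinP.
- by apply/mEFinP; apply: mT_comp => //; exact: integ_mfun ig.
- by apply: (ae_imp fg) => x h _; rewrite /=; apply: le_trans h _; exact: ler_norm.
Qed.

Lemma leR_ae f g : integ f -> integ g -> {ae mu, forall x, f x <= g x} ->
 \int[mu]_x f x <= \int[mu]_x g x.
Proof.
move=> i1 i2 fg; rewrite -subr_ge0 -RintegralB//.
have m1 := integ_mfun i1; have m2 := integ_mfun i2.
rewrite (@Rint_ae _ (fun x => Num.max 0 (g x - f x))).
- by apply: Rintegral_ge0 => x _; rewrite le_max lexx.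
- exact: mfunB.
- by apply: measurable_maxr => //; exact: mfunB.
- by apply: (ae_imp fg) => x h; rewrite max_r// subr_ge0.
Qed.

Lemma Rint_eq0 f : integ f -> {ae mu, forall x, 0 <= f x} -> \int[mu]_x f x = 0 ->
 {ae mu, forall x, f x = 0}.
Proof.
move=> i f0 z; have mf := integ_mfun i.
pose g x := `|f x|.
have mg : meas g by exact: mT_comp.
have gf : {ae mu, forall x, f x = g x} by apply: (ae_imp f0) => x h; rewrite /g ger0_norm.
have ig : integ g by exact: integ_ae mg gf i.
have : {ae mu, forall x, setT x -> (EFin \o g) x = (cst 0%E) x}.
 apply/(ae_eq_integral_abs mu measurableT); first exact/mEFinP.
 rewrite (eq_integral (EFin \o g)); last by move=> x _ /=; rewrite normr_id.
 rewrite -(fineK (integrable_fin_num measurableT ig)); congr (_%:E).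
 by rewrite -[LHS]/(\int[mu]_x g x) -(Rint_ae mf).
by move=> h; apply: (ae_imp2 gf h) => x -> /(_ I) [].
Qed.

Lemma L2_Lfun f : f \in Lfun mu 2%:E <-> L2 f.
Proof.
split => [Lf|[mf i]].
 split; last exact: Lfun2_integrable_sqr.
 by move: Lf; rewrite inE => /andP[]; rewrite inE.
rewrite inE; apply/andP; rewrite !inE/=; split => //.
rewrite /finite_norm unlock/=.
apply: poweR_lty; move: (integ_lt i); congr (_ < _)%E; apply: eq_integral => x _.
by rewrite powR_mulrn// ger0_norm ?sqr_ge0// real_normK ?num_real.
Qed.

Lemma integM f g : L2 f -> L2 g -> integ (fun x => f x * g x).
Proof.
by move=> /L2_Lfun Lf /L2_Lfun Lg; have /Lfun1_integrable := Lfun2_mul_Lfun1 Lf Lg.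
Qed.

Lemma L2_m f : L2 f -> meas f. Proof. by case. Qed.

Lemma L2D f g : L2 f -> L2 g -> L2 (fun x => f x + g x).
Proof.
move=> [mf i] [mg j]; have m := mfunD mf mg; split => //.
apply: (@integ_dom_ae _ (fun x => 2 * f x ^+ 2 + 2 * g x ^+ 2)); first exact: mfunX.
 by apply: integrD => //; exact: integrZ.
apply: ae_all => x; rewrite ger0_norm ?sqr_ge0; have := sqr_ge0 (f x - g x); nra.
Qed.

Lemma L2Z a f : L2 f -> L2 (fun x => a * f x).
Proof.
move=> [mf i]; split; first exact: mfunM.
by under eq_fun do rewrite exprMn; exact: integrZ.
Qed.

Lemma L2N f : L2 f -> L2 (fun x => - f x).
Proof. by move=> /(L2Z (-1)); under eq_fun do rewrite mulN1r. Qed.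

Lemma L2B f g : L2 f -> L2 g -> L2 (fun x => f x - g x).
Proof. by move=> Lf Lg; exact: L2D Lf (L2N Lg). Qed.

Lemma L20 : L2 (fun=> 0).
Proof.
by split=> //; under eq_fun do rewrite expr0n; exact: integrable0.
Qed.

Lemma L2_ae f g : meas g -> {ae mu, forall x, f x = g x} -> L2 f -> L2 g.
Proof.
move=> mg fg [mf i]; split => //; apply: integ_ae i; first exact: mfunX.
by apply: (ae_imp fg) => x ->.
Qed.

Lemma L2_dom f g : meas f -> L2 g -> {ae mu, forall x, `|f x| <= `|g x|} -> L2 f.
Proof.
move=> mf [mg ig] fg; split => //; apply: (integ_dom_ae _ ig); first exact: mfunX.
apply: (ae_imp fg) => x h; rewrite ger0_norm ?sqr_ge0//.
by rewrite -[f x ^+ 2]real_normK ?num_real// -[g x ^+ 2]real_normK ?num_real// ler_sqr.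
Qed.

Lemma L2M c f g : meas f -> {ae mu, forall x, `|f x| <= c} -> L2 g ->
 L2 (fun x => f x * g x).
Proof.
move=> mf fc Lg; apply: (@L2_dom _ (fun x => c * g x)).
- by apply: mfunM => //; exact: L2_m.
- exact: L2Z.
- by apply: (ae_imp fc) => x h; rewrite !normrM ler_wpM2r//; apply: le_trans h _; exact: ler_norm.
Qed.

Lemma L2_bounded c f : integ f -> {ae mu, forall x, `|f x| <= c} -> L2 f.
Proof.
move=> i fc; split; first exact: integ_mfun.
have ii : integ (fun x => c * `|f x|).
 by apply: integrZ => //; exact: integrable_norm i.
apply: (integ_dom_ae _ ii); first by apply: mfunX; exact: integ_mfun.
apply: (ae_imp fc) => x h; rewrite ger0_norm -[f x ^+ 2]real_normK ?num_real//.
by rewrite ler_wpM2r.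
Qed.

Lemma ipC f g : ip f g = ip g f.
Proof. by rewrite /ip; apply: eq_Rintegral => x _; rewrite mulrC. Qed.

Lemma ipDl f g h : L2 f -> L2 g -> L2 h -> ip (fun x => f x + g x) h = ip f h + ip g h.
Proof.
move=> Lf Lg Lh; rewrite /ip -RintegralD//; [|exact: integM|exact: integM].
by apply: eq_Rintegral => x _; rewrite mulrDl.
Qed.

Lemma ipZl a f h : L2 f -> L2 h -> ip (fun x => a * f x) h = a * ip f h.
Proof.
move=> Lf Lh; rewrite /ip -RintegralZl//; last exact: integM.
by apply: eq_Rintegral => x _; rewrite mulrA.
Qed.

Lemma ipBl f g h : L2 f -> L2 g -> L2 h -> ip (fun x => f x - g x) h = ip f h - ip g h.
Proof.
move=> Lf Lg Lh; rewrite /ip -RintegralB//; [|exact: integM|exact: integM].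
by apply: eq_Rintegral => x _; rewrite mulrBl.
Qed.

Lemma ipDr f g h : L2 f -> L2 g -> L2 h -> ip h (fun x => f x + g x) = ip h f + ip h g.
Proof. by move=> *; rewrite ipC ipDl// !(ipC h). Qed.

Lemma ipBr f g h : L2 f -> L2 g -> L2 h -> ip h (fun x => f x - g x) = ip h f - ip h g.
Proof. by move=> *; rewrite ipC ipBl// !(ipC h). Qed.

Lemma ipZr a f h : L2 f -> L2 h -> ip h (fun x => a * f x) = a * ip h f.
Proof. by move=> *; rewrite ipC ipZl// (ipC h). Qed.

Lemma ip_ge0 f : 0 <= ip f f.
Proof. by apply: Rintegral_ge0 => x _; rewrite -expr2 sqr_ge0. Qed.

Lemma ip_ae f f' g g' : L2 f -> L2 g -> L2 f' -> L2 g' ->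
 {ae mu, forall x, f x = f' x} -> {ae mu, forall x, g x = g' x} -> ip f g = ip f' g'.
Proof.
move=> Lf Lg Lf' Lg' e1 e2; apply: Rint_ae.
- by apply: mfunM; exact: L2_m.
- by apply: mfunM; exact: L2_m.
- by apply: (ae_imp2 e1 e2) => x -> ->.
Qed.

Lemma CS2 f g : L2 f -> L2 g -> ip f g ^+ 2 <= ip f f * ip g g.
Proof.
move=> Lf Lg; have H t : 0 <= ip f f - t *+ 2 * ip f g + t ^+ 2 * ip g g.
 have := ip_ge0 (fun x => f x - t * g x).
 rewrite ipBl ?ipBr ?ipZl ?ipZr//; try exact: L2Z; try (by apply: L2B => //; exact: L2Z).
 rewrite (ipC g f); move/le_trans; apply; apply: eq_leW; ring.
have [g0|gn0] := eqVneq (ip g g) 0.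
 rewrite g0 mulr0; have [fg0|fgn0] := eqVneq (ip f g) 0; first by rewrite fg0 expr0n.
 have := H ((ip f f + 1) / (2 * ip f g)); rewrite g0 mulr0 addr0.
 have -> : ((ip f f + 1) / (2 * ip f g)) *+ 2 * ip f g = ip f f + 1.
  by rewrite -mulr_natl; field.
 by rewrite opprD addrA subrr add0r oppr_ge0 ler10.
have gp : 0 < ip g g by rewrite lt_neqAle eq_sym gn0 ip_ge0.
have := H (ip f g / ip g g).
have -> : ip f f - (ip f g / ip g g) *+ 2 * ip f g + (ip f g / ip g g) ^+ 2 * ip g g =
 (ip f f * ip g g - ip f g ^+ 2) / ip g g by rewrite -mulr_natl; field.
by rewrite pmulr_lge0 ?invr_gt0// subr_ge0.
Qed.

Lemma nn_ge0 f : 0 <= nn f. Proof. exact: sqrtr_ge0. Qed.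

Lemma nn_sqr f : nn f ^+ 2 = ip f f. Proof. by rewrite sqr_sqrtr// ip_ge0. Qed.

Lemma CS f g : L2 f -> L2 g -> `|ip f g| <= nn f * nn g.
Proof.
move=> Lf Lg; rewrite -ler_sqr ?nnegrE ?mulr_ge0 ?nn_ge0// real_normK ?num_real//.
by rewrite exprMn !nn_sqr CS2.
Qed.

Lemma nnD f g : L2 f -> L2 g -> nn (fun x => f x + g x) <= nn f + nn g.
Proof.
move=> Lf Lg; rewrite -ler_sqr ?nnegrE ?addr_ge0 ?nn_ge0// sqrrD !nn_sqr.
have LD := L2D Lf Lg.
rewrite ipDl// !ipDr// (ipC g f) addrA -[_ + ip g g]addrA.
have := CS Lf Lg; have := ler_norm (ip f g); rewrite -mulr_natl; lra.
Qed.

Lemma nnZ a f : L2 f -> nn (fun x => a * f x) = `|a| * nn f.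
Proof.
move=> Lf; rewrite /nn ipZl//; last exact: L2Z.
by rewrite ipZr// mulrA -expr2 sqrtrM ?sqr_ge0// sqrtr_sqr.
Qed.

Lemma nnN f : L2 f -> nn (fun x => - f x) = nn f.
Proof. by move=> Lf; rewrite /nn /ip; congr Num.sqrt; apply: eq_Rintegral => x _; rewrite mulrNN. Qed.

Lemma nnB f g : L2 f -> L2 g -> nn (fun x => f x - g x) <= nn f + nn g.
Proof. by move=> Lf Lg; rewrite -(nnN Lg); apply: nnD => //; exact: L2N. Qed.

Lemma nn_dist f g h : L2 f -> L2 g -> L2 h ->
 nn (fun x => f x - h x) <= nn (fun x => f x - g x) + nn (fun x => g x - h x).
Proof.
move=> Lf Lg Lh; have := nnD (L2B Lf Lg) (L2B Lg Lh).
by under eq_fun do rewrite addrA subrK.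
Qed.

Lemma nn_ae f g : L2 f -> L2 g -> {ae mu, forall x, f x = g x} -> nn f = nn g.
Proof. by move=> Lf Lg e; rewrite /nn (ip_ae Lf Lf Lg Lg e e). Qed.

Lemma nn_eq0 f : L2 f -> nn f = 0 -> {ae mu, forall x, f x = 0}.
Proof.
move=> Lf n0; have z : ip f f = 0 by rewrite -nn_sqr n0 expr0n.
have := @Rint_eq0 (fun x => f x * f x) (integM Lf Lf).
move=> /(_ _ z) h; apply: (ae_imp (h _)).
 by apply: ae_all => x; rewrite -expr2 sqr_ge0.
by move=> x /eqP; rewrite mulf_eq0 orbb => /eqP.
Qed.

Lemma Lnorm_nn f : L2 f -> Lnorm mu 2%:E (EFin \o f) = (nn f)%:E.
Proof.
move=> [mf i]; rewrite unlock /=.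
have -> : (\int[mu]_x (`|(f x)%:E| `^ 2) = (ip f f)%:E)%E.
 rewrite /ip /Rintegral fineK.
  by apply: eq_integral => x _; rewrite /= powR_mulrn// -expr2 real_normK ?num_real.
 by have := integrable_fin_num measurableT (integM (conj mf i) (conj mf i)).
by rewrite poweR_EFin /nn -powR12_sqrt// ip_ge0.
Qed.

Lemma ip_nn_cvg {T : Type} (F : set_system T) {FF : Filter F} (f_ g_ : T -> X -> R) f g :
 (forall t, L2 (f_ t)) -> (forall t, L2 (g_ t)) -> L2 f -> L2 g ->
 nn (fun x => f_ t x - f x) @[t --> F] --> (0 : R) ->
 nn (fun x => g_ t x - g x) @[t --> F] --> (0 : R) ->
 ip (f_ t) (g_ t) @[t --> F] --> ip f g.
Proof.
move=> Lf_ Lg_ Lf Lg cf cg.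
pose e t := nn (fun x => f_ t x - f x) * nn (fun x => g_ t x - g x) +
 nn (fun x => f_ t x - f x) * nn g + nn f * nn (fun x => g_ t x - g x).
have ce : e t @[t --> F] --> (0 : R).
 have -> : 0 = 0 * 0 + 0 * nn g + nn f * 0 :> R by ring.
 apply: cvgD; first apply: cvgD; apply: cvgM => //; exact: cvg_cst.
have eb t : `|ip (f_ t) (g_ t) - ip f g| <= e t.
 have -> : ip (f_ t) (g_ t) - ip f g = ip (fun x => f_ t x - f x) (fun x => g_ t x - g x) +
  ip (fun x => f_ t x - f x) g + ip f (fun x => g_ t x - g x).
  rewrite !ipBl ?ipBr//; first by ring.
  exact: L2B.
 apply: le_trans (ler_normD _ _) _; apply: lerD; last by apply: CS => //; exact: L2B.
 apply: le_trans (ler_normD _ _) _; apply: lerD; apply: CS => //; exact: L2B.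
apply/cvgrPdist_le => eps eps0.
have /cvgrPdist_le /(_ _ eps0) := ce; apply: filterS => t; rewrite sub0r normrN.
by rewrite distrC => h; apply: le_trans (eb t) (le_trans (ler_norm _) h).
Qed.

End L2_space.

(** * Completeness of L2 *)

Section L2_complete.
Context {d : measure_display} {X : measurableType d} {R : realType}.
Variable mu : {measure set X -> \bar R}.
Implicit Types (f g : X -> R) (a b c : R).
Local Notation L2 := (L2 mu).
Local Notation nn := (nn mu).
Local Notation integ f := (mu.-integrable setT (EFin \o f)).
Lemma nn_fin f : L2 f -> (\int[mu]_x (f x ^+ 2)%:E = (nn f ^+ 2)%:E)%E.
Proof.
move=> [mf i]; rewrite nn_sqr /ip /Rintegral.
under [in RHS]eq_integral do rewrite -expr2.
by rewrite fineK// (integrable_fin_num measurableT i).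
Qed.

Lemma L2_fatou (u : nat -> X -> R) f c : (forall n, L2 (u n)) -> meas f ->
 {ae mu, forall x, u n x @[n --> \oo] --> f x} -> (forall n, nn (u n) <= c) ->
 L2 f /\ nn f <= c.
Proof.
move=> Lu mf uf nc; have c0 : 0 <= c by apply: le_trans (nc 0%N); exact: nn_ge0.
have mu2 n : meas (fun x => (u n x ^+ 2)%:E).
 by apply/mEFinP; apply: mfunX; exact: L2_m (Lu n).
have H : (\int[mu]_x (f x ^+ 2)%:E <= (c ^+ 2)%:E)%E.
 rewrite (ae_eq_integral (fun x => limn_einf (fun n => (u n x ^+ 2)%:E)))//; last first.
 - apply: (ae_imp uf) => x ux _; have c2 : (u n x ^+ 2)%:E @[n --> \oo] --> (f x ^+ 2)%:E.
   apply/fine_cvgP; split; first exact: nearW.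
   by rewrite /comp /=; under eq_fun do rewrite expr2; rewrite expr2; apply: cvgM.
  by rewrite (cvg_limn_einf_sup c2).
 - apply: (mT_comp (f := -%E)); first exact: oppe_measurable.
  apply: (measurable_fun_limn_esup (f := fun n x => (- (u n x ^+ 2)%:E)%E)) => n.
  by apply: mT_comp => //; exact: oppe_measurable.
 - by apply/mEFinP; exact: mfunX.
 apply: (le_trans (fatou mu measurableT mu2 _)) => [n x _|]; first by rewrite lee_fin sqr_ge0.
 rewrite limn_einf_lim; apply: lime_le; first exact: is_cvg_einfs.
 near=> n; apply: (@le_trans _ _ (\int[mu]_x (u n x ^+ 2)%:E)%E).
  by apply: ereal_inf_lbound; exists n => /=.
 by rewrite nn_fin// lee_fin ler_sqr ?nnegrE ?nn_ge0.
have Lf : L2 f.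
 split => //; apply: integ_fin; first exact: mfunX.
  by move=> x; exact: sqr_ge0.
 by apply: le_lt_trans H _; rewrite ltry.
by split => //; move: H; rewrite nn_fin// lee_fin ler_sqr ?nnegrE ?nn_ge0.
Unshelve. all: by end_near. Qed.

(** Riesz-Fischer. Along a subsequence whose successive differences are at most [2 ^- k] in norm,
    the sum of their absolute values is square integrable, so the subsequence converges almost
    everywhere; Fatou's lemma bounds the distance to the limit. *)
Lemma L2_cauchy (u : nat -> X -> R) : (forall n, L2 (u n)) ->
 (forall e, 0 < e -> exists n0 : nat, forall m n : nat, (n0 <= m)%N -> (n0 <= n)%N ->
  nn (fun x => u m x - u n x) < e) ->
 exists2 f, L2 f & nn (fun x => u n x - f x) @[n --> \oo] --> (0 : R).
Proof.
move=> Lu Cu.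
have /choice[N0 HN0] (k : nat) : exists n0 : nat, forall m n : nat, (n0 <= m)%N -> (n0 <= n)%N ->
  nn (fun x => u m x - u n x) < 2 ^- k by apply: Cu; rewrite invr_gt0 exprn_gt0.
pose N := fix N k := if k is j.+1 then (maxn (N j) (N0 k)).+1 else N0 0%N.
have NN0 k : (N0 k <= N k)%N by case: k => [|k] //=; rewrite leqW// leq_maxr.
have Nlt k : (N k < N k.+1)%N by rewrite /= ltnS leq_maxl.
have Nmon k : (N k <= N k.+1)%N by exact: ltnW.
have Nid k : (k <= N k)%N.
 by elim: k => [//|k IH]; exact: leq_ltn_trans IH (Nlt k).
pose v k := u (N k).
have dv k : nn (fun x => v k.+1 x - v k x) <= 2 ^- k.
 by apply/ltW/HN0; [exact: leq_trans (NN0 k) (Nmon k)|exact: NN0].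
have Lv k : L2 (v k) by exact: Lu.
pose S n x := \sum_(k < n) `|v k.+1 x - v k x|.
have Ld k : L2 (fun x => `|v k.+1 x - v k x|).
 apply: (@L2_dom _ _ _ _ _ (fun x => v k.+1 x - v k x)); last by apply: ae_all => x; rewrite normr_id.
  by apply: mT_comp => //; apply: L2_m; exact: L2B.
 exact: L2B.
have nd k : nn (fun x => `|v k.+1 x - v k x|) <= 2 ^- k.
 apply: le_trans (dv k); apply: eq_leW.
 rewrite /nn /ip; congr Num.sqrt; apply: eq_Rintegral => x _.
 by rewrite -!expr2 real_normK ?num_real.
have LS n : L2 (S n) /\ nn (S n) <= \sum_(k < n) 2 ^- k.
 elim: n => [|n [LSn nSn]].
  have -> : S 0%N = (fun=> 0) by apply/funext => x; rewrite /S big_ord0.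
  split; first exact: L20.
  by rewrite big_ord0 /nn /ip; under eq_Rintegral do rewrite mul0r; rewrite Rintegral_cst// mul0r sqrtr0.
 have -> : S n.+1 = (fun x => S n x + `|v n.+1 x - v n x|).
  by apply/funext => x; rewrite /S big_ord_recr.
 split; first exact: L2D.
 by rewrite big_ord_recr/=; apply: le_trans (nnD LSn (Ld n)) _; exact: lerD.
have geo n : \sum_(k < n) 2 ^- k <= 2 :> R.
 suff -> : \sum_(k < n) 2 ^- k = 2 - 2 * 2 ^- n :> R by rewrite lerBlDr lerDl mulr_ge0// invr_ge0 exprn_ge0.
 elim: n => [|n IH]; first by rewrite big_ord0 expr0 invr1 mulr1 subrr.
 by rewrite big_ord_recr/= IH exprS invfM; lra.
have Sinc x : {homo (fun n => ((S n x) ^+ 2)%:E) : n m / (n <= m)%N >-> (n <= m)%E}.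
 move=> n m nm; rewrite lee_fin ler_sqr ?nnegrE ?sumr_ge0//.
 rewrite -(subnKC nm) /S big_split_ord/= lerDl sumr_ge0//.
have mS n : meas (S n) by exact: L2_m (LS n).1.
have mS2 n : meas (fun x => ((S n x) ^+ 2)%:E).
 by apply/mEFinP; exact: mfunX.
pose SS x := limn (fun n => ((S n x) ^+ 2)%:E).
have cSS x : ((S n x) ^+ 2)%:E @[n --> \oo] --> SS x.
 by apply: ereal_nondecreasing_is_cvgn => n m; exact: Sinc.
have mSS : meas SS.
 apply: (@emeasurable_fun_cvg _ _ _ setT (fun n x => ((S n x) ^+ 2)%:E)); first exact: mS2.
 by move=> x _; exact: cSS.
have SS0 x : (0 <= SS x)%E by apply: lime_ge; [exact: cSS|apply: nearW => n; rewrite lee_fin sqr_ge0].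
have fin : (\int[mu]_x SS x <= 4%:E)%E.
 rewrite monotone_convergence//; last by move=> n x _; rewrite lee_fin sqr_ge0.
  apply: lime_le.
   apply: ereal_nondecreasing_is_cvgn => n m nm; apply: ge0_le_integral => //.
   - by move=> x _; rewrite lee_fin sqr_ge0.
   - by move=> x _; exact: Sinc.
  apply: nearW => n; rewrite nn_fin; last exact: (LS n).1.
  have h : nn (S n) <= 2 by apply: le_trans (LS n).2 (geo n).
  rewrite lee_fin; have -> : 4 = 2 ^+ 2 :> R by rewrite -natrX.
  by rewrite ler_sqr ?nnegrE ?nn_ge0.
have iSS : mu.-integrable setT SS.
 apply/integrableP; split => //.
 by under eq_integral do rewrite gee0_abs ?SS0//; apply: le_lt_trans fin _; rewrite ltry.
have aeS := integrable_ae measurableT iSS.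
(* The upper limit is measurable, and it equals the limit wherever that exists. *)
pose f x := fine (limn_esup (fun k => (v k x)%:E)).
have mf : meas f.
 apply: mT_comp => //; apply: (@measurable_fun_limn_esup _ _ _ _ (fun k x => (v k x)%:E)) => k.
 by apply/mEFinP; exact: L2_m.
have cf : {ae mu, forall x, v k x @[k --> \oo] --> f x}.
 apply: (ae_imp aeS) => x /(_ I) fx.
 have Sb n : S n x <= fine (SS x) + 1.
  have h1 : S n x ^+ 2 <= fine (SS x).
   rewrite -lee_fin fineK//; apply: lime_ge; first exact: cSS.
   by near=> m; apply: Sinc; near: m; exact: nbhs_infty_ge.
  have : 0 <= S n x by exact: sumr_ge0.
  by move=> h0; nra.
 have cS : cvgn (series (fun k => `|v k.+1 x - v k x|)).
  apply: nondecreasing_is_cvgn.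
   by apply: nondecreasing_series.
  exists (fine (SS x) + 1) => _ [n _ <-]; rewrite /series/= big_mkord; exact: Sb.
 have cS2 : cvgn (series (fun k => v k.+1 x - v k x)).
  by apply: normed_cvg.
 have : cvgn (fun k => v k x).
  have -> : (fun k => v k x) = (fun k => series (fun k => v k.+1 x - v k x) k + v 0%N x).
   by apply/funext => k; rewrite /series/= telescope_sumr// subrK.
  by apply: is_cvgD => //; exact: is_cvg_cst.
 move=> /cvg_ex[l cl]; have cl' : (v k x)%:E @[k --> \oo] --> l%:E.
  by apply/fine_cvgP; split => //; exact: nearW.
 by rewrite /f (cvg_limn_einf_sup cl')/=.
have main e : 0 < e -> exists n0, forall n, (n0 <= n)%N -> L2 (fun x => u n x - f x) /\ nn (fun x => u n x - f x) <= e.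
 move=> e0; have [n0 Hn0] := Cu e e0; exists n0 => n n0n.
 apply: (@L2_fatou (fun k x => u n x - v (k + n0)%N x)).
 - by move=> k; exact: L2B.
 - by apply: mfunB => //; exact: L2_m.
 - apply: (ae_imp cf) => x c; apply: cvgB; first exact: cvg_cst.
  by have := c; rewrite -(cvg_shiftn n0).
 by move=> k; apply/ltW/Hn0 => //; apply: leq_trans (Nid _); rewrite leq_addl.
have [n0 Hn0] := main 1 ltr01.
exists f.
 have := L2B (Lu n0) (Hn0 n0 (leqnn _)).1.
 by under eq_fun do rewrite opprB addrC subrK.
apply/cvgrPdist_le => e e0; have [n1 Hn1] := main e e0.
near=> n; rewrite sub0r normrN ger0_norm ?nn_ge0//; apply: (Hn1 n _).2.
by near: n; exact: nbhs_infty_ge.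
Unshelve. all: by end_near. Qed.

End L2_complete.

(** * Null sequence and strict differentiability *)

Section eps.
Context {R : realType}.
Definition eps (n : nat) : R := n.+1%:R^-1.

Lemma eps_gt0 n : 0 < eps n. Proof. by rewrite invr_gt0. Qed.

Lemma eps_neq0 n : eps n != 0. Proof. by rewrite gt_eqF ?eps_gt0. Qed.

Lemma epsN_neq0 n : - eps n != 0. Proof. by rewrite oppr_eq0 eps_neq0. Qed.

Lemma eps_cvg : eps n @[n --> \oo] --> (0 : R). Proof. exact: cvg_harmonic. Qed.

Lemma eps_le m n : (m <= n)%N -> eps n <= eps m.
Proof. by move=> mn; rewrite /eps lef_pV2 ?posrE// ler_nat ltnS. Qed.

Lemma eps_small e : 0 < e -> exists n, eps n <= e.
Proof.
move=> e0; exists (Num.trunc e^-1); rewrite ltW// /eps invf_plt ?posrE//; exact: truncnS_gt.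
Qed.

(** Strict differentiability relative to [D]: both points move, as in [strict_lip], so that
    subtracting [c x] yields a [strict_lip] function with local constant [|phi' x - c|]. *)
Definition sdiff (D : set R) (phi phi' : R -> R) (L : R) : Prop :=
 [/\ forall x, D x -> `|phi' x| <= L,
   forall x y, D x -> D y -> `|phi x - phi y| <= L * `|x - y| &
   forall x, D x -> forall e, 0 < e -> exists2 rho, 0 < rho & forall y z, D y -> D z ->
    `|y - x| < rho -> `|z - x| < rho ->
    `|phi y - phi z - phi' x * (y - z)| <= e * `|y - z|].
End eps.

(** * Scalar inequalities for the carre du champ *)

Section gamma_arith.
Context {R : realType}.
Implicit Types (q a b e m p : R).
Lemma ar_mono q a b e e' : 0 < e -> e <= e' -> 0 <= q -> 0 <= a -> 0 <= b ->
 q <= `|1 - e / e'| * a + `|e / e'| * b ->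
 (q ^+ 2 - a ^+ 2) / (2 * e) <= (b ^+ 2 - a ^+ 2) / (2 * e').
Proof.
move=> e0 ee' q0 a0 b0; have e'0 := lt_le_trans e0 ee'.
pose s := e / e'; rewrite -/s; have s0 : 0 < s by rewrite divr_gt0.
have s1 : s <= 1 by rewrite ler_pdivrMr// mul1r.
rewrite !ger0_norm ?subr_ge0 ?(ltW s0)// => h.
have q2 : q ^+ 2 <= ((1 - s) * a + s * b) ^+ 2 by rewrite ler_sqr ?nnegrE// (le_trans q0 h).
have q3 : q ^+ 2 - a ^+ 2 <= s * (b ^+ 2 - a ^+ 2).
 have : 0 <= s * (1 - s) * (a - b) ^+ 2 by rewrite mulr_ge0 ?sqr_ge0// mulr_ge0 ?subr_ge0// ltW.
 move: q2; rewrite !expr2; nra.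
rewrite ler_pdivrMr ?mulr_gt0//; apply: le_trans q3 _.
apply: eq_leW; rewrite /s; field.
by rewrite !gt_eqF.
Qed.

Lemma ar_neg q a b e : 0 < e -> 0 <= q -> 0 <= a -> 0 <= b ->
 a <= `|2^-1| * q + `|2^-1| * b ->
 (b ^+ 2 - a ^+ 2) / (2 * - e) <= (q ^+ 2 - a ^+ 2) / (2 * e).
Proof.
move=> e0 q0 a0 b0; rewrite ger0_norm ?invr_ge0// => h.
rewrite mulrN invrN mulrN -mulNr ler_pM2r ?invr_gt0 ?mulr_gt0// opprB.
have : a ^+ 2 <= (2^-1 * q + 2^-1 * b) ^+ 2 by rewrite ler_sqr ?nnegrE// (le_trans a0 h).
have -> : (2^-1 * q + 2^-1 * b) ^+ 2 = 2^-1 * q ^+ 2 + 2^-1 * b ^+ 2 - (2^-1 * (q - b)) ^+ 2 by field.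
by have := sqr_ge0 (2^-1 * (q - b)); lra.
Qed.

Lemma ar_bound b a m e : e != 0 -> 0 <= b -> 0 <= a -> 0 <= m ->
 b <= `|1| * a + `|e| * m -> a <= `|1| * b + `|- e| * m ->
 `|(b ^+ 2 - a ^+ 2) / (2 * e)| <= m * a + `|e| / 2 * m ^+ 2.
Proof.
move=> e0 b0 a0 m0; rewrite normr1 !mul1r normrN => k1 k2.
have ep : 0 < `|e| by rewrite normr_gt0.
rewrite normrM normfV normrM (ger0_norm (x := 2))// ler_pdivrMr ?mulr_gt0//.
rewrite subr_sqr normrM (ger0_norm (x := b + a)) ?addr_ge0//.
have k3 : `|b - a| <= `|e| * m by rewrite ler_norml; apply/andP; split; lra.
have k4 : `|b - a| * (b + a) <= (`|e| * m) * (2 * a + `|e| * m).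
 by apply: ler_pM => //; [rewrite addr_ge0|lra].
by apply: le_trans k4 _; apply: eq_leW; field.
Qed.

Lemma ar_add q p b a e e2 : 0 < e -> e2 = e / 2 -> 0 <= q ->
 q <= `|2^-1| * p + `|2^-1| * b ->
 (q ^+ 2 - a ^+ 2) / (2 * e2) <= (p ^+ 2 - a ^+ 2) / (2 * e) + (b ^+ 2 - a ^+ 2) / (2 * e).
Proof.
move=> e0 -> q0; rewrite ger0_norm ?invr_ge0// => h.
rewrite -mulrDl ler_pdivrMr; last by rewrite mulr_gt0// divr_gt0.
have -> : (p ^+ 2 - a ^+ 2 + (b ^+ 2 - a ^+ 2)) / (2 * e) * (2 * (e / 2)) = 2^-1 * (p ^+ 2 + b ^+ 2) - a ^+ 2.
 by field; rewrite gt_eqF.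
have : q ^+ 2 <= (2^-1 * p + 2^-1 * b) ^+ 2 by rewrite ler_sqr ?nnegrE// (le_trans q0 h).
have -> : (2^-1 * p + 2^-1 * b) ^+ 2 = 2^-1 * p ^+ 2 + 2^-1 * b ^+ 2 - (2^-1 * (p - b)) ^+ 2 by field.
by have := sqr_ge0 (2^-1 * (p - b)); lra.
Qed.

(** Let [rat_seq k] tend to [p]. The family is countable because each of its inequalities will only
    hold almost everywhere. *)
Lemma ar_chain1 (A G p m : R) : 0 <= m ->
 (forall k, `|A - rat_seq k * G| <= `|p - rat_seq k| * m) -> A = p * G.
Proof.
move=> m0 h; apply/eqP; rewrite -subr_eq0 -normr_le0; apply/ler_addgt0Pr => e e0; rewrite add0r.
pose M := m + `|G| + 1.
have M0 : 0 < M by rewrite /M -addrA ltr_wpDl// ltr_wpDl.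
have [k /andP[k1 k2]] : exists k, p < rat_seq k < p + e / M.
 by apply: rat_seq_dense; rewrite ltrDl divr_gt0.
have k3 : `|p - rat_seq k| <= e / M by rewrite ler0_norm ?subr_le0 ?ltW//; rewrite opprB; lra.
have -> : A - p * G = (A - rat_seq k * G) - (p - rat_seq k) * G by ring.
apply: le_trans (ler_normB _ _) _; rewrite normrM.
apply: (@le_trans _ _ (e / M * m + e / M * `|G|)).
 apply: lerD; last by rewrite ler_wpM2r.
 by apply: le_trans (h k) _; rewrite ler_wpM2r.
rewrite -mulrDr -ler_pdivlMl ?divr_gt0// invf_div mulfVK ?gt_eqF//.
by rewrite /M lerDl.
Qed.

Lemma ar_chain2 b a c G e : e != 0 -> 0 <= b -> 0 <= a ->
 `|c * a ^+ 2 + e * G| <= b * (`|c| * a) ->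
 e * (c * G) <= c ^+ 2 * (e * ((b ^+ 2 - a ^+ 2) / (2 * e))).
Proof.
move=> e0 b0 a0 h; have {}h : c * (c * a ^+ 2 + e * G) <= c ^+ 2 * (b * a).
 apply: le_trans (ler_norm _) _; rewrite normrM -[c ^+ 2]real_normK ?num_real// expr2.
 by rewrite -mulrA ler_wpM2l//; apply: le_trans h _; rewrite mulrCA.
have -> : e * ((b ^+ 2 - a ^+ 2) / (2 * e)) = (b ^+ 2 - a ^+ 2) / 2 by field.
have h2 : c ^+ 2 * (b * a) <= c ^+ 2 * ((b ^+ 2 + a ^+ 2) / 2).
 by rewrite ler_wpM2l ?sqr_ge0//; have := sqr_ge0 (b - a); rewrite sqrrB; lra.
have := le_trans h h2; have -> : c * (c * a ^+ 2 + e * G) = c ^+ 2 * a ^+ 2 + e * (c * G) by ring.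
have -> : c ^+ 2 * ((b ^+ 2 + a ^+ 2) / 2) = c ^+ 2 * a ^+ 2 + c ^+ 2 * ((b ^+ 2 - a ^+ 2) / 2) by field.
by rewrite lerD2l.
Qed.

Lemma ar_leib (u v A B : R) :
 2^-1 * (2 * (u + v) * (A + B) - 2 * u * A - 2 * v * B) = u * B + v * A.
Proof. by field. Qed.

End gamma_arith.

(** * Right limits and slopes *)

Section right_limits.
Context {R : realType}.
Implicit Types (e c t : R).
Lemma near0P (P : R -> Prop) : (\forall t \near 0^'+, P t) <->
 exists2 dl : R, 0 < dl & forall t, 0 < t -> t < dl -> P t.
Proof.
split=> [[e /= e0 H]|[dl d0 H]].
 exists e => // t t0 te; apply: H => //=; by rewrite sub0r normrN gtr0_norm.
exists dl => //= t /=; rewrite sub0r normrN => h t0; apply: H => //.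
exact: le_lt_trans (ler_norm _) h.
Qed.

Lemma cvg0_EFin (F : R -> \bar R) (phi : R -> R) : (forall t, 0 < t -> F t = (phi t)%:E) ->
 (F t @[t --> 0^'+] --> 0%E) <->
 forall e, 0 < e -> exists2 dl : R, 0 < dl & forall t, 0 < t -> t < dl -> `|phi t| < e.
Proof.
move=> FE.
have near : \forall t \near (0 : R)^'+, F t = (phi t)%:E by apply/near0P; exists 1 => // t t0 _; exact: FE.
have step : (F t @[t --> 0^'+] --> 0%E) <-> (phi t @[t --> 0^'+] --> (0 : R)).
 split=> [c|c].
  have c' : (phi t)%:E @[t --> 0^'+] --> 0%E.
   by apply: cvg_trans c; apply: near_eq_cvg; apply: filterS near => t ->.
  exact: (fine_cvg c').
 have : (phi t)%:E @[t --> 0^'+] --> 0%E by apply: cvg_EFin => //; exact: nearW.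
 by apply: cvg_trans; apply: near_eq_cvg; apply: filterS near => t ->.
split=> [/step c e e0|H].
 apply/near0P; move/cvgrPdist_lt : c => /(_ e e0); apply: filterS => t; by rewrite sub0r normrN.
apply/step/cvgrPdist_lt => e e0; have := H e e0; move/near0P; apply: filterS => t.
by rewrite sub0r normrN.
Qed.

(** Sum the hypothesis over [n] equal steps shorter than [dl]; uniformity of [dl] in [s] takes the
    place of continuity of [phi]. *)
Lemma tel_slope (phi : R -> R) c t : 0 <= t ->
 (forall e, 0 < e -> exists2 dl : R, 0 < dl & forall s h : R, 0 <= s -> 0 < h -> h < dl ->
  s + h <= t -> phi (s + h) <= phi s + (c + e) * h) ->
 phi t <= phi 0 + c * t.
Proof.
rewrite le_eqVlt => /orP[/eqP <- _|t0 H]; first by rewrite mulr0 addr0.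
apply/ler_addgt0Pr => e e0.
have [dl d0 D] := H (e / t) (divr_gt0 e0 t0).
have [n nP] : exists n : nat, t / dl < n%:R.
 by exists (Num.bound (t / dl)); apply: archi_boundP; rewrite divr_ge0// ltW.
have n0 : 0 < n%:R :> R by apply: lt_trans nP; exact: divr_gt0.
have n0' : n%:R != 0 :> R by rewrite gt_eqF.
have hk k : (k <= n)%N -> phi (k%:R * (t / n%:R)) <= phi 0 + (c + e / t) * (k%:R * (t / n%:R)).
 elim: k => [|k IH] kn; first by rewrite mul0r mulr0 addr0.
 have h0 : 0 < t / n%:R by exact: divr_gt0.
 have -> : k.+1%:R * (t / n%:R) = k%:R * (t / n%:R) + t / n%:R by rewrite -natr1; ring.
 apply: (le_trans (D _ _ _ h0 _ _)).
 - by rewrite mulr_ge0// ltW.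
 - by rewrite ltr_pdivrMr// mulrC -ltr_pdivrMr.
 - have -> : k%:R * (t / n%:R) + t / n%:R = k.+1%:R * (t / n%:R) by rewrite -natr1; ring.
  by rewrite mulrA ler_pdivrMr// mulrC ler_pM2l// ler_nat.
 - by rewrite mulrDr addrA lerD2r; exact: IH (ltnW kn).
have := hk n (leqnn n); have -> : n%:R * (t / n%:R) = t by rewrite mulrC mulfVK.
move/le_trans; apply; rewrite mulrDl addrA lerD2l -mulrA mulVf ?mulr1// gt_eqF//.
Qed.

End right_limits.

(** * Logarithm and reciprocal *)

Section log_estimates.
Context {R : realType}.
Implicit Types (x y z dl : R).
Lemma ln_le_sub1 x : 0 < x -> ln x <= x - 1.
Proof.
move=> x0; have -> : x = 1 + (x - 1) by ring.
by rewrite [X in _ <= X - 1]addrC addrK; apply: le_ln1Dx; lra.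
Qed.

(** From [ln z <= z - 1] at [x / y] and at [y / x]: the gap between the resulting bounds is
    [(x - y)^2 / (x y)]. *)
Lemma ln_taylor dl x y : 0 < dl -> dl <= x -> dl <= y ->
 `|ln x - ln y - (x - y) / x| <= (x - y) ^+ 2 / dl ^+ 2.
Proof.
move=> d0 dx dy; have x0 : 0 < x by lra. have y0 : 0 < y by lra.
have h1 := ln_le_sub1 (divr_gt0 x0 y0); have h2 := ln_le_sub1 (divr_gt0 y0 x0).
rewrite ln_div// in h1; rewrite ln_div// in h2.
have e1 : (x - y) / x = 1 - y / x by field; rewrite gt_eqF.
have e2 : x / y - 1 - (1 - y / x) = (x - y) ^+ 2 / (x * y) by field; rewrite !gt_eqF.
rewrite ger0_norm; last by rewrite e1; lra.
apply: (@le_trans _ _ ((x - y) ^+ 2 / (x * y))); first by rewrite -e2 e1; lra.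
rewrite ler_wpM2l ?sqr_ge0// lef_pV2 ?posrE ?exprn_gt0 ?mulr_gt0// expr2.
by apply: ler_pM => //; exact: ltW.
Qed.

Lemma inv_lip dl x y : 0 < dl -> dl <= x -> dl <= y -> `|x^-1 - y^-1| <= `|x - y| / dl ^+ 2.
Proof.
move=> d0 dx dy; have x0 : 0 < x by lra. have y0 : 0 < y by lra.
have -> : x^-1 - y^-1 = (y - x) / (x * y) by field; rewrite !gt_eqF.
rewrite normrM distrC ler_wpM2l// ger0_norm ?invr_ge0 ?mulr_ge0 ?(ltW x0) ?(ltW y0)//.
rewrite lef_pV2 ?posrE ?exprn_gt0 ?mulr_gt0// expr2; apply: ler_pM => //; exact: ltW.
Qed.

(** The increment between [y] and [z] is linearised at [z], and the slope is then moved from [z] to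
    [x] by the Lipschitz bound on [phi']. *)
Lemma sdiff_C11 (D : set R) (phi phi' : R -> R) L K : 0 <= K ->
 (forall x, D x -> `|phi' x| <= L) ->
 (forall x y, D x -> D y -> `|phi x - phi y - phi' y * (x - y)| <= K * (x - y) ^+ 2) ->
 (forall x y, D x -> D y -> `|phi' x - phi' y| <= K * `|x - y|) ->
 (forall x y, D x -> D y -> `|phi x - phi y| <= L * `|x - y|) -> sdiff D phi phi' L.
Proof.
move=> K0 h1 h2 h3 h4; split=> // x Dx e e0; have K1 : 0 < 3 * K + 1 by lra.
exists (e / (3 * K + 1)); first exact: divr_gt0.
move=> y z Dy Dz yx zx; have a := h2 y z Dy Dz; have b := h3 z x Dz Dx.
have -> : phi y - phi z - phi' x * (y - z) = (phi y - phi z - phi' z * (y - z)) + (phi' z - phi' x) * (y - z) by ring.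
apply: (le_trans (ler_normD _ _)); rewrite normrM.
apply: (@le_trans _ _ (K * `|y - z| * `|y - z| + K * `|z - x| * `|y - z|)).
 by apply: lerD; [rewrite -mulrA -expr2 real_normK ?num_real|rewrite ler_wpM2r].
rewrite -mulrDl ler_wpM2r//.
have yz : `|y - z| <= `|y - x| + `|z - x|.
 rewrite (_ : y - z = (y - x) - (z - x)); last by ring.
 exact: ler_normB.
have : e / (3 * K + 1) * (3 * K + 1) = e by field; rewrite gt_eqF.
move: (e / _) yx zx yz => r; move: `|y - x| `|z - x| `|y - z| => p q s pr qr sp er.
nra.
Qed.

Lemma sdiff_log dl : 0 < dl -> sdiff [set x | 0 <= x] (fun x => ln (1 + x / dl)) (fun x => (x + dl)^-1) dl^-1.
Proof.
move=> d0; have lE x : 0 <= x -> ln (1 + x / dl) = ln (x + dl) - ln dl.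
 move=> x0; rewrite -ln_div ?posrE//; last lra.
 by congr ln; field; rewrite gt_eqF.
have ib x : 0 <= x -> 0 < (x + dl)^-1 <= dl^-1.
 move=> x0; have h : 0 < x + dl by lra.
 by rewrite invr_gt0 h/= lef_pV2 ?posrE//; lra.
apply: (@sdiff_C11 _ _ _ _ (dl ^- 2)).
- by rewrite invr_ge0 exprn_ge0// ltW.
- by move=> x /= x0; have /andP[h1 h2] := ib x x0; rewrite gtr0_norm.
- move=> x y /= x0 y0; rewrite (lE x x0) (lE y y0).
 have := @ln_taylor dl (y + dl) (x + dl) d0; move/(_ _ _) => H.
 have := H ltac:(lra) ltac:(lra).
 have -> : ln (y + dl) - ln (x + dl) - (y + dl - (x + dl)) / (y + dl) =
  - (ln (x + dl) - ln dl - (ln (y + dl) - ln dl) - (y + dl)^-1 * (x - y)) by ring.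
 have -> : y + dl - (x + dl) = - (x - y) by ring.
 by rewrite normrN sqrrN [X in _ -> _ <= X]mulrC.
- move=> x y /= x0 y0; have := @inv_lip dl (x + dl) (y + dl) d0; move/(_ _ _) => H.
 have := H ltac:(lra) ltac:(lra); have -> : x + dl - (y + dl) = x - y by ring.
 by rewrite mulrC.
- move=> x y; wlog xy : x y / y <= x.
  by move=> W x0 y0; have [|/ltW] := leP y x => h; [exact: W|rewrite (distrC (ln _)) (distrC x); exact: W].
 move=> /= x0 y0; rewrite (lE x x0) (lE y y0).
 have -> : ln (x + dl) - ln dl - (ln (y + dl) - ln dl) = ln ((x + dl) / (y + dl)).
  rewrite ln_div ?posrE; [ring|lra|lra].
 have p0 : 0 < (x + dl) / (y + dl) by apply: divr_gt0; lra.
 rewrite ger0_norm; last by apply: ln_ge0; rewrite ler_pdivlMr; lra.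
 rewrite ger0_norm ?subr_ge0//; apply: (le_trans (ln_le_sub1 p0)).
 have /andP[i0 i1] := ib y y0.
 have -> : (x + dl) / (y + dl) - 1 = (y + dl)^-1 * (x - y) by field; rewrite gt_eqF//; lra.
 by rewrite ler_wpM2r// subr_ge0.
Qed.

Lemma ar_inv (p q r m : R) : 0 <= q -> q <= r -> 0 <= m -> 0 <= p -> p <= r ^+ 2 * m ->
 p * (q * m) <= 2 * r ^+ 3 * m ^+ 2.
Proof.
move=> q0 qr m0 p0 h; have r0 := le_trans q0 qr.
apply: (@le_trans _ _ (r ^+ 2 * m * (r * m))).
 by apply: ler_pM => //; [exact: mulr_ge0|exact: ler_wpM2r].
have -> : r ^+ 2 * m * (r * m) = r ^+ 3 * m ^+ 2 by ring.
by rewrite -mulrA mulr_natl mulr2n lerDl mulr_ge0 ?exprn_ge0.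
Qed.

Lemma sdiff_inv dl : 0 < dl ->
 sdiff [set x | 0 <= x] (fun x => dl^-1 - (x + dl)^-1) (fun x => (x + dl) ^- 2) (dl ^- 2).
Proof.
move=> d0; have ib x : 0 <= x -> 0 < (x + dl)^-1 <= dl^-1.
 move=> x0; have h : 0 < x + dl by lra.
 by rewrite invr_gt0 h/= lef_pV2 ?posrE//; lra.
have il x y : 0 <= x -> 0 <= y -> `|(x + dl)^-1 - (y + dl)^-1| <= dl ^- 2 * `|x - y|.
 move=> x0 y0; have H := @inv_lip dl (x + dl) (y + dl) d0.
 have := H ltac:(lra) ltac:(lra); have -> : x + dl - (y + dl) = x - y by ring.
 by rewrite mulrC.
have d1 : 0 <= dl^-1 by rewrite invr_ge0 ltW.
apply: (@sdiff_C11 _ _ _ _ (2 * dl ^- 3)).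
- by rewrite mulr_ge0// invr_ge0 exprn_ge0// ltW.
- move=> x /= x0; have /andP[h1 h2] := ib x x0.
 by rewrite -!exprVn ger0_norm ?exprn_ge0 ?(ltW h1)// lerXn2r ?nnegrE// ltW.
- move=> x y /= x0 y0; have /andP[h1 h2] := ib x x0; have /andP[h3 h4] := ib y y0.
 have -> : dl^-1 - (x + dl)^-1 - (dl^-1 - (y + dl)^-1) - (y + dl) ^- 2 * (x - y) =
  ((x + dl)^-1 - (y + dl)^-1) * ((y + dl)^-1 * (x - y)).
  by field; rewrite !gt_eqF; lra.
 rewrite !normrM -(real_normK (num_real (x - y))) (gtr0_norm h3).
 have := il x y x0 y0; rewrite -!exprVn => h; exact: ar_inv (ltW h3) h4 (normr_ge0 _) (normr_ge0 _) h.
- move=> x y /= x0 y0; have /andP[h1 h2] := ib x x0; have /andP[h3 h4] := ib y y0.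
 rewrite -!exprVn subr_sqr normrM (ger0_norm (addr_ge0 (ltW h1) (ltW h3))).
 have := il x y x0 y0; rewrite -!exprVn.
 have -> : 2 * dl^-1 ^+ 3 * `|x - y| = dl^-1 ^+ 2 * `|x - y| * (2 * dl^-1) by ring.
 move=> h; apply: ler_pM => //; [exact: addr_ge0 (ltW h1) (ltW h3)|lra].
- by move=> x y /= x0 y0; have := il y x y0 x0; rewrite [X in _ * X]distrC; have -> : (y + dl)^-1 - (x + dl)^-1 = dl^-1 - (x + dl)^-1 - (dl^-1 - (y + dl)^-1) by ring.
Qed.

End log_estimates.

(** * Dini derivatives and Riccati comparison *)

Section dini.
Context {R : realType}.
Implicit Types (phi Y : R -> R) (a b s t : R) (tau z : nat -> R).
Definition seq_cont phi b := forall s (s_ : nat -> R), 0 <= s -> s <= b ->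
 (forall n, 0 <= s_ n <= b) -> s_ n @[n --> \oo] --> s -> phi (s_ n) @[n --> \oo] --> phi s.

(** The last point where [phi s <= phi 0 + e s] is attained by continuity. It must be [b], since the
    Dini bound along one sequence of increments would carry the inequality further. *)
Lemma dini_seq phi b : 0 <= b -> seq_cont phi b ->
 (forall s tau (e : R), 0 <= s -> s < b -> (forall n, 0 < tau n) -> (forall n, s + tau n <= b) ->
  tau n @[n --> \oo] --> (0 : R) -> 0 < e -> exists n, phi (s + tau n) <= phi s + tau n * e) ->
 phi b <= phi 0.
Proof.
move=> b0 cphi H; apply/ler_addgt0Pr => e' e'0.
pose e := e' / (b + 1); have b1 : 0 < b + 1 by rewrite ltr_wpDl.
have e0 : 0 < e by exact: divr_gt0.
pose S := [set s | [/\ 0 <= s, s <= b & phi s <= phi 0 + e * s]].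
have S0 : S 0 by split=> //; rewrite mulr0 addr0.
have hS : has_sup S by split; [exists 0|exists b => x []].
pose sg := sup S; have sg0 : 0 <= sg by apply: ub_le_sup => //; exact: hS.2.
have sgb : sg <= b by apply: ge_sup => [|x []]; [exists 0|].
have Ssg : S sg.
 split=> //; have /choice[s_ sP] : forall n, exists s, S s /\ sg - eps n < s.
  by move=> n; have [s Ss h] := sup_adherent (@eps_gt0 R n) hS; exists s.
 have sle n : s_ n <= sg by apply: ub_le_sup; [exact: hS.2|exact: (sP n).1].
 have cs : s_ n @[n --> \oo] --> sg.
  have c : sg - eps n @[n --> \oo] --> sg - 0 by apply: cvgB; [exact: cvg_cst|exact: eps_cvg].
  rewrite subr0 in c; apply: (squeeze_cvgr _ c (cvg_cst sg)); apply: nearW => n.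
  by rewrite sle andbT ltW// (sP n).2.
 have l1 : phi (s_ n) @[n --> \oo] --> phi sg.
  by apply: cphi => // n; have [[h1 h2 _] _] := sP n; rewrite h1.
 apply: (cvgr_to_le l1); apply: nearW => n; have [[_ _ h] _] := sP n; apply: (le_trans h).
 by rewrite lerD2l ler_pM2l.
have [Hlt|Hge] := ltP sg b; last first.
 have sb : sg = b by apply/eqP; rewrite eq_le sgb.
 case: Ssg => _ _; rewrite sb => h; apply: (le_trans h); rewrite lerD2l /e mulrC mulrA ler_pdivrMr//.
 by rewrite mulrC ler_pM2l// lerDl.
exfalso; pose tau n := (b - sg) * eps n.
have bs : 0 < b - sg by rewrite subr_gt0.
have t0 n : 0 < tau n by rewrite mulr_gt0// eps_gt0.
have tb n : sg + tau n <= b.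
 rewrite -lerBrDl -[leRHS]mulr1 ler_pM2l// /eps invf_le1 ?ler1n//.
have ct : tau n @[n --> \oo] --> (0 : R).
 by rewrite -[X in _ --> X](mulr0 (b - sg)); apply: cvgM; [exact: cvg_cst|exact: eps_cvg].
have [n hn] := H sg tau e sg0 Hlt t0 tb ct e0.
have : S (sg + tau n).
 split=> //; first by rewrite addr_ge0// ltW.
 by case: Ssg => _ _ h; rewrite mulrDr addrA; apply: (le_trans hn); rewrite [tau n * e]mulrC lerD2r.
by move/(ub_le_sup hS.2); rewrite -/sg; apply/negP; rewrite -ltNge ltrDl.
Qed.

Lemma ar_riccati (y y' z a s t e : R) : 0 < y -> 0 < y' -> 0 < t -> y + t * z <= y' ->
 a - z / (y * y') <= e -> y'^-1 + a * (s + t) <= y^-1 + a * s + t * e.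
Proof.
move=> y0 y'0 t0 h1 h2; have yy : 0 < y * y' by exact: mulr_gt0.
have e1 : y'^-1 = y^-1 - (y' - y) / (y * y') by field; rewrite !gt_eqF.
have h3 : t * (z / (y * y')) <= (y' - y) / (y * y').
 by rewrite mulrA ler_pM2r ?invr_gt0//; lra.
have h4 : t * (a - z / (y * y')) <= t * e by rewrite ler_pM2l.
rewrite e1; lra.
Qed.

(** If [Y 0] exceeded [1 / (a t)], then [Y] would be at least [Y 0 > 0] and [1 / Y + a s] would be
    nonincreasing, which drives [1 / Y] below zero once [s] passes [1 / (a Y 0)], still before
    [t]. *)
Lemma riccati Y a t : 0 < a -> 0 < t -> (forall b, 0 <= b -> b < t -> seq_cont Y b) ->
 (forall s tau, 0 <= s -> s < t -> (forall n, 0 < tau n) -> (forall n, s + tau n <= (s + t) / 2) ->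
  tau n @[n --> \oo] --> (0 : R) -> exists z : nat -> R, z n @[n --> \oo] --> a * Y s ^+ 2 /\
   forall n, Y s + tau n * z n <= Y (s + tau n)) ->
 Y 0 <= (a * t)^-1.
Proof.
move=> a0 t0 cY H; rewrite leNgt; apply/negP => y0.
have at0 : 0 < a * t by exact: mulr_gt0.
have Y0 : 0 < Y 0 by apply: lt_trans y0; rewrite invr_gt0.
(* The hypothesis wants increments ending before [(s + t) / 2]; dropping finitely many terms of the
   null sequence ensures it. *)
have H' s tau b : 0 <= s -> s < b -> b < t -> (forall n, 0 < tau n) -> (forall n, s + tau n <= b) ->
  tau n @[n --> \oo] --> (0 : R) -> exists k, exists z : nat -> R, z n @[n --> \oo] --> a * Y s ^+ 2 /\
   forall n, Y s + tau (n + k)%N * z n <= Y (s + tau (n + k)%N).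
 move=> s0 sb bt tp tb ct; have h0 : 0 < (t - s) / 2 by apply: divr_gt0 => //; lra.
 move/cvgrPdist_lt : (ct) => /(_ _ h0) [k _ kP]; exists k.
 have tp' n : 0 < tau (n + k)%N by [].
 have tb' n : s + tau (n + k)%N <= (s + t) / 2.
  by have := kP (n + k)%N (leq_addl _ _); rewrite /= sub0r normrN gtr0_norm//; lra.
 have ct' : tau (n + k)%N @[n --> \oo] --> (0 : R) by rewrite (@cvg_shiftn k _ tau).
 have [z [cz hz]] := H s (fun n => tau (n + k)%N) s0 (lt_trans sb bt) tp' tb' ct'.
 by exists z; split.
have mono b : 0 <= b -> b < t -> Y 0 <= Y b.
 move=> b0 bt; rewrite -lerN2; apply: (@dini_seq (fun s => - Y s) b b0).
  by move=> s s_ s0 sb sn cs; apply: cvgN; exact: (cY b b0 bt s s_ s0 sb sn cs).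
 move=> s tau e s0 sb tp tb ct e0; have [k [z [cz hz]]] := H' s tau b s0 sb bt tp tb ct.
 have /filter_ex[n nz] : \forall n \near \oo, - e < z n.
  apply: cvgr_gt cz _ _; apply: (@lt_le_trans _ _ 0); rewrite ?oppr_lt0// mulr_ge0 ?sqr_ge0// ltW//.
 exists (n + k)%N; have := hz n; have := ltr_pM2l (tp (n + k)%N) (- e) (z n); rewrite nz mulrN; lra.
(* Midway between the blow-up time [1 / (a Y 0)] and [t]. *)
pose b := (t + (a * Y 0)^-1) / 2.
have aY : 0 < a * Y 0 by exact: mulr_gt0.
have ay : (a * Y 0)^-1 < t.
 by rewrite -(ltr_pM2l a0) invfM mulrA mulfV ?gt_eqF// mul1r -[ltRHS]invrK ltf_pV2 ?posrE// invr_gt0.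
have ay0 : 0 < (a * Y 0)^-1 by rewrite invr_gt0.
have b0 : 0 <= b by rewrite /b divr_ge0//; lra.
have bt : b < t by rewrite /b; lra.
have Yp s : 0 <= s -> s <= b -> 0 < Y s by move=> s0 sb; apply: (lt_le_trans Y0); apply: mono => //; exact: le_lt_trans bt.
have : (Y b)^-1 + a * b <= (Y 0)^-1 + a * 0.
 apply: (@dini_seq (fun s => (Y s)^-1 + a * s) b b0).
  move=> s s_ s0 sb sn cs; apply: cvgD; last by apply: cvgM => //; exact: cvg_cst.
  by apply: cvgV; [rewrite gt_eqF// Yp|exact: (cY b b0 bt s s_ s0 sb sn cs)].
 move=> s tau e s0 sb tp tb ct e0; have [k [z [cz hz]]] := H' s tau b s0 sb bt tp tb ct.
 have y0' := Yp s s0 (ltW sb); have yn n : 0 < Y (s + tau (n + k)%N) by apply: Yp => //; rewrite addr_ge0// ltW.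
 have cs : s + tau (n + k)%N @[n --> \oo] --> s.
  rewrite -[X in _ --> X]addr0; apply: cvgD; first exact: cvg_cst.
  by rewrite (@cvg_shiftn k _ tau).
 have cy : Y (s + tau (n + k)%N) @[n --> \oo] --> Y s.
  apply: (cY b b0 bt s _ s0 (ltW sb) _ cs) => n; rewrite tb andbT addr_ge0// ltW//.
 have c : a - z n / (Y s * Y (s + tau (n + k)%N)) @[n --> \oo] --> a - a * Y s ^+ 2 / (Y s * Y s).
  apply: cvgB; first exact: cvg_cst.
  apply: cvgM => //; apply: cvgV; first by rewrite gt_eqF// mulr_gt0.
  by apply: cvgM => //; exact: cvg_cst.
 have e1 : a - a * Y s ^+ 2 / (Y s * Y s) = 0 by field; rewrite gt_eqF.
 rewrite e1 in c; have /filter_ex[n nz] : \forall n \near \oo, a - z n / (Y s * Y (s + tau (n + k)%N)) < e.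
  exact: (cvgr_lt _ c _ e0).
 exists (n + k)%N; apply: (@ar_riccati (Y s) (Y (s + tau (n + k)%N)) (z n)) => //.
 exact: ltW.
rewrite mulr0 addr0; have : 0 < (Y b)^-1 by rewrite invr_gt0 Yp.
have : a * (a * Y 0)^-1 = (Y 0)^-1 by field; rewrite !gt_eqF.
have : a * (a * Y 0)^-1 < a * b by rewrite ltr_pM2l// /b; lra.
lra.
Qed.

End dini.

(** * Finite differences and a quantitative identity principle *)

Section finite_differences.
Context {R : realType}.
Implicit Types (F G : R -> R) (r s t e : R).
Definition fdif e F t := F (t + e) - F t.

Lemma iter_fdif_shift i e F s t : iter i (fdif e) F (t + s) = iter i (fdif e) (fun r => F (r + s)) t.
Proof. by elim: i t => [//|i IH] t; rewrite !iterS /fdif -!IH addrAC. Qed.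

Lemma iter_fdif_ext i e F G t : 0 <= e -> (forall r, t <= r -> F r = G r) -> iter i (fdif e) F t = iter i (fdif e) G t.
Proof.
move=> e0; elim: i t => [|i IH] t H; first exact: H.
by rewrite !iterS /fdif !IH// => r h; apply: H => //; apply: le_trans h; rewrite lerDl.
Qed.

Lemma iter_fdif_eq0 i e F t : (forall j, (j <= i)%N -> F (t + j%:R * e) = 0) -> iter i (fdif e) F t = 0.
Proof.
elim: i F => [|i IH] F H; first by have := H 0%N isT; rewrite mul0r addr0.
rewrite iterSr; apply: IH => j ji; rewrite /fdif H ?(leqW ji)// subr0 -addrA -{2}(mul1r e) -mulrDl natr1.
exact: H.
Qed.

Lemma newton m e F t : F (t + m%:R * e) = \sum_(0 <= i < m.+1) 'C(m, i)%:R * iter i (fdif e) F t.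
Proof.
elim: m F => [|m IH] F; first by rewrite mul0r addr0 big_nat1 bin0 mul1r.
have -> : F (t + m.+1%:R * e) = F (t + m%:R * e) + fdif e F (t + m%:R * e).
 by rewrite /fdif addrCA subrr addr0 -addrA -natr1 mulrDl mul1r.
rewrite !IH big_nat_recl// [in RHS]big_nat_recl// !bin0 -addrA; congr (_ + _).
under [in RHS]eq_big_nat => i _ do rewrite binS natrD mulrDl.
rewrite big_split /= [X in _ = X + _]big_nat_recr//= bin_small// mul0r addr0; congr (_ + _).
by apply: eq_bigr => i _; rewrite -iterSr.
Qed.

(** One term of the exponential series at [i]. *)
Lemma exp_fact i : i%:R ^+ i / i`!%:R <= expR 1 ^+ i :> R.
Proof.
rewrite -expRM_natl mulr1; case: i => [|i]; first by rewrite expr0 fact0 divr1 expR0.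
by apply: le_trans (expR_ge1Dxn i (ler0n R i.+1)); rewrite lerDr.
Qed.

Lemma bin_le_pow m i : 'C(m, i)%:R <= m%:R ^+ i / i`!%:R :> R.
Proof.
rewrite ler_pdivlMr ?ltr0n ?fact_gt0// -natrM bin_ffact -natrX ler_nat.
elim: i => [//|i IH]; rewrite ffactnSr expnSr; apply: leq_mul => //; exact: leq_subr.
Qed.

(* Newton's forward formula at step [dl / n]: the first [n] differences vanish and the remaining ones
 are geometrically small since [i^i <= e^i i!]. *)
Lemma fdif_extend F a dl C : 0 < dl -> dl <= a / (8 * expR 1) -> 0 <= C ->
 (forall i e, (0 < i)%N -> 0 < e -> `|iter i (fdif e) F a| <= (i%:R * e / a) ^+ i * C) ->
 (forall t, a <= t -> t < a + dl -> F t = 0) -> F (a + 2 * dl) = 0.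
Proof.
move=> d0 da C0 H F0; have E0 : 0 < expR (1 : R) by exact: expR_gt0.
have a0 : 0 < a by have := lt_le_trans d0 da; rewrite pmulr_lgt0// invr_gt0 mulr_gt0.
have key n : (0 < n)%N -> `|F (a + 2 * dl)| <= 2^-1 ^+ n * C.
 move=> n0; pose e := dl / n%:R; have nR : 0 < n%:R :> R by rewrite ltr0n.
 have e0 : 0 < e by rewrite divr_gt0.
 have -> : 2 * dl = (n + n)%:R * e by rewrite natrD /e; field; rewrite gt_eqF.
 rewrite newton (big_cat_nat (n := n)) //=; last by rewrite -addnS leq_addr.
 rewrite big_nat big1 ?add0r => [|i /andP[_ ilt]]; last first.
  rewrite iter_fdif_eq0 ?mulr0// => j ji; apply: F0; first by rewrite lerDl mulr_ge0// ltW.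
  rewrite ltrD2l /e mulrCA -[ltRHS]mulr1 ltr_pM2l// ltr_pdivrMr// mul1r ltr_nat.
  exact: leq_ltn_trans ji ilt.
 apply: (le_trans (ler_norm_sum _ _ _)).
 (* As [dl <= a / (8 e)], the ratio [2 e dl / a] is at most [1 / 4]; the [n + 1] remaining terms are
    then absorbed by [2 ^ n]. *)
 have b i : (n <= i < (n + n).+1)%N -> `|'C(n + n, i)%:R * iter i (fdif e) F a| <= 4^-1 ^+ n * C.
  move=> /andP[ni _]; have i0 : (0 < i)%N by exact: leq_trans n0 ni.
  rewrite normrM ger0_norm//; apply: (@le_trans _ _ (((n + n)%:R * expR 1 * e / a) ^+ i * C)).
   apply: (le_trans (ler_pM (ler0n _ _) (normr_ge0 _) (bin_le_pow _ _) (H i e i0 e0))).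
   rewrite mulrA ler_wpM2r//.
   have -> : (n + n)%:R ^+ i / i`!%:R * (i%:R * e / a) ^+ i =
     (i%:R ^+ i / i`!%:R) * ((n + n)%:R * e / a) ^+ i :> R by rewrite !exprMn; ring.
   have -> : ((n + n)%:R * expR 1 * e / a) ^+ i = expR 1 ^+ i * ((n + n)%:R * e / a) ^+ i :> R.
    by rewrite -exprMn; congr (_ ^+ _); ring.
   by rewrite ler_wpM2r ?exp_fact// exprn_ge0// divr_ge0 ?mulr_ge0 ?(ltW d0) ?invr_ge0 ?(ltW a0).
  rewrite ler_wpM2r//; apply: (@le_trans _ _ (4^-1 ^+ i)).
   rewrite lerXn2r ?nnegrE ?invr_ge0//.
    by rewrite divr_ge0 ?mulr_ge0 ?invr_ge0 ?(ltW d0) ?(ltW a0) ?(ltW E0).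
   have -> : (n + n)%:R * expR 1 * e / a = dl * (2 * expR 1 / a).
    by rewrite natrD /e; field; rewrite !gt_eqF.
   apply: (le_trans (ler_wpM2r _ da)); first by rewrite divr_ge0 ?mulr_ge0 ?(ltW a0) ?(ltW E0).
   by apply: eq_leW; field; rewrite !gt_eqF.
  by apply: ler_wiXn2l => //; rewrite ?invr_ge0//; lra.
 rewrite big_nat; apply: (le_trans (ler_sum _ b)); rewrite -big_nat sumr_const_nat.
 rewrite subSn ?leq_addr// addKn -[leLHS]mulr_natl mulrA ler_wpM2r//.
 have -> : 2^-1 ^+ n = 2 ^+ n * 4^-1 ^+ n :> R by rewrite -exprMn; congr (_ ^+ _); field.
 by rewrite ler_wpM2r ?exprn_ge0 ?invr_ge0// -natrX ler_nat ltn_expl.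
apply/eqP; rewrite -normr_le0.
have c : (2^-1 : R) ^+ n * C @[n --> \oo] --> 0 * C.
 apply: cvgM; last exact: cvg_cst.
 by apply: cvg_expr; rewrite ger0_norm ?invr_ge0// invf_lt1//; lra.
rewrite mul0r in c; apply: (ler_cvg_to (cvg_cst _) c); near=> n; apply: key; near: n; exact: nbhs_infty_gt.
Unshelve. all: by end_near.
Qed.

End finite_differences.

Section positivity_arithmetic.
Context {R : realType}.
Lemma ar_lower (A B Z c q s r I : R) : A - c * (q - s) * I <= Z -> B - c * (s - r) * I <= A -> B - c * (q - r) * I <= Z.
Proof. move=> h1 h2; have -> : B - c * (q - r) * I = B - c * (s - r) * I - c * (q - s) * I by ring.
by lra. Qed.

Lemma ar_lower_lim (A B Z c q s I b e : R) : A - c * (q - s) * I <= Z -> `|A - B| <= b -> b <= e ->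
 0 <= c * s * I -> B - c * q * I <= Z + e.
Proof.
move=> h; rewrite ler_norml => /andP[h1 _] h2 h3.
have e1 : c * (q - s) * I = c * q * I - c * s * I by ring.
rewrite e1 in h; lra.
Qed.

End positivity_arithmetic.

Section derivative.
Context {R : realType}.
Lemma eps_delta_derive (f : R -> R) (t D : R) :
 (forall e : R, 0 < e -> exists2 dl : R, 0 < dl & forall h : R, h != 0 -> `|h| < dl ->
  `|f (t + h) - f t - h * D| <= e * `|h|) -> is_derive t 1 f D.
Proof.
move=> H; have c : h^-1 *: ((f \o shift t) (h *: 1) - f t) @[h --> 0^'] --> D.
 apply/cvgrPdist_le => e e0; have [dl d0 Hd] := H e e0.
 near=> h; have h0 : h != 0 by near: h; exact: nbhs_dnbhs_neq.
 have hd : `|h| < dl by near: h; exact: dnbhs0_lt.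
 have := Hd h h0 hd; rewrite /= [h%:A]mulr1 [h + t]addrC => h1.
 have hn : 0 < `|h| by rewrite normr_gt0.
 rewrite -(ler_pM2l hn) [`|h| * e]mulrC -normrM.
 have -> : h * (D - h^-1 *: (f (t + h) - f t)) = - (f (t + h) - f t - h * D).
  by rewrite -[_ *: _]/(_ * _); field.
 by rewrite normrN.
by apply: DeriveDef; [apply/cvg_ex; exists D|exact: cvg_lim].
Unshelve. all: by end_near.
Qed.

Lemma is_derive_ln (f : R -> R) (t D : R) : 0 < f t -> is_derive t 1 f D ->
 is_derive t 1 (fun s => ln (f s)) ((f t)^-1 * D).
Proof. by move=> f0 d; apply: (@is_derive1_comp _ (@ln R) f); exact: is_derive1_ln. Qed.

End derivative.

Section rcd.
Context {R : realType} {d : measure_display} {X : borelMetricType R d}.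
Hypothesis sepX : @separable_space R d X.
Hypothesis propX : @proper_space R d X.
Variable mu : {measure set X -> \bar R}.
Hypothesis lfmu : locally_finite mu.
Hypothesis hilb : W12_hilbert mu.
Local Notation "[ 'ae' x | P ]" := {ae mu, forall x, P} (at level 0, x name, P at level 200).
Local Notation wug := (weak_upper_gradient mu).
Local Notation L2 := (L2 mu).
Local Notation ip := (ip mu).
Local Notation nn := (nn mu).
Local Notation ng := (norm_grad mu).
Local Notation W12 := (W12 mu).
Local Notation Gam := (grad_inner mu).
Local Notation DA := (is_form_laplacian mu).
Local Notation integ f := (mu.-integrable setT (EFin \o f)).

(** * The energy form on W12 *)

Section energy.
Implicit Types (f g G : X -> R) (a b c e r s t : R).
Lemma W12P f : W12 f <-> L2 f /\ exists G, L2 G /\ wug f G.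
Proof.
split=> [[/L2_Lfun Lf [G [/L2_Lfun LG w]]]|[/L2_Lfun Lf [G [/L2_Lfun LG w]]]]; split => //; exists G => //.
Qed.

Lemma W12_L2 f : W12 f -> L2 f. Proof. by move=> /W12P[]. Qed.

Lemma W12_m f : W12 f -> meas f. Proof. by move=> /W12_L2[]. Qed.

Lemma L2loc_dom G H : meas G -> L2 H ->
 (forall x, exists c, exists2 r0 : R, 0 < r0 & forall y, ball x r0 y -> `|G y| <= `|c * H y|) -> L2loc mu G.
Proof.
move=> mG LH dom; split => // x; have [c [r0 r00 b]] := dom x; have [mc ic] := L2Z c LH.
near=> r; have rr : r <= r0 by near: r; exact: nbhs_right_le.
apply: le_lt_trans (integ_lt ic); rewrite [leLHS]integral_mkcond; apply: ge0_le_integral => //.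
- by move=> y _; rewrite patchE; case: ifP => // _; rewrite lee_fin sqr_ge0.
- apply/(measurable_restrictT _ _).1; first by apply: openMX; exact: open_ballX.
 by apply: mfunTS; apply/mEFinP; exact: mfunX.
- by apply/mEFinP; apply: mT_comp => //; exact: mfunX.
move=> y _; rewrite patchE ger0_norm ?sqr_ge0//; case: ifP => [/set_mem hy|_]; rewrite lee_fin ?sqr_ge0//.
by rewrite -[leLHS]real_normK ?num_real// -[leRHS]real_normK ?num_real// lerXn2r ?nnegrE//; exact: b (le_ball rr hy).
Unshelve. all: by end_near. Qed.

Lemma L2_L2loc G : L2 G -> L2loc mu G.
Proof. by move=> LG; apply: (L2loc_dom LG.1 LG) => x; exists 1; exists 1 => // y _; rewrite mul1r. Qed.

Lemma minimal_unique f G H : minimal_weak_upper_gradient mu f G ->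
 minimal_weak_upper_gradient mu f H -> [ae x | G x = H x].
Proof.
move=> [l1 w1 m1] [l2 w2 m2]; apply: (ae_imp2 (m1 _ l2 w2) (m2 _ l1 w1)) => x h1 h2.
by apply/eqP; rewrite eq_le h1.
Qed.

Lemma ng_spec f : W12 f -> minimal_weak_upper_gradient mu f (ng f) /\ L2 (ng f).
Proof.
move=> /W12P[Lf [G0 [[mG0 iG0] w0]]].
have [G [iG mG]] := minimal_exists sepX propX w0 iG0.
have mng : minimal_weak_upper_gradient mu f (ng f) by rewrite /norm_grad; apply: (xgetPex _ (ex_intro _ G mG)).
split => //; apply: (@L2_ae _ _ _ _ G); [by case: mng => -[]|exact: minimal_unique mG mng|].
by split; case: mG => -[].
Qed.

Lemma ng_wug f : W12 f -> wug f (ng f). Proof. by move=> /ng_spec[[]]. Qed.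

Lemma ng_L2 f : W12 f -> L2 (ng f). Proof. by move=> /ng_spec[]. Qed.

Lemma ng_m f : W12 f -> meas (ng f). Proof. by move=> /ng_L2[]. Qed.

Lemma ng_ge0 f x : 0 <= ng f x.
Proof.
rewrite /norm_grad; case: xgetP => [G _ [_ [_ _ h _] _]|_]; [exact: h|by []].
Qed.

Lemma ng_le f G : wug f G -> L2loc mu G -> [ae x | ng f x <= G x].
Proof.
move=> w lG; rewrite /norm_grad; case: xgetP => [H _ [_ _ m]|_]; first exact: m.
by apply: ae_all => x; case: w => _ _ h _; exact: h.
Qed.

(** Both functions have the same set of minimal gradients, so [norm_grad] makes the same choice for
    them: the equality holds everywhere. *)
Lemma ng_ae f g : meas f -> meas g ->
 [ae x | f x = g x] -> ng f = ng g.
Proof.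
have H u v G : meas v -> [ae x | u x = v x] -> wug u G -> wug v G.
 move=> mv e w; have [_ mG G0 _] := w.
 by apply: (wug_ae sepX w mv mG G0 e); apply: ae_all.
move=> mf mg fg; have gf : [ae x | g x = f x] by apply: (ae_imp fg).
rewrite /norm_grad; congr xget; apply/seteqP; split => G [lG w m]; split => //.
- exact: H mg fg w.
- by move=> G' l' w'; apply: (m G' l'); exact: H mf gf w'.
- exact: H mf gf w.
- by move=> G' l' w'; apply: (m G' l'); exact: H mg fg w'.
Qed.

Lemma W12_ae f g : W12 f -> meas g -> [ae x | f x = g x] -> W12 g.
Proof.
move=> Wf mg e; apply/W12P; split; first exact: L2_ae mg e (W12_L2 Wf).
exists (ng f); split; first exact: ng_L2.
have w := ng_wug Wf; have [_ mG G0 _] := w.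
by apply: (wug_ae sepX w mg mG G0 e); exact: ae_all.
Qed.

Lemma W12_lin a b f g : W12 f -> W12 g -> W12 (fun x => a * f x + b * g x) /\
 [ae x | ng (fun x => a * f x + b * g x) x <= `|a| * ng f x + `|b| * ng g x].
Proof.
move=> Wf Wg; have w := wug_lin sepX a b (ng_wug Wf) (ng_wug Wg).
have LG : L2 (fun x => `|a| * ng f x + `|b| * ng g x) by apply: L2D; apply: L2Z; exact: ng_L2.
split; last by apply: ng_le w _; exact: L2_L2loc.
apply/W12P; split; last by exists (fun x => `|a| * ng f x + `|b| * ng g x).
by apply: L2D; apply: L2Z; exact: W12_L2.
Qed.

Lemma W12D f g : W12 f -> W12 g -> W12 (fun x => f x + g x).
Proof. by move=> Wf Wg; have [+ _] := W12_lin 1 1 Wf Wg; under eq_fun do rewrite !mul1r. Qed.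

Lemma W12Z a f : W12 f -> W12 (fun x => a * f x).
Proof. by move=> Wf; have [+ _] := W12_lin a 0 Wf Wf; under eq_fun do rewrite mul0r addr0. Qed.

Lemma W12B f g : W12 f -> W12 g -> W12 (fun x => f x - g x).
Proof. by move=> Wf Wg; have [+ _] := W12_lin 1 (-1) Wf Wg; under eq_fun do rewrite mul1r mulN1r. Qed.

Lemma W12N f : W12 f -> W12 (fun x => - f x).
Proof. by move=> /(W12Z (-1)); under eq_fun do rewrite mulN1r. Qed.

Lemma ngZ a f : W12 f -> [ae x | ng (fun x => a * f x) x = `|a| * ng f x].
Proof.
have le1 c g : W12 g -> [ae x | ng (fun x => c * g x) x <= `|c| * ng g x].
 move=> Wg; have [_] := W12_lin c 0 Wg Wg.
 have -> : (fun x => c * g x + 0 * g x) = (fun x => c * g x) by apply/funext => x; rewrite mul0r addr0.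
 by move=> /ae_imp; apply => x; rewrite normr0 mul0r addr0.
move=> Wf; have [->|a0] := eqVneq a 0.
 by apply: (ae_imp (le1 0 f Wf)) => x; rewrite normr0 mul0r => h; apply/eqP; rewrite eq_le h ng_ge0.
have := le1 a^-1 _ (W12Z a Wf); have -> : (fun x => a^-1 * (a * f x)) = f.
 by apply/funext => x; rewrite mulKf.
move=> h; apply: (ae_imp2 h (le1 a f Wf)) => x h1 h2; apply/eqP; rewrite eq_le h2/=.
have a0' : 0 < `|a| by rewrite normr_gt0.
by move: h1; rewrite normrV ?unitfE// -ler_pdivrMl ?invr_gt0// invrK.
Qed.

Lemma L2_finite_length G : L2 G -> (forall x, 0 <= G x) -> fin_len mu G.
Proof.
move=> [mG iG] G0 pi tp; apply: (wlen_fin sepX tp mG G0).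
have := integ_lt iG; congr (_ < _)%E; apply: eq_integral => x _.
by rewrite ger0_norm ?sqr_ge0.
Qed.

Lemma W12_chain (D : set R) (phi c : R -> R) L f : strict_lip D phi c L -> (forall x, D (f x)) ->
 meas (phi \o f) -> meas (c \o f) -> L2 (phi \o f) -> W12 f ->
 W12 (phi \o f) /\ [ae x | ng (phi \o f) x <= c (f x) * ng f x].
Proof.
move=> sl Df mphi mc Lphi Wf; have w := ng_wug Wf; have [_ mG G0 _] := w.
have fl := L2_finite_length (ng_L2 Wf) G0.
have := wug_chain_min sepX sl Df mphi mc w w fl fl.
have -> : (fun x => c (f x) * Num.min (ng f x) (ng f x)) = (fun x => c (f x) * ng f x).
 by apply/funext => x; rewrite minxx.
move=> w2; have L2c : L2 (fun x => c (f x) * ng f x).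
 apply: (@L2M _ _ _ _ L); [exact: mc| |exact: ng_L2].
 by apply: ae_all => x; case: sl => cL _ _; have /andP[h1 h2] := cL _ (Df x); rewrite ger0_norm.
split; last by apply: ng_le w2 _; exact: L2_L2loc.
by apply/W12P; split => //; exists (fun x => c (f x) * ng f x).
Qed.

Fact Q_key : unit. Proof. by []. Qed.

(** Twice the Cheeger energy, with [E] as its polarisation. *)
Definition Q := locked_with Q_key (fun f => ip (ng f) (ng f)).

Definition E := locked_with Q_key (fun f g => (Q (fun x => f x + g x) - Q (fun x => f x - g x)) / 4).

Lemma QE f : Q f = ip (ng f) (ng f). Proof. by rewrite /Q unlock. Qed.

Lemma EE f g : E f g = (Q (fun x => f x + g x) - Q (fun x => f x - g x)) / 4.
Proof. by rewrite /E unlock. Qed.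

Opaque Defs.W12 norm_grad grad_inner weak_upper_gradient.
Lemma W12_normE f : W12 f -> W12_norm mu f ^+ 2 = ip f f + Q f.
Proof.
move=> Wf; rewrite /W12_norm sqr_sqrtr.
 by rewrite QE; congr (_ + _); apply: eq_Rintegral => x _; rewrite expr2.
by rewrite addr_ge0//; apply: Rintegral_ge0 => x _; exact: sqr_ge0.
Qed.

(** Subtracting the L2 product from the inner product of the Hilbert hypothesis leaves a symmetric
    bilinear form with diagonal [Q], which polarisation identifies with [E]. *)
Lemma E_exists : exists B : (X -> R) -> (X -> R) -> R,
 [/\ forall f g, W12 f -> W12 g -> B f g = B g f,
   forall a f g k, W12 f -> W12 g -> W12 k -> B (fun x => a * f x + g x) k = a * B f k + B g k,
   forall f, W12 f -> B f f = Q f & forall f g, W12 f -> W12 g -> E f g = B f g].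
Proof.
have [[B0 [sB lB qB]] _] := hilb.
pose B f g := B0 f g - ip f g.
have lB' a f g k : W12 f -> W12 g -> W12 k -> B (fun x => a * f x + g x) k = a * B f k + B g k.
 move=> Wf Wg Wk; rewrite /B lB// ipDl ?ipZl; try exact: W12_L2; first by ring.
 by apply: L2Z; exact: W12_L2.
have sB' f g : W12 f -> W12 g -> B f g = B g f by move=> Wf Wg; rewrite /B sB// ipC.
have qB' f : W12 f -> B f f = Q f by move=> Wf; rewrite /B qB// W12_normE// addrC addKr.
exists B; split => // f g Wf Wg.
have lr a u v k : W12 u -> W12 v -> W12 k -> B k (fun x => a * u x + v x) = a * B k u + B k v.
 by move=> Wu Wv Wk; rewrite sB' ?lB' ?(sB' k)//; exact: W12D (W12Z _ Wu) Wv.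
have e1 : (fun x => f x + g x) = (fun x => 1 * g x + f x) by apply/funext => x; ring.
have e2 : (fun x => f x - g x) = (fun x => (-1) * g x + f x) by apply/funext => x; ring.
have W1 : W12 (fun x => 1 * g x + f x) by rewrite -e1; exact: W12D.
have W2 : W12 (fun x => (-1) * g x + f x) by rewrite -e2; exact: W12B.
by rewrite EE e1 e2 -!qB'// !lB'// !lr// (sB')//; field.
Qed.

Lemma EC f g : W12 f -> W12 g -> E f g = E g f.
Proof. by move=> Wf Wg; have [B [h1 h2 h3 h4]] := E_exists; rewrite !h4// h1. Qed.

Lemma EDZl a f g k : W12 f -> W12 g -> W12 k -> E (fun x => a * f x + g x) k = a * E f k + E g k.
Proof.
move=> Wf Wg Wk; have [B [h1 h2 h3 h4]] := E_exists; rewrite !h4 ?h2//.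
exact: W12D (W12Z _ Wf) Wg.
Qed.

Lemma EDl f g k : W12 f -> W12 g -> W12 k -> E (fun x => f x + g x) k = E f k + E g k.
Proof.
move=> Wf Wg Wk; have := EDZl 1 Wf Wg Wk; rewrite mul1r => <-.
by congr E; apply/funext => x; rewrite mul1r.
Qed.

Lemma EZl a f k : W12 f -> W12 k -> E (fun x => a * f x) k = a * E f k.
Proof.
move=> Wf Wk; have W0 : W12 (fun x => 0 * f x) by exact: W12Z.
have E0 : E (fun x => 0 * f x) k = 0.
 have := EDl W0 W0 Wk.
 have -> : (fun x => 0 * f x + 0 * f x) = (fun x => 0 * f x) by apply/funext => x; ring.
 move: (E _ _) => y; lra.
have := EDZl a Wf W0 Wk; rewrite E0 addr0 => <-.
by congr E; apply/funext => x; ring.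
Qed.

Lemma EBl f g k : W12 f -> W12 g -> W12 k -> E (fun x => f x - g x) k = E f k - E g k.
Proof.
move=> Wf Wg Wk; have := EDZl (-1) Wg Wf Wk; rewrite mulN1r addrC => <-.
by congr E; apply/funext => x; ring.
Qed.

Lemma EDr f g k : W12 f -> W12 g -> W12 k -> E k (fun x => f x + g x) = E k f + E k g.
Proof. by move=> *; rewrite EC ?EDl ?(EC (f := k))//; exact: W12D. Qed.

Lemma EBr f g k : W12 f -> W12 g -> W12 k -> E k (fun x => f x - g x) = E k f - E k g.
Proof. by move=> *; rewrite EC ?EBl ?(EC (f := k))//; exact: W12B. Qed.

Lemma EZr a f k : W12 f -> W12 k -> E k (fun x => a * f x) = a * E k f.
Proof. by move=> *; rewrite EC ?EZl ?(EC (f := k))//; exact: W12Z. Qed.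

Lemma EQ f : W12 f -> E f f = Q f.
Proof. by move=> Wf; have [B [h1 h2 h3 h4]] := E_exists; rewrite h4// h3. Qed.

Lemma Q_ge0 f : 0 <= Q f. Proof. by rewrite QE ip_ge0. Qed.

Lemma Q_lin e f g : W12 f -> W12 g ->
 Q (fun x => g x + e * f x) = Q g + 2 * e * E f g + e ^+ 2 * Q f.
Proof.
move=> Wf Wg; have Wef := W12Z e Wf; have W1 := W12D Wg Wef.
rewrite -!EQ// EDl// !EDr// !EZl// !EZr// (EC Wg Wf); ring.
Qed.

Lemma E_CS f g : W12 f -> W12 g -> E f g ^+ 2 <= Q f * Q g.
Proof.
move=> Wf Wg; have H t : 0 <= Q g + 2 * t * E f g + t ^+ 2 * Q f by rewrite -Q_lin// Q_ge0.
have [f0|fn0] := eqVneq (Q f) 0.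
 rewrite f0 mul0r; have [->|en0] := eqVneq (E f g) 0; first by rewrite expr0n.
 have := H (- (Q g + 1) / (2 * E f g)); rewrite f0 mulr0 addr0.
 have -> : 2 * (- (Q g + 1) / (2 * E f g)) * E f g = - (Q g + 1) by field.
 by rewrite opprD addrA subrr add0r oppr_ge0 ler10.
have fp : 0 < Q f by rewrite lt_neqAle eq_sym fn0 Q_ge0.
have := H (- E f g / Q f).
have -> : Q g + 2 * (- E f g / Q f) * E f g + (- E f g / Q f) ^+ 2 * Q f =
 (Q f * Q g - E f g ^+ 2) / Q f by field.
by rewrite pmulr_lge0 ?invr_gt0// subr_ge0.
Qed.

End energy.

(** * The carre du champ: existence, bilinearity and chain rules *)

Section gamma.
Implicit Types (f g G : X -> R) (a b c e r s t : R).
Definition dq := locked_with Q_key (fun e f g x =>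
 (ng (fun z => g z + e * f z) x ^+ 2 - ng g x ^+ 2) / (2 * e)).

Lemma dqE e f g x : dq e f g x =
 (ng (fun z => g z + e * f z) x ^+ 2 - ng g x ^+ 2) / (2 * e).
Proof. by rewrite /dq unlock. Qed.

Lemma W12e e f g : W12 f -> W12 g -> W12 (fun z => g z + e * f z).
Proof. by move=> Wf Wg; apply: (W12D Wg); exact: (W12Z). Qed.
Let WL a b f g h : W12 f -> W12 g -> (forall x, h x = a * f x + b * g x) ->
 [ae x | ng h x <= `|a| * ng f x + `|b| * ng g x].
Proof.
move=> Wf Wg hE; have [_] := W12_lin a b Wf Wg.
by have -> : (fun x => a * f x + b * g x) = h by apply/funext => x; rewrite hE.
Qed.

(** Convexity: [g + e f] is the mean of [g] and [g + e' f] with weights [1 - e / e'] and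
    [e / e']. *)
Lemma dq_mono f g e e' : W12 f -> W12 g -> 0 < e -> e <= e' ->
 [ae x | dq e f g x <= dq e' f g x].
Proof.
move=> Wf Wg e0 ee'; have e'0 := lt_le_trans e0 ee'.
pose s := e / e'; have s0 : 0 < s by rewrite divr_gt0.
have s1 : s <= 1 by rewrite ler_pdivrMr// mul1r.
have := @WL (1 - s) s g _ (fun z => g z + e * f z) Wg (W12e e' Wf Wg).
move=> /(_ _) h; apply: (ae_imp (h _)) => [x|x {}h].
 by rewrite /s; field; rewrite gt_eqF.
by rewrite !dqE; apply: (ar_mono e0 ee' _ _ _ h); exact: ng_ge0.
Qed.

Lemma dqN f g e x : dq (- e) f g x = - dq e (fun z => - f z) g x.
Proof.
rewrite !dqE mulrN invrN mulrN; have -> : (fun z => g z + - e * f z) = (fun z => g z + e * - f z).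
 by apply/funext => z; ring.
by [].
Qed.

(** Convexity again, [g] being the midpoint of [g + e f] and [g - e f]. *)
Lemma dqN_le f g e : W12 f -> W12 g -> 0 < e ->
 [ae x | dq (- e) f g x <= dq e f g x].
Proof.
move=> Wf Wg e0.
have := @WL 2^-1 2^-1 _ _ g (W12e e Wf Wg) (W12e (- e) Wf Wg).
move=> /(_ _) h; apply: (ae_imp (h _)) => [x|x {}h]; first by field.
by rewrite !dqE; apply: (ar_neg e0 _ _ _ h); exact: ng_ge0.
Qed.

Lemma dq_bound f g e : W12 f -> W12 g -> e != 0 ->
 [ae x | `|dq e f g x| <= ng f x * ng g x + `|e| / 2 * ng f x ^+ 2].
Proof.
move=> Wf Wg e0; have We := W12e e Wf Wg.
have h1 := @WL 1 e g f (fun z => g z + e * f z) Wg Wf (fun x => ltac:(by rewrite mul1r)).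
have h2 := @WL 1 (- e) _ f g We Wf.
apply: (ae_imp2 h1 (h2 _)) => [x|x k1 k2]; first by ring.
by rewrite !dqE; apply: (ar_bound e0 _ _ _ k1 k2); exact: ng_ge0.
Qed.

Lemma ng2_int f : W12 f -> integ (fun x => ng f x ^+ 2) /\ \int[mu]_x (ng f x ^+ 2) = Q f.
Proof.
move=> Wf; have [m i] := ng_L2 Wf; split => //.
by rewrite QE; apply: eq_Rintegral => x _; rewrite expr2.
Qed.

Lemma dq_int f g e : W12 f -> W12 g -> e != 0 -> integ (dq e f g) /\
 \int[mu]_x dq e f g x = E f g + e / 2 * Q f.
Proof.
move=> Wf Wg e0; have We := W12e e Wf Wg.
have [i1 q1] := ng2_int We; have [i2 q2] := ng2_int Wg.
have i12 := integrB measurableT i1 i2.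
have -> : dq e f g = (fun x => (2 * e)^-1 * (ng (fun z => g z + e * f z) x ^+ 2 - ng g x ^+ 2)).
 by apply/funext => x; rewrite dqE mulrC.
split; first exact: integrZ.
rewrite RintegralZl// RintegralB// q1 q2 (Q_lin e Wf Wg); field.
exact: e0.
Qed.

Lemma dq_m f g e : W12 f -> W12 g -> meas (dq e f g).
Proof.
move=> Wf Wg; have We := W12e e Wf Wg.
have -> : dq e f g = (fun x => (ng (fun z => g z + e * f z) x ^+ 2 - ng g x ^+ 2) / (2 * e)).
 by apply/funext => x; rewrite dqE.
apply: mfunM => //.
by apply: mfunB; apply: mfunX; exact: (ng_m).
Qed.

Lemma gamma_exists f g : W12 f -> W12 g -> exists T : X -> R,
 [/\ meas T,
  (forall e, 0 < e -> [ae x | dq (- e) f g x <= T x <= dq e f g x]),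
  [ae x | dq (eps n) f g x @[n --> \oo] --> T x] &
  [ae x | dq (- eps n) f g x @[n --> \oo] --> T x]].
Proof.
move=> Wf Wg; have WNf := W12N Wf.
pose U n x := dq (eps n) f g x; pose V n x := dq (- eps n) f g x.
pose T x := fine (limn_esup (fun n => (U n x)%:E)).
pose S x := fine (limn_esup (fun n => (V n x)%:E)).
have mU n : meas (U n) by exact: dq_m.
have mV n : meas (V n) by exact: dq_m.
have mT : meas T.
 apply: mT_comp => //; apply: (@measurable_fun_limn_esup _ _ _ _ (fun k x => (U k x)%:E)) => k.
 exact/mEFinP.
have mS : meas S.
 apply: mT_comp => //; apply: (@measurable_fun_limn_esup _ _ _ _ (fun k x => (V k x)%:E)) => k.
 exact/mEFinP.
have good : [ae x | forall n, [/\ U n.+1 x <= U n x, V n x <= V n.+1 x & V n x <= U n x]].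
 apply/ae_foralln => n.
 have h1 := dq_mono Wf Wg (eps_gt0 n.+1) (eps_le (leqnSn n)).
 have h2 := dq_mono WNf Wg (eps_gt0 n.+1) (eps_le (leqnSn n)).
 have h3 := dqN_le Wf Wg (eps_gt0 n).
 apply: (ae_imp2 (ae_and h1 h2) h3) => x [k1 k2] k3; split => //.
 by rewrite /V !dqN lerN2.
have lims : [ae x | [/\ U n x @[n --> \oo] --> T x, V n x @[n --> \oo] --> S x,
  forall n, T x <= U n x & forall n, V n x <= S x]].
 apply: (ae_imp good) => x h.
 have Ud : {homo (U^~ x) : n m / (n <= m)%N >-> m <= n}.
  by apply: (@homo_leq _ (U^~ x) (fun a b => b <= a)) => // [a b c ab bc|n]; [exact: le_trans bc ab|case: (h n)].
 have Vi : {homo (V^~ x) : n m / (n <= m)%N >-> n <= m}.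
  by apply: (@homo_leq _ (V^~ x) (fun a b => a <= b)) => // [a b c ab bc|n]; [exact: le_trans ab bc|case: (h n)].
 have VU n m : V n x <= U m x.
  have h1 : V (maxn n m) x <= U (maxn n m) x by case: (h (maxn n m)).
  by apply: le_trans (Vi _ _ (leq_maxl n m)) (le_trans h1 (Ud _ _ (leq_maxr n m))).
 have fineE (u : nat -> R) l : u n @[n --> \oo] --> l -> fine (limn_esup (fun n => (u n)%:E)) = l.
  move=> c; have c' : (u n)%:E @[n --> \oo] --> l%:E by apply/fine_cvgP; split => //; exact: nearW.
  by rewrite (cvg_limn_einf_sup c').
 have cU : U n x @[n --> \oo] --> inf (range (U^~ x)).
  by apply: nonincreasing_cvgn => //; exists (V 0%N x) => _ [n _ <-].
 have cV : V n x @[n --> \oo] --> sup (range (V^~ x)).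
  by apply: nondecreasing_cvgn => //; exists (U 0%N x) => _ [n _ <-].
 rewrite /T /S (fineE (U^~ x) _ cU) (fineE (V^~ x) _ cV); split => // n.
  by apply: ge_inf; [exists (V 0%N x) => _ [m _ <-]|exists n].
 by apply: ub_le_sup; [exists (U 0%N x) => _ [m _ <-]|exists n].
have ST : [ae x | S x <= T x].
 apply: (ae_imp2 lims good) => x [c1 c2 _ _] h.
 by apply: (ler_cvg_to c2 c1); apply: nearW => n; case: (h n).
have iU n := dq_int Wf Wg (eps_neq0 n); have iV n := dq_int Wf Wg (epsN_neq0 n).
have iD n := integrB measurableT (iU n).1 (iV n).1.
have TSD n : [ae x | T x - S x <= U n x - V n x].
 by apply: (ae_imp lims) => x [_ _ h1 h2]; apply: lerB.
have iTS : integ (fun x => T x - S x).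
 apply: (integ_dom_ae _ (iD 0%N)); first exact: mfunB.
 by apply: (ae_imp2 (TSD 0%N) ST) => x h1 h2; rewrite ger0_norm ?subr_ge0.
have z : \int[mu]_x (T x - S x) = 0.
 apply/eqP; rewrite eq_le; apply/andP; split; last first.
  have i0 : integ (fun=> 0) by have := integrable0 mu setT.
  have -> : 0 = \int[mu]_x 0 by rewrite Rintegral_cst// mul0r.
  by apply: (leR_ae i0 iTS); apply: (ae_imp ST) => x; rewrite subr_ge0.
 have : eps n * Q f @[n --> \oo] --> 0 * Q f by apply: cvgM; [exact: eps_cvg|exact: cvg_cst].
 rewrite mul0r => c; apply: (cvgr_to_ge c); apply: nearW => n.
 apply: le_trans (leR_ae iTS (iD n) (TSD n)) _.
 rewrite RintegralB//; [|exact: (iU n).1|exact: (iV n).1].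
 by rewrite (iU n).2 (iV n).2; move: (eps n) (E f g) (Q f) => ? ? ?; lra.
have eqTS : [ae x | T x - S x = 0].
 by apply: (Rint_eq0 iTS) => //; apply: (ae_imp ST) => x; rewrite subr_ge0.
exists T; split => //.
- move=> e e0; have [n en] := eps_small e0.
 have h1 := dq_mono Wf Wg (eps_gt0 n) en; have h2 := dq_mono WNf Wg (eps_gt0 n) en.
 apply: (ae_imp2 (ae_and h1 h2) (ae_and lims eqTS)) => x [k1 k2] [[_ _ k3 k4]] /eqP.
 rewrite subr_eq0 => /eqP TS; apply/andP; split; last exact: le_trans (k3 n) k1.
 rewrite TS; apply: le_trans (k4 n); by rewrite /V !dqN lerN2.
- by apply: (ae_imp lims) => x [].
- by apply: (ae_imp2 lims eqTS) => x [_ h _ _] /eqP; rewrite subr_eq0 => /eqP ->.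
Qed.

Transparent grad_inner.
Lemma grad_innerE f g :
 Gam f g = xget (fun=> 0) [set h | is_ess_inf_pos mu (fun e x => dq e f g x) h].
Proof.
have e : (fun eps x => (ng (fun z => g z + eps * f z) x ^+ 2 - ng g x ^+ 2) / (2 * eps)) =
  (fun e x => dq e f g x).
 by apply/funext => eps; apply/funext => x; rewrite dqE.
by rewrite /grad_inner e.
Qed.

Opaque grad_inner.
Lemma grad_inner_ess_inf f g T : is_ess_inf_pos mu (fun e x => dq e f g x) T ->
 is_ess_inf_pos mu (fun e x => dq e f g x) (Gam f g).
Proof. by rewrite grad_innerE => h; exact: (xgetPex _ (ex_intro _ T h)). Qed.

Lemma gam_spec f g : W12 f -> W12 g ->
 [/\ meas (Gam f g),
  (forall e, 0 < e -> [ae x | dq (- e) f g x <= Gam f g x <= dq e f g x]),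
  [ae x | dq (eps n) f g x @[n --> \oo] --> Gam f g x] &
  [ae x | dq (- eps n) f g x @[n --> \oo] --> Gam f g x]].
Proof.
move=> Wf Wg; have [T [mT bT c1 c2]] := gamma_exists Wf Wg.
have infT : is_ess_inf_pos mu (fun e x => dq e f g x) T.
 split => //; first by move=> e e0; apply: (ae_imp (bT e e0)) => x /andP[].
 move=> k mk hk; apply: (ae_imp2 c1 (ae_foralln (fun n => hk _ (eps_gt0 n)))) => x c h.
 by apply: (cvgr_to_ge c); apply: nearW.
have [mG uG gG] := grad_inner_ess_inf infT; have [_ uT gT] := infT.
have GT : [ae x | T x = Gam f g x].
 by apply: (ae_imp2 (gG T mT uT) (gT _ mG uG)) => x h1 h2; apply/eqP; rewrite eq_le h1.
split => //.
- by move=> e e0; apply: (ae_imp2 GT (bT e e0)) => x ->.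
- by apply: (ae_imp2 GT c1) => x ->.
- by apply: (ae_imp2 GT c2) => x ->.
Qed.

Lemma gam_unique f g (S : X -> R) : W12 f -> W12 g ->
 (forall n, [ae x | dq (- eps n) f g x <= S x <= dq (eps n) f g x]) ->
 [ae x | Gam f g x = S x].
Proof.
move=> Wf Wg h; have [_ _ c1 c2] := gam_spec Wf Wg.
apply: (ae_imp2 (ae_and c1 c2) (ae_foralln h)) => x [k1 k2] k; apply/eqP; rewrite eq_le; apply/andP; split.
 by apply: (cvgr_to_le k2); apply: nearW => n; have /andP[] := k n.
by apply: (cvgr_to_ge k1); apply: nearW => n; have /andP[] := k n.
Qed.

Lemma gam_m f g : W12 f -> W12 g -> meas (Gam f g).
Proof. by move=> Wf Wg; case: (gam_spec Wf Wg). Qed.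

Lemma gam_le f g : W12 f -> W12 g -> [ae x | `|Gam f g x| <= ng f x * ng g x].
Proof.
move=> Wf Wg; have [_ _ c1 _] := gam_spec Wf Wg.
apply: (ae_imp2 c1 (ae_foralln (fun n => dq_bound Wf Wg (eps_neq0 n)))) => x c h.
have c' : (ng f x * ng g x + eps n / 2 * ng f x ^+ 2) @[n --> \oo] --> ng f x * ng g x + 0 / 2 * ng f x ^+ 2.
 apply: cvgD; first exact: cvg_cst.
 apply: cvgM; last exact: cvg_cst.
 by apply: cvgM; [exact: eps_cvg|exact: cvg_cst].
rewrite mul0r mul0r addr0 in c'.
apply: (ler_cvg_to (cvg_norm c) c'); apply: nearW => n.
by have := h n; rewrite (ger0_norm (ltW (eps_gt0 n))).
Qed.

Lemma gam_int f g : W12 f -> W12 g -> integ (Gam f g) /\ \int[mu]_x Gam f g x = E f g.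
Proof.
move=> Wf Wg.
have i : integ (Gam f g).
 apply: (integ_dom_ae (gam_m Wf Wg) _ (gam_le Wf Wg)).
 by apply: integM; exact: (ng_L2).
split => //; have [_ b _ _] := gam_spec Wf Wg.
have c s : (E f g + s * eps n / 2 * Q f) @[n --> \oo] --> E f g + s * 0 / 2 * Q f.
 apply: cvgD; first exact: cvg_cst.
 apply: cvgM; last exact: cvg_cst.
 by apply: cvgM; [apply: cvgM; [exact: cvg_cst|exact: eps_cvg]|exact: cvg_cst].
apply/eqP; rewrite eq_le; apply/andP; split.
 have := c 1; rewrite mulr0 mul0r mul0r addr0 => c1; apply: (cvgr_to_ge c1); apply: nearW => n.
 have [iU eU] := dq_int Wf Wg (eps_neq0 n); rewrite mul1r -eU.
 by apply: (leR_ae i iU); apply: (ae_imp (b _ (eps_gt0 n))) => x /andP[].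
have := c (-1); rewrite mulr0 mul0r mul0r addr0 => c1; apply: (cvgr_to_le c1); apply: nearW => n.
have [iU eU] := dq_int Wf Wg (epsN_neq0 n); rewrite mulN1r -eU.
by apply: (leR_ae iU i); apply: (ae_imp (b _ (eps_gt0 n))) => x /andP[].
Qed.

(** Convexity makes [Gam] subadditive in its first argument; it is odd there because left and right
    derivatives agree, and together these give equality. *)
Lemma gamD f1 f2 g : W12 f1 -> W12 f2 -> W12 g ->
 [ae x | Gam (fun z => f1 z + f2 z) g x = Gam f1 g x + Gam f2 g x].
Proof.
move=> W1 W2 Wg; have W := W12D W1 W2.
have dqD u1 u2 n : W12 u1 -> W12 u2 ->
  [ae x | dq (eps (n + n).+1) (fun z => u1 z + u2 z) g x <= dq (eps n) u1 g x + dq (eps n) u2 g x].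
 (* The index [(n + n).+1] halves the step, so that the midpoint of the two perturbations
    appears. *)
 move=> Wu1 Wu2; have e2 : eps (n + n).+1 = eps n / 2 :> R.
  by rewrite /eps -invfM; congr (_^-1); rewrite -!natr1; ring.
 have := @WL 2^-1 2^-1 _ _ (fun z => g z + eps (n + n).+1 * (u1 z + u2 z))
  (W12e (eps n) Wu1 Wg) (W12e (eps n) Wu2 Wg).
 move=> /(_ _) h; apply: (ae_imp (h _)) => [x|x {}h]; first by rewrite e2; field.
 by rewrite !dqE; apply: (ar_add (ng g x) (eps_gt0 n) e2 _ h); exact: ng_ge0.
have le1 u1 u2 : W12 u1 -> W12 u2 ->
  [ae x | Gam (fun z => u1 z + u2 z) g x <= Gam u1 g x + Gam u2 g x].
 move=> Wu1 Wu2; have Wu := W12D Wu1 Wu2.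
 have [_ b _ _] := gam_spec Wu Wg; have [_ _ c1 _] := gam_spec Wu1 Wg; have [_ _ c2 _] := gam_spec Wu2 Wg.
 apply: (ae_imp2 (ae_and c1 c2) (ae_foralln (fun n => ae_and (b _ (eps_gt0 (n + n).+1)) (dqD u1 u2 n Wu1 Wu2)))).
 move=> x [k1 k2] h; apply: (cvgr_to_ge (cvgD k1 k2)); apply: nearW => n.
 by have [/andP[_ h1] h2] := h n; exact: le_trans h1 h2.
have gN u : W12 u -> [ae x | Gam (fun z => - u z) g x = - Gam u g x].
 move=> Wu; have [_ _ c1 c2] := gam_spec Wu Wg; have [_ _ _ c3] := gam_spec (W12N Wu) Wg.
 apply: (ae_imp2 c1 c3) => x k1 k3; apply: (cvg_unique _ k3); first exact: Rhausdorff.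
 have -> : (fun n => dq (- eps n) (fun z => - u z) g x) = (fun n => - dq (eps n) u g x).
  apply/funext => n; rewrite dqN; have -> // : (fun z => - - u z) = u.
  by apply/funext => z; rewrite opprK.
 exact: cvgN k1.
have l1 := le1 _ _ W1 W2.
have l2 := le1 _ _ (W12N W1) (W12N W2).
have eN : (fun z => - f1 z + - f2 z) = (fun z => - (f1 z + f2 z)) by apply/funext => z; ring.
rewrite eN in l2.
apply: (ae_imp2 (ae_and l1 l2) (ae_and (gN _ W) (ae_and (gN _ W1) (gN _ W2)))) => x [k1 k2] [e0 [e1 e2]].
move: k2; rewrite e0 e1 e2 -opprD lerN2 => k2.
by apply/eqP; rewrite eq_le k1.
Qed.

Lemma gam_self f : W12 f -> [ae x | Gam f f x = ng f x ^+ 2].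
Proof.
move=> Wf; apply: (gam_unique Wf Wf) => n.
have key e : e != 0 -> [ae x | dq e f f x = (1 + e / 2) * ng f x ^+ 2].
 move=> e0; apply: (ae_imp (ngZ (1 + e) Wf)) => x h; rewrite dqE.
 have -> : (fun z => f z + e * f z) = (fun z => (1 + e) * f z) by apply/funext => z; ring.
 rewrite h exprMn real_normK ?num_real//; field.
 exact: e0.
apply: (ae_imp2 (key _ (eps_neq0 n)) (key _ (epsN_neq0 n))) => x -> ->.
have := @eps_gt0 R n; have := sqr_ge0 (ng f x); move: (ng f x ^+ 2) (eps n) => q e q0 e0.
by rewrite mulNr; apply/andP; split; nra.
Qed.

Lemma gamZ c f g : W12 f -> W12 g -> [ae x | Gam (fun z => c * f z) g x = c * Gam f g x].
Proof.
move=> Wf Wg; have Wcf := W12Z c Wf.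
have [c0|cn0] := eqVneq c 0.
 apply: (ae_imp2 (gam_le Wcf Wg) (ngZ c Wf)) => x + e; rewrite e c0 normr0 !mul0r.
 by rewrite normr_le0 => /eqP.
suff H : [ae x | Gam f g x = c^-1 * Gam (fun z => c * f z) g x].
 by apply: (ae_imp H) => x ->; rewrite mulrA divff// mul1r.
apply: (gam_unique Wf Wg) => n.
have [_ b _ _] := gam_spec Wcf Wg.
have dqZ e x : dq e f g x = c^-1 * dq (e / c) (fun z => c * f z) g x.
 rewrite !dqE; have -> : (fun z => g z + e / c * (c * f z)) = (fun z => g z + e * f z).
  by apply/funext => z; field.
 have [->|e0] := eqVneq e 0; first by rewrite mul0r !mulr0 invr0 !mulr0.
 by field; rewrite cn0.
have ec : 0 < eps n / `|c| by rewrite divr_gt0 ?eps_gt0// normr_gt0.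
apply: (ae_imp (b _ ec)) => x; rewrite !dqZ mulNr.
have [cp|cm|c0] := ltgtP 0 c; last by rewrite -c0 eqxx in cn0.
 by rewrite gtr0_norm// !ler_pM2l ?invr_gt0.
by rewrite ltr0_norm// invrN mulrN opprK => /andP[h1 h2]; rewrite !ler_nM2l ?invr_lt0// h2.
Qed.

Lemma gamB f1 f2 g : W12 f1 -> W12 f2 -> W12 g ->
 [ae x | Gam (fun z => f1 z - f2 z) g x = Gam f1 g x - Gam f2 g x].
Proof.
move=> W1 W2 Wg; have W2' := W12Z (-1) W2.
apply: (ae_imp2 (gamD W1 W2' Wg) (gamZ (-1) W2 Wg)) => x h1 h2.
have -> : (fun z => f1 z - f2 z) = (fun z => f1 z + -1 * f2 z) by apply/funext => z; ring.
by rewrite h1 h2 mulN1r.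
Qed.

Lemma sdiff_lip D phi phi' L c : sdiff D phi phi' L ->
 strict_lip D (fun x => phi x - c * x) (fun x => `|phi' x - c|) (L + `|c|).
Proof.
move=> [bL Lip loc]; split.
- move=> x Dx; rewrite normr_ge0/=; apply: le_trans (ler_normB _ _) _; rewrite lerD2r; exact: bL.
- move=> x y Dx Dy; have -> : phi x - c * x - (phi y - c * y) = (phi x - phi y) - c * (x - y) by ring.
 apply: le_trans (ler_normB _ _) _; rewrite normrM mulrDl lerD2r; exact: Lip.
move=> x Dx e e0; have [rho rho0 H] := loc x Dx e e0; exists rho => // y z Dy Dz h1 h2.
have -> : phi y - c * y - (phi z - c * z) = (phi y - phi z - phi' x * (y - z)) + (phi' x - c) * (y - z) by ring.
by apply: le_trans (ler_normD _ _) _; rewrite normrM addrC mulrDl lerD2l; exact: H.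
Qed.

Section chain.
Variables (D : set R) (phi phi' : R -> R) (L : R) (f : X -> R).
Hypotheses (sd : sdiff D phi phi' L) (Df : forall x, D (f x)) (Wf : W12 f).
Hypotheses (mphi : meas (phi \o f)) (mphi' : meas (phi' \o f)).
Hypothesis (Lphi : L2 (phi \o f)).
Lemma chain_W12 : W12 (phi \o f) /\ [ae x | ng (phi \o f) x <= `|phi' (f x)| * ng f x].
Proof.
have sl := sdiff_lip 0 sd.
have e1 : (fun x => phi x - 0 * x) = phi by apply/funext => x; rewrite mul0r subr0.
have e2 : (fun x => `|phi' x - 0|) = (fun x => `|phi' x|) by apply/funext => x; rewrite subr0.
rewrite e1 e2 in sl; apply: (W12_chain sl Df mphi _ Lphi Wf).
exact: (mT_comp (f := fun y : R => `|y|)).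
Qed.

Lemma chain_c c : [ae x | ng (fun x => phi (f x) - c * f x) x <= `|phi' (f x) - c| * ng f x].
Proof.
have := W12_chain (sdiff_lip c sd) Df _ _ _ Wf.
move=> h; apply: (h _ _ _).2.
- apply: mfunB; first exact: mphi.
 by apply: mfunM => //; exact: W12_m Wf.
- apply: (mT_comp (f := fun y : R => `|y|)) => //.
 by apply: mfunB.
- by apply: L2B => //; apply: L2Z; exact: W12_L2.
Qed.

(** Cauchy-Schwarz for [phi (f x) - c * f x] gives an error proportional to [|phi' (f x) - c|] for
    each rational [c]; then [c] tends to [phi' (f x)] pointwise. *)
Lemma gam_chain1 g : W12 g -> [ae x | Gam (phi \o f) g x = phi' (f x) * Gam f g x].
Proof.
move=> Wg; have [Wphi _] := chain_W12.
have key c : [ae x | `|Gam (phi \o f) g x - c * Gam f g x| <= `|phi' (f x) - c| * ng f x * ng g x].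
 have Wcf := W12Z c Wf; have Wd := W12B Wphi Wcf.
 apply: (ae_imp2 (ae_and (gamB Wphi Wcf Wg) (gamZ c Wf Wg)) (ae_and (gam_le Wd Wg) (chain_c c))).
 move=> x [h1 h2] [h3 h4]; rewrite -h2 -h1; apply: le_trans h3 _.
 by rewrite ler_wpM2r ?ng_ge0.
apply: (ae_imp (ae_foralln (fun k => key (rat_seq k)))) => x h.
by apply: (@ar_chain1 _ _ _ _ (ng f x * ng g x)) => [|k]; [rewrite mulr_ge0 ?ng_ge0|rewrite mulrA].
Qed.

Lemma ng_chain : [ae x | ng (phi \o f) x = `|phi' (f x)| * ng f x].
Proof.
have [Wphi le1] := chain_W12.
apply: (ae_imp2 (ae_and le1 (gam_chain1 Wf)) (ae_and (gam_self Wf) (gam_le Wphi Wf))) => x [h1 h2] [h3 h4].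
apply/eqP; rewrite eq_le h1/=; move: h4; rewrite h2 h3 normrM (ger0_norm (sqr_ge0 _)) mulrA.
have [->|n0] := eqVneq (ng f x) 0; first by move=> _; rewrite mulr0 ng_ge0.
by rewrite ler_pM2r// lt_neqAle eq_sym n0 ng_ge0.
Qed.

(** The definition of [Gam] is not linear in its second argument and symmetry comes only later. So
    Cauchy-Schwarz is applied to [f + e g] against [phi \o f]: compared for both signs of [e], it
    bounds the derivative from either side. *)
Lemma gam_chain2 g : W12 g -> [ae x | Gam g (phi \o f) x = phi' (f x) * Gam g f x].
Proof.
move=> Wg; have [Wphi le1] := chain_W12.
have gpp : [ae x | Gam f (phi \o f) x = phi' (f x) * ng f x ^+ 2 \/ phi' (f x) = 0].
 apply: (ae_imp2 (ae_and (gam_chain1 Wphi) (gam_self Wphi)) ng_chain) => x [h1 h2] h3.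
 have [->|c0] := eqVneq (phi' (f x)) 0; [by right|left].
 apply: (mulfI c0); rewrite -h1 h2 h3 exprMn real_normK ?num_real; ring.
have key e : e != 0 -> [ae x | e * (phi' (f x) * Gam g (phi \o f) x) <= phi' (f x) ^+ 2 * (e * dq e g f x)].
 move=> e0; have Wfe := W12e e Wg Wf; have Weg := W12Z e Wg.
 apply: (ae_imp2 (ae_and gpp (ae_and (gamD Wf Weg Wphi) (gamZ e Wg Wphi))) (ae_and ng_chain (gam_le Wfe Wphi))).
 move=> x [[h1|->] [h2 h3]] [h4 h5]; last by rewrite !mul0r mulr0 expr0n/= mul0r.
 move: h5; rewrite h2 h3 h1 h4 dqE => h5; apply: (ar_chain2 e0 _ _ h5); exact: ng_ge0.
have [_ _ c1 c2] := gam_spec Wg Wf.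
apply: (ae_imp2 (ae_and gpp (ae_and c1 c2)) (ae_and (ae_and (gam_le Wg Wphi) ng_chain)
 (ae_and (ae_foralln (fun n => key _ (eps_neq0 n))) (ae_foralln (fun n => key _ (epsN_neq0 n)))))).
move=> x [_ [k1 k2]] [[k3 k5] [h1 h2]].
have [c0|cn0] := eqVneq (phi' (f x)) 0.
 by move: k3; rewrite k5 c0 normr0 !mul0r mulr0 normr_le0 => /eqP.
apply: (mulfI cn0); rewrite mulrA -expr2.
apply/eqP; rewrite eq_le; apply/andP; split.
 have c : phi' (f x) ^+ 2 * dq (eps n) g f x @[n --> \oo] --> phi' (f x) ^+ 2 * Gam g f x.
  by apply: cvgM => //; exact: cvg_cst.
 apply: (cvgr_to_ge c); apply: nearW => n; have := h1 n.
 by rewrite [leRHS]mulrCA ler_pM2l ?eps_gt0.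
have c : phi' (f x) ^+ 2 * dq (- eps n) g f x @[n --> \oo] --> phi' (f x) ^+ 2 * Gam g f x.
 by apply: cvgM => //; exact: cvg_cst.
apply: (cvgr_to_le c); apply: nearW => n; have := h2 n.
by rewrite [leRHS]mulrCA ler_nM2l// oppr_lt0 eps_gt0.
Qed.

End chain.
Definition bdd f := exists M, forall x, `|f x| <= M.

Lemma sdiff_sqr M : 0 <= M -> sdiff [set x : R | `|x| <= M] (fun x => x ^+ 2) (fun x => 2 * x) (2 * M).
Proof.
move=> M0; split => /=.
- by move=> x xM; rewrite normrM ger0_norm// ler_pM2l.
- move=> x y xM yM; rewrite subr_sqr normrM mulrC ler_wpM2r//.
 by apply: le_trans (ler_normD _ _) _; lra.
move=> x xM e e0; exists (e / 2); first by rewrite divr_gt0.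
move=> y z yM zM h1 h2; have -> : y ^+ 2 - z ^+ 2 - 2 * x * (y - z) = ((y - x) + (z - x)) * (y - z) by ring.
rewrite normrM ler_wpM2r//; apply: le_trans (ler_normD _ _) _; lra.
Qed.

Lemma bddM_ge0 f M : (forall x, `|f x| <= M) -> 0 <= M.
Proof. by move=> h; exact: le_trans (normr_ge0 _) (h point). Qed.

Lemma L2_sqr f : W12 f -> bdd f -> L2 (fun x => f x ^+ 2).
Proof.
move=> /W12_L2 Lf [M fM]; rewrite (_ : (fun x => _) = (fun x => f x * f x)).
 by apply: (@L2M _ _ _ _ M) => //; [exact: L2_m Lf|exact: ae_all].
by []; rewrite expr2.
Qed.

Lemma sqr_gam f : W12 f -> bdd f -> W12 (fun x => f x ^+ 2) /\
 (forall g, W12 g -> [ae x | Gam (fun x => f x ^+ 2) g x = 2 * f x * Gam f g x] /\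
  [ae x | Gam g (fun x => f x ^+ 2) x = 2 * f x * Gam g f x]).
Proof.
move=> Wf bf; have [M fM] := bf; have M0 := bddM_ge0 fM.
have mf := W12_m Wf; have sd := sdiff_sqr M0.
have m1 : meas ((fun x : R => x ^+ 2) \o f) by exact: mfunX.
have m2 : meas ((fun x : R => 2 * x) \o f) by exact: mfunM.
have Lf2 : L2 ((fun x : R => x ^+ 2) \o f) by exact: L2_sqr.
split; first exact: (chain_W12 sd fM Wf m1 m2 Lf2).1.
by move=> g Wg; split; [exact: (gam_chain1 sd fM Wf m1 m2 Lf2 Wg)|exact: (gam_chain2 sd fM Wf m1 m2 Lf2 Wg)].
Qed.

Lemma bddD f g : bdd f -> bdd g -> bdd (fun x => f x + g x).
Proof.
by move=> [M h1] [N h2]; exists (M + N) => x; apply: le_trans (ler_normD _ _) (lerD (h1 x) (h2 x)).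
Qed.

Lemma bddM f g : bdd f -> bdd g -> bdd (fun x => f x * g x).
Proof. by move=> [M h1] [N h2]; exists (M * N) => x; rewrite normrM ler_pM. Qed.

Lemma bddZ c f : bdd f -> bdd (fun x => c * f x).
Proof. by move=> [M h1]; exists (`|c| * M) => x; rewrite normrM ler_wpM2l. Qed.

(** Polarisation of the chain rule for the square, which is Lipschitz on bounded ranges. *)
Lemma W12M f h : W12 f -> W12 h -> bdd f -> bdd h -> W12 (fun x => f x * h x) /\
 (forall g, W12 g -> [ae x | Gam (fun x => f x * h x) g x = f x * Gam h g x + h x * Gam f g x]).
Proof.
move=> Wf Wh bf bh; have Wfh := W12D Wf Wh.
have [W1 g1] := sqr_gam Wfh (bddD bf bh); have [W2 g2] := sqr_gam Wf bf; have [W3 g3] := sqr_gam Wh bh.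
have W4 := W12B W1 W2; have W5 := W12B W4 W3.
have e : (fun x => 2^-1 * ((f x + h x) ^+ 2 - f x ^+ 2 - h x ^+ 2)) = (fun x => f x * h x).
 by apply/funext => x; field.
split; first by rewrite -e; exact: (W12Z).
move=> g Wg; rewrite -e.
apply: (ae_imp2 (ae_and (gamZ 2^-1 W5 Wg) (ae_and (gamB W4 W3 Wg) (gamB W1 W2 Wg)))
 (ae_and (g1 g Wg).1 (ae_and (g2 g Wg).1 (ae_and (g3 g Wg).1 (gamD Wf Wh Wg))))).
by move=> x [-> [-> ->]] [-> [-> [-> ->]]]; exact: ar_leib.
Qed.

End gamma.
Opaque Defs.W12 norm_grad grad_inner weak_upper_gradient.

(** * Compactly supported Lipschitz functions and density *)

Section density.
Implicit Types (f g G : X -> R) (a b c e r s t : R).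
Definition lipc f := metric_lipschitz f /\ compactly_supported f.

Lemma compact_bounded_metric (K : set X) (x0 : X) : compact K -> exists n : nat, forall x, K x -> mdist x x0 <= n%:R.
Proof.
rewrite compact_cover => /(_ nat setT (fun n => [set y | mdist y x0 < n%:R])) [].
- by move=> n _; exact: open_mball.
- by move=> x _; exists (Num.trunc (mdist x x0)).+1 => //=; exact: truncnS_gt.
move=> F _ KF; exists (\max_(i <- finmap.enum_fset F) i) => x /KF[n /= nF nx].
apply: ltW; apply: lt_le_trans nx _; rewrite ler_nat.
by apply: leq_bigmax_seq.
Qed.

Lemma finite_compact (K : set X) : compact K -> (mu (closure K) < +oo)%E.
Proof.
move=> cK; have L1 : L2loc mu (fun=> 1).
 split => // x; have [U [oU Ux] fU] := lfmu x.
 have := open_nbhs_nbhs (conj oU Ux).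
 move=> /nbhs_ballP[e /= e0 He]; near=> r.
 have rB : ball x r `<=` U.
  by apply: subset_trans He; apply: le_ball; near: r; exact: nbhs_right_le.
 under eq_integral do rewrite expr1n.
 rewrite integral_cst ?mul1e; last by apply: openMX; exact: open_ballX.
 apply: le_lt_trans fU; apply: le_measure => //; rewrite inE; apply: openMX => //.
 exact: open_ballX.
have hX : hausdorff_space X by exact: metric_hausdorff.
rewrite -(closure_id _).1; last exact: compact_closed.
have [U [oU KU]] := L2loc_compact L1 cK.
under eq_integral do rewrite expr1n.
rewrite integral_cst ?mul1e; last exact: openMX.
apply: le_lt_trans; apply: le_measure; rewrite ?inE//; last exact: openMX.
rewrite -[K]setCK; apply: measurableC; apply: openMX; apply: closed_openC.
exact: compact_closed.
Unshelve. all: by end_near. Qed.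

Lemma lipc_props f : lipc f -> exists L, [/\ meas f, bdd f, 0 < L, W12 f &
 [ae x | ng f x <= L]].
Proof.
move=> [[L0 Lip0] cK]; pose L := `|L0| + 1.
have Lp : 0 < L by rewrite ltr_wpDl.
have Lip x y : `|f x - f y| <= L * mdist x y.
 by apply: le_trans (Lip0 x y) _; rewrite ler_wpM2r ?mdist_ge0// /L ler_wpDr// ler_norm.
have mf : meas f by apply: contMX; exact: lip_contX Lip.
pose K := closure [set x | f x != 0].
have f0 x : ~ K x -> f x = 0.
 by move=> nK; apply/eqP/negPn/negP => fx; apply: nK; exact: subset_closure.
have clK : closed K by exact: closed_closure.
have mK : measurable K by rewrite -[K]setCK; apply: measurableC; apply: openMX; exact: closed_openC.
have fK : (mu K < +oo)%E by have := finite_compact cK; rewrite -(closure_id _).1.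
have bf : bdd f.
 have [n Hn] := compact_bounded_metric point cK.
 exists (`|f point| + L * n%:R) => x; have [Kx|/f0 ->] := pselect (K x).
  have -> : f x = f point + (f x - f point) by ring.
  apply: le_trans (ler_normD _ _) _; rewrite lerD2l; apply: le_trans (Lip _ _) _.
  by rewrite ler_wpM2l ?(ltW Lp)// Hn.
 by rewrite normr0 addr_ge0// mulr_ge0// ltW.
have w := wug_lipschitz sepX mu Lp clK Lip f0.
have iK : integ (\1_K : X -> R).
 apply: integ_fin => //.
 by rewrite integral_indic// setIT.
have LK : L2 (fun x => L * \1_K x).
 apply: L2Z; split => //; rewrite (_ : (fun x => _) = \1_K)//.
 by apply/funext => x; rewrite indicE; case: (x \in K); rewrite ?expr1n ?expr0n.
have Lf : L2 f.
 have [M fM] := bf; have M0 := bddM_ge0 fM; apply: (L2_dom mf (L2Z M (L2Z L^-1 LK))).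
 apply: ae_all => x; rewrite mulKf ?gt_eqF//; have [Kx|nK] := pselect (K x).
  by rewrite indicE mem_set// mulr1 (ger0_norm M0).
 by rewrite f0// normr0.
exists L; split => //; first by apply/W12P; split => //; exists (fun x => L * \1_K x).
apply: (ae_imp (ng_le w (L2_L2loc LK))) => x h; apply: le_trans h _.
by rewrite indicE; case: (x \in K); rewrite ?mulr1// mulr0 ltW.
Qed.

Section envelope.
Variable (U : set X).
Hypothesis oU : open U.
(* Lipschitz functions increasing to the indicator of U *)
Definition env n x : R := inf [set \1_U y + n%:R * mdist x y | y in setT].

Let env_lb n x : has_lbound [set \1_U y + n%:R * mdist x y | y in setT].
Proof. by exists 0 => _ [y _ <-]; rewrite addr_ge0 ?indicE// mulr_ge0 ?mdist_ge0. Qed.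

Lemma env_ge0 n x : 0 <= env n x.
Proof.
apply: lb_le_inf; first by exists (\1_U x + n%:R * mdist x x); exists x.
by move=> _ [y _ <-]; rewrite addr_ge0 ?indicE// mulr_ge0 ?mdist_ge0.
Qed.

Lemma env_le n x : env n x <= \1_U x.
Proof. by apply: (ge_inf (env_lb n x)); exists x => //; rewrite mdistxx mulr0 addr0. Qed.

Lemma env_lip n x y : `|env n x - env n y| <= n%:R * mdist x y.
Proof.
have H u v : env n u <= env n v + n%:R * mdist u v.
 rewrite -lerBlDr; apply: lb_le_inf; first by exists (\1_U v + n%:R * mdist v v); exists v.
 move=> _ [z _ <-]; rewrite lerBlDr; apply: (@le_trans _ _ (\1_U z + n%:R * mdist u z)).
  by apply: (ge_inf (env_lb n u)); exists z.
 rewrite -addrA lerD2l -mulrDr ler_wpM2l// addrC; exact: metric_triangle.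
by rewrite ler_norml; apply/andP; split; have := H x y; have := H y x; rewrite (metric_sym); lra.
Qed.

Lemma env_cvg x : env n x @[n --> \oo] --> (\1_U x : R).
Proof.
have [Ux|nU] := pselect (U x); last first.
 have z n : env n x = 0.
  by apply/eqP; rewrite eq_le env_ge0 andbT; have := env_le n x; rewrite indicE memNset.
 by rewrite indicE memNset//; under eq_fun do rewrite z; exact: cvg_cst.
have := open_nbhs_nbhs (conj oU Ux).
move=> /nbhs_ballP[r /= r0]; rewrite ballEmdist => Hr.
apply: cvg_near_cst; near=> n.
apply/eqP; rewrite eq_le env_le/=; apply: lb_le_inf.
 by exists (\1_U x + n%:R * mdist x x); exists x.
move=> _ [y _ <-]; rewrite indicE mem_set//.
have [yr|yr] := ltP (mdist x y) r.
 by rewrite indicE mem_set ?lerDl ?mulr_ge0 ?mdist_ge0//; exact: Hr.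
apply: (@le_trans _ _ (n%:R * mdist x y)); last by rewrite lerDr.
apply: (@le_trans _ _ (n%:R * r)); last by rewrite ler_wpM2l.
rewrite -ler_pdivrMr//; near: n; exact: nbhs_infty_ger.
Unshelve. all: by end_near. Qed.

Lemma env_lipc n x0 r : U `<=` [set y | mdist x0 y <= r] -> lipc (env n).
Proof.
move=> UB; split; first by exists n%:R => x y; exact: env_lip.
have cB : closed [set y : X | mdist x0 y <= r].
 by apply: compact_closed; [exact: metric_hausdorff|exact: propX].
apply: (subclosed_compact _ (@propX x0 r)); first exact: closed_closure.
rewrite [X in _ `<=` X](closure_id _).1//; apply: closure_subset => y /= ny; apply: UB.
apply: contrapT => nU; move: ny; rewrite (_ : env n y = 0) ?eqxx//.
by apply/eqP; rewrite eq_le env_ge0 andbT; have := env_le n y; rewrite indicE memNset.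
Qed.

End envelope.
Definition cball (n : nat) : set X := [set y | mdist y (point : X) < n.+1%:R].

Lemma open_cball n : open (cball n). Proof. exact: open_mball. Qed.

(** Lipschitz envelopes increasing to indicators turn the hypothesis into vanishing integrals over
    bounded open sets. Open sets form a pi-system generating the Borel sets, so all integrals over
    Borel subsets of a ball vanish, in particular those over the sets where [f] or [- f] is
    positive. *)
Lemma lipc_orth f : meas f ->
 (forall n, mu.-integrable (cball n) (EFin \o f)) ->
 (forall chi, lipc chi -> (forall x, 0 <= chi x) -> \int[mu]_x (chi x * f x) = 0) ->
 [ae x | f x = 0].
Proof.
move=> mf fi f0.
have mB n : measurable (cball n) by apply: openMX; exact: open_cball.
have opn n U : open U -> U `<=` cball n -> \int[mu]_(x in U) f x = 0.
 move=> oU UB; have mU := openMX oU.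
 have iU : mu.-integrable U (EFin \o f) by exact: integrableS (fi n).
 have ifU : integ (fun x => f x * \1_U x).
  move: iU; rewrite (integrable_mkcond _ mU); congr (integrable _ _ _).
  by apply/funext => x; rewrite patchE /= indicE; case: (x \in U); rewrite ?mulr1 ?mulr0.
 have -> : \int[mu]_(x in U) f x = \int[mu]_x (f x * \1_U x).
  rewrite /Rintegral integral_mkcond; congr fine; apply: eq_integral => x _.
  by rewrite patchE indicE; case: (x \in U); rewrite ?mulr1 ?mulr0.
 have UB' : U `<=` [set y | mdist (point : X) y <= n.+1%:R].
  by move=> y /UB /ltW; rewrite metric_sym.
 have me k : meas (env U k).
  by apply: contMX; exact: lip_contX (env_lip U k).
 have DC := @dominated_convergence _ _ _ mu _ measurableT
  (fun k x => (env U k x * f x)%:E) (fun x => (f x * \1_U x)%:E) (fun x => `|f x * \1_U x|%:E).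
 have [| | | | |_ _ c] := DC.
 - by move=> k; apply/mEFinP; exact: mfunM.
 - by apply/mEFinP; apply: mfunM => //; exact: measurable_indic.
 - apply: ae_all => x _; apply/fine_cvgP; split; first exact: nearW.
  by rewrite mulrC; apply: cvgM; [exact: env_cvg|exact: cvg_cst].
 - exact: integrable_norm ifU.
 - apply: ae_all => x k _; rewrite lee_fin !normrM mulrC ler_wpM2l//.
  rewrite ger0_norm ?env_ge0// ger0_norm; have := env_le U k x; by [].
 have z k : (\int[mu]_x (env U k x * f x)%:E = 0)%E.
  have iek : integ (fun x => env U k x * f x).
   apply: (integ_dom_ae _ (integrable_norm ifU)); first exact: mfunM.
   apply: ae_all => x /=; rewrite !normrM mulrC ler_wpM2l//.
   rewrite ger0_norm ?env_ge0// ger0_norm; have := env_le U k x; by [].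
  rewrite -(fineK (integrable_fin_num measurableT iek)).
  by have := f0 _ (env_lipc k UB') (env_ge0 U k); rewrite /Rintegral => ->.
 rewrite /Rintegral (_ : (\int[mu]_x (f x * \1_U x)%:E = 0)%E)//.
 have c' : (0%E : \bar R) @[_ --> \oo] --> (\int[mu]_x (f x * \1_U x)%:E)%E.
  by apply: cvg_trans c; apply: near_eq_cvg; apply: nearW => k /=; rewrite z.
 by apply: (cvg_unique _ c'); [exact: ereal_hausdorff|exact: cvg_cst].
have all_n n A : measurable A -> \int[mu]_(x in A `&` cball n) f x = 0.
 rewrite [in X in X -> _]borelE.
 apply: (@dynkin_induction _ X [set U : set X | open U] (fun A => \int[mu]_(x in A `&` cball n) f x = 0)).
 - by rewrite borelE.
 - by move=> U V oU oV; exact: openI.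
 - by rewrite setTI; apply: (opn n) => //; exact: open_cball.
 - move=> U oU; apply: (opn n); last exact: subIsetr.
  by apply: openI => //; exact: open_cball.
 - move=> S mS S0; have := @Rintegral_setU _ _ _ mu (S `&` cball n) (~` S `&` cball n) f.
  rewrite -setIUl setUv setTI S0 add0r (opn n _ (open_cball n))//.
  move=> h; rewrite -h//.
  + exact: measurableI.
  + by apply: measurableI => //; exact: measurableC.
  + by apply/disj_setPS => x [[? _] [+ _]].
 move=> F mF tF F0; rewrite setI_bigcupl /Rintegral integral_bigcup.
 - rewrite eseries0// => k _ _.
  have : mu.-integrable (F k `&` cball n) (EFin \o f).
   by apply: integrableS (fi n) => //; exact: measurableI.
  move=> i; rewrite -(fineK (integrable_fin_num (measurableI _ _ (mF k) (mB n)) i)).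
  by have := F0 k; rewrite /Rintegral => ->.
 - by apply: trivIset_setIr.
 - by move=> k; exact: measurableI.
 apply: integrableS (fi n) => //; first by apply: bigcup_measurable => k _; exact: measurableI.
 by apply: bigcup_sub => k _; exact: subIsetr.
have nul n : [ae x | cball n x -> f x = 0].
 have pos g : meas g -> mu.-integrable (cball n) (EFin \o g) ->
   (forall A, measurable A -> \int[mu]_(x in A `&` cball n) g x = 0) ->
   [ae x | cball n x -> g x <= 0].
  move=> mg ig g0; pose A := [set x | 0 < g x].
  have mA : measurable A.
   rewrite (_ : A = g @^-1` `]0, +oo[%classic); last by apply/seteqP; split=> x /=; rewrite in_itv/= andbT.
   by rewrite -[X in measurable X]setTI; apply: mg => //; exact: m_itv.
  have mAB : measurable (A `&` cball n) by exact: measurableI.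
  have iAB : mu.-integrable (A `&` cball n) (EFin \o g) by exact: integrableS ig.
  have : [ae x | (A `&` cball n) x -> (EFin \o g) x = (cst 0%E) x].
   apply/(ae_eq_integral_abs mu mAB); first exact: measurable_int iAB.
   rewrite (eq_integral (EFin \o g)); last first.
    by move=> x /set_mem[/= gx _]; rewrite ger0_norm// ltW.
   rewrite -(fineK (integrable_fin_num mAB iAB)).
   by have := g0 A mA; rewrite /Rintegral => ->.
  move=> /ae_imp; apply => x h Bx; rewrite leNgt; apply/negP => gx.
  by have [e] := h (conj gx Bx); move: gx; rewrite e ltxx.
 have h1 := pos f mf (fi n) (all_n n).
 have h2 : [ae x | cball n x -> - f x <= 0].
  apply: pos; first exact: mT_comp.
   have := integrZ (mB n) (-1) (fi n).
   by have -> : (fun x => -1 * f x) = (fun x => - f x) by apply/funext => x; rewrite mulN1r.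
  move=> A mA; rewrite (_ : (fun x => - f x) = (fun x => -1 * f x)); last by apply/funext => x; rewrite mulN1r.
  have mAB : measurable (A `&` cball n) by exact: measurableI.
  by rewrite RintegralZl ?all_n ?mulr0//; exact: integrableS (fi n).
 apply: (ae_imp2 h1 h2) => x k1 k2 Bx; apply/eqP; rewrite eq_le k1//=.
 by have := k2 Bx; rewrite oppr_le0.
apply: (ae_imp (ae_foralln nul)) => x h; apply: (h (Num.trunc (mdist x (point : X)))).
exact: truncnS_gt.
Qed.

Lemma lipcD a b f g : lipc f -> lipc g -> lipc (fun x => a * f x + b * g x).
Proof.
move=> [[L1 l1] c1] [[L2 l2] c2]; split.
 exists (`|a| * L1 + `|b| * L2) => x y.
 have -> : a * f x + b * g x - (a * f y + b * g y) = a * (f x - f y) + b * (g x - g y) by ring.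
 apply: le_trans (ler_normD _ _) _; rewrite !normrM mulrDl -!mulrA.
 by apply: lerD; apply: ler_wpM2l.
apply: (subclosed_compact (@closed_closure _ _) (compactU c1 c2)).
rewrite -closureU; apply: closure_subset => x /= h.
apply: contrapT => /not_orP[/= /negP + /negP]; rewrite !negbK => /eqP e1 /eqP e2.
by move: h; rewrite e1 e2 !mulr0 addr0 eqxx.
Qed.

Lemma ar_var (b c : R) : (forall t, 0 <= 2 * t * b + t ^+ 2 * c) -> b = 0.
Proof.
move=> h; apply/eqP; rewrite -sqrf_eq0 eq_le sqr_ge0 andbT.
pose k := `|c| + 1; have k0 : 0 < k by rewrite ltr_wpDl.
have := h (- b / k); have -> : 2 * (- b / k) * b + (- b / k) ^+ 2 * c = b ^+ 2 * (c - 2 * k) / k ^+ 2.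
 by field; rewrite gt_eqF.
rewrite pmulr_lge0 ?invr_gt0 ?exprn_gt0// => h1; rewrite leNgt; apply/negP => b0.
by move: h1; rewrite pmulr_rge0 /k; have := ler_norm c; have := normr_ge0 c; lra.
Qed.

(* A subspace of L^2 with trivial orthogonal complement is dense: minimise the
 distance to it. *)
Lemma orth_dense (S : (X -> R) -> Prop) : (forall u, S u -> L2 u) -> S (fun=> 0) ->
 (forall a b u v, S u -> S v -> S (fun x => a * u x + b * v x)) ->
 (forall g, L2 g -> (forall u, S u -> ip g u = 0) -> [ae x | g x = 0]) ->
 forall g e, L2 g -> 0 < e -> exists2 u, S u & nn (fun x => g x - u x) < e.
Proof.
move=> SL S0 Slin Sorth g e Lg e0.
pose V := [set v : R | exists2 u : X -> R, S u & v = ip (fun x => g x - u x) (fun x => g x - u x)].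
have hV : has_inf V.
 split; first by exists (ip (fun x => g x - 0) (fun x => g x - 0)); exists (fun=> 0).
 by exists 0 => _ [s _ ->]; exact: ip_ge0.
pose I := inf V.
have IV (u : X -> R) : S u -> I <= ip (fun x => g x - u x) (fun x => g x - u x).
 by move=> Su; apply: ge_inf; [exact: hV.2|exists u].
have /choice[sq Hs] n : exists u : X -> R, S u /\ ip (fun x => g x - u x) (fun x => g x - u x) < I + eps n.
 by have [_ [s Ss ->] lt1] := inf_adherent (@eps_gt0 R n) hV; exists s.
have Ls n : L2 (sq n) by apply: SL; exact: (Hs n).1.
have par m n : ip (fun x => sq m x - sq n x) (fun x => sq m x - sq n x) <= 2 * (eps m + eps n).
 pose mid x := 2^-1 * sq m x + 2^-1 * sq n x.
 have Sm : S mid by apply: Slin; [exact: (Hs m).1|exact: (Hs n).1].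
 have := IV _ Sm; have [_ h1] := Hs m; have [_ h2] := Hs n.
 have Lu := L2B Lg (Ls m); have Lv := L2B Lg (Ls n).
 have -> : (fun x => g x - mid x) = (fun x => 2^-1 * ((g x - sq m x) + (g x - sq n x))).
  by apply/funext => x; rewrite /mid; field.
 have -> : (fun x => sq m x - sq n x) = (fun x => (g x - sq n x) - (g x - sq m x)).
  by apply/funext => x; ring.
 have LD := L2D Lu Lv; have LB := L2B Lv Lu; have LZ := L2Z 2^-1 LD.
 rewrite (ipZl 2^-1 LD LZ) (ipZr 2^-1 LD LD) (ipDl Lu Lv LD) !(ipDr Lu)// (ipBl Lv Lu LB) !(ipBr Lv)//.
 rewrite (ipC mu (fun x => g x - sq n x) (fun x => g x - sq m x)).
 move: h1 h2; move: (ip _ _) (ip _ _) (ip _ _) (eps m) (eps n) => A B C em en; lra.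
have [|h Lh ch] := @L2_cauchy _ _ _ mu sq Ls.
 move=> a a0; have [k ka] := eps_small (ltac:(by rewrite divr_gt0 ?exprn_gt0) : 0 < a ^+ 2 / 8).
 exists k => m n km kn; rewrite -ltr_sqr ?nnegrE ?nn_ge0 ?ltW// nn_sqr.
 apply: le_lt_trans (par m n) _.
 have k1 := @eps_le R _ _ km; have k2 := @eps_le R _ _ kn.
 have : 0 < a ^+ 2 by exact: exprn_gt0.
 by lra.
have cip (u : X -> R) : L2 u -> ip (fun x => g x - sq n x + u x) (fun x => g x - sq n x + u x) @[n --> \oo]
  --> ip (fun x => g x - h x + u x) (fun x => g x - h x + u x).
 move=> Lu; have cc : nn (fun x => (g x - sq n x + u x) - (g x - h x + u x)) @[n --> \oo] --> (0 : R).
  apply: cvg_trans ch; apply: near_eq_cvg; apply: nearW => n.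
  rewrite -(nnN (L2B (Ls n) Lh)); congr (nn _); apply/funext => x; ring.
 have LL n : L2 (fun x => g x - sq n x + u x) by apply: L2D => //; exact: L2B.
 have LL' : L2 (fun x => g x - h x + u x) by apply: L2D => //; exact: L2B.
 exact: ip_nn_cvg.
have Lgh := L2B Lg Lh.
have e0' k : (fun x => g x - k x + 0) = (fun x => g x - k x) by apply/funext => x; rewrite addr0.
have up : ip (fun x => g x - h x) (fun x => g x - h x) <= I.
 have c1 := cip _ (L20 mu).
 have c2 : I + eps n @[n --> \oo] --> I + 0 by apply: cvgD; [exact: cvg_cst|exact: eps_cvg].
 rewrite addr0 in c2; rewrite -e0'; apply: (ler_cvg_to c1 c2); apply: nearW => n.
 by rewrite e0' ltW//; exact: (Hs n).2.
have gh : [ae x | g x - h x = 0].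
 apply: Sorth => // u Su; have Lu := SL _ Su; apply: (@ar_var _ (ip u u)) => t.
 have Ltu := L2Z t Lu.
 have low : I <= ip (fun x => g x - h x + t * u x) (fun x => g x - h x + t * u x).
  apply: (cvgr_to_ge (cip _ Ltu)); apply: nearW => n.
  have -> : (fun x => g x - sq n x + t * u x) = (fun x => g x - (1 * sq n x + (- t) * u x)).
   by apply/funext => x; ring.
  by apply: IV; apply: Slin => //; exact: (Hs n).1.
 have := le_trans up low; have LD := L2D Lgh Ltu.
 rewrite (ipDl Lgh Ltu LD) !(ipDr Lgh)// !(ipZl)// !(ipZr)//.
 rewrite (ipC mu u (fun x => g x - h x)).
 move: (ip _ _) (ip _ _) (ip _ _) => A B C; rewrite expr2; lra.
have /cvgrPdist_lt /(_ _ e0) ch' := ch.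
have [n Hn] := filter_ex ch'.
exists (sq n); first exact: (Hs n).1.
apply: le_lt_trans (nn_dist Lg Lh (Ls n)) _.
have -> : nn (fun x => g x - h x) = 0.
 rewrite (nn_ae Lgh (L20 mu) gh) nnE ipE; under eq_Rintegral do rewrite mul0r.
 by rewrite Rintegral_cst// mul0r sqrtr0.
rewrite add0r -(nnN (L2B Lh (Ls n))).
have -> : (fun x => - (h x - sq n x)) = (fun x => sq n x - h x) by apply/funext => x; ring.
by move: Hn; rewrite sub0r normrN ger0_norm ?nn_ge0.
Qed.

Lemma lipc0 : lipc (fun=> 0).
Proof.
split; first by exists 0 => x y; rewrite subrr normr0 mul0r.
rewrite /compactly_supported (_ : [set x | 0 != 0] = set0); last by apply/seteqP; split => x ; rewrite eqxx.
by rewrite closure0; exact: compact0.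
Qed.

Lemma L2_cball f n : L2 f -> mu.-integrable (cball n) (EFin \o f).
Proof.
move=> Lf; have mB : measurable (cball n) by apply: openMX; exact: open_cball.
have fin : (mu (cball n) < +oo)%E.
 have := finite_compact (@propX (point : X) n.+1%:R); apply: le_lt_trans; apply: le_measure; rewrite ?inE//.
  rewrite -[X in measurable X]setCK; apply: measurableC; apply: openMX; apply: closed_openC.
  exact: closed_closure.
 by move=> y; rewrite /cball /= metric_sym => /ltW h; apply: subset_closure.
have L1 : L2 (\1_(cball n) : X -> R).
 split; first exact: measurable_indic.
 have -> : (fun x => \1_(cball n) x ^+ 2) = (\1_(cball n) : X -> R).
  by apply/funext => x; rewrite indicE; case: (x \in _); rewrite ?expr1n ?expr0n.
 apply: integ_fin; [exact: measurable_indic|by move=> x; rewrite indicE|].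
 by rewrite integral_indic// setIT.
have := integM L1 Lf; rewrite (integrable_mkcond _ mB); congr (integrable _ _ _).
by apply/funext => x; rewrite patchE /= indicE; case: (x \in _); rewrite ?mul1r ?mul0r.
Qed.

Lemma lipc_dense g e : L2 g -> 0 < e -> exists2 u, lipc u & nn (fun x => g x - u x) < e.
Proof.
apply: (@orth_dense lipc) => {g e}.
- by move=> u /lipc_props[L [_ _ _ /W12_L2]].
- exact: lipc0.
- by move=> a b u v; exact: lipcD.
move=> g Lg h; apply: lipc_orth; [exact: L2_m Lg|by move=> n; exact: L2_cball|].
by move=> chi lchi _; rewrite -(h chi lchi) ipC.
Qed.

Lemma lipc_pos f : lipc f -> lipc (fun x => Num.max 0 (f x)).
Proof.
move=> [[L l] c]; split.
 exists L => x y; apply: le_trans (l x y).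
 by rewrite /Num.max; case: ltP => a; case: ltP => b; rewrite ler_norml; apply/andP; split;
  have := ler_norm (f x - f y); have := ler_norm (f y - f x); rewrite distrC; lra.
apply: (subclosed_compact (@closed_closure _ _) c); apply: closure_subset => x /=.
by apply: contra_neq => ->; rewrite maxxx.
Qed.

(** Test against approximations of the negative part [g] of [f]: their positive parts are admissible
    and no further from [g]. In the limit [0 <= ip g f = - ip g g]. *)
Lemma lipc_test f : L2 f -> (forall chi, lipc chi -> (forall x, 0 <= chi x) -> 0 <= ip chi f) ->
 [ae x | 0 <= f x].
Proof.
move=> Lf h; pose g x := Num.max 0 (- f x).
have mg : meas g by apply: measurable_maxr => //; apply: mT_comp => //; exact: L2_m Lf.
have Lg : L2 g.
 apply: (L2_dom mg Lf); apply: ae_all => x; rewrite /g /Num.max; case: ltP => _; rewrite ?normrN// normr0//.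
have key : 0 <= ip g f.
 apply/ler_addgt0Pr => e e0; rewrite -lerBlDr sub0r.
 pose k := nn f + 1; have k0 : 0 < k by rewrite ltr_wpDl ?nn_ge0.
 have [u lu nu] := lipc_dense Lg (divr_gt0 e0 k0).
 have [_ [mu_ _ _ /W12_L2 Lu _]] := lipc_props lu.
 have [_ [_ _ _ /W12_L2 Lp _]] := lipc_props (lipc_pos lu).
 have LB := L2B Lg Lp.
 have nb : nn (fun x => g x - Num.max 0 (u x)) <= e / k.
  apply: le_trans (ltW nu); rewrite -ler_sqr ?nnegrE ?nn_ge0// !nn_sqr.
  have LB' := L2B Lg Lu.
  apply: leR_ae; [exact: integM|exact: integM|]; apply: ae_all => x.
  rewrite -!expr2 -[leLHS]real_normK ?num_real// -[leRHS]real_normK ?num_real// ler_sqr ?nnegrE//.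
  have : 0 <= g x by rewrite /g le_max lexx.
  move: (g x) (u x) => a b a0; rewrite /Num.max; case: ltP => b0 //.
  by rewrite !ger0_norm; lra.
 have := h _ (lipc_pos lu) (fun x => ltac:(by rewrite le_max lexx)).
 have -> : ip (fun x => Num.max 0 (u x)) f = ip g f - ip (fun x => g x - Num.max 0 (u x)) f.
  by rewrite (ipBl Lg Lp Lf); ring.
 have := CS LB Lf; rewrite ler_norml => /andP[h1 _] h2.
 have h3 : nn (fun x => g x - Num.max 0 (u x)) * nn f <= e.
  apply: (@le_trans _ _ (e / k * nn f)); first by rewrite ler_wpM2r ?nn_ge0.
  by rewrite -mulrA ler_piMr ?(ltW e0)// ler_pdivrMl// mulr1 /k lerDl.
 by move: h1 h2 h3; lra.
have gf x : g x * f x = - (g x * g x).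
 by rewrite /g /Num.max; case: ltP => _; ring.
have z : ip g g = 0.
 apply/eqP; rewrite eq_le ip_ge0 andbT -oppr_ge0; apply: le_trans key _.
 rewrite !ipE -mulN1r -RintegralZl//; last exact: integM.
 by apply: eq_leW; apply: eq_Rintegral => x _; rewrite mulN1r.
have n0 : nn g = 0 by rewrite nnE z sqrtr0.
apply: (ae_imp (nn_eq0 Lg n0)) => x; rewrite /g /Num.max; case: ltP => [_ /eqP|a _].
 by rewrite oppr_eq0 => /eqP ->.
by rewrite -oppr_le0.
Qed.

End density.

(** * Symmetry of the carre du champ *)

Section gamma_sym.
Implicit Types (f g : X -> R) (a b c e r s t : R).
Lemma integM_bdd f g : meas f -> bdd f -> integ g -> integ (fun x => f x * g x).
Proof.
move=> mf [M fM] ig; apply: (integ_dom_ae _ (integrZ measurableT M (integrable_norm ig))).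
 by apply: mfunM => //; exact: integ_mfun ig.
by apply: ae_all => x; rewrite normrM ler_wpM2r.
Qed.

Section weighted.
Variable phi : X -> R.
Hypotheses (Wp : W12 phi) (bp : bdd phi) (p0 : forall x, 0 <= phi x).
(** The energy with weight [phi]. The Leibniz rule writes it through [E] alone, which is symmetric
    and bilinear, so its derivative at [g] in direction [f] is visibly symmetric in the two. *)
Definition Qw f := \int[mu]_x (phi x * ng f x ^+ 2).

Lemma QwE g : W12 g -> bdd g ->
 Qw g = E (fun x => phi x * g x) g - 2^-1 * E phi (fun x => g x ^+ 2).
Proof.
move=> Wg bg; have [Wpg gpg] := W12M Wp Wg bp bg.
have [Wg2 gg2] := sqr_gam Wg bg.
have [i1 <-] := gam_int Wpg Wg.
have [i2 <-] := gam_int Wp Wg2.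
have j2 := integrZ measurableT 2^-1 i2.
rewrite -(RintegralZl 2^-1 measurableT i2) -(RintegralB measurableT i1 j2).
apply: Rint_ae.
- apply: mfunM; first exact: W12_m Wp.
 by apply: mfunX; exact: ng_m Wg.
- by apply: mfunB; [exact: integ_mfun i1|apply: mfunM => //; exact: integ_mfun i2].
apply: (ae_imp2 (ae_and (gpg g Wg) (gg2 phi Wp).2) (gam_self Wg)) => x [-> ->] ->.
by field.
Qed.

Lemma Qw_lin e f g : W12 f -> W12 g -> bdd f -> bdd g ->
 Qw (fun x => g x + e * f x) = Qw g +
  e * (E (fun x => phi x * f x) g + E (fun x => phi x * g x) f - E phi (fun x => f x * g x)) +
  e ^+ 2 * Qw f.
Proof.
move=> Wf Wg bf bg; have Wef := W12Z e Wf; have Wge := W12D Wg Wef.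
have bef := bddZ e bf; have bge := bddD bg bef.
rewrite !QwE//.
have [Wpf _] := W12M Wp Wf bp bf.
have [Wpg _] := W12M Wp Wg bp bg.
have [Wfg _] := W12M Wf Wg bf bg.
have [Wf2 _] := sqr_gam Wf bf.
have [Wg2 _] := sqr_gam Wg bg.
have e1 : (fun x => phi x * (g x + e * f x)) = (fun x => phi x * g x + e * (phi x * f x)).
 by apply/funext => x; ring.
have e2 : (fun x => (g x + e * f x) ^+ 2) = (fun x => (g x ^+ 2 + (2 * e) * (f x * g x)) + e ^+ 2 * f x ^+ 2).
 by apply/funext => x; ring.
have Wepf := W12Z e Wpf; have W2fg := W12Z (2 * e) Wfg.
have Wef2 := W12Z (e ^+ 2) Wf2; have Ws := W12D Wg2 W2fg.
rewrite e1 e2 (EDl Wpg Wepf Wge) !(EDr Wg)//.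
rewrite !(EZl)// !(EZr)//.
rewrite (EDr Ws Wef2 Wp) (EDr Wg2 W2fg Wp) !(EZr)//.
by field.
Qed.

Lemma gam_weighted f g : W12 f -> W12 g -> bdd f -> bdd g ->
 \int[mu]_x (phi x * Gam f g x) =
 2^-1 * (E (fun x => phi x * f x) g + E (fun x => phi x * g x) f - E phi (fun x => f x * g x)).
Proof.
move=> Wf Wg bf bg; set B := (_ + _ - _ : R).
have mp := W12_m Wp.
have dqw e : e != 0 -> integ (fun x => phi x * dq e f g x) /\
  \int[mu]_x (phi x * dq e f g x) = B / 2 + e * (Qw f / 2).
 move=> e0; have [id _] := dq_int Wf Wg e0.
 split; first exact: integM_bdd.
 have Wef := W12Z e Wf; have Wge := W12D Wg Wef.
 have [i1 _] := ng2_int Wge; have [i2 _] := ng2_int Wg.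
 have j1 := integM_bdd mp bp i1; have j2 := integM_bdd mp bp i2.
 have -> : (fun x => phi x * dq e f g x) =
  (fun x => (2 * e)^-1 * (phi x * ng (fun z => g z + e * f z) x ^+ 2 - phi x * ng g x ^+ 2)).
  by apply/funext => x; rewrite dqE -mulrBr mulrA mulrC.
 have j12 := integrB measurableT j1 j2.
 rewrite RintegralZl// RintegralB//.
 have := Qw_lin e Wf Wg bf bg; rewrite {1}/Qw => ->; rewrite -/B -/(Qw g).
 by move: B (Qw g) (Qw f) => *; field.
have [iG _] := gam_int Wf Wg; have iw := integM_bdd mp bp iG.
have [_ b _ _] := gam_spec Wf Wg.
have cc s : B / 2 + s * eps n * (Qw f / 2) @[n --> \oo] --> B / 2 + s * 0 * (Qw f / 2).
 apply: cvgD; first exact: cvg_cst.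
 apply: cvgM; last exact: cvg_cst.
 by apply: cvgM; [exact: cvg_cst|exact: eps_cvg].
rewrite [RHS]mulrC; apply/eqP; rewrite eq_le; apply/andP; split.
 have := cc 1; rewrite mulr0 mul0r addr0 => c1; apply: (cvgr_to_ge c1); apply: nearW => n.
 have [i1 e1] := dqw _ (@eps_neq0 R n); rewrite mul1r -e1; apply: (leR_ae iw i1).
 by apply: (ae_imp (b _ (@eps_gt0 R n))) => x /andP[_ h]; rewrite ler_wpM2l.
have := cc (-1); rewrite mulr0 mul0r addr0 => c1; apply: (cvgr_to_le c1); apply: nearW => n.
have [i1 e1] := dqw _ (@epsN_neq0 R n); rewrite mulN1r -e1; apply: (leR_ae i1 iw).
by apply: (ae_imp (b _ (@eps_gt0 R n))) => x /andP[h _]; rewrite ler_wpM2l.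
Qed.

End weighted.
(** Integrated against any nonnegative Lipschitz weight of compact support, both sides have the same
    expression in [E]. *)
Lemma gamC f g : W12 f -> W12 g -> bdd f -> bdd g -> [ae x | Gam f g x = Gam g f x].
Proof.
move=> Wf Wg bf bg; have [i1 _] := gam_int Wf Wg.
have [i2 _] := gam_int Wg Wf; have i12 := integrB measurableT i1 i2.
suff : [ae x | Gam f g x - Gam g f x = 0].
 by move=> /ae_imp; apply => x /eqP; rewrite subr_eq0 => /eqP.
apply: (lipc_orth (integ_mfun i12)).
 move=> n; apply: (integrableS measurableT _ _ i12) => //.
 by apply: openMX; exact: open_cball.
move=> chi lchi chi0; have [L [mc bc _ Wc _]] := lipc_props lchi.
have j1 := integM_bdd mc bc i1; have j2 := integM_bdd mc bc i2.
have -> : (fun x => chi x * (Gam f g x - Gam g f x)) = (fun x => chi x * Gam f g x - chi x * Gam g f x).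
 by apply/funext => x; rewrite mulrBr.
have e1 := gam_weighted Wc bc chi0 Wf Wg bf bg; have e2 := gam_weighted Wc bc chi0 Wg Wf bg bf.
apply: (etrans (RintegralB measurableT j1 j2)).
apply: (etrans (congr2 (fun a b => a - b) e1 e2)).
have -> : (fun x => g x * f x) = (fun x => f x * g x) by apply/funext => x; rewrite mulrC.
by rewrite -mulrBr [X in _ * (_ - (X - _))]addrC subrr mulr0.
Qed.

Lemma gamBr f1 f2 g : W12 f1 -> W12 f2 -> W12 g -> bdd f1 -> bdd f2 -> bdd g ->
 [ae x | Gam g (fun z => f1 z - f2 z) x = Gam g f1 x - Gam g f2 x].
Proof.
move=> W1 W2 Wg b1 b2 bg; have W := W12B W1 W2.
have b : bdd (fun z => f1 z - f2 z).
 have := bddD b1 (bddZ (-1) b2); have -> // : (fun x => f1 x + -1 * f2 x) = (fun z => f1 z - f2 z).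
 by apply/funext => x; rewrite mulN1r.
apply: (ae_imp2 (ae_and (gamC Wg W1 bg b1) (gamC Wg W2 bg b2)) (ae_and (gamC Wg W bg b) (gamB W1 W2 Wg))).
by move=> x [-> ->] [-> ->].
Qed.

End gamma_sym.

(** * The L2 Laplacian *)

Section laplacian.
Implicit Types (f g h k u v : X -> R) (a b c e r s t : R).
Lemma DAP f h : DA f h <->
 [/\ W12 f, L2 h & forall psi, W12 psi -> E f psi = - ip h psi].
Proof.
split=> -[Wf Lh H]; split=> //.
- exact/L2_Lfun.
- move=> psi Wpsi; have [_ <-] := gam_int Wf Wpsi; exact: H.
- exact/L2_Lfun.
- move=> psi Wpsi; have [_ ->] := gam_int Wf Wpsi; exact: H.
Qed.

Lemma E_ae f f' g : meas f -> meas f' -> meas g ->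
 [ae x | f x = f' x] -> E f g = E f' g.
Proof.
move=> mf mf' mg ff'; rewrite !EE !QE.
have -> : ng (fun x => f x + g x) = ng (fun x => f' x + g x).
 by apply: (ng_ae (mfunD mf mg) (mfunD mf' mg)); apply: (ae_imp ff') => x /= ->.
have -> // : ng (fun x => f x - g x) = ng (fun x => f' x - g x).
by apply: (ng_ae (mfunB mf mg) (mfunB mf' mg)); apply: (ae_imp ff') => x /= ->.
Qed.

Lemma DA_ae f f' h h' : DA f h -> meas f' -> meas h' ->
 [ae x | f x = f' x] -> [ae x | h x = h' x] -> DA f' h'.
Proof.
move=> /DAP[Wf Lh H] mf' mh' ff' hh'; have Lh' := L2_ae mh' hh' Lh.
apply/DAP; split=> //; first exact: W12_ae Wf mf' ff'.
move=> psi Wp; rewrite -(E_ae (W12_m Wf) mf' (W12_m Wp) ff') H//; congr (- _).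
by apply: ip_ae => //; [exact: W12_L2|exact: W12_L2|exact: ae_all].
Qed.

Lemma DA_W12 f h : DA f h -> W12 f. Proof. by move=> /DAP[]. Qed.

Lemma DA_L2 f h : DA f h -> L2 h. Proof. by move=> /DAP[]. Qed.

Lemma DA_fL2 f h : DA f h -> L2 f. Proof. by move=> /DA_W12; exact: W12_L2. Qed.

Lemma DA_E f h psi : DA f h -> W12 psi -> E f psi = - ip h psi.
Proof. by move=> /DAP[_ _]; exact. Qed.

Lemma DA_lin a b f h g k : DA f h -> DA g k ->
 DA (fun x => a * f x + b * g x) (fun x => a * h x + b * k x).
Proof.
move=> /DAP[Wf Lh H] /DAP[Wg Lk K].
have Waf := W12Z a Wf; have Wbg := W12Z b Wg.
have Lah := L2Z a Lh; have Lbk := L2Z b Lk.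
apply/DAP; split; [exact: W12D|exact: L2D|] => psi Wp; have Lp := W12_L2 Wp.
rewrite (EDl Waf Wbg Wp) (EZl _ Wf Wp) (EZl _ Wg Wp).
by rewrite H// K// (ipDl Lah Lbk Lp) (ipZl a Lh Lp) (ipZl b Lk Lp); ring.
Qed.

Lemma W12_sep g : L2 g -> (forall psi, W12 psi -> ip g psi = 0) -> [ae x | g x = 0].
Proof.
move=> Lg H.
have h1 : [ae x | 0 <= g x].
 apply: (lipc_test Lg) => chi lc _; have [L [_ _ _ Wc _]] := lipc_props lc.
 by rewrite ipC H.
have h2 : [ae x | 0 <= - g x].
 apply: (lipc_test (L2N Lg)) => chi lc _.
 have [L [_ _ _ Wc _]] := lipc_props lc; have Lc := W12_L2 Wc.
 have -> : (fun x => - g x) = (fun x => -1 * g x) by apply/funext => x; rewrite mulN1r.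
 by rewrite (ipZr _ Lg Lc) ipC H.
by apply: (ae_imp2 h1 h2) => x; rewrite oppr_ge0 => g0 g1; apply/eqP; rewrite eq_le g1.
Qed.

Lemma DA_uniq f h k : DA f h -> DA f k -> [ae x | h x = k x].
Proof.
move=> /DAP[Wf Lh H] /DAP[_ Lk K].
have : [ae x | h x - k x = 0].
 apply: (W12_sep (L2B Lh Lk)) => psi Wp; rewrite (ipBl Lh Lk (W12_L2 Wp)).
 by apply/eqP; rewrite subr_eq0 -eqr_opp -H// K.
by move=> /ae_imp; apply => x /eqP; rewrite subr_eq0 => /eqP.
Qed.

Lemma DA_sym f h g k : DA f h -> DA g k -> ip h g = ip f k.
Proof.
move=> D1 D2; have := DA_E D1 (DA_W12 D2); have := DA_E D2 (DA_W12 D1).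
rewrite (EC (DA_W12 D2) (DA_W12 D1)) => -> /eqP; rewrite eqr_opp => /eqP.
by rewrite ipC => ->.
Qed.

Definition qn f := Num.sqrt (Q f).

Lemma qn_ge0 f : 0 <= qn f. Proof. exact: sqrtr_ge0. Qed.

Lemma qn_sqr f : qn f ^+ 2 = Q f. Proof. by rewrite sqr_sqrtr// Q_ge0. Qed.

Lemma E_abs f g : W12 f -> W12 g -> `|E f g| <= qn f * qn g.
Proof.
move=> Wf Wg; rewrite -[leLHS]ger0_norm// -ler_sqr ?nnegrE//; last by rewrite mulr_ge0// qn_ge0.
by rewrite ger0_norm// real_normK ?num_real// exprMn !qn_sqr; exact: (E_CS).
Qed.

Lemma Q_DA f h : DA f h -> Q f = - ip h f.
Proof. by move=> D; rewrite -(EQ (DA_W12 D)) (DA_E D)//; exact: DA_W12 D. Qed.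

Lemma W12_norm_ge f : W12 f -> nn f <= W12_norm mu f /\ qn f <= W12_norm mu f.
Proof.
move=> Wf; have n0 : 0 <= W12_norm mu f by exact: sqrtr_ge0.
have := W12_normE Wf; have := nn_sqr mu f; have := qn_sqr f.
have := nn_ge0 mu f; have := qn_ge0 f; rewrite -/(qn).
move: (nn f) (qn f) (W12_norm mu f) (ip f f) (Q f) n0 => p q n i j n0 q0 p0 e1 e2 e3.
by split; rewrite -ler_sqr ?nnegrE// e3 -e1 -e2 ?lerDl ?lerDr sqr_ge0.
Qed.

Lemma W12_cauchy (u : nat -> X -> R) (c : nat -> R) : (forall n, W12 (u n)) ->
 (forall m n, ip (fun x => u m x - u n x) (fun x => u m x - u n x) + Q (fun x => u m x - u n x)
  <= c m + c n) -> c n @[n --> \oo] --> (0 : R) ->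
 exists f, [/\ W12 f, nn (fun x => u n x - f x) @[n --> \oo] --> (0 : R) &
  qn (fun x => u n x - f x) @[n --> \oo] --> (0 : R)].
Proof.
move=> Wu H c0; have Wuu m n := W12B (Wu m) (Wu n).
have [f [Wf cf]] : exists f, W12 f /\ W12_norm mu (fun x => u n x - f x) @[n --> \oo] --> (0 : R).
 apply: (hilb.2 u Wu) => e e0.
 have e2 : 0 < e ^+ 2 / 2 by rewrite divr_gt0// exprn_gt0.
 have /cvgrPdist_lt/(_ _ e2)[n0 _ n0P] := c0.
 exists n0 => m n mn nn0; rewrite -ltr_sqr ?nnegrE ?sqrtr_ge0 ?ltW// W12_normE//.
 apply: (le_lt_trans (H m n)).
 have := n0P m mn; have := n0P n nn0; rewrite !sub0r !normrN.
 by move=> /(le_lt_trans (ler_norm _)) h1 /(le_lt_trans (ler_norm _)) h2; lra.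
exists f; split=> //; (apply: (squeeze_cvgr _ (cvg_cst 0) cf); apply: nearW => n).
- by rewrite nn_ge0/=; have [] := W12_norm_ge (W12B (Wu n) Wf).
- by rewrite qn_ge0/=; have [] := W12_norm_ge (W12B (Wu n) Wf).
Qed.

Lemma E_cvg (u : nat -> X -> R) f g : (forall n, W12 (u n)) -> W12 f -> W12 g ->
 qn (fun x => u n x - f x) @[n --> \oo] --> (0 : R) -> E (u n) g @[n --> \oo] --> E f g.
Proof.
move=> Wu Wf Wg c; apply/cvgrPdist_le => /= e e0.
have cg : qn (fun x => u n x - f x) * qn g @[n --> \oo] --> (0 : R).
 by rewrite -[X in _ --> X](mul0r (qn g)); apply: cvgM => //; exact: cvg_cst.
move/cvgrPdist_le : cg => /(_ _ e0); apply: filterS => n; rewrite sub0r normrN => h.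
rewrite distrC -(EBl (Wu n) Wf Wg); apply: le_trans (le_trans (ler_norm _) h).
exact: (E_abs (W12B (Wu n) Wf)).
Qed.

Lemma ip_cvgl (u : nat -> X -> R) f g : (forall n, L2 (u n)) -> L2 f -> L2 g ->
 nn (fun x => u n x - f x) @[n --> \oo] --> (0 : R) -> ip (u n) g @[n --> \oo] --> ip f g.
Proof.
move=> Lu Lf Lg c; apply: (ip_nn_cvg Lu (fun=> Lg) Lf Lg c).
have -> : (fun=> nn (fun x => g x - g x)) = (fun _ : nat => 0 : R); last exact: cvg_cst.
apply/funext => n; have -> : (fun x => g x - g x) = (fun x => 0 * g x).
 by apply/funext => x; rewrite subrr mul0r.
by rewrite (nnZ 0 Lg) normr0 mul0r.
Qed.

Lemma ar_closed (am an bm bn i q : R) : 0 <= am -> 0 <= an -> 0 <= bm -> 0 <= bn ->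
 i <= (bm + bn) ^+ 2 -> q <= (am + an) * (bm + bn) ->
 i + q <= 2 * (am + bm) ^+ 2 + 2 * (an + bn) ^+ 2.
Proof.
move=> am0 an0 bm0 bn0 hi hq.
have h1 : (am + an) * (bm + bn) + (bm + bn) ^+ 2 <= ((am + bm) + (an + bn)) ^+ 2 by nra.
have h2 : ((am + bm) + (an + bn)) ^+ 2 <= 2 * (am + bm) ^+ 2 + 2 * (an + bn) ^+ 2.
 by have := sqr_ge0 ((am + bm) - (an + bn)); lra.
by lra.
Qed.

Lemma cvg_unique_nn (u : nat -> X -> R) f g : (forall n, L2 (u n)) -> L2 f -> L2 g ->
 nn (fun x => u n x - f x) @[n --> \oo] --> (0 : R) ->
 nn (fun x => u n x - g x) @[n --> \oo] --> (0 : R) -> [ae x | f x = g x].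
Proof.
move=> Lu Lf Lg cf cg; have Lfg := L2B Lf Lg.
have : nn (fun x => f x - g x) = 0.
 apply/eqP; rewrite eq_le nn_ge0 andbT.
 have c : nn (fun x => u n x - f x) + nn (fun x => u n x - g x) @[n --> \oo] --> (0 + 0 : R) by exact: cvgD.
 rewrite addr0 in c; apply: (cvgr_to_ge c); apply: nearW => n.
 apply: (le_trans (nn_dist Lf (Lu n) Lg)); rewrite lerD2r.
 have -> : (fun x => f x - u n x) = (fun x => - (u n x - f x)) by apply/funext => x; rewrite opprB.
 by rewrite (nnN (L2B (Lu n) Lf)).
by move=> /(nn_eq0 Lfg) /ae_imp; apply => x /eqP; rewrite subr_eq0 => /eqP.
Qed.

Lemma nn_sym f g : L2 f -> L2 g -> nn (fun x => f x - g x) = nn (fun x => g x - f x).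
Proof.
move=> Lf Lg; rewrite -(nnN (L2B Lg Lf)); congr (nn _); apply/funext => x; by rewrite opprB.
Qed.

(** On the domain [Q (u m - u n)] is minus the product of the differences of Laplacians and of
    functions, so L2 convergence of both makes the sequence Cauchy in W12. *)
Lemma DA_closed (u h : nat -> X -> R) f k : (forall n, DA (u n) (h n)) -> L2 f -> L2 k ->
 nn (fun x => u n x - f x) @[n --> \oo] --> (0 : R) ->
 nn (fun x => h n x - k x) @[n --> \oo] --> (0 : R) -> DA f k.
Proof.
move=> D Lf Lk cu ch.
have Wu n := DA_W12 (D n); have Lu n := W12_L2 (Wu n); have Lh n := DA_L2 (D n).
pose a n := nn (fun x => h n x - k x); pose b n := nn (fun x => u n x - f x).
have [||f' [Wf' c1 c2]] := @W12_cauchy u (fun n => 2 * (a n + b n) ^+ 2) Wu.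
- move=> m n; have Dmn := DA_lin 1 (-1) (D m) (D n).
 have e1 : (fun x => 1 * u m x + -1 * u n x) = (fun x => u m x - u n x) by apply/funext => x; ring.
 have e2 : (fun x => 1 * h m x + -1 * h n x) = (fun x => h m x - h n x) by apply/funext => x; ring.
 rewrite e1 e2 in Dmn; rewrite (Q_DA Dmn) -nn_sqr.
 have b1 : nn (fun x => u m x - u n x) <= b m + b n.
  by apply: (le_trans (nn_dist (Lu m) Lf (Lu n))); rewrite (nn_sym Lf (Lu n)).
 have a1 : nn (fun x => h m x - h n x) <= a m + a n.
  by apply: (le_trans (nn_dist (Lh m) Lk (Lh n))); rewrite (nn_sym Lk (Lh n)).
 apply: ar_closed; rewrite ?nn_ge0//.
  by rewrite ler_sqr ?nnegrE ?addr_ge0 ?nn_ge0.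
 rewrite -mulN1r; apply: (le_trans (ler_norm _)); rewrite mulN1r normrN.
 apply: (le_trans (CS (L2B (Lh m) (Lh n)) (L2B (Lu m) (Lu n)))).
 by apply: ler_pM; rewrite ?nn_ge0.
- have cab : a n + b n @[n --> \oo] --> (0 + 0 : R) by exact: cvgD.
 rewrite addr0 in cab.
 have : 2 * ((a n + b n) * (a n + b n)) @[n --> \oo] --> (2 * (0 * 0) : R).
  by apply: cvgM; [exact: cvg_cst|exact: cvgM].
 by rewrite !mulr0.
have ff' := cvg_unique_nn Lu (W12_L2 Wf') Lf c1 cu.
apply: (@DA_ae f' f k k) => //; [|exact: L2_m Lf|exact: L2_m Lk|exact: ae_all].
apply/DAP; split=> // psi Wp; have l1 := E_cvg Wu Wf' Wp c2.
have l2 := ip_cvgl Lh Lk (W12_L2 Wp) ch.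
apply: (cvg_unique _ l1); first exact: Rhausdorff.
have -> : (fun n => E (u n) psi) = (fun n => - ip (h n) psi) by apply/funext => n; exact: DA_E.
exact: cvgN.
Qed.

Definition B f g := ip f g + E f g.

Lemma B_lin e f g : W12 f -> W12 g ->
 B (fun x => g x + e * f x) (fun x => g x + e * f x) = B g g + 2 * e * B f g + e ^+ 2 * B f f.
Proof.
move=> Wf Wg; rewrite /B; have Wef := W12Z e Wf; have Ws := W12D Wg Wef.
rewrite (EQ Ws) (Q_lin _ Wf Wg) (EQ Wf) (EQ Wg).
have Lf := W12_L2 Wf; have Lg := W12_L2 Wg; have Lef := W12_L2 Wef; have Ls := W12_L2 Ws.
rewrite (ipDl Lg Lef Ls) (ipZl e Lf Ls) !(ipDr)// !(ipZr)// (ipC).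
by move: (Q f) (Q g) (E f g) (ip f f) (ip g g) (ip f g) => *; ring.
Qed.

Lemma ar_par (Ji Jj m b c ei ej : R) : Ji = Jj + 2 * 1 * b + 1 ^+ 2 * c ->
 m <= Jj + 2 * 2^-1 * b + 2^-1 ^+ 2 * c -> Ji < m + ei -> Jj < m + ej -> c <= 2 * ei + 2 * ej.
Proof. by move=> *; lra. Qed.

(** Minimise [B u u - 2 * ip g u], whose Euler-Lagrange equation is [u - Lap u = g]; the
    parallelogram identity makes minimising sequences Cauchy in W12. *)
Lemma resolvent g : L2 g -> exists u, DA u (fun x => u x - g x).
Proof.
move=> Lg; pose J u := B u u - 2 * ip g u; pose S := [set J u | u in [set u | W12 u]].
have W0 : W12 (fun=> 0) by have [L [_ _ _]] := lipc_props (@lipc0).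
have S0 : S !=set0 by exists (J (fun=> 0)), (fun=> 0).
have Jge u : W12 u -> - ip g g <= J u.
 move=> Wu; have := ip_ge0 mu (fun x => u x - g x); have Lu := W12_L2 Wu.
 rewrite (ipBl Lu Lg (L2B Lu Lg)) !(ipBr)// (ipC) /J /B (EQ Wu).
 have := Q_ge0 u; move: (ip u u) (ip g g) (ip g u) (Q u) => *; lra.
have lS : has_lbound S by exists (- ip g g) => _ [u Wu <-]; exact: Jge.
have hi : has_inf S by split.
pose m := inf S; have mJ u : W12 u -> m <= J u by move=> Wu; apply: ge_inf => //; exists u.
have /choice[u uP] : forall n, exists u, W12 u /\ J u < m + eps n.
 move=> n; have [_ [u Wu <-] h] := inf_adherent (@eps_gt0 R n) hi; by exists u.
have Wu n := (uP n).1; have Lu n := W12_L2 (Wu n).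
have Jlin e f v : W12 f -> W12 v ->
  J (fun x => v x + e * f x) = J v + 2 * e * (B f v - ip g f) + e ^+ 2 * B f f.
 move=> Wf Wv; rewrite /J (B_lin e Wf Wv) (ipDr (W12_L2 Wv) (L2Z e (W12_L2 Wf)) Lg) (ipZr e (W12_L2 Wf) Lg).
 by move: (B f f) (B f v) (B v v) (ip g f) (ip g v) => *; ring.
have [||f [Wf c1 c2]] := @W12_cauchy u (fun n => 2 * eps n) Wu.
- move=> i j; have Wij := W12B (Wu i) (Wu j).
 have e1 : (fun x => u j x + 1 * (u i x - u j x)) = u i by apply/funext => x; ring.
 have := Jlin 1 _ _ Wij (Wu j); rewrite e1.
 have := mJ _ (W12D (Wu j) (W12Z 2^-1 Wij)); rewrite (Jlin _ _ _ Wij (Wu j)).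
 move=> h1 h2; have := ar_par h2 h1 (uP i).2 (uP j).2; by rewrite /B (EQ).
- rewrite -[X in _ --> X](mulr0 2); apply: cvgM; [exact: cvg_cst|exact: eps_cvg].
exists f; have Lf := W12_L2 Wf; apply/DAP; split=> //; first exact: L2B.
move=> psi Wp; have Lp := W12_L2 Wp; rewrite (ipBl Lf Lg Lp).
suff h : B psi f - ip g psi = 0.
 move: h; rewrite /B (EC Wp Wf) (ipC) => /eqP.
 by rewrite subr_eq0 => /eqP <-; ring.
apply: (@ar_var _ (B psi psi)) => t.
have cB : B psi (u n) @[n --> \oo] --> B psi f.
 have -> : (fun n => B psi (u n)) = (fun n => ip (u n) psi + E (u n) psi).
  by apply/funext => n; rewrite /B ipC (EC (Wu n)).
 rewrite /B ipC (EC Wp Wf); apply: cvgD; [exact: ip_cvgl|exact: E_cvg].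
have c : eps n + (2 * t * (B psi (u n) - ip g psi) + t ^+ 2 * B psi psi) @[n --> \oo] -->
  0 + (2 * t * (B psi f - ip g psi) + t ^+ 2 * B psi psi).
 apply: cvgD; first exact: eps_cvg.
 apply: cvgD; last exact: cvg_cst.
 apply: cvgM; first exact: cvg_cst.
 by apply: cvgB => //; exact: cvg_cst.
rewrite add0r in c; apply: (cvgr_to_ge c); apply: nearW => n.
have := mJ _ (W12D (Wu n) (W12Z t Wp)); rewrite (Jlin _ _ _ Wp (Wu n)).
have := (uP n).2; move: (B _ _) (ip _ _) (J _) (eps n) (B _ _) => *; lra.
Qed.

(** If [g] is orthogonal to the domain, pair it with its own resolvent [u]: then [Q u + |u|^2 = 0],
    so [u] vanishes and [g] with it. *)
Lemma DA_dense g e : L2 g -> 0 < e ->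
 exists2 u, (exists h, DA u h) & nn (fun x => g x - u x) < e.
Proof.
move: g e; apply: orth_dense.
- by move=> u [h D]; exact: DA_fL2 D.
- have [u D] := resolvent (L20 mu); exists (fun=> 0).
 have := DA_lin 0 0 D D; have -> : (fun x => 0 * u x + 0 * u x) = (fun=> 0 : R) by apply/funext => x; ring.
 by have -> : (fun x => 0 * (u x - 0) + 0 * (u x - 0)) = (fun=> 0 : R) by apply/funext => x; ring.
- by move=> a b u v [h D] [k K]; exists (fun x => a * h x + b * k x); exact: DA_lin.
move=> g Lg H; have [u D] := resolvent Lg; have gu := H u (ex_intro _ _ D).
have Lu := DA_fL2 D; have := Q_DA D; rewrite (ipBl Lu Lg Lu) gu subr0 => Qu.
have u0 : nn u = 0.
 apply/eqP; rewrite -sqrf_eq0 nn_sqr eq_le ip_ge0 andbT.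
 by have := Q_ge0 u; rewrite Qu; lra.
have au := nn_eq0 Lu u0; have m0 : meas (fun _ : X => 0 : R) by [].
apply: W12_sep => // psi Wp; have := DA_E D Wp.
rewrite (E_ae (W12_m (DA_W12 D)) m0 (W12_m Wp) au).
have -> : ip (fun x => u x - g x) psi = - ip g psi.
 rewrite (ipBl Lu Lg (W12_L2 Wp)); suff -> : ip u psi = 0 by rewrite sub0r.
 have := CS Lu (W12_L2 Wp); rewrite u0 mul0r normr_le0 => /eqP //.
have -> : (fun=> 0) = (fun x => 0 * psi x) by apply/funext => x; rewrite mul0r.
by rewrite (EZl _ Wp Wp) mul0r opprK.
Qed.

Lemma DA_dense_seq g : L2 g -> exists u h : nat -> X -> R, (forall n, DA (u n) (h n)) /\
 nn (fun x => u n x - g x) @[n --> \oo] --> (0 : R).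
Proof.
move=> Lg; have /choice[uh uhP] : forall n, exists uh : (X -> R) * (X -> R), DA uh.1 uh.2 /\
  nn (fun x => g x - uh.1 x) < eps n.
 by move=> n; have [u [h D] H] := DA_dense Lg (@eps_gt0 R n); exists (u, h).
exists (fun n => (uh n).1), (fun n => (uh n).2); split; first by move=> n; exact: (uhP n).1.
apply: (squeeze_cvgr _ (cvg_cst 0) (@eps_cvg R)); apply: nearW => n.
by rewrite nn_ge0 (nn_sym (DA_fL2 (uhP n).1) Lg) ltW// (uhP n).2.
Qed.

End laplacian.

(** * Smoothing, self-adjointness and uniqueness of the heat semigroup *)

Section semigroup.
Implicit Types (f g h k u v : X -> R) (a b c e r s t : R).
Lemma nn_ae_le f g : L2 f -> meas g -> [ae x | f x = g x] -> nn g = nn f.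
Proof. by move=> Lf mg fg; rewrite (nn_ae Lf (L2_ae mg fg Lf)). Qed.

Lemma ae_sym f g : [ae x | f x = g x] -> [ae x | g x = f x].
Proof. by move=> /ae_imp; apply => x ->. Qed.

Lemma ae_tr f g h : [ae x | f x = g x] -> [ae x | g x = h x] ->
 [ae x | f x = h x].
Proof. by move=> H1 H2; apply: (ae_imp2 H1 H2) => x -> ->. Qed.

Section one.
Variable P : R -> (X -> R) -> (X -> R).
Hypothesis SG : is_heat_semigroup mu P.
Lemma P_L2 t f : 0 <= t -> L2 f -> L2 (P t f).
Proof. by move=> t0 /L2_Lfun Lf; case: SG => H _ _ _ _; apply/L2_Lfun; have [] := H t f t0 Lf. Qed.

Lemma P_nn t f : 0 <= t -> L2 f -> nn (P t f) <= nn f.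
Proof.
move=> t0 Lf; case: SG => H _ _ _ _; have [_] := H t f t0 ((L2_Lfun _ _).2 Lf).
by rewrite (Lnorm_nn (P_L2 t0 Lf)) (Lnorm_nn).
Qed.

Lemma P_lin0 t a f g : 0 <= t -> L2 f -> L2 g ->
 [ae x | P t (fun z => a * f z + g z) x = a * P t f x + P t g x].
Proof. by move=> t0 /L2_Lfun Lf /L2_Lfun Lg; case: SG => _ H _ _ _; exact: H. Qed.

Lemma P_B t f g : 0 <= t -> L2 f -> L2 g ->
 [ae x | P t (fun z => f z - g z) x = P t f x - P t g x].
Proof.
move=> t0 Lf Lg; have := P_lin0 (-1) t0 Lg Lf.
have -> : (fun z => -1 * g z + f z) = (fun z => f z - g z) by apply/funext => z; ring.
by move=> /ae_imp; apply => x ->; ring.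
Qed.

Lemma P_nnB t f g : 0 <= t -> L2 f -> L2 g ->
 nn (fun x => P t f x - P t g x) <= nn (fun x => f x - g x).
Proof.
move=> t0 Lf Lg; have Lp := P_L2 t0 (L2B Lf Lg).
rewrite (nn_ae_le Lp (L2_m (L2B (P_L2 t0 Lf) (P_L2 t0 Lg))) (P_B t0 Lf Lg)).
exact: P_nn t0 (L2B Lf Lg).
Qed.

Lemma P_ae t f g : 0 <= t -> L2 f -> meas g -> [ae x | f x = g x] ->
 [ae x | P t f x = P t g x].
Proof.
move=> t0 Lf mg fg; have Lg := L2_ae mg fg Lf.
have h0 : nn (fun x => P t f x - P t g x) = 0.
 apply/eqP; rewrite eq_le nn_ge0 andbT; apply: (le_trans (P_nnB t0 Lf Lg)).
 have m0 : L2 (fun=> 0) := L20 mu.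
 rewrite (@nn_ae _ _ _ _ _ (fun=> 0 * 0) (L2B Lf Lg)).
 - by rewrite (nnZ 0 m0) normr0 mul0r.
 - exact: L2Z 0 m0.
 - by apply: (ae_imp fg) => x ->; rewrite subrr mul0r.
have := nn_eq0 (L2B (P_L2 t0 Lf) (P_L2 t0 Lg)) h0.
by move=> /ae_imp; apply => x /eqP; rewrite subr_eq0 => /eqP.
Qed.

Lemma P_zero t : 0 <= t -> [ae x | P t (fun=> 0) x = 0].
Proof.
move=> t0; have := P_lin0 0 t0 (L20 mu) (L20 mu).
have := P_lin0 1 t0 (L20 mu) (L20 mu).
have -> : (fun _ : X => 1 * 0 + 0) = (fun=> 0 : R) by apply/funext => z; ring.
by move=> /ae_imp h _; apply: h => x /eqP; rewrite mul1r -subr_eq0 opprD addrA subrr sub0r oppr_eq0 => /eqP.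
Qed.

Lemma P_lin t a b f g : 0 <= t -> L2 f -> L2 g ->
 [ae x | P t (fun z => a * f z + b * g z) x = a * P t f x + b * P t g x].
Proof.
move=> t0 Lf Lg; have h1 := P_lin0 a t0 Lf (L2Z b Lg).
have := P_lin0 b t0 Lg (L20 mu).
have -> : (fun z => b * g z + 0) = (fun z => b * g z) by apply/funext => z; ring.
move=> h2; apply: (ae_imp2 (ae_and h1 h2) (P_zero t0)) => x [-> ->] ->; ring.
Qed.

Lemma P_Z t a f : 0 <= t -> L2 f -> [ae x | P t (fun z => a * f z) x = a * P t f x].
Proof.
move=> t0 Lf; have := P_lin a 0 t0 Lf Lf.
have -> : (fun z => a * f z + 0 * f z) = (fun z => a * f z) by apply/funext => z; ring.
by move=> /ae_imp; apply => x ->; ring.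
Qed.

Lemma P_0 f : L2 f -> [ae x | P 0 f x = f x].
Proof. by move=> /L2_Lfun Lf; case: SG => _ _ H _ _; have [] := H f Lf. Qed.

Lemma P_add s t f : 0 <= s -> 0 <= t -> L2 f -> [ae x | P (s + t) f x = P s (P t f) x].
Proof. by move=> s0 t0 /L2_Lfun Lf; case: SG => _ _ H _ _; have [_] := H f Lf; apply. Qed.

Lemma P_cont f e : L2 f -> 0 < e -> exists2 dl : R, 0 < dl &
 forall t, 0 <= t -> t < dl -> nn (fun x => P t f x - f x) < e.
Proof.
move=> Lf e0; case: SG => _ _ _ H _; have := H f ((L2_Lfun _ _).2 Lf).
have E0 t : 0 < t -> Lnorm mu 2%:E (EFin \o (fun x => P t f x - f x)) = (nn (fun x => P t f x - f x))%:E.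
 by move=> t0; rewrite Lnorm_nn//; exact: L2B (P_L2 (ltW t0) Lf) Lf.
move/(cvg0_EFin E0)/(_ e e0) => [dl d0 D]; exists dl => // t; rewrite le_eqVlt => /orP[/eqP <-|t0] td.
 have L := L2B (P_L2 (lexx 0) Lf) Lf.
 have : [ae x | P 0 f x - f x = 0 * f x].
  by apply: (ae_imp (P_0 Lf)) => x ->; rewrite subrr mul0r.
 by move=> h; rewrite (nn_ae L (L2Z 0 Lf) h) (nnZ 0 Lf) normr0 mul0r.
by have := D t t0 td; rewrite ger0_norm ?nn_ge0.
Qed.

Definition P_rem f h t x := P t f x - f x - t * h x.

Lemma P_rem_L2 f h t : 0 <= t -> L2 f -> L2 h -> L2 (P_rem f h t).
Proof. by move=> t0 Lf Lh; exact: L2B (L2B (P_L2 t0 Lf) Lf) (L2Z t Lh). Qed.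

Lemma P_gen f h : L2 f -> L2 h -> DA f h <->
 forall e, 0 < e -> exists2 dl : R, 0 < dl & forall t, 0 < t -> t < dl -> nn (P_rem f h t) <= e * t.
Proof.
move=> Lf Lh; case: SG => _ _ _ _ H.
have E0 t : 0 < t -> Lnorm mu 2%:E (EFin \o (fun x => (P t f x - f x) / t - h x)) = (t^-1 * nn (P_rem f h t))%:E.
 move=> t0; have Lr := P_rem_L2 (ltW t0) Lf Lh.
 have e1 : (fun x => (P t f x - f x) / t - h x) = (fun x => t^-1 * P_rem f h t x).
  by apply/funext => x; rewrite /P_rem; field; rewrite gt_eqF.
 by rewrite e1 Lnorm_nn ?nnZ//; [rewrite ger0_norm// invr_ge0 ltW|exact: L2Z].
have HH := H f h ((L2_Lfun _ _).2 Lf) ((L2_Lfun _ _).2 Lh).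
split=> [/HH/(cvg0_EFin E0) K e e0|K].
 have [dl d0 D] := K e e0; exists dl => // t t0 td; have := D t t0 td.
 rewrite ger0_norm ?mulr_ge0 ?nn_ge0 ?invr_ge0 ?(ltW t0)//.
 by rewrite mulrC ltr_pdivrMr// => /ltW.
apply/HH/(cvg0_EFin E0) => e e0; have e2 : 0 < e / 2 by rewrite divr_gt0.
have [dl d0 D] := K _ e2; exists dl => // t t0 td.
rewrite ger0_norm ?mulr_ge0 ?nn_ge0 ?invr_ge0 ?(ltW)// mulrC ltr_pdivrMr//.
by apply: (le_lt_trans (D t t0 td)); rewrite ltr_pM2r// ltr_pdivrMr// mulr_natr ltrDl.
Qed.

Lemma P_rem_P f h s t : 0 <= s -> 0 <= t -> L2 f -> L2 h ->
 [ae x | P s (P_rem f h t) x = P (t + s) f x - P s f x - t * P s h x].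
Proof.
move=> s0 t0 Lf Lh; have LP := P_L2 t0 Lf; have h1 := P_B s0 (L2B LP Lf) (L2Z t Lh).
have h2 := P_B s0 LP Lf; have h3 := P_Z t s0 Lh.
have h4 := ae_sym (P_add s0 t0 Lf); rewrite addrC in h4.
apply: (ae_imp2 (ae_and h1 h2) (ae_and h3 h4)) => x [e1 e2] [e3 e4].
by rewrite e1 e2 e3 e4.
Qed.

Lemma DA_P f h s : DA f h -> 0 <= s -> DA (P s f) (P s h).
Proof.
move=> D s0; have Lf := DA_fL2 D; have Lh := DA_L2 D.
apply/(P_gen (P_L2 s0 Lf) (P_L2 s0 Lh)) => e e0.
have [dl d0 H] := (P_gen Lf Lh).1 D e e0; exists dl => // t t0 td.
have t0' := ltW t0; apply: le_trans (H t t0 td); have Lr := P_rem_L2 t0' Lf Lh.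
rewrite (@nn_ae _ _ _ mu _ (P s (P_rem f h t))); first exact: P_nn.
- exact: P_rem_L2 t0' (P_L2 s0 Lf) (P_L2 s0 Lh).
- exact: P_L2.
apply: (ae_imp2 (P_rem_P s0 t0' Lf Lh) (P_add t0' s0 Lf)) => x e1 e2; by rewrite /P_rem -e2.
Qed.

(** The remainder at time [s] is [P s] of the remainder at time [0], so contraction makes the step
    uniform in [s], which is what [tel_slope] consumes. *)
Lemma P_step f k e : DA f k -> 0 < e -> exists2 dl : R, 0 < dl &
 forall s t, 0 <= s -> 0 < t -> t < dl -> exists r : X -> R, [/\ L2 r, nn r <= e * t &
  [ae x | P (s + t) f x = P s f x + t * P s k x + r x]].
Proof.
move=> D e0; have Lf := DA_fL2 D; have Lk := DA_L2 D.
have [dl d0 H] := (P_gen Lf Lk).1 D e e0; exists dl => // s t s0 t0 td; have t0' := ltW t0.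
have Lr := P_rem_L2 t0' Lf Lk; exists (P s (P_rem f k t)); split; first exact: P_L2.
 exact: le_trans (P_nn s0 Lr) (H t t0 td).
by apply: (ae_imp (P_rem_P s0 t0' Lf Lk)) => x ->; rewrite [t + s]addrC; ring.
Qed.

Lemma P_step_ip f k e : DA f k -> 0 < e -> exists2 dl : R, 0 < dl &
 forall s t (v : X -> R), 0 <= s -> 0 < t -> t < dl -> L2 v ->
  `|ip (P (s + t) f) v - ip (P s f) v - t * ip (P s k) v| <= e * t * nn v.
Proof.
move=> D e0; have Lf := DA_fL2 D; have Lk := DA_L2 D.
have [dl d0 H] := P_step D e0; exists dl => // s t v s0 t0 td Lv.
have [r [Lr nr re]] := H s t s0 t0 td.
have LPf := P_L2 s0 Lf; have LPk := P_L2 s0 Lk; have Lt := L2Z t LPk.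
have L1 := L2D LPf Lt; have L3 := L2D L1 Lr.
have st0 : 0 <= s + t by rewrite addr_ge0// ltW.
have -> : ip (P (s + t) f) v = ip (fun x => P s f x + t * P s k x + r x) v.
 by apply: ip_ae => //; [exact: P_L2|exact: ae_all].
rewrite (ipDl L1 Lr Lv) (ipDl LPf Lt Lv) (ipZl t LPk Lv).
have -> : ip (P s f) v + t * ip (P s k) v + ip r v - ip (P s f) v - t * ip (P s k) v = ip r v by ring.
by apply: (le_trans (CS Lr Lv)); rewrite ler_wpM2r// nn_ge0.
Qed.

Lemma P_step_nn f k : DA f k -> forall e, 0 < e -> exists2 dl : R, 0 < dl &
 forall s t, 0 <= s -> 0 < t -> t < dl -> nn (fun x => P (s + t) f x - P s f x) <= t * (nn k + e).
Proof.
move=> D e e0; have Lf := DA_fL2 D; have Lk := DA_L2 D.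
have [dl d0 H] := P_step D e0; exists dl => // s t s0 t0 td.
have [r [Lr nr re]] := H s t s0 t0 td; have Lt := L2Z t (P_L2 s0 Lk).
have L1 := L2D Lt Lr; have st0 : 0 <= s + t by rewrite addr_ge0// ltW.
rewrite (@nn_ae _ _ _ mu _ (fun x => t * P s k x + r x)) //; last 2 first.
- exact: L2B (P_L2 st0 Lf) (P_L2 s0 Lf).
- by apply: (ae_imp re) => x ->; ring.
apply: (le_trans (nnD Lt Lr)); rewrite (nnZ t (P_L2 s0 Lk)) gtr0_norm// mulrDr.
by apply: lerD; [rewrite ler_pM2l//; exact: P_nn|rewrite mulrC].
Qed.

Lemma P_lip f k t : DA f k -> 0 <= t -> nn (fun x => P t f x - f x) <= t * nn k.
Proof.
move=> D t0; have Lf := DA_fL2 D.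
have := @tel_slope R (fun s => nn (fun x => P s f x - f x)) (nn k) t t0; rewrite mulrC.
have -> : nn (fun x => P 0 f x - f x) = 0.
 rewrite (@nn_ae _ _ _ mu _ (fun x => 0 * f x)); first by rewrite (nnZ 0 Lf) normr0 mul0r.
 - exact: L2B (P_L2 _ Lf) Lf.
 - exact: L2Z.
 - by apply: (ae_imp (P_0 Lf)) => x ->; rewrite subrr mul0r.
rewrite add0r; apply=> e e0; have [dl d0 H] := P_step_nn D e0; exists dl => // s r s0 r0 rd _.
have sr0 : 0 <= s + r by rewrite addr_ge0// ltW.
apply: (le_trans (nn_dist (P_L2 sr0 Lf) (P_L2 s0 Lf) Lf)).
by rewrite addrC lerD2l mulrC; exact: H.
Qed.

(** The derivative of [Q (P s f)] is [- 2 |P s k|^2], and [|P s k|] is at least its value at time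
    [t]. *)
Lemma Q_P_le f k t : DA f k -> 0 <= t -> 2 * t * nn (P t k) ^+ 2 <= Q f - Q (P t f).
Proof.
move=> D t0; have Lf := DA_fL2 D; have Lk := DA_L2 D.
set c := nn (P t k) ^+ 2.
suff : Q (P t f) <= Q (P 0 f) + - (2 * c) * t.
 have -> : Q (P 0 f) = Q f.
  by rewrite !QE (ng_ae (L2_m (P_L2 (lexx 0) Lf)) (L2_m Lf) (P_0 Lf)).
 by move: (Q _) (Q _) c => *; lra.
apply: (@tel_slope R (fun s => Q (P s f)) _ t t0) => e e0.
(* Three error terms appear below, each at most [e / M * nn k] per unit of time. *)
pose M := 1 + 3 * nn k; have M0 : 0 < M by rewrite ltr_pwDl// mulr_ge0// nn_ge0.
have eM : 0 < e / M by rewrite divr_gt0.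
have [d1 d10 H1] := P_step D eM; have [d2 d20 H2] := P_cont Lk eM.
exists (Num.min d1 d2); first by rewrite lt_min d10.
move=> s h s0 h0; rewrite lt_min => /andP[hd1 hd2] sht.
have [r [Lr nr re]] := H1 s h s0 h0 hd1; have sh0 : 0 <= s + h by rewrite addr_ge0// ltW.
have Da := DA_P D sh0; have Db := DA_P D s0.
have Wa := DA_W12 Da; have Wb := DA_W12 Db.
have La := W12_L2 Wa; have Lb := W12_L2 Wb; have Lka := DA_L2 Da; have Lkb := DA_L2 Db.
have Wd := W12B Wa Wb.
have e1 : Q (P (s + h) f) - Q (P s f) =
  - ip (P (s + h) k) (fun x => P (s + h) f x - P s f x) - ip (P s k) (fun x => P (s + h) f x - P s f x).
 rewrite -(DA_E Da Wd) -(DA_E Db Wd) !(EBr)//.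
 rewrite (EC Wb Wa) (EQ Wa) (EQ Wb).
 by move: (Q _) (Q _) (E _ _) => *; ring.
have e2 v : L2 v -> ip v (fun x => P (s + h) f x - P s f x) = h * ip v (P s k) + ip v r.
 move=> Lv; have Lhk := L2Z h Lkb.
 rewrite -(ipZr h Lkb Lv) -(ipDr Lhk Lr Lv); apply: ip_ae => //; [exact: L2B|exact: L2D|exact: ae_all|].
 by apply: (ae_imp re) => x ->; ring.
have n1 : nn (P (s + h) k) <= nn k by exact: P_nn. have n2 : nn (P s k) <= nn k by exact: P_nn.
have n3 : c <= ip (P s k) (P s k).
 rewrite -nn_sqr /c ler_sqr ?nnegrE ?nn_ge0//.
 have ts : 0 <= t - s by rewrite subr_ge0 (le_trans _ sht)// lerDl ltW.
 have := P_add ts s0 Lk; rewrite subrK => h3.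
 by rewrite (nn_ae (P_L2 t0 Lk) (P_L2 ts (P_L2 s0 Lk)) h3); exact: P_nn.
have n4 : `|ip (P (s + h) k) (P s k) - ip (P s k) (P s k)| <= e / M * nn k.
 rewrite -(ipBl Lka Lkb Lkb); apply: (le_trans (CS (L2B Lka Lkb) Lkb)).
 apply: ler_pM; rewrite ?nn_ge0//; apply: le_trans (ltW (H2 h (ltW h0) hd2)).
 apply: le_trans (P_nnB s0 (P_L2 (ltW h0) Lk) Lk).
 rewrite (@nn_ae _ _ _ mu _ (fun x => P s (P h k) x - P s k x))//; [exact: L2B|exact: L2B (P_L2 s0 (P_L2 (ltW h0) Lk)) Lkb|].
 by apply: (ae_imp (P_add s0 (ltW h0) Lk)) => x ->.
have n5 : `|ip (P (s + h) k) r| <= nn k * (e / M * h).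
 by apply: (le_trans (CS Lka Lr)); apply: ler_pM; rewrite ?nn_ge0.
have n6 : `|ip (P s k) r| <= nn k * (e / M * h).
 by apply: (le_trans (CS Lkb Lr)); apply: ler_pM; rewrite ?nn_ge0.
rewrite -lerBlDl e1 !e2//.
have n7 : e / M * nn k + 2 * (nn k * (e / M)) <= e.
 have -> : e / M * nn k + 2 * (nn k * (e / M)) = e * (3 * nn k / M) by field; rewrite gt_eqF.
 by rewrite -[leRHS]mulr1 ler_pM2l// ler_pdivrMr// mul1r /M lerDr.
move: n3 n4 n5 n6 n7 h0; clear.
move: (ip _ r) (ip _ r) (ip _ _) (ip _ _) (nn k) (e / M) c => a1 a2 a3 a4 n m c.
rewrite !ler_norml => n3 /andP[n4 _] /andP[n5 _] /andP[n6 _] n7 h0.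
have : 0 <= h * (a4 - c) by rewrite mulr_ge0 ?subr_ge0// ltW.
have : 0 <= h * (a3 - a4 + m * n) by rewrite mulr_ge0; lra.
have : 0 <= h * (e - (m * n + 2 * (n * m))) by rewrite mulr_ge0 ?subr_ge0// ltW.
lra.
Qed.

(** The derivative of [|P s f|^2] is [- 2 Q (P s f)], and the energy decreases along the flow. *)
Lemma nn_P_le f k t : DA f k -> 0 <= t -> 2 * t * Q (P t f) <= nn f ^+ 2.
Proof.
move=> D t0; have Lf := DA_fL2 D.
set c := Q (P t f).
suff : nn (P t f) ^+ 2 <= nn (P 0 f) ^+ 2 + - (2 * c) * t.
 rewrite (nn_ae (P_L2 (lexx 0) Lf) Lf (P_0 Lf)).
 by have := sqr_ge0 (nn (P t f)); move: (nn _ ^+ 2) (nn _ ^+ 2) c => *; lra.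
apply: (@tel_slope R (fun s => nn (P s f) ^+ 2) _ t t0) => e e0.
pose M := 1 + 2 * nn f; have M0 : 0 < M by rewrite ltr_pwDl// mulr_ge0// nn_ge0.
have e2 : 0 < e / 2 by rewrite divr_gt0. have eM : 0 < e / 2 / M by rewrite divr_gt0.
have [d1 d10 H1] := P_step_ip D eM; have [d2 d20 H2] := P_step_nn D ltr01.
(* For steps below [d3] the squared increment stays below [e / 2 * h]. *)
pose d3 := e / 2 / (nn k + 1) ^+ 2.
have k0 : 0 < (nn k + 1) ^+ 2 by rewrite exprn_gt0// ltr_wpDl// nn_ge0.
exists (Num.min (Num.min d1 d2) d3); first by rewrite !lt_min d10 d20 divr_gt0.
move=> s h s0 h0; rewrite !lt_min => /andP[/andP[hd1 hd2] hd3] sht.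
have sh0 : 0 <= s + h by rewrite addr_ge0// ltW.
have Da := DA_P D sh0; have Db := DA_P D s0.
have La := DA_fL2 Da; have Lb := DA_fL2 Db; have Lkb := DA_L2 Db.
have Ld := L2B La Lb.
have e1 : nn (P (s + h) f) ^+ 2 = nn (P s f) ^+ 2 + 2 * (ip (P (s + h) f) (P s f) - ip (P s f) (P s f)) +
  nn (fun x => P (s + h) f x - P s f x) ^+ 2.
 rewrite !nn_sqr (ipBl La Lb Ld) !(ipBr)// (ipC mu (P s f) (P (s + h) f)).
 by move: (ip _ _) (ip _ _) (ip _ _) => *; ring.
have n1 := H1 s h _ s0 h0 hd1 Lb; have n2 := H2 s h s0 h0 hd2.
have n3 : ip (P s k) (P s f) <= - c.
 have -> : ip (P s k) (P s f) = - Q (P s f) by rewrite (Q_DA Db) opprK.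
 rewrite lerN2 /c; have ts : 0 <= t - s by rewrite subr_ge0 (le_trans _ sht)// lerDl ltW.
 have := Q_P_le Db ts; have := P_add ts s0 Lf; rewrite subrK => h3.
 have -> : Q (P t f) = Q (P (t - s) (P s f)).
  by rewrite !QE (ng_ae (L2_m (P_L2 t0 Lf)) (L2_m (P_L2 ts Lb))).
 have : 0 <= 2 * (t - s) * nn (P (t - s) (P s k)) ^+ 2 by apply: mulr_ge0; [rewrite mulr_ge0|exact: sqr_ge0].
 by move=> h1 h2; rewrite -subr_ge0; exact: le_trans h1 h2.
have n4 : nn (fun x => P (s + h) f x - P s f x) ^+ 2 <= e / 2 * h.
 apply: (@le_trans _ _ ((h * (nn k + 1)) ^+ 2)).
  by rewrite ler_sqr ?nnegrE ?nn_ge0// mulr_ge0 ?(ltW h0)// addr_ge0 ?nn_ge0.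
 rewrite exprMn expr2 -mulrA [e / 2 * h]mulrC ler_pM2l//.
 by move: hd3; rewrite /d3 ltr_pdivlMr// => /ltW.
have n5 : e / 2 / M * h * nn (P s f) <= e / 4 * h.
 have n6 : nn (P s f) <= nn f by exact: P_nn.
 apply: (@le_trans _ _ (e / 2 / M * h * nn f)); first by rewrite ler_wpM2l// mulr_ge0// ltW.
 have -> : e / 2 / M * h * nn f = e / 4 * h * (2 * nn f / M) by field; rewrite gt_eqF.
 rewrite -[leRHS]mulr1 ler_wpM2l//; first by rewrite mulr_ge0 ?divr_ge0// ltW.
 by rewrite ler_pdivrMr// mul1r /M lerDr.
rewrite e1; move: n1 n3 n4 n5 h0; clear.
move: (e / 2 / M * h * _) (ip _ _) (ip _ _) (ip _ _) (nn _ ^+ 2) (nn _ ^+ 2) c => m a1 a2 a3 p q c.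
rewrite ler_norml => /andP[_ n1] n3 n4 n5 h0.
have : 0 <= h * (- c - a1) by rewrite mulr_ge0 ?subr_ge0// ltW.
lra.
Qed.

(** Chain the two decay estimates on the two halves of the time interval. This is the smoothing
    bound behind analyticity. *)
Lemma P_A_le f k t : DA f k -> 0 < t -> nn (P t k) <= nn f / t.
Proof.
move=> D t0; have t2 : 0 <= t / 2 by rewrite divr_ge0// ltW.
have Lk := DA_L2 D.
have h1 := nn_P_le D t2; have h2 := Q_P_le (DA_P D t2) t2.
have := P_add t2 t2 Lk; rewrite -splitr => /(nn_ae (P_L2 (ltW t0) Lk) (P_L2 t2 (P_L2 t2 Lk))) h3.
rewrite -h3 in h2; have := Q_ge0 (P (t / 2) (P (t / 2) f)) => q0.
rewrite -ler_sqr ?nnegrE ?divr_ge0 ?nn_ge0 ?(ltW t0)// exprMn exprVn ler_pdivlMr ?exprn_gt0//.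
have e1 : 2 * (t / 2) = t by field.
move: h1 h2 q0; rewrite e1; move: (Q _) (Q _) (nn _ ^+ 2) (nn _ ^+ 2) => q1 q2 a b h1 h2 q0.
rewrite mulrA; apply: le_trans h1; rewrite [leRHS]mulrC ler_pM2r//.
by rewrite mulrC; lra.
Qed.

(** On the domain this is [P_A_le]; the bound makes the Laplacians of approximants Cauchy, and the
    Laplacian is closed. *)
Lemma P_DA f t : L2 f -> 0 < t -> exists h, DA (P t f) h /\ nn h <= nn f / t.
Proof.
move=> Lf t0; have [u [k [D cu]]] := DA_dense_seq Lf.
have t0' := ltW t0; have Lu n := DA_fL2 (D n); have Lk n := DA_L2 (D n).
have LPk n := P_L2 t0' (Lk n).
have [|h Lh ch] := L2_cauchy LPk.
 move=> e e0; have et : 0 < e * t / 2 by rewrite divr_gt0// mulr_gt0.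
 have /cvgrPdist_lt/(_ _ et)[n0 _ n0P] := cu; exists n0 => m n mn nn0.
 have Dmn := DA_lin 1 (-1) (D m) (D n).
 have e1 : (fun x => 1 * u m x + -1 * u n x) = (fun x => u m x - u n x) by apply/funext => x; ring.
 have e2 : (fun x => 1 * k m x + -1 * k n x) = (fun x => k m x - k n x) by apply/funext => x; ring.
 rewrite e1 e2 in Dmn; have := P_A_le Dmn t0.
 have -> : nn (P t (fun x => k m x - k n x)) = nn (fun x => P t (k m) x - P t (k n) x).
  apply: (nn_ae (P_L2 t0' (L2B (Lk m) (Lk n))) (L2B (LPk m) (LPk n))); exact: P_B.
 move/le_lt_trans; apply; rewrite ltr_pdivrMr//.
 have := n0P m mn; have := n0P n nn0; rewrite !sub0r !normrN !ger0_norm ?nn_ge0//.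
 move=> h1 h2; apply: (le_lt_trans (nn_dist (Lu m) Lf (Lu n))); rewrite (nn_sym Lf (Lu n)); lra.
have cPu : nn (fun x => P t (u n) x - P t f x) @[n --> \oo] --> (0 : R).
 apply: (squeeze_cvgr _ (cvg_cst 0) cu); apply: nearW => n.
 by rewrite nn_ge0; exact: P_nnB.
exists h; split.
 apply: (DA_closed (fun n => DA_P (D n) t0') _ Lh cPu ch); exact: P_L2.
have c : nn (fun x => P t (k n) x - h x) + (nn f + nn (fun x => u n x - f x)) / t @[n --> \oo] --> 0 + (nn f + 0) / t.
 apply: cvgD => //; apply: cvgM; last exact: cvg_cst.
 by apply: cvgD => //; exact: cvg_cst.
rewrite add0r addr0 in c; apply: (cvgr_to_ge c); apply: nearW => n.
have e1 : h = (fun x => P t (k n) x - (P t (k n) x - h x)) by apply/funext => x; ring.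
rewrite {1}e1; apply: (le_trans (nnB (LPk n) (L2B (LPk n) Lh))); rewrite addrC lerD2l.
apply: (le_trans (P_A_le (D n) t0)); rewrite ler_pM2r ?invr_gt0//.
have e2 : u n = (fun x => f x + (u n x - f x)) by apply/funext => x; ring.
by rewrite {1}e2; exact: nnD Lf (L2B (Lu n) Lf).
Qed.

End one.
(** The function [s |-> ip (P s f) (P' (t - s) g)] has zero derivative, the common generator being
    symmetric. Allowing two semigroups yields self-adjointness and uniqueness together; exchanging
    the roles gives the other inequality. *)
Lemma dual2 P P' f h g k t : is_heat_semigroup mu P -> is_heat_semigroup mu P' ->
 DA f h -> DA g k -> 0 <= t -> ip (P t f) g <= ip f (P' t g).
Proof.
move=> SG SG' D D' t0; have Lf := DA_fL2 D; have Lg := DA_fL2 D'.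
have := @tel_slope R (fun s => ip (P s f) (P' (t - s) g)) 0 t t0.
rewrite mul0r addr0 subr0 subrr.
have -> : ip (P t f) (P' 0 g) = ip (P t f) g.
 by apply: ip_ae => //; [exact: P_L2|exact: P_L2|exact: P_L2|exact: ae_all|exact: P_0].
have -> : ip (P 0 f) (P' t g) = ip f (P' t g).
 by apply: ip_ae => //; [exact: P_L2|exact: P_L2|exact: P_L2|exact: P_0|exact: ae_all].
apply=> e e0; pose M := 1 + nn f + nn g.
have M0 : 0 < M by rewrite ltr_wpDr ?nn_ge0// ltr_wpDr ?nn_ge0.
have eM : 0 < e / M by rewrite divr_gt0.
have [d1 d10 H1] := P_step_ip SG D eM; have [d2 d20 H2] := P_step_ip SG' D' eM.
exists (Num.min d1 d2); first by rewrite lt_min d10.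
move=> s r s0 r0; rewrite lt_min => /andP[rd1 rd2] srt.
have ts : 0 <= t - (s + r) by rewrite subr_ge0.
have := H1 s r _ s0 r0 rd1 (P_L2 SG' ts Lg); have := H2 _ r _ ts r0 rd2 (P_L2 SG s0 Lf).
have -> : t - (s + r) + r = t - s by ring.
rewrite (ipC mu (P' (t - s) g)) !(ipC mu (P' (t - (s + r)) g)) (ipC mu (P' (t - (s + r)) k)).
have := DA_sym (DA_P SG D s0) (DA_P SG' D' ts) => ->.
have n1 := P_nn SG s0 Lf; have n2 := P_nn SG' ts Lg.
rewrite !ler_norml => /andP[h1 _] /andP[_ h2].
have h3 : e / M * r * nn (P s f) + e / M * r * nn (P' (t - (s + r)) g) <= e * r.
 have -> : e / M * r * nn (P s f) + e / M * r * nn (P' (t - (s + r)) g) =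
  e * r * ((nn (P s f) + nn (P' (t - (s + r)) g)) / M) by field; rewrite gt_eqF.
 rewrite -[leRHS]mulr1 ler_pM2l ?mulr_gt0// ler_pdivrMr// mul1r /M.
 by move: n1 n2; move: (nn _) (nn _) (nn f) (nn g) => *; lra.
move: h1 h2 h3; rewrite add0r; move: (_ * nn _) (_ * nn _) (ip _ _) (ip _ _) (ip _ _) (ip _ _) => *; lra.
Qed.

Lemma dual P P' f g t : is_heat_semigroup mu P -> is_heat_semigroup mu P' ->
 L2 f -> L2 g -> 0 <= t -> ip (P t f) g = ip f (P' t g).
Proof.
move=> SG SG' Lf Lg t0.
have [u [h [D cu]]] := DA_dense_seq Lf.
have [v [k [D' cv]]] := DA_dense_seq Lg.
have Lu n := DA_fL2 (D n); have Lv n := DA_fL2 (D' n).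
have cP (S : R -> (X -> R) -> X -> R) w w0 : is_heat_semigroup mu S -> (forall n : nat, L2 (w n)) -> L2 w0 ->
  nn (fun x => w n x - w0 x) @[n --> \oo] --> (0 : R) ->
  nn (fun x => S t (w n) x - S t w0 x) @[n --> \oo] --> (0 : R).
 move=> SS Lw Lw0 c; apply: (squeeze_cvgr _ (cvg_cst 0) c); apply: nearW => n.
 by rewrite nn_ge0; exact: P_nnB.
have l1 : ip (P t (u n)) (v n) @[n --> \oo] --> ip (P t f) g.
 exact: (ip_nn_cvg (fun n => P_L2 SG t0 (Lu n)) Lv (P_L2 SG t0 Lf) Lg (cP _ _ _ SG Lu Lf cu) cv).
have l2 : ip (u n) (P' t (v n)) @[n --> \oo] --> ip f (P' t g).
 exact: (ip_nn_cvg Lu (fun n => P_L2 SG' t0 (Lv n)) Lf (P_L2 SG' t0 Lg) cu (cP _ _ _ SG' Lv Lg cv)).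
apply: (cvg_unique _ l1); first exact: Rhausdorff.
suff -> : (fun n => ip (P t (u n)) (v n)) = (fun n => ip (u n) (P' t (v n))) by [].
apply/funext => n; apply/eqP; rewrite eq_le (dual2 SG SG' (D n) (D' n) t0)/=.
by rewrite ipC (ipC mu (P t (u n))); exact: (dual2 SG' SG (D' n) (D n) t0).
Qed.

(** Both flows have [P] as adjoint, so their difference is orthogonal to itself. *)
Lemma P_uniq P P' f t : is_heat_semigroup mu P -> is_heat_semigroup mu P' ->
 L2 f -> 0 <= t -> [ae x | P t f x = P' t f x].
Proof.
move=> SG SG' Lf t0; have L1 := P_L2 SG t0 Lf; have L1' := P_L2 SG' t0 Lf.
have L3 := L2B L1 L1'; have : nn (fun x => P t f x - P' t f x) = 0.
 apply/eqP; rewrite -sqrf_eq0 nn_sqr (ipBl L1 L1' L3) subr_eq0.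
 by rewrite (dual SG SG Lf L3 t0) (dual SG' SG).
by move=> /(nn_eq0 L3) /ae_imp; apply => x /eqP; rewrite subr_eq0 => /eqP.
Qed.

End semigroup.
Variable P : R -> (X -> R) -> (X -> R).
Hypothesis SG : is_heat_semigroup mu P.
Variable N : R.
Hypothesis N1 : 1 <= N.
Hypothesis BE : forall f t, W12 f -> 0 < t -> exists h u,
 [/\ is_laplacian mu (P t f) h, is_heat_L1 mu P t (fun x => ng f x ^+ 2) u &
   [ae x | ng (P t f) x ^+ 2 + RCD_coef 0 N t * h x ^+ 2 <= expR (- (2 * 0 * t)) * u x]].
Let N0 : 0 < N. Proof. exact: lt_le_trans ltr01 N1. Qed.

(** * Markov property and integrated Bakry-Ledoux bounds *)

Section markov.
Implicit Types (f g h k u v chi : X -> R) (a b c e r s t : R).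
Lemma nn_le f g : L2 f -> L2 g -> [ae x | `|f x| <= `|g x|] -> nn f <= nn g.
Proof.
move=> Lf Lg fg; rewrite -ler_sqr ?nnegrE ?nn_ge0// !nn_sqr; apply: leR_ae; [exact: integM|exact: integM|].
by apply: (ae_imp fg) => x h; rewrite -!expr2 -(real_normK (num_real (f x))) -(real_normK (num_real (g x))) ler_sqr.
Qed.

Lemma integM_ae M f g : meas f -> [ae x | `|f x| <= M] -> integ g ->
 integ (fun x => f x * g x).
Proof.
move=> mf fM ig; apply: (integ_dom_ae _ (integrZ measurableT M (integrable_norm ig))).
 by apply: mfunM => //; exact: integ_mfun ig.
by apply: (ae_imp fM) => x h; rewrite normrM ler_wpM2r.
Qed.

Lemma Q_le f g : W12 f -> W12 g -> [ae x | ng f x <= ng g x] -> Q f <= Q g.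
Proof.
move=> Wf Wg h; have [i1 <-] := ng2_int Wf; have [i2 <-] := ng2_int Wg.
by apply: (leR_ae i1 i2); apply: (ae_imp h) => x; rewrite ler_sqr ?nnegrE ?ng_ge0.
Qed.

(** Nondecreasing normal contractions; monotonicity is asked for so that [x - phi x] is a
    contraction too. *)
Definition mono1 (phi : R -> R) := phi 0 = 0 /\
 forall x y, y <= x -> 0 <= phi x - phi y <= x - y.

Lemma mono1_lip phi x y : mono1 phi -> `|phi x - phi y| <= `|x - y|.
Proof.
move=> [_ H]; have [yx|/ltW xy] := leP y x.
 by have /andP[h1 h2] := H x y yx; rewrite (ger0_norm h1) ger0_norm ?subr_ge0.
by have /andP[h1 h2] := H y x xy; rewrite distrC [leRHS]distrC (ger0_norm h1) ger0_norm ?subr_ge0.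
Qed.

Lemma lip1_m (phi : R -> R) : (forall x y, `|phi x - phi y| <= `|x - y|) -> meas phi.
Proof.
move=> lip; apply: continuous_measurable_fun => x; apply/cvgrPdist_lt => e e0.
by exists e => // y; exact: le_lt_trans (lip x y).
Qed.

Lemma mono1_L2 phi f : mono1 phi -> L2 f -> L2 (phi \o f).
Proof.
move=> H Lf; apply: (L2_dom _ Lf).
 by apply: mT_comp (L2_m Lf); apply: lip1_m => x y; exact: mono1_lip.
by apply: ae_all => x; have := mono1_lip (f x) 0 H; rewrite H.1 !subr0.
Qed.

Lemma lip1_W12 phi f : (forall x y, `|phi x - phi y| <= `|x - y|) -> phi 0 = 0 -> W12 f ->
 W12 (phi \o f) /\ [ae x | ng (phi \o f) x <= ng f x].
Proof.
move=> lip p0 Wf.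
have sl : strict_lip setT phi (fun=> 1) 1.
 split=> [x _|x y _ _|x _ e e0]; rewrite ?ler01 ?lexx ?mul1r//.
 by exists 1 => // y z _ _ _ _; apply: (le_trans (lip _ _)); rewrite mulrDl mul1r lerDl mulr_ge0// ltW.
have mp : meas (phi \o f) by apply: mT_comp (W12_m Wf); exact: lip1_m.
have Lp : L2 (phi \o f).
 apply: (L2_dom mp (W12_L2 Wf)); apply: ae_all => x /=.
 by have := lip (f x) 0; rewrite p0 !subr0.
have mc : meas ((fun=> 1 : R) \o f) by exact: measurable_cst.
have [W h] := W12_chain sl (fun=> I) mp mc Lp Wf.
by split=> //; apply: (ae_imp h) => x; rewrite mul1r.
Qed.

Lemma mono1_W12 phi f : mono1 phi -> W12 f -> W12 (phi \o f).
Proof.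
move=> H Wf; have [|//] := @lip1_W12 phi f _ H.1 Wf.
by move=> x y; exact: mono1_lip.
Qed.

(** Subtracting [phi \o f] from [f] is again a contraction of [f], so it does not raise the energy;
    expanding the square leaves twice [E (phi \o f) f] at least [Q (phi \o f)]. *)
Lemma mono1_E phi f : mono1 phi -> W12 f -> 0 <= E (phi \o f) f.
Proof.
move=> H Wf; have Wp := mono1_W12 H Wf.
have [] := @lip1_W12 (fun x => x + -1 * phi x) f _ _ Wf.
- move=> x y; wlog yx : x y / y <= x.
  by move=> W; have [|/ltW] := leP y x; [exact: W|move=> h; rewrite distrC [leRHS]distrC; exact: W].
 have /andP[h1 h2] := H.2 x y yx.
 by rewrite [leRHS]ger0_norm ?subr_ge0// ler_norml; apply/andP; split; lra.
- by rewrite H.1; ring.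
move=> W1 h1; have := Q_lin (-1) Wp Wf.
have : Q (fun x => f x + -1 * (phi \o f) x) <= Q f.
 exact: (Q_le W1 Wf h1).
have := Q_ge0 (phi \o f); move: (Q _) (Q _) (Q _) (E _ _) => *; lra.
Qed.

Definition trunc c r := Num.max 0 (r - c).

Definition clip r := Num.max (-1) (Num.min 1 r).

Lemma trunc_mono1 c : 0 <= c -> mono1 (trunc c).
Proof.
move=> c0; rewrite /trunc; split; first by rewrite sub0r; apply/max_idPl; rewrite oppr_le0.
move=> x y yx; case: (lerP 0 (x - c)) => h1; case: (lerP 0 (y - c)) => h2; lra.
Qed.

Lemma clip_mono1 : mono1 clip.
Proof.
rewrite /clip; split; first by rewrite /Num.min ltNge ler01 /= /Num.max; case: ifP; lra.
move=> x y yx; case: (lerP 1 x) => h1; case: (lerP 1 y) => h2; try lra.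
all: by rewrite /Num.max; do 2 case: ifP; move=> *; lra.
Qed.

Lemma trunc_sqr c a b : trunc c b ^+ 2 <= (trunc c a + (b - a)) ^+ 2.
Proof.
rewrite /trunc; case: (lerP 0 (b - c)) => h1; last by rewrite expr0n; exact: sqr_ge0.
rewrite ler_sqr ?nnegrE; case: (lerP 0 (a - c)) => h2; lra.
Qed.

(** The Leibniz formulas are for bounded functions, so bounded tests must suffice. The candidate is
    compared with the resolvent [u] of [f - h]: testing the equation of [w = u - f] on [w] clipped
    to [[-1, 1]] forces [w = 0]. *)
Lemma DA_bdd f h : W12 f -> L2 h -> (forall psi, W12 psi -> bdd psi -> E f psi = - ip h psi) -> DA f h.
Proof.
move=> Wf Lh H; have Lf := W12_L2 Wf; have Lg := L2B Lf Lh.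
have [u D] := resolvent Lg; have Wu := DA_W12 D; have Lu := W12_L2 Wu.
have Ww := W12B Wu Wf; have Lw := W12_L2 Ww.
set w := (fun x => u x - f x) in Ww Lw; have Wc := mono1_W12 clip_mono1 Ww; have Lc := W12_L2 Wc.
have bc : bdd (clip \o w).
 exists 1 => x /=; rewrite /clip ler_norml /Num.max /Num.min; do 2 case: ifP; move=> *; lra.
have e1 : ip w (clip \o w) + E w (clip \o w) = 0.
 rewrite /w (EBl Wu Wf Wc) (H _ Wc bc) (DA_E D Wc).
 by rewrite (ipBl Lu Lf Lc) (ipBl Lu Lg Lc) (ipBl Lf Lh Lc); ring.
have e2 : ip (clip \o w) (clip \o w) <= ip w (clip \o w).
 apply: leR_ae; [exact: integM|exact: integM|apply: ae_all => x /=].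
 by rewrite /clip /Num.max /Num.min; do 2 case: ifP; move=> *; nra.
have c0 : nn (clip \o w) = 0.
 apply/eqP; rewrite -sqrf_eq0 nn_sqr eq_le ip_ge0 andbT; apply: (le_trans e2).
 have := mono1_E clip_mono1 Ww; rewrite (EC Wc Ww); lra.
have w0 : [ae x | u x = f x].
 apply: (ae_imp (nn_eq0 Lc c0)) => x /=; rewrite /clip /w /Num.max /Num.min; do 2 case: ifP; move=> *; lra.
apply: (DA_ae D (W12_m Wf) (L2_m Lh) w0).
by apply: (ae_imp w0) => x ->; ring.
Qed.

(** The squared norm of the excess over [c] has derivative twice the product of the Laplacian with
    that excess, nonpositive by [mono1_E]. *)
Lemma trunc_DA c f k t : DA f k -> 0 <= c -> 0 <= t -> nn (trunc c \o P t f) <= nn (trunc c \o f).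
Proof.
move=> D c0 t0; have Lf := DA_fL2 D.
have mT := trunc_mono1 c0; have LT w : L2 w -> L2 (trunc c \o w) by exact: mono1_L2.
rewrite -ler_sqr ?nnegrE ?nn_ge0//.
have -> : nn (trunc c \o f) = nn (trunc c \o P 0 f).
 apply: nn_ae; [exact: LT|exact: LT (P_L2 SG _ Lf)|by apply: (ae_imp (P_0 SG Lf)) => x /= ->].
have := @tel_slope R (fun s => nn (trunc c \o P s f) ^+ 2) 0 t t0; rewrite mul0r addr0; apply=> e e0.
pose M := 1 + 4 * nn f; have M0 : 0 < M by rewrite ltr_pwDl// mulr_ge0// nn_ge0.
have e2 : 0 < e / 2 by rewrite divr_gt0. have eM : 0 < e / M by rewrite divr_gt0.
have [d1 d10 H1] := P_step_ip SG D eM; have [d2 d20 H2] := P_step_nn SG D ltr01.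
pose d3 := e / 2 / (nn k + 1) ^+ 2.
have k0 : 0 < (nn k + 1) ^+ 2 by rewrite exprn_gt0// ltr_wpDl// nn_ge0.
exists (Num.min (Num.min d1 d2) d3); first by rewrite !lt_min d10 d20 divr_gt0.
move=> s h s0 h0; rewrite !lt_min => /andP[/andP[hd1 hd2] hd3] sht.
have sh0 : 0 <= s + h by rewrite addr_ge0// ltW.
have Db := DA_P SG D s0; have Wb := DA_W12 Db.
have La := P_L2 SG sh0 Lf; have Lb := P_L2 SG s0 Lf; have Ld := L2B La Lb.
have Lv := LT _ Lb; set v := trunc c \o P s f in Lv *.
have n1 : nn (trunc c \o P (s + h) f) ^+ 2 <=
  nn v ^+ 2 + 2 * (ip (P (s + h) f) v - ip (P s f) v) + nn (fun x => P (s + h) f x - P s f x) ^+ 2.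
 have -> : nn v ^+ 2 + 2 * (ip (P (s + h) f) v - ip (P s f) v) + nn (fun x => P (s + h) f x - P s f x) ^+ 2
   = nn (fun x => v x + (P (s + h) f x - P s f x)) ^+ 2.
  rewrite -(ipBl La Lb Lv) !nn_sqr (ipDl Lv Ld (L2D Lv Ld)) !(ipDr Lv)// (ipC mu v (fun x => _ - _)).
  by move: (ip _ _) (ip _ _) (ip _ _) => *; ring.
 rewrite !nn_sqr; apply: leR_ae; [exact: integM (LT _ La) (LT _ La)|exact: integM (L2D Lv Ld) (L2D Lv Ld)|].
 by apply: ae_all => x; rewrite -!expr2; exact: trunc_sqr.
have n2 := H1 s h _ s0 h0 hd1 Lv; have n3 := H2 s h s0 h0 hd2.
have n4 : ip (P s k) v <= 0.
 have Wv := mono1_W12 mT Wb; have := mono1_E mT Wb; rewrite (EC Wv Wb).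
 by rewrite (DA_E Db Wv) oppr_ge0.
have n5 : nn (fun x => P (s + h) f x - P s f x) ^+ 2 <= e / 2 * h.
 apply: (@le_trans _ _ ((h * (nn k + 1)) ^+ 2)).
  by rewrite ler_sqr ?nnegrE ?nn_ge0// mulr_ge0 ?(ltW h0)// addr_ge0 ?nn_ge0.
 rewrite exprMn expr2 -mulrA [e / 2 * h]mulrC ler_pM2l//.
 by move: hd3; rewrite /d3 ltr_pdivlMr// => /ltW.
have n6 : e / M * h * nn v <= e / 4 * h.
 have n6 : nn v <= nn f.
  apply: le_trans (P_nn SG s0 Lf); apply: nn_le => //; apply: ae_all => x.
  by have := mono1_lip (P s f x) 0 mT; rewrite mT.1 !subr0.
 apply: (@le_trans _ _ (e / M * h * nn f)); first by rewrite ler_wpM2l// mulr_ge0// ltW.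
 have -> : e / M * h * nn f = e / 4 * h * (4 * nn f / M) by field; rewrite gt_eqF.
 rewrite -[leRHS]mulr1 ler_wpM2l//; first by rewrite mulr_ge0 ?divr_ge0// ltW.
 by rewrite ler_pdivrMr// mul1r /M lerDr.
apply: (le_trans n1); move: n2 n4 n5 n6 h0; clear.
move: (e / M * h * _) (ip _ _) (ip _ _) (ip _ _) (nn _ ^+ 2) (nn _ ^+ 2) => m a1 a2 a3 p q.
rewrite ler_norml => /andP[_ n1] n3 n4 n5 h0.
have : h * a1 <= 0 by rewrite pmulr_rle0.
lra.
Qed.

Lemma P_le c f t : L2 f -> 0 <= c -> 0 <= t -> [ae x | f x <= c] ->
 [ae x | P t f x <= c].
Proof.
move=> Lf c0 t0 fc; have [u [k [D cu]]] := DA_dense_seq Lf.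
have mT := trunc_mono1 c0; have LT w : L2 w -> L2 (trunc c \o w) by exact: mono1_L2.
have Lu n := DA_fL2 (D n); have LP := P_L2 SG t0 Lf.
have Td v w : L2 v -> L2 w -> nn (trunc c \o v) <= nn (trunc c \o w) + nn (fun x => v x - w x).
 move=> Lv Lw; have e1 : trunc c \o v = (fun x => (trunc c \o w) x + (trunc c (v x) - trunc c (w x))).
  by apply/funext => x /=; ring.
 have L1 := L2B (LT _ Lv) (LT _ Lw); rewrite {1}e1; apply: (le_trans (nnD (LT _ Lw) L1)).
 rewrite lerD2l; apply: (nn_le L1 (L2B Lv Lw)); apply: ae_all => x; exact: mono1_lip.
have T0 : nn (trunc c \o f) = 0.
 rewrite (@nn_ae _ _ _ mu _ (fun x => 0 * f x) (LT _ Lf) (L2Z 0 Lf)); first by rewrite (nnZ 0 Lf) normr0 mul0r.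
 by apply: (ae_imp fc) => x h; rewrite mul0r /trunc; apply/max_idPl; rewrite subr_le0.
have TP : nn (trunc c \o P t f) = 0.
 apply/eqP; rewrite eq_le nn_ge0 andbT.
 have cc : 2 * nn (fun x => u n x - f x) @[n --> \oo] --> (2 * 0 : R) by apply: cvgM => //; exact: cvg_cst.
 rewrite mulr0 in cc; apply: (cvgr_to_ge cc); apply: nearW => n.
 apply: (le_trans (Td _ _ LP (P_L2 SG t0 (Lu n)))).
 have h1 := trunc_DA (D n) c0 t0; have := Td _ _ (Lu n) Lf; rewrite T0 add0r => h2.
 have h3 := P_nnB SG t0 Lf (Lu n); rewrite (nn_sym Lf (Lu n)) in h3; lra.
apply: (ae_imp (nn_eq0 (LT _ LP) TP)) => x /=; rewrite /trunc /Num.max; case: ifP; move=> *; lra.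
Qed.

Lemma P_ge0 f t : L2 f -> 0 <= t -> [ae x | 0 <= f x] -> [ae x | 0 <= P t f x].
Proof.
move=> Lf t0 f0; have := P_le (L2Z (-1) Lf) (lexx 0) t0; move/(_ _)/ae_imp2 => H.
apply: (H _ _ _ (P_Z SG (-1) t0 Lf)); first by apply: (ae_imp f0) => x; rewrite mulN1r oppr_le0.
by move=> x h1 h2; rewrite h2 mulN1r oppr_le0 in h1.
Qed.

Lemma P_bdd f c t : L2 f -> 0 <= t -> 0 <= c -> [ae x | `|f x| <= c] ->
 [ae x | `|P t f x| <= c].
Proof.
move=> Lf t0 c0 fc.
have h1 : [ae x | P t f x <= c].
 by apply: P_le => //; apply: (ae_imp fc) => x; exact: le_trans (ler_norm _).
have h2 : [ae x | P t (fun z => -1 * f z) x <= c].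
 apply: (P_le (L2Z (-1) Lf)) => //; apply: (ae_imp fc) => x; rewrite mulN1r.
 by apply: le_trans; rewrite -normrN; exact: ler_norm.
apply: (ae_imp2 (ae_and h1 h2) (P_Z SG (-1) t0 Lf)) => x [h3 h4] h5.
by rewrite h5 mulN1r in h4; rewrite ler_norml h3 andbT lerNl.
Qed.

Lemma L2_indic n : L2 (\1_(cball n) : X -> R).
Proof.
have mB : measurable (cball n : set X) by apply: openMX; exact: open_cball.
have mI : meas (\1_(cball n) : X -> R) by exact: measurable_indic.
split=> //; have -> : (fun x : X => \1_(cball n) x ^+ 2) = (\1_(cball n) : X -> R).
 by apply/funext => x; rewrite indicE; case: (x \in _); rewrite ?expr1n ?expr0n.
apply: integ_fin => // ; rewrite integral_indic// setIT.
have := finite_compact (@propX (point : X) n.+1%:R); apply: le_lt_trans.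
apply: le_measure; rewrite ?inE//; last by apply: subset_trans (@subset_closure _ _) => x; rewrite /cball/= metric_sym => /ltW.
by rewrite -[X in measurable X]setCK; apply: measurableC; apply: openMX; apply: closed_openC; exact: closed_closure.
Qed.

(** Square roots turn the bounds on integrals into L2 bounds, so that [L2_fatou] passes to the union
    of the balls. *)
Lemma int_exhaust f c : meas f -> [ae x | 0 <= f x] ->
 (forall n, integ (fun x => \1_(cball n) x * f x) /\ ip (\1_(cball n)) f <= c) ->
 integ f /\ \int[mu]_x f x <= c.
Proof.
move=> mf f0 H; pose v x := Num.sqrt (f x).
have mv : meas v by apply: mT_comp mf; apply: continuous_measurable_fun; exact: sqrt_continuous.
have mB n : measurable (cball n : set X) by apply: openMX; exact: open_cball.
have mI n : meas (\1_(cball n) : X -> R) by exact: measurable_indic.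
have sq n : [ae x | \1_(cball n) x * f x = (\1_(cball n) x * v x) ^+ 2].
 apply: (ae_imp f0) => x h; rewrite exprMn sqr_sqrtr// indicE.
 by case: (x \in _); rewrite ?expr1n ?expr0n.
have mv2 n : meas (fun x => \1_(cball n) x * v x) by exact: mfunM.
have Lv n : L2 (fun x => \1_(cball n) x * v x).
 by split => //; apply: integ_ae (sq n) (H n).1; exact: mfunX.
have c0 : 0 <= c.
 apply: le_trans (H 0%N).2; rewrite /ip; have [i0 _] := H 0%N.
 have z0 : integ (fun=> 0 : R) by have := integrZ measurableT 0 i0; have -> : (fun x => 0 * (\1_(cball 0%N) x * f x)) = (fun=> 0) by apply/funext => x; rewrite mul0r.
 have := leR_ae z0 i0; have -> : \int[mu]_x (0 : R) = 0 by rewrite /Rintegral integral0.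
 apply.
 by apply: (ae_imp f0) => x h; rewrite mulr_ge0.
have nv n : nn (fun x => \1_(cball n) x * v x) <= Num.sqrt c.
 rewrite /nn ler_wsqrtr//; apply: le_trans (H n).2; apply: eq_leW.
 apply: Rint_ae; [exact: mfunM|exact: mfunM|].
 by apply: (ae_imp (sq n)) => x ->; rewrite expr2.
have [|[_ iv] nvc] := L2_fatou Lv mv _ nv.
 apply: ae_all => x; apply: cvg_near_cst; have [m mP'] : exists m : nat, mdist x (point : X) < m%:R.
  by exists (Num.bound (mdist x (point : X))); apply: archi_boundP; exact: mdist_ge0.
 exists m => // n /= mn; rewrite indicE mem_set ?mul1r//= /cball/=.
 by apply: (lt_le_trans mP'); rewrite ler_nat (leq_trans mn).
have fv : [ae x | v x ^+ 2 = f x] by apply: (ae_imp f0) => x h; rewrite sqr_sqrtr.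
split; first exact: integ_ae fv iv.
rewrite -(Rint_ae _ mf fv); last exact: mfunX.
have -> : \int[mu]_x (v x ^+ 2) = nn v ^+ 2 by rewrite nn_sqr.
by rewrite -(sqr_sqrtr c0) ler_sqr ?nnegrE ?nn_ge0.
Qed.

(** Duality with indicators of balls, whose images under [P t] stay below [1]. *)
Lemma P_int f t : L2 f -> integ f -> 0 <= t -> [ae x | 0 <= f x] ->
 integ (P t f) /\ \int[mu]_x P t f x <= \int[mu]_x f x.
Proof.
move=> Lf fi t0 f0; have LP := P_L2 SG t0 Lf; have P0 := P_ge0 Lf t0 f0; have mP := L2_m LP.
have bnd n : ip (\1_(cball n)) (P t f) <= \int[mu]_x f x.
 have Li := L2_indic n; rewrite ipC (dual SG SG Lf Li t0) ipC.
 apply: leR_ae => //; first exact: integM (P_L2 SG t0 Li) Lf.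
 have : [ae x | P t (\1_(cball n)) x <= 1].
  by apply: (P_le Li ler01 t0); apply: ae_all => x; rewrite lern1 leq_b1.
 by move=> h; apply: (ae_imp2 h f0) => x h1 h2; rewrite -[leRHS]mul1r ler_wpM2r.
apply: int_exhaust => // n; split; [exact: integM (L2_indic n) LP|exact: bnd].
Qed.

Lemma P_int_abs f t : L2 f -> integ f -> 0 <= t -> integ (P t f).
Proof.
move=> Lf fi t0; have La : L2 (fun x => `|f x|).
 apply: (L2_dom _ Lf); first by apply: mT_comp (L2_m Lf).
 by apply: ae_all => x; rewrite normr_id.
have [i _] := P_int La (integrable_norm fi) t0 (ae_all _ (fun x => normr_ge0 (f x))).
have h1 := P_ge0 (L2B La Lf) t0 (ae_all _ (fun x => _)).
have h2 := P_ge0 (L2D (L2Z 1 La) (L2Z 1 Lf)) t0 (ae_all _ (fun x => _)).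
apply: (integ_dom_ae (L2_m (P_L2 SG t0 Lf)) i).
have h3 : [ae x | 0 <= P t (fun x => `|f x| - f x) x].
 by apply: h1 => x; rewrite subr_ge0 ler_norm.
have h4 : [ae x | 0 <= P t (fun x => 1 * `|f x| + 1 * f x) x].
 by apply: h2 => x; rewrite !mul1r -lerBlDr sub0r -normrN ler_norm.
apply: (ae_imp2 (ae_and h3 h4) (ae_and (P_B SG t0 La Lf) (P_lin SG 1 1 t0 La Lf))) => x [e1 e2] [e3 e4].
by rewrite e3 in e1; rewrite e4 in e2; rewrite ler_norml; apply/andP; split; lra.
Qed.

Lemma L1_cvg (a : nat -> X -> R) g chi M : (forall n, integ (a n)) -> integ g ->
 Lnorm mu 1%:E (EFin \o (fun x => a n x - g x)) @[n --> \oo] --> 0%E ->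
 meas chi -> [ae x | `|chi x| <= M] ->
 \int[mu]_x (chi x * a n x) @[n --> \oo] --> \int[mu]_x (chi x * g x).
Proof.
move=> ia ig c mc cM.
have id n := integrB measurableT (ia n) ig.
have jn n : integ (fun x => `|a n x - g x|) by exact: integrable_norm (id n).
have e1 n : Lnorm mu 1%:E (EFin \o (fun x => a n x - g x)) = (\int[mu]_x `|a n x - g x|)%:E.
 rewrite Lnorm1 /Rintegral fineK//; exact: integrable_fin_num (jn n).
have c1 : \int[mu]_x `|a n x - g x| @[n --> \oo] --> (0 : R).
 have : (\int[mu]_x `|a n x - g x|)%:E @[n --> \oo] --> 0%E.
  by apply: cvg_trans c; apply: near_eq_cvg; apply: nearW => n; rewrite e1.
 by move=> h; exact: (fine_cvg h).
have c2 : `|M| * \int[mu]_x `|a n x - g x| @[n --> \oo] --> (0 : R).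
 by rewrite -[X in _ --> X](mulr0 `|M|); apply: cvgM => //; exact: cvg_cst.
apply/cvgrPdist_le => e e0; move/cvgrPdist_le : c2 => /(_ _ e0); apply: filterS => n.
rewrite sub0r normrN => h; apply: (le_trans _ (le_trans (ler_norm _) h)).
have i1 := integM_ae mc cM (ia n); have i2 := integM_ae mc cM ig.
rewrite distrC -RintegralB//; apply: (le_trans (le_normr_Rintegral _ _)) => //.
 exact: integrB.
have j1 := integrZ measurableT `|M| (jn n); rewrite -RintegralZl//.
apply: leR_ae => //; first by have := integrable_norm (integrB measurableT i1 i2).
apply: (ae_imp cM) => x cx; rewrite -mulrBr normrM ler_wpM2r//.
exact: le_trans cx (ler_norm M).
Qed.

(** Moving [P t] to the bounded test function identifies the L1 extension weakly, since L1
    convergence of the approximants passes through bounded weights. *)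
Lemma heat_L1 t g u chi M : 0 <= t -> is_heat_L1 mu P t g u -> L2 chi -> 0 <= M ->
 [ae x | `|chi x| <= M] -> \int[mu]_x (chi x * u x) = \int[mu]_x (P t chi x * g x).
Proof.
move=> t0 [/Lfun1_integrable ig /Lfun1_integrable iu [g_ [Lg_ c1 c2]]] Lc M0 cM.
have i1 n : integ (g_ n) by have [/Lfun1_integrable] := Lg_ n.
have L2g n : L2 (g_ n) by have [_ /L2_Lfun] := Lg_ n.
have LP := P_L2 SG t0 Lc; have PM := P_bdd Lc t0 M0 cM.
have l1 := L1_cvg i1 ig c1 (L2_m LP) PM.
have l2 := L1_cvg (fun n => P_int_abs (L2g n) (i1 n) t0) iu c2 (L2_m Lc) cM.
apply: (cvg_unique _ l2); first exact: Rhausdorff.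
suff -> : (fun n => \int[mu]_x (chi x * P t (g_ n) x)) = (fun n => \int[mu]_x (P t chi x * g_ n x)) by [].
by apply/funext => n; have := dual SG SG Lc (L2g n) t0.
Qed.

(** The hypothesis speaks of a local Laplacian [h]. Its own inequality bounds [h^2] by a multiple of
    the integrable [u], so [h] is in L2, and testing on compactly supported Lipschitz functions
    identifies it with [k]. *)
Lemma BE_DA f t k : W12 f -> 0 < t -> DA (P t f) k -> exists u,
 is_heat_L1 mu P t (fun x => ng f x ^+ 2) u /\
 [ae x | ng (P t f) x ^+ 2 + 2 * t / N * k x ^+ 2 <= u x].
Proof.
move=> Wf t0 D; have [h [u [[Wl [mh _] Hh] Hu H]]] := BE Wf t0; exists u; split => //.
have [_ /Lfun1_integrable iu _] := Hu; have Lk := DA_L2 D.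
have WP := DA_W12 D.
have H' : [ae x | ng (P t f) x ^+ 2 + 2 * t / N * h x ^+ 2 <= u x].
 by apply: (ae_imp H) => x; rewrite /RCD_coef eqxx mulr0 mul0r oppr0 expR0 mul1r.
have tN : 0 < 2 * t / N by rewrite divr_gt0// mulr_gt0.
have Lh : L2 h.
 split=> //; apply: (integ_dom_ae _ (integrZ measurableT (2 * t / N)^-1 iu)).
  exact: mfunX.
 apply: (ae_imp H') => x hx; rewrite ger0_norm ?sqr_ge0// mulrC ler_pdivlMr// mulrC.
 by apply: le_trans hx; rewrite lerDr sqr_ge0.
have hk : [ae x | h x - k x = 0].
 apply: (lipc_orth (L2_m (L2B Lh Lk))); first by move=> n; apply: L2_cball; exact: L2B.
 move=> chi lc _; have [L [_ _ _ Wc _]] := lipc_props lc; have Lc := W12_L2 Wc.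
 have : ip chi (fun x => h x - k x) = 0.
  rewrite (ipBr Lh Lk Lc) (ipC) (ipC mu chi).
  have [] := Hh chi; first by split=> //; exists (closure [set x | chi x != 0]); [exact: lc.2|
   apply: ae_all => x nx; apply/eqP; apply: contra_notT nx => cx; exact: subset_closure].
  move=> _; have [_ ->] := gam_int WP Wc; rewrite (DA_E D Wc).
  by move=> /eqP; rewrite /ip => /eqP ->; rewrite subrr.
 by [].
by apply: (ae_imp2 H' hk) => x h1 /eqP; rewrite subr_eq0 => /eqP <-.
Qed.

Lemma BE_weak f t k chi M : W12 f -> 0 < t -> DA (P t f) k -> L2 chi -> 0 <= M ->
 [ae x | 0 <= chi x <= M] ->
 \int[mu]_x (chi x * (ng (P t f) x ^+ 2 + 2 * t / N * k x ^+ 2)) <= \int[mu]_x (P t chi x * ng f x ^+ 2).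
Proof.
move=> Wf t0 D Lc M0 cM; have [u [Hu H]] := BE_DA Wf t0 D.
have cM' : [ae x | `|chi x| <= M].
 by apply: (ae_imp cM) => x /andP[h1 h2]; rewrite ger0_norm.
rewrite -(heat_L1 (ltW t0) Hu Lc M0 cM'); have [_ /Lfun1_integrable iu _] := Hu.
have Lk := DA_L2 D; have WP := DA_W12 D.
have [i1 _] := ng2_int WP; have i2 := integrZ measurableT (2 * t / N) Lk.2.
have i3 := integrD measurableT i1 i2.
apply: leR_ae; [exact: integM_ae (L2_m Lc) cM' i3|exact: integM_ae (L2_m Lc) cM' iu|].
by apply: (ae_imp2 H cM) => x h1 /andP[h2 _]; rewrite ler_wpM2l.
Qed.

(** A bounded gradient makes [|grad f|^2] square integrable, so [u] is [P t] of it in the L2 sense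
    and inherits the bound [L ^ 2]. *)
Lemma BE_bound f t k L : W12 f -> 0 < t -> DA (P t f) k -> [ae x | ng f x <= L] ->
 [ae x | ng (P t f) x ^+ 2 + 2 * t / N * k x ^+ 2 <= L ^+ 2].
Proof.
move=> Wf t0 D fL; have [u [Hu H]] := BE_DA Wf t0 D; have t0' := ltW t0.
have [_ /Lfun1_integrable iu _] := Hu; have [ig _] := ng2_int Wf.
have gL : [ae x | ng f x ^+ 2 <= L ^+ 2].
 by apply: (ae_imp fL) => x h; rewrite lerXn2r ?nnegrE ?ng_ge0// (le_trans (ng_ge0 _ _) h).
have Lg : L2 (fun x => ng f x ^+ 2).
 by apply: (@L2_bounded _ _ _ _ (L ^+ 2)) => //; apply: (ae_imp gL) => x; rewrite ger0_norm ?sqr_ge0.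
have LP := P_L2 SG t0' Lg.
have : [ae x | u x - P t (fun x => ng f x ^+ 2) x = 0].
 apply: (lipc_orth).
 - by apply: mfunB; [exact: integ_mfun iu|exact: L2_m LP].
 - move=> n; apply: integrB; first by apply: openMX; exact: open_cball.
   by apply: (integrableS measurableT _ _ iu) => //; apply: openMX; exact: open_cball.
  exact: L2_cball.
 move=> chi lc c0; have [K [mc [M bM] _ Wc _]] := lipc_props lc; have Lc := W12_L2 Wc.
 have bM' : [ae x | `|chi x| <= M] by exact: ae_all.
 have -> : (fun x => chi x * (u x - P t (fun x0 => ng f x0 ^+ 2) x)) =
  (fun x => chi x * u x - chi x * P t (fun x0 => ng f x0 ^+ 2) x) by apply/funext => x; rewrite mulrBr.
 have j1 := integM_ae mc bM' iu; have j2 := integM Lc LP.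
 rewrite (RintegralB measurableT j1 j2) (heat_L1 t0' Hu Lc (bddM_ge0 bM) bM').
 have := dual SG SG Lc Lg t0'; rewrite /ip => ->; exact: subrr.
move=> e1; have e2 := P_le Lg (sqr_ge0 L) t0' gL.
apply: (ae_imp2 H (ae_and e1 e2)) => x h1 [/eqP]; rewrite subr_eq0 => /eqP <- h2; exact: le_trans h1 h2.
Qed.

End markov.

(** * Leibniz and chain rules for the Laplacian *)

Section calculus.
Implicit Types (f g h k u v w a b chi psi : X -> R) (c e r s t M L C : R).
Lemma L2_bddM f g : meas f -> bdd f -> L2 g -> L2 (fun x => f x * g x).
Proof. by move=> mf [M fM]; apply: (@L2M _ _ _ _ M) => //; exact: ae_all. Qed.

Lemma gamMr f g h : W12 f -> W12 g -> W12 h -> bdd f -> bdd g -> bdd h ->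
 [ae x | Gam g (fun z => f z * h z) x = f x * Gam g h x + h x * Gam g f x].
Proof.
move=> Wf Wg Wh bf bg bh; have [W H] := W12M Wf Wh bf bh.
have b := bddM bf bh.
apply: (ae_imp2 (ae_and (gamC Wg W bg b) (H g Wg))
 (ae_and (gamC Wg Wh bg bh) (gamC Wg Wf bg bf))).
by move=> x [-> ->] [-> ->].
Qed.

Lemma gam_L2 L f g : W12 f -> W12 g -> [ae x | ng f x <= L] -> L2 (Gam f g).
Proof.
move=> Wf Wg fL; apply: (L2_dom (gam_m Wf Wg) (L2Z `|L| (ng_L2 Wg))).
apply: (ae_imp2 (gam_le Wf Wg) fL) => x h1 h2; apply: (le_trans h1).
by rewrite normrM normr_id (ger0_norm (ng_ge0 g x)) ler_wpM2r ?ng_ge0// (le_trans h2)// ler_norm.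
Qed.

(** Integration by parts: [psi * a + Gam u psi] is the divergence of [psi grad u], square integrable
    because [|grad u|] is bounded. *)
Lemma int_psi_gam L u a psi w : DA u a -> bdd u -> W12 psi -> bdd psi -> W12 w -> bdd w ->
 [ae x | ng u x <= L] ->
 L2 (fun x => psi x * a x + Gam u psi x) /\
 \int[mu]_x (psi x * Gam u w x) = - ip w (fun x => psi x * a x + Gam u psi x).
Proof.
move=> D bu Wp bp Ww bw uL; have Wu := DA_W12 D; have La := DA_L2 D.
have LG := gam_L2 Wu Wp uL; have Lpa := L2_bddM (W12_m Wp) bp La; split; first exact: L2D.
have [Wpw _] := W12M Wp Ww bp bw.
have [i1 e1] := gam_int Wu Wpw; have Lw := W12_L2 Ww.
rewrite (ipDr Lpa LG Lw) opprD.
have -> : - ip w (fun x => psi x * a x) = E u (fun x => psi x * w x).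
 rewrite (DA_E D Wpw); congr (- _); apply: eq_Rintegral => x _; ring.
have i2 := integM Lw LG; rewrite -e1 -(RintegralB measurableT i1 i2).
apply: Rint_ae.
- by apply: mfunM; [exact: W12_m Wp|exact: gam_m].
- by apply: mfunB; [exact: integ_mfun i1|exact: integ_mfun i2].
by apply: (ae_imp (gamMr Wp Wu Ww bp bu bw)) => x ->; rewrite addrK.
Qed.

Lemma ar_neg3 (p q r : R) : - (- p - q + r) = p + q - r.
Proof. by ring. Qed.

Lemma DA_mul L u a psi b : DA u a -> DA psi b -> bdd u -> bdd psi -> [ae x | ng u x <= L] ->
 DA (fun x => psi x * u x) (fun x => psi x * a x + u x * b x + 2 * Gam u psi x).
Proof.
move=> D D' bu bp uL; have Wu := DA_W12 D; have Wp := DA_W12 D'.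
have La := DA_L2 D; have Lb := DA_L2 D'.
have LG := gam_L2 Wu Wp uL; have L1 := L2_bddM (W12_m Wp) bp La; have Lub := L2_bddM (W12_m Wu) bu Lb.
have [Wpu H] := W12M Wp Wu bp bu.
have L12 := L2D L1 Lub; have LG2 := L2Z 2 LG.
apply: (DA_bdd Wpu); first exact: L2D.
move=> g Wg bg; have Lg := W12_L2 Wg.
have [Wpg _] := W12M Wp Wg bp bg; have [Wug _] := W12M Wu Wg bu bg.
rewrite (ipDl L12 LG2 Lg) (ipDl L1 Lub Lg) (ipZl 2 LG Lg).
have [i0 <-] := gam_int Wpu Wg.
have -> : ip (fun x => psi x * a x) g = - E u (fun x => psi x * g x).
 rewrite (DA_E D Wpg) opprK; apply: eq_Rintegral => x _; ring.
have -> : ip (fun x => u x * b x) g = - E psi (fun x => u x * g x).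
 rewrite (DA_E D' Wug) opprK; apply: eq_Rintegral => x _; ring.
have [i1 <-] := gam_int Wu Wpg; have [i2 <-] := gam_int Wp Wug.
have i3 := integM LG Lg; have i4 := integrZ measurableT 2 i3.
have i12 := integrD measurableT i1 i2.
rewrite ar_neg3 -(RintegralD measurableT i1 i2) /ip -(RintegralZl 2 measurableT i3) -(RintegralB measurableT i12 i4).
apply: Rint_ae.
- exact: integ_mfun i0.
- by apply: mfunB; [exact: integ_mfun i12|exact: integ_mfun i4].
apply: (ae_imp2 (ae_and (gamMr Wp Wu Wg bp bu bg) (gamMr Wu Wp Wg bu bp bg))
 (ae_and (H g Wg) (gamC Wp Wu bp bu))) => x [-> ->] [-> ->].
by move: (Gam u psi x) (Gam psi g x) (Gam u g x) (g x) (psi x) (u x) => *; ring.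
Qed.

Section log.
Variable dl : R.
Hypothesis dl0 : 0 < dl.
Definition qd u x := (u x + dl)^-1.

(** [- qd u] shifted so as to vanish where [u] does, which puts it in W12. *)
Definition qm u x := dl^-1 - (u x + dl)^-1.

(** This is [ln (u + dl) - ln dl], normalised to vanish with [u] so that it lies in L2. *)
Definition lg u x := ln (1 + u x / dl).

Lemma qd_bounds u x : 0 <= u x -> 0 < qd u x <= dl^-1.
Proof.
move=> u0; have h : 0 < u x + dl by exact: ltr_wpDl.
by rewrite /qd invr_gt0 h/= lef_pV2 ?posrE// lerDr.
Qed.

Lemma qd_m u : meas u -> (forall x, 0 <= u x) -> meas (qd u).
Proof.
(* The factor [dl ^ 2] makes the truncated reciprocal [1]-Lipschitz, hence measurable. *)
move=> mu_ u0; pose phi (y : R) := dl ^+ 2 * (Num.max 0 y + dl)^-1.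
have -> : qd u = (fun x => dl ^- 2 * phi (u x)).
 apply/funext => x; rewrite /phi /qd (max_idPr (u0 x)) mulrA mulVf ?mul1r// expf_neq0// gt_eqF//.
apply: mfunM => //; apply: mT_comp mu_; apply: lip1_m => x y.
rewrite /phi -mulrBr normrM ger0_norm ?exprn_ge0 ?(ltW dl0)// mulrC -ler_pdivlMr ?exprn_gt0//.
apply: (le_trans (inv_lip dl0 _ _)); rewrite ?lerDr ?le_max ?lexx//.
rewrite ler_pM2r ?invr_gt0 ?exprn_gt0//.
have -> : Num.max 0 x + dl - (Num.max 0 y + dl) = Num.max 0 x - Num.max 0 y by ring.
by have := mono1_lip x y (trunc_mono1 (lexx 0)); rewrite /trunc !subr0.
Qed.

Lemma lg_W12 u : W12 u -> (forall x, 0 <= u x) ->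
 [/\ W12 (lg u), forall x, 0 <= lg u x <= dl^-1 * u x &
  [ae x | ng (lg u) x <= (u x + dl)^-1 * ng u x]].
Proof.
move=> Wu u0; have mu' := W12_m Wu.
have lg0 x : 0 <= lg u x <= dl^-1 * u x.
 have ud : 0 <= u x / dl by rewrite divr_ge0// ltW.
 by rewrite mulrC ln_ge0 ?lerDl//= le_ln1Dx; lra.
have mlg : meas (lg u).
 have -> : lg u = @ln R \o (fun x => 1 + dl^-1 * u x) by apply/funext => x; rewrite /lg mulrC.
 by apply: mT_comp => //; apply: mfunD => //; exact: mfunM.
have Llg : L2 (lg u).
 apply: (L2_dom mlg (L2Z dl^-1 (W12_L2 Wu))); apply: ae_all => x; have /andP[h1 h2] := lg0 x.
 by rewrite !ger0_norm//; exact: le_trans h2.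
have [W h] := chain_W12 (sdiff_log dl0) u0 Wu mlg (qd_m mu' u0) Llg.
split=> //; apply: (ae_imp h) => x; congr (_ <= _ * _).
by rewrite gtr0_norm// invr_gt0 ltr_wpDl.
Qed.

Variables (M L : R) (u a : X -> R).
Hypotheses (D : DA u a) (u0 : forall x, 0 <= u x <= M) (uL : [ae x | ng u x <= L]).
Let u00 x : 0 <= u x. Proof. by have /andP[] := u0 x. Qed.
Let Wu := DA_W12 D.

Let mu' := W12_m Wu.

Let bu : bdd u. Proof. by exists M => x; have /andP[h1 h2] := u0 x; rewrite ger0_norm. Qed.

Lemma lg_props : [/\ W12 (lg u), bdd (lg u), forall x, 0 <= lg u x,
 [ae x | ng (lg u) x = qd u x * ng u x] &
 forall g, W12 g -> [ae x | Gam g (lg u) x = qd u x * Gam g u x] /\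
 [ae x | Gam (lg u) g x = qd u x * Gam u g x]].
Proof.
have sd := sdiff_log dl0; have mq := qd_m mu' u00; have [W lg0 _] := lg_W12 Wu u00.
have mlg := W12_m W; have Llg := W12_L2 W.
split=> //.
- exists (dl^-1 * M) => x; have /andP[h1 h2] := lg0 x; rewrite ger0_norm//; apply: (le_trans h2).
 by rewrite ler_pM2l ?invr_gt0//; have /andP[] := u0 x.
- by move=> x; have /andP[] := lg0 x.
- apply: (ae_imp (ng_chain sd u00 Wu mlg mq Llg)) => x ->.
 by rewrite gtr0_norm; have /andP[] := qd_bounds (u00 x).
- move=> g Wg; split; first exact: (gam_chain2 sd u00 Wu mlg mq Llg Wg).
 exact: (gam_chain1 sd u00 Wu mlg mq Llg Wg).
Qed.

Lemma qm_props : [/\ W12 (qm u), bdd (qm u) &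
 forall g, W12 g -> [ae x | Gam g (qm u) x = qd u x ^+ 2 * Gam g u x]].
Proof.
have mq := qd_m mu' u00.
have mqm : meas (qm u) by exact: mfunB.
have q0 x : 0 <= qm u x <= dl^-1.
 have /andP[h1 h2] := qd_bounds (u00 x); rewrite /qm /qd in h1 h2 *; lra.
have Lqm : L2 (qm u).
 apply: (L2_dom mqm (L2Z (dl ^- 2) (W12_L2 Wu))); apply: ae_all => x.
 have [_ _ _] := sdiff_inv dl0; have [_ lip _] := sdiff_inv dl0.
 by have := lip (u x) 0 (u00 x) (lexx _); rewrite add0r subrr !subr0 normrM [`|_ ^- 2|]ger0_norm// invr_ge0 exprn_ge0// ltW.
have sd := sdiff_inv dl0.
have mq2 : meas ((fun x : R => (x + dl) ^- 2) \o u).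
 have -> : (fun x : R => (x + dl) ^- 2) \o u = (fun x => qd u x ^+ 2) by apply/funext => x; rewrite /qd exprVn.
 exact: mfunX.
have [W h] := chain_W12 sd u00 Wu mqm mq2 Lqm.
split=> //; first by exists dl^-1 => x; have /andP[h1 h2] := q0 x; rewrite ger0_norm.
move=> g Wg; apply: (ae_imp (gam_chain2 sd u00 Wu mqm mq2 Lqm Wg)) => x ->.
by rewrite /qd exprVn.
Qed.

Definition lap_lg x := qd u x * a x - qd u x ^+ 2 * ng u x ^+ 2.

Lemma bdd_qd : bdd (qd u).
Proof. by exists dl^-1 => x; have /andP[h1 h2] := qd_bounds (u00 x); rewrite gtr0_norm. Qed.

Lemma ng2_L2 : L2 (fun x => ng u x ^+ 2).
Proof.
have [i _] := ng2_int Wu; apply: (@L2_bounded _ _ _ _ (L ^+ 2)) => //.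
apply: (ae_imp uL) => x h; rewrite ger0_norm ?sqr_ge0// lerXn2r ?nnegrE ?ng_ge0//.
exact: le_trans (ng_ge0 _ _) h.
Qed.

Lemma DA_lg : DA (lg u) lap_lg.
Proof.
have [Wl bl l0 ngl gl] := lg_props; have [Wm bm gm] := qm_props.
have La := DA_L2 D; have mq := qd_m mu' u00.
have L1 := L2_bddM mq bdd_qd La; have Lg2 := ng2_L2.
have mq2 : meas (fun x => qd u x ^+ 2) by exact: mfunX.
have bq2 : bdd (fun x => qd u x ^+ 2) by exact: bddM bdd_qd bdd_qd.
have L2' := L2_bddM mq2 bq2 Lg2.
apply: (DA_bdd Wl); first exact: L2B.
move=> g Wg bg; have Lg := W12_L2 Wg; rewrite (ipBl L1 L2' Lg).
have [i0 <-] := gam_int Wl Wg.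
have [Wgm _] := W12M Wg Wm bg bm.
(* [qd u] need not be in L2, so the test function [g * qd u] is written as [dl^-1 * g - g * qm u],
   with both terms in W12. *)
have Wdg := W12Z dl^-1 Wg; have Ws := W12B Wdg Wgm.
have -> : ip (fun x => qd u x * a x) g = - E u (fun x => dl^-1 * g x - g x * qm u x).
 rewrite (DA_E D Ws) opprK; apply: eq_Rintegral => x _.
 by rewrite /qm /qd; ring.
have [i1 <-] := gam_int Wu Ws; have i2 := integM L2' Lg.
rewrite opprD !opprK -(RintegralD measurableT i1 i2).
apply: Rint_ae; [exact: integ_mfun i0|by apply: mfunD; [exact: integ_mfun i1|exact: integ_mfun i2]|].
have bdg := bddZ dl^-1 bg; have bgm := bddM bg bm.
apply: (ae_imp2 (ae_and (ae_and (gl g Wg).2 (gamBr Wdg Wgm Wu bdg bgm bu))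
 (ae_and (gamMr Wg Wu Wm bg bu bm) (gm u Wu)))
 (ae_and (ae_and (gamC Wu Wdg bu bdg) (gamZ dl^-1 Wg Wu))
  (ae_and (gamC Wg Wu bg bu) (gam_self Wu)))).
move=> x [[-> ->] [-> ->]] [[-> ->] [-> ->]]; rewrite /qm /qd.
by move: (ng u x) (Gam u g x) (u x + dl)^-1 (g x) => *; ring.
Qed.

End log.
(** Only differences have to be in L2, which covers limits such as [qd u] that need not be. *)
Definition cvL2 (f_ : nat -> X -> R) f := (forall n, L2 (fun x => f_ n x - f x)) /\
 nn (fun x => f_ n x - f x) @[n --> \oo] --> (0 : R).

Lemma cvL2_le (f_ g_ : nat -> X -> R) f g c : (forall n, meas (fun x => g_ n x - g x)) ->
 (forall n, [ae x | `|g_ n x - g x| <= c * `|f_ n x - f x|]) -> cvL2 f_ f -> cvL2 g_ g.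
Proof.
move=> mg H [Lf cf]; have Lg n : L2 (fun x => g_ n x - g x).
 apply: (L2_dom (mg n) (L2Z c (Lf n))); apply: (ae_imp (H n)) => x h; apply: (le_trans h).
 by rewrite normrM ler_wpM2r// ler_norm.
split=> //; have cc : `|c| * nn (fun x => f_ n x - f x) @[n --> \oo] --> (0 : R).
 by rewrite -[X in _ --> X](mulr0 `|c|); apply: cvgM => //; exact: cvg_cst.
apply: (squeeze_cvgr _ (cvg_cst 0) cc); apply: nearW => n; rewrite nn_ge0 /= -(nnZ c (Lf n)).
apply: (nn_le (Lg n) (L2Z c (Lf n))); apply: (ae_imp (H n)) => x h; apply: (le_trans h).
by rewrite normrM ler_wpM2r// ler_norm.
Qed.

Lemma cvL2D (f_ g_ : nat -> X -> R) f g s t : cvL2 f_ f -> cvL2 g_ g ->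
 cvL2 (fun n x => s * f_ n x + t * g_ n x) (fun x => s * f x + t * g x).
Proof.
move=> [Lf cf] [Lg cg].
have e1 n : (fun x => s * f_ n x + t * g_ n x - (s * f x + t * g x)) =
 (fun x => s * (f_ n x - f x) + t * (g_ n x - g x)) by apply/funext => x; ring.
have L1 n := L2Z s (Lf n); have L3 n := L2Z t (Lg n).
split=> [n|]; first by rewrite e1; exact: L2D.
have cc : `|s| * nn (fun x => f_ n x - f x) + `|t| * nn (fun x => g_ n x - g x) @[n --> \oo] --> `|s| * 0 + `|t| * 0.
 by apply: cvgD; apply: cvgM => //; exact: cvg_cst.
rewrite !mulr0 addr0 in cc; apply: (squeeze_cvgr _ (cvg_cst 0) cc); apply: nearW => n.
by rewrite nn_ge0 e1 -(nnZ s (Lf n)) -(nnZ t (Lg n)); exact: nnD.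
Qed.

Lemma cvL2M (f_ g_ : nat -> X -> R) f g K K' : cvL2 f_ f -> cvL2 g_ g ->
 (forall n, meas (g_ n)) -> meas f ->
 [ae x | `|f x| <= K] -> (forall n, [ae x | `|g_ n x| <= K']) ->
 cvL2 (fun n x => f_ n x * g_ n x) (fun x => f x * g x).
Proof.
move=> [Lf cf] [Lg cg] mg mf fK gK.
have e1 n : (fun x => f_ n x * g_ n x - f x * g x) =
 (fun x => g_ n x * (f_ n x - f x) + f x * (g_ n x - g x)) by apply/funext => x; ring.
have L1 n := L2M (mg n) (gK n) (Lf n); have L3 n := L2M mf fK (Lg n).
split=> [n|]; first by rewrite e1; exact: L2D.
have cc : `|K'| * nn (fun x => f_ n x - f x) + `|K| * nn (fun x => g_ n x - g x) @[n --> \oo] --> `|K'| * 0 + `|K| * 0.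
 by apply: cvgD; apply: cvgM => //; exact: cvg_cst.
rewrite !mulr0 addr0 in cc; apply: (squeeze_cvgr _ (cvg_cst 0) cc); apply: nearW => n.
rewrite nn_ge0 e1 -(nnZ K' (Lf n)) -(nnZ K (Lg n)); apply: (le_trans (nnD (L1 n) (L3 n))).
apply: lerD; apply: nn_le => //; try exact: L2Z.
- by apply: (ae_imp (gK n)) => x h; rewrite !normrM ler_wpM2r// (le_trans h)// ler_norm.
- by apply: (ae_imp fK) => x h; rewrite !normrM ler_wpM2r// (le_trans h)// ler_norm.
Qed.

Lemma cvL2_L2 (f_ : nat -> X -> R) f n : cvL2 f_ f -> L2 f -> L2 (f_ n).
Proof.
move=> [Lf _] L; have -> : f_ n = (fun x => (f_ n x - f x) + f x) by apply/funext => x; ring.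
exact: L2D.
Qed.

Lemma cvL2_ip (f_ g_ : nat -> X -> R) f g : cvL2 f_ f -> cvL2 g_ g -> L2 f -> L2 g ->
 ip (f_ n) (g_ n) @[n --> \oo] --> ip f g.
Proof.
move=> cf cg Lf Lg.
exact: (ip_nn_cvg (fun n => cvL2_L2 n cf Lf) (fun n => cvL2_L2 n cg Lg) Lf Lg cf.2 cg.2).
Qed.

Lemma cvL2_cst f : meas f -> cvL2 (fun=> f) f.
Proof.
move=> mf; have -> : cvL2 (fun=> f) f = cvL2 (fun _ _ => 0) (fun=> 0).
 by rewrite /cvL2; have -> : (fun x => f x - f x) = (fun x => 0 - 0) by apply/funext => x; rewrite !subrr.
have L0 : L2 (fun x : X => 0 - 0) by rewrite subrr; exact: L20.
split=> [//|]; have -> : nn (fun x : X => 0 - 0) = 0; last exact: cvg_cst.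
by have := nnZ 0 (L20 mu); rewrite mulr0 normr0 mul0r subrr.
Qed.

Lemma cvL2_ae (f_ g_ : nat -> X -> R) f : cvL2 f_ f -> (forall n, meas (fun x => g_ n x - f x)) ->
 (forall n, [ae x | f_ n x = g_ n x]) -> cvL2 g_ f.
Proof.
move=> cf mg fg; apply: (@cvL2_le f_ _ _ _ 1 mg _ cf) => n.
by apply: (ae_imp (fg n)) => x ->; rewrite mul1r.
Qed.

End calculus.
Implicit Types (f g h k u v w a b chi psi phi : X -> R) (c e r s t M L C dl : R) (x y z : X).

(** * The differential inequality for the tested quantity *)

Section liyau_step.
(** The remainder [P_rem f a s] has derivative [P s a - a]. *)
Lemma P_sup f a t K : DA f a -> 0 <= t ->
 (forall s, 0 <= s -> s <= t -> nn (fun x => P s a x - a x) <= K) -> nn (P_rem P f a t) <= K * t.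
Proof.
move=> D t0 H; have Lf := DA_fL2 D; have La := DA_L2 D.
have LR s : 0 <= s -> L2 (P_rem P f a s) by move=> s0; exact: P_rem_L2.
have := @tel_slope R (fun s => nn (P_rem P f a s)) K t t0.
have -> : nn (P_rem P f a 0) = 0.
 rewrite (@nn_ae _ _ _ mu _ (fun x => 0 * f x) (LR 0 (lexx _)) (L2Z 0 Lf)); first by rewrite (nnZ 0 Lf) normr0 mul0r.
 by apply: (ae_imp (P_0 SG Lf)) => x e1; rewrite /P_rem e1 subrr !mul0r subrr.
rewrite add0r; apply=> e e0; have [d1 d10 H1] := P_step SG D e0.
exists d1 => // s h s0 h0 hd sht; have [r [Lr nr re]] := H1 s h s0 h0 hd.
have sh0 : 0 <= s + h by rewrite addr_ge0// ltW.
have LPa := P_L2 SG s0 La; have L1 := L2Z h (L2B LPa La); have L3 := L2D (LR s s0) L1.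
rewrite (@nn_ae _ _ _ mu _ (fun x => P_rem P f a s x + h * (P s a x - a x) + r x) (LR _ sh0) (L2D L3 Lr)); last first.
 by apply: (ae_imp re) => x e1; rewrite /P_rem e1; ring.
apply: (le_trans (nnD L3 Lr)); apply: (@le_trans _ _ (nn (P_rem P f a s) + h * nn (fun x => P s a x - a x) + e * h)).
 by apply: lerD => //; apply: (le_trans (nnD (LR s s0) L1)); rewrite (nnZ h (L2B LPa La)) gtr0_norm.
rewrite mulrDl addrA lerD2r lerD2l mulrC ler_pM2r//; apply: H => //.
by apply: le_trans sht; rewrite lerDl ltW.
Qed.

Lemma P_cvL2 (v_ : nat -> X -> R) v (tau : nat -> R) : cvL2 v_ v -> L2 v -> (forall n, 0 <= tau n) ->
 tau n @[n --> \oo] --> (0 : R) -> cvL2 (fun n => P (tau n) (v_ n)) v.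
Proof.
move=> cv Lv t0 ct; have Lv_ n := cvL2_L2 n cv Lv; have LP n := P_L2 SG (t0 n) (Lv_ n).
split=> [n|]; first exact: L2B.
apply/cvgrPdist_lt => e e0; have e2 : 0 < e / 2 by rewrite divr_gt0.
have [dl d0 H] := P_cont SG Lv e2.
move/cvgrPdist_lt : ct => /(_ _ d0) ct; move/cvgrPdist_lt : cv.2 => /(_ _ e2) cn.
apply: filterS2 ct cn => n; rewrite !sub0r !normrN => h1 h2.
rewrite ger0_norm ?nn_ge0//; have LPv := P_L2 SG (t0 n) Lv.
apply: (le_lt_trans (nn_dist (LP n) LPv Lv)); have := P_nnB SG (t0 n) (Lv_ n) Lv.
have := H _ (t0 n) (le_lt_trans (ler_norm _) h1); rewrite ger0_norm ?nn_ge0 in h2; lra.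
Qed.

(** The functions vary with [n]: [P_sup] bounds the remainder by the oscillation of [P s (a_ n)],
    which is uniformly small because [a_ n] converges. *)
Lemma gen_cvg (v_ a_ : nat -> X -> R) a (tau : nat -> R) : (forall n, DA (v_ n) (a_ n)) ->
 cvL2 a_ a -> L2 a -> (forall n, 0 < tau n) -> tau n @[n --> \oo] --> (0 : R) ->
 cvL2 (fun n x => (tau n)^-1 * (P (tau n) (v_ n) x - v_ n x)) a.
Proof.
move=> D ca La t0 ct; have Lv n := DA_fL2 (D n); have La_ n := DA_L2 (D n).
have LP n := P_L2 SG (ltW (t0 n)) (Lv n).
have Lx n := L2Z (tau n)^-1 (L2B (LP n) (Lv n)).
split=> [n|]; first exact: L2B.
apply/cvgrPdist_lt => e e0; have e2 : 0 < e / 4 by rewrite divr_gt0.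
have [dl d0 H] := P_cont SG La e2.
move/cvgrPdist_lt : ct => /(_ _ d0) ct; move/cvgrPdist_lt : ca.2 => /(_ _ e2) cn.
apply: filterS2 ct cn => n; rewrite !sub0r !normrN => h1 h2; rewrite !ger0_norm ?nn_ge0// in h2 *.
have h3 : nn (P_rem P (v_ n) (a_ n) (tau n)) <= (e / 4 + e / 4 + e / 4) * tau n.
 apply: P_sup => // [|s s0 st]; first exact: ltW.
 have LPa := P_L2 SG s0 La; have LPa_ := P_L2 SG s0 (La_ n).
 apply: (le_trans (nn_dist LPa_ LPa (La_ n))); have := P_nnB SG s0 (La_ n) La.
 have := nn_dist LPa La (La_ n); rewrite (nn_sym La (La_ n)).
 have := H s s0 (le_lt_trans st (le_lt_trans (ler_norm _) h1)); lra.
apply: (le_lt_trans (nn_dist (Lx n) (La_ n) La)).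
have Lr := P_rem_L2 SG (ltW (t0 n)) (Lv n) (La_ n).
have -> : (fun x => (tau n)^-1 * (P (tau n) (v_ n) x - v_ n x) - a_ n x) =
 (fun x => (tau n)^-1 * P_rem P (v_ n) (a_ n) (tau n) x).
 by apply/funext => x; rewrite /P_rem; field; rewrite gt_eqF.
rewrite (nnZ (tau n)^-1 Lr) ger0_norm ?invr_ge0 ?(ltW (t0 n))//.
have : (tau n)^-1 * nn (P_rem P (v_ n) (a_ n) (tau n)) <= e / 4 + e / 4 + e / 4.
 by rewrite mulrC ler_pdivrMr.
lra.
Qed.

(** What a bounded datum with bounded gradient gains along the flow. The bounds on [u] hold at every
    point so that the chain rules for functions of a nonnegative variable apply. *)
Definition nice M L C u a := [/\ DA u a, forall x, 0 <= u x <= M,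
 [ae x | ng u x <= L] & [ae x | `|a x| <= C]].

Lemma nice_bdd M L C u a : nice M L C u a -> bdd u.
Proof. by move=> [_ h _ _]; exists M => x; have /andP[h1 h2] := h x; rewrite ger0_norm. Qed.

Lemma ng_dist u v : W12 u -> W12 v ->
 [ae x | `|ng u x - ng v x| <= ng (fun z => u z - v z) x].
Proof.
move=> Wu Wv; have Wd := W12B Wu Wv.
have [_ h1] := W12_lin 1 1 Wv Wd; have [_ h2] := W12_lin 1 (-1) Wu Wd.
have e1 : (fun x => 1 * v x + 1 * (u x - v x)) = u by apply/funext => x; ring.
have e2 : (fun x => 1 * u x + -1 * (u x - v x)) = v by apply/funext => x; ring.
rewrite e1 in h1; rewrite e2 in h2; apply: (ae_imp2 h1 h2) => x.
by rewrite normrN1 normr1 !mul1r => g1 g2; rewrite ler_norml; apply/andP; split; lra.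
Qed.

Lemma ar_pt (x1 x2 x3 x4 x5 x6 c : R) : x1 * (x2 * x5) <= x1 * ((x4 ^+ 2 - (x2 * x3) ^+ 2) / (2 * 1)) ->
 x1 * x2 * (x3 ^+ 2 * x2) + 2 * (x1 * x2 * x5) + c * (x1 * x6 ^+ 2) <= x1 * (x4 ^+ 2 + c * x6 ^+ 2).
Proof.
rewrite mulr1; have -> : x1 * ((x4 ^+ 2 - (x2 * x3) ^+ 2) / 2) = (x1 * x4 ^+ 2 - x1 * (x2 * x3) ^+ 2) / 2 by field.
move=> h; have -> : x1 * x2 * (x3 ^+ 2 * x2) = x1 * (x2 * x3) ^+ 2 by ring.
have -> : 2 * (x1 * x2 * x5) = 2 * (x1 * (x2 * x5)) by ring.
by rewrite mulrDr [x1 * (c * _)]mulrCA; lra.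
Qed.

Lemma ar_fin (p q c g e t a : R) : p + 2 * q + c <= g -> e <= c ->
 p - a + (2 * q + e - t) <= g - t - a.
Proof. by lra. Qed.

Lemma ar_sqsum (p q r : R) : 0 <= p -> 0 <= q -> r ^+ 2 <= q * p -> r ^+ 2 <= (p + q) ^+ 2.
Proof.
move=> p0 q0 h; apply: (le_trans h); have := mulr_ge0 q0 p0; have := sqr_ge0 q; have := sqr_ge0 p; lra.
Qed.

Section conv.
Variables (M L C dl : R).
Hypothesis dl0 : 0 < dl.
Variables (v_ a_ : nat -> X -> R) (u a : X -> R).
Hypotheses (nu : nice M L C u a) (nv : forall n, nice M L C (v_ n) (a_ n)).
Hypotheses (cv : cvL2 v_ u) (ca : cvL2 a_ a).
Let Wu : W12 u. Proof. by case: nu => D _ _ _; exact: DA_W12 D. Qed.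
Let Wv n : W12 (v_ n). Proof. by case: (nv n) => D _ _ _; exact: DA_W12 D. Qed.
Let u0 x : 0 <= u x. Proof. by case: nu => _ h _ _; have /andP[] := h x. Qed.
Let v0 n x : 0 <= v_ n x. Proof. by case: (nv n) => _ h _ _; have /andP[] := h x. Qed.

(** The energy of [v_ n - u] is controlled by the L2 norms of the differences of functions and of
    Laplacians; bounded gradients then take care of the squares. *)
Lemma cvL2_ng2 : cvL2 (fun n x => ng (v_ n) x ^+ 2) (fun x => ng u x ^+ 2).
Proof.
have [D _ uL _] := nu.
apply: (@cvL2_le (fun n => ng (fun z => v_ n z - u z)) _ (fun=> 0) _ (2 * L)).
- move=> n; apply: mfunB; apply: mfunX; exact: (ng_m).
- move=> n; have [_ _ vL _] := nv n; apply: (ae_imp2 (ng_dist (Wv n) Wu) (ae_and uL vL)) => x h [h1 h2].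
 rewrite subr0 subr_sqr normrM [leRHS]mulrC (ger0_norm (ng_ge0 (fun z => _) x)).
 apply: ler_pM => //; rewrite ger0_norm ?addr_ge0 ?ng_ge0//; lra.
split=> [n|]; first by apply: L2B (L20 mu); exact: (ng_L2 (W12B (Wv n) Wu)).
have c2 : nn (fun x => v_ n x - u x) + nn (fun x => a_ n x - a x) @[n --> \oo] --> (0 + 0 : R).
 by apply: cvgD; [exact: cv.2|exact: ca.2].
rewrite addr0 in c2; apply: (squeeze_cvgr _ (cvg_cst 0) c2); apply: nearW => n; rewrite nn_ge0 /=.
have [Dn _ _ _] := nv n; have Dd := DA_lin 1 (-1) Dn D.
have e1 : (fun x => 1 * v_ n x + -1 * u x) = (fun x => v_ n x - u x) by apply/funext => x; ring.
have e2 : (fun x => 1 * a_ n x + -1 * a x) = (fun x => a_ n x - a x) by apply/funext => x; ring.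
rewrite e1 e2 in Dd; have := Q_DA Dd; rewrite QE -nn_sqr => e3.
have -> : (fun x => ng (fun z => v_ n z - u z) x - 0) = ng (fun z => v_ n z - u z) by apply/funext => x; rewrite subr0.
have := CS (DA_L2 Dd) (DA_fL2 Dd).
have := nn_ge0 mu (fun x => v_ n x - u x); have := nn_ge0 mu (fun x => a_ n x - a x).
rewrite -normrN -e3 ger0_norm ?sqr_ge0//.
have := nn_ge0 mu (ng (fun z => v_ n z - u z)).
move: (nn _) (nn _) (nn _) => p q r p0 q0 r0 h; rewrite -ler_sqr ?nnegrE ?addr_ge0//.
exact: ar_sqsum h.
Qed.

Lemma qd_mf n : meas (qd dl (v_ n)). Proof. exact: qd_m (W12_m (Wv n)) (v0 n). Qed.

Lemma qd_mu : meas (qd dl u). Proof. exact: qd_m (W12_m Wu) u0. Qed.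

Lemma qd_abs w x : 0 <= w x -> `|qd dl w x| <= dl^-1.
Proof. by move=> w0; have /andP[h1 h2] := qd_bounds dl0 w0; rewrite gtr0_norm. Qed.

Lemma cvL2_qd : cvL2 (fun n => qd dl (v_ n)) (qd dl u).
Proof.
apply: (@cvL2_le v_ _ u _ (dl ^- 2)) => // [n|n].
 by apply: mfunB; [exact: qd_mf|exact: qd_mu].
apply: ae_all => x; have := @inv_lip R dl (v_ n x + dl) (u x + dl) dl0.
rewrite !lerDr => /(_ (v0 n x) (u0 x)); rewrite opprD addrACA subrr addr0 mulrC; exact.
Qed.
Let g2b : [ae x | `|ng u x ^+ 2| <= L ^+ 2].
Proof.
have [_ _ uL _] := nu; apply: (ae_imp uL) => x h; rewrite ger0_norm ?sqr_ge0// lerXn2r ?nnegrE ?ng_ge0//.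
exact: le_trans (ng_ge0 _ _) h.
Qed.
Let mg2 : meas (fun x => ng u x ^+ 2).
Proof. by apply: mfunX; exact: ng_m. Qed.

Lemma cvL2_ngq : cvL2 (fun n x => ng (v_ n) x ^+ 2 * qd dl (v_ n) x) (fun x => ng u x ^+ 2 * qd dl u x).
Proof.
apply: (@cvL2M _ _ _ _ (L ^+ 2) dl^-1 cvL2_ng2 cvL2_qd qd_mf mg2 g2b) => n.
by apply: ae_all => x; exact: qd_abs.
Qed.

Lemma cvL2_ngq2 : cvL2 (fun n x => ng (v_ n) x ^+ 2 * qd dl (v_ n) x * qd dl (v_ n) x)
 (fun x => ng u x ^+ 2 * qd dl u x * qd dl u x).
Proof.
apply: (@cvL2M _ _ _ _ (L ^+ 2 * dl^-1) dl^-1 cvL2_ngq cvL2_qd qd_mf).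
- by apply: mfunM => //; exact: qd_mu.
- by apply: (ae_imp g2b) => x h; rewrite normrM ler_pM//; exact: qd_abs.
- by move=> n; apply: ae_all => x; exact: qd_abs.
Qed.

Lemma cvL2_lap : cvL2 (fun n => lap_lg dl (v_ n) (a_ n)) (lap_lg dl u a).
Proof.
have [D _ _ aC] := nu; have ma := L2_m (DA_L2 D).
have c1 : cvL2 (fun n x => a_ n x * qd dl (v_ n) x) (fun x => a x * qd dl u x).
 apply: (@cvL2M _ _ _ _ C dl^-1 ca cvL2_qd qd_mf ma aC) => n.
 by apply: ae_all => x; exact: qd_abs.
have := cvL2D 1 (-1) c1 cvL2_ngq2.
have -> : (fun x => 1 * (a x * qd dl u x) + -1 * (ng u x ^+ 2 * qd dl u x * qd dl u x)) = lap_lg dl u a.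
 by apply/funext => x; rewrite /lap_lg; ring.
have -> // : (fun n x => 1 * (a_ n x * qd dl (v_ n) x) + -1 * (ng (v_ n) x ^+ 2 * qd dl (v_ n) x * qd dl (v_ n) x))
 = (fun n => lap_lg dl (v_ n) (a_ n)).
by apply/funext => n; apply/funext => x; rewrite /lap_lg; ring.
Qed.

End conv.
Lemma weighted_CS chi b : meas chi -> (forall x, 0 <= chi x) -> bdd chi -> integ chi -> L2 b ->
 ip chi b ^+ 2 <= (\int[mu]_x chi x) * \int[mu]_x (chi x * b x ^+ 2).
Proof.
move=> mc c0 [K cK] ic Lb; pose s x := Num.sqrt (chi x).
have ms : meas s.
 by apply: mT_comp mc; apply: continuous_measurable_fun; exact: sqrt_continuous.
have ss x : s x * s x = chi x by rewrite -expr2 sqr_sqrtr.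
have Ls : L2 s by split => //; have -> : (fun x => s x ^+ 2) = chi by apply/funext => x; rewrite expr2.
have Lsb : L2 (fun x => s x * b x).
 apply: (@L2M _ _ _ _ (Num.sqrt K)) => //; apply: ae_all => x.
 by rewrite ger0_norm ?sqrtr_ge0// ler_wsqrtr// (le_trans (ler_norm _)).
have := CS2 Ls Lsb.
have -> : ip s (fun x => s x * b x) = ip chi b by apply: eq_Rintegral => x _; rewrite mulrA ss.
have -> : ip s s = \int[mu]_x chi x by apply: eq_Rintegral => x _; rewrite ss.
have -> // : ip (fun x => s x * b x) (fun x => s x * b x) = \int[mu]_x (chi x * b x ^+ 2).
by apply: eq_Rintegral => x _; rewrite -ss; ring.
Qed.

(** A representative with bounds at every point; it agrees with [f] almost everywhere as soon as [f]
    satisfies them almost everywhere. *)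
Definition clampf (K : R) f x := Num.max 0 (Num.min K (f x)).

Lemma clampf_bounds K f x : 0 <= K -> 0 <= clampf K f x <= K.
Proof. by move=> K0; rewrite /clampf le_max lexx ge_max K0 ge_min lexx. Qed.

Lemma clampf_m K f : meas f -> meas (clampf K f).
Proof. by move=> mf; apply: measurable_maxr => //; exact: measurable_minr. Qed.

Lemma clampf_ae K f : [ae x | 0 <= f x] -> [ae x | f x <= K] ->
 [ae x | f x = clampf K f x].
Proof. by move=> h1 h2; apply: (ae_imp2 h1 h2) => x p q; rewrite /clampf (min_idPr q) (max_idPr p). Qed.

Section step.
Variables (M L C dl M0 : R).
Hypotheses (dl0 : 0 < dl) (M00 : 0 < M0).
Variables (psi b u a : X -> R).
Hypotheses (Dp : DA psi b) (p0 : forall x, 0 <= psi x <= M) (bC : [ae x | `|b x| <= C]).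
Hypothesis (nu : nice M L C u a).
(** Minus the Laplacian of [ln (u + dl)] tested against [psi (u + dl)]; the Li-Yau inequality is an
    upper bound for it. *)
Definition Yf psi u a := ip psi (fun x => ng u x ^+ 2 * qd dl u x - a x).

(** The weight put into the Bakry-Ledoux inequality: times [qd dl u] it gives back [psi], and its
    mass is the denominator of the quadratic term. *)
Definition chif x := psi x * (u x + dl).

Hypotheses (ichi : integ chif) (chiM : \int[mu]_x chif x <= M0).
Let D : DA u a. Proof. by case: nu. Qed.
Let Wu : W12 u. Proof. exact: DA_W12 D. Qed.
Let Lu : L2 u. Proof. exact: W12_L2. Qed.
Let La : L2 a. Proof. exact: DA_L2 D. Qed.
Let Wp : W12 psi. Proof. exact: DA_W12 Dp. Qed.
Let Lp : L2 psi. Proof. exact: W12_L2. Qed.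
Let Lb : L2 b. Proof. exact: DA_L2 Dp. Qed.
Let bp : bdd psi. Proof. by exists M => x; have /andP[h1 h2] := p0 x; rewrite ger0_norm. Qed.
Let bu : bdd u. Proof. exact: nice_bdd nu. Qed.
Let u0 x : 0 <= u x. Proof. by case: nu => _ h _ _; have /andP[] := h x. Qed.
Let uM x : u x <= M. Proof. by case: nu => _ h _ _; have /andP[] := h x. Qed.
Let psi0 x : 0 <= psi x. Proof. by have /andP[] := p0 x. Qed.
Let psiM x : psi x <= M. Proof. by have /andP[] := p0 x. Qed.
Let M_ge0 : 0 <= M. Proof. exact: le_trans (psi0 point) (psiM point). Qed.
Let uL : [ae x | ng u x <= L]. Proof. by case: nu. Qed.
Let Lpu : L2 (fun x => psi x * u x). Proof. exact: L2_bddM (W12_m Wp) bp Lu. Qed.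
Let chiE : chif = (fun x => 1 * (psi x * u x) + dl * psi x).
Proof. by apply/funext => x; rewrite /chif; ring. Qed.
Let Lchi : L2 chif. Proof. by rewrite chiE; apply: L2D; exact: L2Z. Qed.
Let chi0 x : 0 <= chif x. Proof. by rewrite /chif mulr_ge0// addr_ge0// ltW. Qed.
Let chiK x : chif x <= M * (M + dl).
Proof. by rewrite /chif ler_pM ?addr_ge0 ?(ltW dl0)// lerD2r. Qed.
Let chib : bdd chif. Proof. by exists (M * (M + dl)) => x; rewrite ger0_norm. Qed.
Let chiq x : chif x * qd dl u x = psi x.
Proof.
rewrite /chif /qd; have ne : u x + dl != 0 by rewrite gt_eqF// ltr_wpDl.
by rewrite -mulrA (mulfV ne) mulr1.
Qed.

(** The divergence of [psi grad u]. *)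
Definition Bf x := psi x * a x + Gam u psi x.

Let LB : L2 Bf.
Proof. by apply: L2D; [exact: L2_bddM (W12_m Wp) bp La|exact: gam_L2 uL]. Qed.
Let u0M x : 0 <= u x <= M. Proof. by rewrite u0 uM. Qed.

(** The squared gradient of [lg dl v]. *)
Definition Gf v x := ng v x ^+ 2 * qd dl v x * qd dl v x.

Lemma ngq_L2 v a' : nice M L C v a' -> L2 (fun x => ng v x ^+ 2 * qd dl v x) /\ L2 (Gf v).
Proof.
move=> [Dv v0M vL _]; have Wv := DA_W12 Dv; have v0 x : 0 <= v x by have /andP[] := v0M x.
have L1 := ng2_L2 Dv vL; have mq := qd_m dl0 (W12_m Wv) v0.
have bq : bdd (qd dl v) by exists dl^-1 => x; exact: qd_abs.
have Lq (f : X -> R) : L2 f -> L2 (fun x => f x * qd dl v x).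
 by move=> Lf; have := L2_bddM mq bq Lf; have -> : (fun x => qd dl v x * f x) = (fun x => f x * qd dl v x) by apply/funext => x; rewrite mulrC.
by split; [exact: Lq|exact: Lq (Lq _ L1)].
Qed.

Section one.
Variables (tau : R) (v a' psi' : X -> R).
Hypotheses (t0 : 0 < tau) (nv : nice M L C v a') (mpsi' : meas psi').
Hypotheses (psi'P : [ae x | psi' x = P tau psi x]) (psi'0 : forall x, 0 <= psi' x <= M).
Hypothesis (uP : [ae x | u x = P tau v x]).
Let t0' := ltW t0.

Let Dv : DA v a'. Proof. by case: nv. Qed.
Let v0M x : 0 <= v x <= M. Proof. by case: nv. Qed.
Let Wv : W12 v. Proof. exact: DA_W12 Dv. Qed.
Let v0 x : 0 <= v x. Proof. by have /andP[] := v0M x. Qed.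
Let Lv : L2 v. Proof. exact: W12_L2. Qed.
Let La' : L2 a'. Proof. exact: DA_L2 Dv. Qed.
Let Lpsi' : L2 psi'. Proof. by apply: (L2_ae mpsi' (ae_sym psi'P)); exact: P_L2. Qed.

Definition hf := lg dl v.

Definition Ahf := lap_lg dl v a'.

Definition pf := clampf (M / dl) (P tau hf).

(** Per unit of time, the failure of [P tau] to carry [psi u] to the product of the evolved [psi']
    and the earlier [v]; its limit is [2 Bf]. *)
Definition Af x := tau^-1 * (P tau (fun x => psi x * u x) x - psi' x * v x).

Lemma hf_props : [/\ DA hf Ahf, forall x, 0 <= hf x, forall x, hf x <= M / dl & W12 hf].
Proof.
have vL : [ae x | ng v x <= L] by case: nv.
have Dh := DA_lg dl0 Dv v0M vL; split=> //; last exact: DA_W12 Dh.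
 by have [_ _ h _ _] := lg_props dl0 Dv v0M.
move=> x; rewrite /hf /lg; apply: (le_trans (le_ln1Dx _)).
 by apply: (@lt_le_trans _ _ 0); rewrite ?oppr_lt0// divr_ge0// ltW.
by rewrite ler_pM2r ?invr_gt0; have /andP[] := v0M x.
Qed.

Lemma pf_props : [/\ DA pf (P tau Ahf), [ae x | P tau hf x = pf x], W12 pf & bdd pf].
Proof.
have [Dh h0 hM Wh] := hf_props; have Lh := W12_L2 Wh.
have Md : 0 <= M / dl by rewrite divr_ge0// ltW.
have e1 : [ae x | P tau hf x = pf x].
 apply: clampf_ae; first by apply: (P_ge0 Lh t0'); exact: ae_all.
 by apply: (P_le Lh Md t0'); exact: ae_all.
have LPA := P_L2 SG t0' (DA_L2 Dh).
have mp : meas pf by apply: clampf_m; exact: L2_m (P_L2 SG t0' Lh).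
have Dpf : DA pf (P tau Ahf).
 by apply: (DA_ae (DA_P SG Dh t0') mp (L2_m LPA) e1); exact: ae_all.
split=> //; first exact: DA_W12 Dpf.
by exists (M / dl) => x; have /andP[h1 h2] := clampf_bounds (P tau hf) x Md; rewrite ger0_norm.
Qed.

(** Self-adjointness moves [P tau] from [psi] to [a'], and [P tau a'] is the Laplacian of [u]: this
    part of [Yf] is constant. *)
Lemma step_drift : ip psi' a' = ip psi a.
Proof.
have LPp := P_L2 SG t0' Lp; have LPa := P_L2 SG t0' La'.
rewrite (ip_ae Lpsi' La' LPp La' psi'P (ae_all _ (fun => erefl))).
rewrite (dual SG SG Lp La' t0'); apply: ip_ae => //; first exact: ae_all.
have D1 := DA_P SG Dv t0'.
apply: (DA_uniq _ D).
by apply: (DA_ae D1 (W12_m Wu) (L2_m LPa) (ae_sym uP)); exact: ae_all.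
Qed.

(** Up to [tau * Af], [P tau chif] is [psi' (v + dl)], and [(v + dl) * Gf v] is the gradient part of
    [Yf psi' v a']. *)
Lemma step_main : ip psi' (fun x => ng v x ^+ 2 * qd dl v x) =
 ip (P tau chif) (Gf v) - tau * ip Af (Gf v).
Proof.
have [L1 LG] := ngq_L2 nv; have LPpu := P_L2 SG t0' Lpu.
have bp' : bdd psi' by exists M => x; have /andP[h1 h2] := psi'0 x; rewrite ger0_norm.
have Lpv : L2 (fun x => psi' x * v x) by exact: L2_bddM mpsi' bp' Lv.
have LA : L2 Af by rewrite /Af; exact: (L2Z tau^-1 (L2B LPpu Lpv)).
rewrite -(ipZl tau LA LG).
have -> : (fun x => tau * Af x) = (fun x => P tau (fun x => psi x * u x) x - psi' x * v x).
 by apply/funext => x; rewrite /Af mulrA mulfV ?mul1r// gt_eqF.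
have LPc := P_L2 SG t0' Lchi.
rewrite -(ipBl LPc (L2B LPpu Lpv) LG).
have Ldp := L2Z dl Lpsi'; have Ls := L2D Ldp Lpv.
transitivity (ip (fun x => dl * psi' x + psi' x * v x) (Gf v)).
 apply: eq_Rintegral => x _; rewrite /Gf /qd.
 have : v x + dl != 0 by rewrite gt_eqF// ltr_wpDl.
 by move: (ng v x) (v x) (psi' x) => p q r ne; field.
apply: (ip_ae Ls LG (L2B LPc (L2B LPpu Lpv)) LG); last exact: ae_all.
have h1 := P_lin SG 1 dl t0' Lpu Lp; rewrite -chiE in h1.
by apply: (ae_imp2 h1 psi'P) => x -> ->; ring.
Qed.

(** The Bakry-Ledoux inequality for [hf] over time [tau], weighted by [chif]. Its right side is
    rewritten by [step_main], its gradient term is bounded below by convexity around [lg dl u], and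
    Cauchy-Schwarz against the mass [M0] turns its Laplacian term into a square. *)
Lemma step_one : Yf psi u a + (2 * ip (fun x => lg dl u x - pf x) Bf +
  2 / (N * M0) * tau * ip chif (P tau Ahf) ^+ 2 - tau * ip Af (Gf v)) <= Yf psi' v a'.
Proof.
have [L1 LG] := ngq_L2 nv; have [L1u LGu] := ngq_L2 nu.
have [Dh h0 hM Wh] := hf_props; have [Dpf pE Wpf bpf] := pf_props.
have [Wk bk k0 ngk gk] := lg_props dl0 D u0M.
have [_ _ _ ngh _] := lg_props dl0 Dv v0M.
have LPc := P_L2 SG t0' Lchi; have Lbn := P_L2 SG t0' (DA_L2 Dh).
set bn := P tau Ahf in Lbn *.
rewrite {1}/Yf (ipBr L1u La Lp) /Yf (ipBr L1 La' Lpsi') step_drift step_main.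
have Lk := W12_L2 Wk; have Lpf := W12_L2 Wpf; have Lh := W12_L2 Wh.
have Wz := W12B Wpf Wk; set z := (fun x => pf x - lg dl u x) in Wz.
have bz : bdd z.
 have := bddD bpf (bddZ (-1) bk); have -> // : (fun x => pf x + -1 * lg dl u x) = z.
 by apply/funext => x; rewrite /z mulN1r.
have [_ zE] := int_psi_gam D bu Wp bp Wz bz uL.
have e1 : ip (fun x => lg dl u x - pf x) Bf = \int[mu]_x (psi x * Gam u z x).
 rewrite zE -/(Bf) (ipBl Lk Lpf LB) (ipBl Lpf Lk LB); ring.
have c0 : 0 <= M * (M + dl) by rewrite mulr_ge0// addr_ge0// ltW.
have BEw := BE_weak Wh t0 (DA_P SG Dh t0') Lchi c0
 (ae_all _ (fun x => (_ : 0 <= chif x <= M * (M + dl)))).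
have {BEw} BEw := BEw (fun x => introT andP (conj (chi0 x) (chiK x))).
have e2 : ng (P tau hf) = ng pf.
 by apply: (ng_ae (L2_m (P_L2 SG t0' Lh)) (W12_m Wpf)).
have e3 : \int[mu]_x (P tau chif x * ng (lg dl v) x ^+ 2) = ip (P tau chif) (Gf v).
 apply: Rint_ae; [by apply: mfunM; [exact: L2_m LPc|apply: mfunX; exact: (ng_m Wh)]|exact: mfunM (L2_m LPc) (L2_m LG)|].
 by apply: (ae_imp ngh) => x ->; rewrite /Gf; ring.
rewrite e2 -/hf e3 in BEw.
have [i1 _] := gam_int Wu Wz; have j1 := integM_bdd (W12_m Wp) bp i1.
have j2 := integM Lp L1u; have j3 := integM_bdd (L2_m Lchi) chib Lbn.2.
pose c := 2 * tau / N.
have j4 := integrZ measurableT 2 j1; have j5 := integrZ measurableT c j3.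
have j6 := integrD measurableT j2 j4; have j7 := integrD measurableT j6 j5.
(* The difference quotient at step [1] bounds [|grad pf|^2] below by
   [|grad lg u|^2 + 2 Gam z (lg u)]; the weight [chif] and a factor [qd u] of each term combine to
   [psi]. *)
have low : ip psi (fun x => ng u x ^+ 2 * qd dl u x) + 2 * \int[mu]_x (psi x * Gam u z x) +
  c * \int[mu]_x (chif x * bn x ^+ 2) <= ip (P tau chif) (Gf v).
 apply: le_trans BEw; rewrite /ip -(RintegralZl 2 measurableT j1) -(RintegralZl c measurableT j3).
 rewrite -(RintegralD measurableT j2 j4) -(RintegralD measurableT j6 j5).
 apply: leR_ae => //.
  have [i2 _] := ng2_int Wpf; apply: (integM_bdd (L2_m Lchi) chib).
  exact: (integrD measurableT i2 (integrZ measurableT c Lbn.2)).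
 have [_ gs _ _] := gam_spec Wz Wk.
 apply: (ae_imp2 (ae_and (gs 1 ltr01) ngk) (ae_and (gk z Wz).1 (gamC Wz Wu bz bu))).
 move=> x [/andP[_ g1] g2] [g3 g4]; rewrite dqE in g1; rewrite g3 g4 g2 in g1.
 have e4 : (fun y => lg dl u y + 1 * z y) = pf by apply/funext => y; rewrite /z; ring.
 rewrite e4 in g1; have q0 := chiq x.
 have := ler_wpM2l (chi0 x) g1; rewrite -/c -q0; exact: ar_pt.
have cs := weighted_CS (L2_m Lchi) chi0 chib ichi Lbn.
have J0 : 0 <= \int[mu]_x (chif x * bn x ^+ 2).
 by apply: Rintegral_ge0 => x _; rewrite mulr_ge0// sqr_ge0.
have cs2 : 2 / (N * M0) * tau * ip chif bn ^+ 2 <= c * \int[mu]_x (chif x * bn x ^+ 2).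
 have -> : 2 / (N * M0) * tau * ip chif bn ^+ 2 = c * (ip chif bn ^+ 2 / M0).
  by rewrite /c; move: (ip chif bn) => y; field; rewrite !gt_eqF.
 rewrite ler_wpM2l//; first by rewrite /c divr_ge0 ?mulr_ge0// ltW.
 by rewrite ler_pdivrMr// mulrC; apply: le_trans cs _; rewrite ler_wpM2r.
rewrite e1; exact: ar_fin low cs2.
Qed.

End one.
Section limit.
Variables (tau : nat -> R) (v_ a_ psi_ : nat -> X -> R).
Hypotheses (t0 : forall n, 0 < tau n) (ct : tau n @[n --> \oo] --> (0 : R)).
Hypotheses (nv : forall n, nice M L C (v_ n) (a_ n)) (mpsi_ : forall n, meas (psi_ n)).
Hypotheses (psiP : forall n, [ae x | psi_ n x = P (tau n) psi x]).
Hypotheses (psi_0 : forall n x, 0 <= psi_ n x <= M).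
Hypotheses (uP : forall n, [ae x | u x = P (tau n) (v_ n) x]).
Hypotheses (cv : cvL2 v_ u) (ca : cvL2 a_ a).
Let x_ n x := (tau n)^-1 * (u x - v_ n x).

Let Wv n : W12 (v_ n). Proof. by case: (nv n) => Dn _ _ _; exact: DA_W12 Dn. Qed.
Let Lv n := W12_L2 (Wv n).

Let v0 n x : 0 <= v_ n x. Proof. by case: (nv n) => _ h _ _; have /andP[] := h x. Qed.
Let vM n x : `|v_ n x| <= M. Proof. by case: (nv n) => _ h _ _; have /andP[h1 h2] := h x; rewrite ger0_norm. Qed.
Let Dv n : DA (v_ n) (a_ n). Proof. by case: (nv n). Qed.
Let aC : [ae x | `|a x| <= C]. Proof. by case: nu. Qed.
Let mu_ : meas u := W12_m Wu.

Let mq : meas (qd dl u). Proof. exact: qd_m. Qed.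

Lemma cv_x : cvL2 x_ a.
Proof.
have c := gen_cvg Dv ca La t0 ct; apply: (cvL2_ae c) => n.
 by apply: mfunB (L2_m La); apply: mfunM => //; apply: mfunB => //; exact: L2_m.
by apply: (ae_imp (uP n)) => x e1; rewrite /x_ e1.
Qed.

(** A chain rule in time: the Taylor error divided by [tau n] is at most [dl ^- 2] times the
    quotient [x_ n] times [u - v_ n], and this product tends to [a u - a u = 0]. *)
Lemma cv_log : cvL2 (fun n x => (tau n)^-1 * (lg dl u x - lg dl (v_ n) x)) (fun x => qd dl u x * a x).
Proof.
have mx n : meas (x_ n) by apply: mfunM => //; apply: mfunB => //; exact: L2_m.
have mq' : meas (qd dl u) := mq.
have cq := cvL2_cst mq.
have qb : forall n : nat, [ae x | `|qd dl u x| <= dl^-1] by move=> n; apply: ae_all => x; exact: qd_abs.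
have c1 : cvL2 (fun n x => x_ n x * qd dl u x) (fun x => a x * qd dl u x).
 exact: (@cvL2M _ _ _ _ C dl^-1 cv_x cq (fun=> mq) (L2_m La) aC qb).
have uMn : forall n : nat, [ae x | `|u x| <= M] by move=> n; apply: ae_all => x; rewrite ger0_norm.
have c2 := @cvL2M _ _ _ _ C M cv_x (cvL2_cst mu_) (fun=> mu_) (L2_m La) aC uMn.
have c3 := @cvL2M _ _ _ _ C M cv_x cv (fun n => W12_m (Wv n)) (L2_m La) aC (fun n => ae_all _ (vM n)).
have c4 := cvL2D 1 (-1) c2 c3.
have mlu : meas (lg dl u).
 by have [W _ _ _ _] := lg_props dl0 D u0M; exact: W12_m W.
have mlv n : meas (lg dl (v_ n)).
 have [Dn h _ _] := nv n; have [W _ _ _ _] := lg_props dl0 Dn h; exact: W12_m W.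
pose er n x := (tau n)^-1 * (lg dl u x - lg dl (v_ n) x) - x_ n x * qd dl u x.
have mer n : meas (er n).
 apply: mfunB; last exact: mfunM.
 by apply: mfunM => //; exact: mfunB.
have c5 : cvL2 er (fun x => 1 * (a x * u x) + -1 * (a x * u x)).
 apply: (cvL2_le (c := dl ^- 2) _ _ c4) => n.
  have ma := L2_m La; apply: (mfunB (mer n)).
  by apply: mfunD; apply: mfunM => //; exact: mfunM.
 apply: ae_all => x; rewrite mul1r mulN1r subrr !subr0 mul1r mulN1r -mulrBr normrM.
 have lE w : 0 <= w x -> lg dl w x = ln (w x + dl) - ln dl.
  move=> w0; rewrite /lg -ln_div ?posrE//; last exact: ltr_wpDl.
  by congr ln; field; rewrite gt_eqF.
 have := @ln_taylor R dl (u x + dl) (v_ n x + dl) dl0; rewrite !lerDr => /(_ (u0 x) (v0 n x)).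
 rewrite /er /x_ (lE _ (u0 x)) (lE _ (v0 n x)) /qd.
 have -> : u x + dl - (v_ n x + dl) = u x - v_ n x by ring.
 set l1 := ln _; set l2 := ln _; set l3 := ln _; have t1 : 0 < (tau n)^-1 by rewrite invr_gt0.
 have -> : (tau n)^-1 * (l1 - l3 - (l2 - l3)) - (tau n)^-1 * (u x - v_ n x) * (u x + dl)^-1 =
  (tau n)^-1 * (l1 - l2 - (u x - v_ n x) / (u x + dl)) by ring.
 rewrite !normrM !(gtr0_norm t1); move=> h.
 by rewrite -mulrA -normrM [`|_ ^+ 2|]ger0_norm ?sqr_ge0// mulrCA ler_pM2l// [leRHS]mulrC.
have := cvL2D 1 1 c1 c5.
have -> : (fun x => 1 * (a x * qd dl u x) + 1 * (1 * (a x * u x) + -1 * (a x * u x))) = (fun x => qd dl u x * a x).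
 by apply/funext => x; ring.
have -> // : (fun n x => 1 * (x_ n x * qd dl u x) + 1 * er n x) = (fun n x => (tau n)^-1 * (lg dl u x - lg dl (v_ n) x)).
by apply/funext => n; apply/funext => x; rewrite /er; ring.
Qed.

(** [lg u - pf] is the increment of the logarithm along the flow minus the heat increment of
    [lg (v_ n)]. In the limit this is [qd u * a] minus the Laplacian of [lg u], that is
    [|grad lg u|^2]. *)
Lemma cv_z : cvL2 (fun n x => (tau n)^-1 * (lg dl u x - pf (tau n) (v_ n) x)) (Gf u).
Proof.
have Dh n : DA (hf (v_ n)) (Ahf (v_ n) (a_ n)) by have [] := hf_props (nv n).
have cl := cvL2_lap dl0 nu nv cv ca.
have Dk := DA_lg dl0 D u0M uL.
have c1 := gen_cvg Dh cl (DA_L2 Dk) t0 ct.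
have := cvL2D 1 (-1) cv_log c1.
have -> : (fun x => 1 * (qd dl u x * a x) + -1 * lap_lg dl u a x) = Gf u.
 by apply/funext => x; rewrite /lap_lg /Gf; ring.
move=> c2; apply: (cvL2_ae c2) => n.
 have [_ _ Wpf _] := pf_props (t0 n) (nv n); have [W _ _ _ _] := lg_props dl0 D u0M.
 apply: mfunB; last by have [_ /L2_m] := ngq_L2 nu.
 by apply: mfunM => //; apply: mfunB; [exact: W12_m W|exact: W12_m Wpf].
have [_ pE _ _] := pf_props (t0 n) (nv n); apply: (ae_imp pE) => x <-; rewrite /hf; ring.
Qed.

(** The limit is the Laplacian of [psi u], minus [u b], plus [psi a], the last sign being due to
    [v_ n] preceding [u] in time; the Leibniz rule leaves [2 Bf]. *)
Lemma cv_A : cvL2 (fun n => Af (tau n) (v_ n) (psi_ n)) (fun x => 2 * Bf x).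
Proof.
have Dpu := DA_mul D Dp bu bp uL.
have c1 := gen_cvg (fun=> Dpu) (cvL2_cst (L2_m (DA_L2 Dpu))) (DA_L2 Dpu) t0 ct.
have c2 := gen_cvg (fun=> Dp) (cvL2_cst (L2_m Lb)) Lb t0 ct.
have c3 := @cvL2M _ _ _ _ C M c2 cv (fun n => W12_m (Wv n)) (L2_m Lb) bC (fun n => ae_all _ (vM n)).
have pMn : forall n : nat, [ae x | `|psi x| <= M] by move=> n; apply: ae_all => x; rewrite ger0_norm.
have c4 := @cvL2M _ _ _ _ C M cv_x (cvL2_cst (W12_m Wp)) (fun=> W12_m Wp) (L2_m La) aC pMn.
have := cvL2D 1 1 (cvL2D 1 (-1) c1 c3) c4.
set lim := (X in cvL2 _ X); have -> : lim = (fun x => 2 * Bf x).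
 by apply/funext => x; rewrite /lim /Bf; move: (Gam u psi x) => y; ring.
move=> c; apply: (cvL2_ae c) => n.
 apply: mfunB; last by apply: mfunM => //; exact: L2_m LB.
 apply: mfunM => //; apply: mfunB; first exact: L2_m (P_L2 SG (ltW (t0 n)) Lpu).
 by apply: mfunM => //; exact: L2_m.
by apply: (ae_imp (psiP n)) => x e1; rewrite /Af e1 /x_; ring.
Qed.

(** In the limit [2 * ip (Gf u) Bf] and the product of [2 Bf] with [Gf u] cancel, while [chif] times
    the Laplacian of the logarithm integrates to [- Yf psi u a]; only the square survives. *)
Lemma step_limit : exists z : nat -> R, z n @[n --> \oo] --> 2 / (N * M0) * Yf psi u a ^+ 2 /\
 forall n, Yf psi u a + tau n * z n <= Yf (psi_ n) (v_ n) (a_ n).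
Proof.
have Dk := DA_lg dl0 D u0M uL; have LAk := DA_L2 Dk.
have [L1u LGu] := ngq_L2 nu.
have cb : cvL2 (fun n => P (tau n) (Ahf (v_ n) (a_ n))) (lap_lg dl u a).
 by apply: (P_cvL2 _ LAk _ ct) => [|n]; [exact: cvL2_lap nu nv cv ca|exact: ltW].
have cG := cvL2_ngq2 dl0 nu nv cv ca.
have Yk : ip chif (lap_lg dl u a) = - Yf psi u a.
 rewrite /Yf -[RHS]mulN1r -(ipZr (-1) (L2B L1u La) Lp); apply: eq_Rintegral => x _.
 rewrite /chif /lap_lg /qd; have : u x + dl != 0 by rewrite gt_eqF// ltr_wpDl.
 by move: (ng u x) (u x) (a x) (psi x) => *; field.
pose z n := 2 * ip (fun x => (tau n)^-1 * (lg dl u x - pf (tau n) (v_ n) x)) Bf +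
  2 / (N * M0) * ip chif (P (tau n) (Ahf (v_ n) (a_ n))) ^+ 2 - ip (Af (tau n) (v_ n) (psi_ n)) (Gf (v_ n)).
exists z; split.
 have l1 := cvL2_ip cv_z (cvL2_cst (L2_m LB)) LGu LB.
 have l2 := cvL2_ip (cvL2_cst (L2_m Lchi)) cb Lchi LAk.
 have l3 := cvL2_ip cv_A cG (L2Z 2 LB) LGu.
 have -> : 2 / (N * M0) * Yf psi u a ^+ 2 = 2 * ip (Gf u) Bf + 2 / (N * M0) * ip chif (lap_lg dl u a) ^+ 2 -
   ip (fun x => 2 * Bf x) (Gf u).
  by rewrite Yk (ipZl 2 LB LGu) (ipC); ring.
 apply: cvgB l3; apply: cvgD; first by apply: cvgM l1; exact: cvg_cst.
 by apply: cvgM; [exact: cvg_cst|exact: cvgM].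
move=> n; have := step_one (t0 n) (nv n) (mpsi_ n) (psiP n) (psi_0 n) (uP n).
have [_ _ Wpf _] := pf_props (t0 n) (nv n); have [W _ _ _ _] := lg_props dl0 D u0M.
have Ld := L2B (W12_L2 W) (W12_L2 Wpf).
have tn : tau n != 0 by rewrite gt_eqF.
rewrite /z (ipZl (tau n)^-1 Ld LB).
move: (ip _ Bf) (ip chif _) (ip _ (Gf (v_ n))) (Yf _ _ _) (Yf _ _ _) => p q r y y' h.
by apply: le_trans h; rewrite le_eqVlt; apply/orP; left; apply/eqP; field; rewrite/= !gt_eqF.
Qed.

End limit.
End step.
End liyau_step.

(** * The Li-Yau inequality for the heat flow *)

Section liyau.
Lemma lipc_cball f : lipc f -> exists n, forall x, f x = \1_(cball n) x * f x.
Proof.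
move=> [_ cf]; have [n nP] := compact_bounded_metric (point : X) cf; exists n => x.
have [->|fx] := eqVneq (f x) 0; first by rewrite mulr0.
rewrite indicE mem_set ?mul1r// /cball /=.
by apply: (le_lt_trans (nP x _)); [exact: subset_closure|rewrite ltr_nat].
Qed.

Lemma lipc_int f : lipc f -> integ f.
Proof.
move=> lf; have [n nP] := lipc_cball lf; have [L [_ _ _ /W12_L2 Lf _]] := lipc_props lf.
by have := integM (L2_indic n) Lf; have -> : (fun x => \1_(cball n) x * f x) = f by apply/funext => x; rewrite -nP.
Qed.

Lemma lipcM f g : lipc f -> lipc g -> lipc (fun x => f x * g x).
Proof.
move=> lf lg; have [_ [_ [M fM] _ _ _]] := lipc_props lf.
have [_ [_ [M' gM] _ _ _]] := lipc_props lg.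
have [[L fL] cf] := lf; have [[L' gL] cg] := lg; split.
 exists (M' * L + M * L') => x y; have -> : f x * g x - f y * g y = g x * (f x - f y) + f y * (g x - g y) by ring.
 apply: (le_trans (ler_normD _ _)); rewrite !normrM mulrDl -!mulrA; apply: lerD; exact: ler_pM.
apply: (subclosed_compact (@closed_closure _ _) cf); apply: closure_subset => x /=.
by apply: contra_neq => ->; rewrite mul0r.
Qed.

Definition tent n x : R := Num.max 0 (n.+2%:R - mdist x (point : X)).

Lemma tent_lipc n : lipc (tent n).
Proof.
split.
 exists 1 => x y; rewrite mul1r.
 have := mono1_lip (n.+2%:R - mdist x (point : X)) (n.+2%:R - mdist y (point : X)) (trunc_mono1 (lexx (0 : R))).
 rewrite /trunc !subr0 => h; apply: (le_trans h).
 have h1 := metric_triangle y x (point : X); have h2 := metric_triangle x y (point : X).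
 rewrite (metric_sym y x) in h1; rewrite ler_norml; apply/andP; split; lra.
apply: (subclosed_compact (@closed_closure _ _) (@propX (point : X) n.+2%:R)).
have cl : closed [set y : X | mdist (point : X) y <= n.+2%:R] by apply: compact_closed; [exact: metric_hausdorff|exact: propX].
rewrite [X in _ `<=` X](closure_id _).1//.
apply: closure_subset => x /=; rewrite /tent metric_sym; apply: contra_neqT; rewrite -ltNge => h.
by apply/max_idPl; rewrite subr_le0 ltW.
Qed.

Lemma tent_ge0 n x : 0 <= tent n x. Proof. by rewrite /tent le_max lexx. Qed.

(* Positive constants need not be in L2, whence the local integrability bookkeeping. *)
Lemma lipc_test_loc F c : L2 F -> (forall chi, lipc chi -> (forall x, 0 <= chi x) ->
  0 <= ip chi F + c * \int[mu]_x chi x) -> [ae x | 0 <= F x + c].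
Proof.
move=> LF H.
have Ln n : L2 (fun x => tent n x * F x + c * tent n x).
 have [_ [mt bt _ /W12_L2 Lt _]] := lipc_props (tent_lipc n).
 by apply: L2D; [exact: L2_bddM|exact: L2Z].
have Hn n : [ae x | 0 <= tent n x * F x + c * tent n x].
 apply: (lipc_test (Ln n)) => chi lc c0.
 have lct := lipcM lc (tent_lipc n); have [_ [_ _ _ /W12_L2 Lct _]] := lipc_props lct.
 have := H _ lct (fun x => mulr_ge0 (c0 x) (tent_ge0 n x)).
 have i1 := integM Lct LF; have i2 := integrZ measurableT c (lipc_int lct).
 rewrite -(RintegralZl c measurableT (lipc_int lct)) -(RintegralD measurableT i1 i2).
 have -> // : (fun x => chi x * tent n x * F x + c * (chi x * tent n x)) =
  (fun x => chi x * (tent n x * F x + c * tent n x)) by apply/funext => x; ring.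
apply: (ae_imp (ae_foralln Hn)) => x h.
have [n nP] : exists n : nat, mdist x (point : X) < n%:R.
 by exists (Num.bound (mdist x (point : X))); apply: archi_boundP; exact: mdist_ge0.
have t0 : 0 < tent n x.
 by rewrite /tent lt_max subr_gt0; apply/orP; right; apply: (lt_trans nP); rewrite ltr_nat.
by have := h n; rewrite [c * _]mulrC -mulrDr pmulr_rge0.
Qed.

Lemma cvL2B (f_ g_ : nat -> X -> R) f g : cvL2 f_ f -> cvL2 g_ g ->
 cvL2 (fun n x => f_ n x - g_ n x) (fun x => f x - g x).
Proof.
move=> cf cg; have := cvL2D 1 (-1) cf cg.
have -> : (fun x => 1 * f x + -1 * g x) = (fun x => f x - g x) by apply/funext => x; ring.
by have -> : (fun n x => 1 * f_ n x + -1 * g_ n x) = (fun n x => f_ n x - g_ n x)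
 by apply/funext => n; apply/funext => x; ring.
Qed.

Lemma P_cont_seq f s (s_ : nat -> R) : L2 f -> 0 <= s -> (forall n, 0 <= s_ n) ->
 s_ n @[n --> \oo] --> s -> cvL2 (fun n => P (s_ n) f) (P s f).
Proof.
move=> Lf s0 sn cs; have LP r : 0 <= r -> L2 (P r f) by move=> r0; exact: P_L2.
split=> [n|]; first exact: L2B (LP _ (sn n)) (LP _ s0).
have key p q e dl : 0 <= p -> p <= q -> (forall t, 0 <= t -> t < dl -> nn (fun x => P t f x - f x) < e) ->
  q - p < dl -> nn (fun x => P q f x - P p f x) < e.
 move=> p0 pq H qp; have q0 := le_trans p0 pq; have qp0 : 0 <= q - p by rewrite subr_ge0.
 have LPq := LP _ qp0; apply: le_lt_trans (H _ qp0 qp); apply: le_trans (P_nnB SG p0 LPq Lf).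
 rewrite (@nn_ae _ _ _ mu _ (fun x => P p (P (q - p) f) x - P p f x))//.
 - exact: L2B (LP _ q0) (LP _ p0).
 - exact: L2B (P_L2 SG p0 LPq) (LP _ p0).
 - have := P_add SG p0 qp0 Lf; have -> : p + (q - p) = q by ring.
  by move=> /ae_imp; apply => x ->.
apply/cvgrPdist_lt => e e0; have [dl d0 H] := P_cont SG Lf e0.
move/cvgrPdist_lt : cs => /(_ _ d0); apply: filterS => n h; rewrite sub0r normrN ger0_norm ?nn_ge0//.
have [le1|/ltW le1] := leP s (s_ n).
 by apply: (key _ _ _ dl) => //; apply: le_lt_trans h; rewrite distrC ler_norm.
rewrite (nn_sym (LP _ (sn n)) (LP _ s0)); apply: (key _ _ _ dl) => //.
by apply: le_lt_trans h; exact: ler_norm.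
Qed.

Definition Lap u : X -> R := xget (fun=> 0) [set h | DA u h].

Lemma LapP u h : DA u h -> DA u (Lap u).
Proof. by move=> D; apply: (@xgetPex _ (fun=> 0) [set h | DA u h]); exists h. Qed.

Lemma Lap_P f t : L2 f -> 0 < t -> DA (P t f) (Lap (P t f)).
Proof. by move=> Lf t0; have [h [D _]] := P_DA SG Lf t0; exact: LapP D. Qed.

Lemma Lap_add f s t : L2 f -> 0 <= s -> 0 < t ->
 [ae x | Lap (P (s + t) f) x = P s (Lap (P t f)) x].
Proof.
move=> Lf s0 t0; have D1 := Lap_P Lf t0; have D2 := DA_P SG D1 s0.
have st0 : 0 < s + t by rewrite ltr_wpDl.
have LP := P_L2 SG s0 (DA_L2 D1).
apply: (DA_uniq (Lap_P Lf st0)).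
apply: (DA_ae D2 (L2_m (P_L2 SG (ltW st0) Lf)) (L2_m LP)); last exact: ae_all.
exact: ae_sym (P_add SG s0 (ltW t0) Lf).
Qed.

(** Write [Lap (P r f)] as [P (r - s1)] of [Lap (P s1 f)] and use strong continuity. *)
Lemma Lap_cont_seq f s (s_ : nat -> R) s1 : L2 f -> 0 < s1 -> s1 <= s -> (forall n, s1 <= s_ n) ->
 s_ n @[n --> \oo] --> s -> cvL2 (fun n => Lap (P (s_ n) f)) (Lap (P s f)).
Proof.
move=> Lf s10 ss sn cs; have La := DA_L2 (Lap_P Lf s10).
have c : cvL2 (fun n => P (s_ n - s1) (Lap (P s1 f))) (P (s - s1) (Lap (P s1 f))).
 apply: (P_cont_seq La); [by rewrite subr_ge0|by move=> n; rewrite subr_ge0|].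
 by apply: cvgB => //; exact: cvg_cst.
have E r : s1 <= r -> [ae x | P (r - s1) (Lap (P s1 f)) x = Lap (P r f) x].
 by move=> sr; have := @Lap_add f (r - s1) s1 Lf; rewrite subrK subr_ge0 => /(_ sr s10)/ae_sym.
have ml r : s1 <= r -> meas (Lap (P r f)).
 by move=> sr; exact: L2_m (DA_L2 (Lap_P Lf (lt_le_trans s10 sr))).
apply: (cvL2_le (c := 1) _ _ c) => n; first by apply: mfunB; exact: ml.
by apply: (ae_imp2 (E _ (sn n)) (E _ ss)) => x -> ->; rewrite mul1r.
Qed.

Section flow.
Variables (M L : R) (f : X -> R).
Hypotheses (Wf : W12 f) (f0 : forall x, 0 <= f x <= M) (fL : [ae x | ng f x <= L]).
Let Lf : L2 f. Proof. exact: W12_L2. Qed.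
Let M_ge0 : 0 <= M. Proof. by have /andP[h1 h2] := f0 point; exact: le_trans h1 h2. Qed.

Lemma flow_ae s : 0 <= s -> [ae x | P s f x = clampf M (P s f) x].
Proof.
move=> s0; apply: clampf_ae.
 by apply: (P_ge0 Lf s0); apply: ae_all => x; have /andP[] := f0 x.
by apply: (P_le Lf M_ge0 s0); apply: ae_all => x; have /andP[] := f0 x.
Qed.

Lemma flow_m s : 0 <= s -> meas (clampf M (P s f)).
Proof. by move=> s0; apply: clampf_m; exact: L2_m (P_L2 SG s0 Lf). Qed.

(** Both bounds come from [BE_bound], the Laplacian one from [2 s / N * (Lap u)^2 <= L^2]; the lower
    time [s1] makes the constant uniform. *)
Lemma flow_nice s1 C s : 0 < s1 -> `|L| * Num.sqrt (N / (2 * s1)) <= C -> s1 <= s ->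
 nice M L C (clampf M (P s f)) (Lap (P s f)).
Proof.
move=> s10 hC s1s; have s0 := lt_le_trans s10 s1s; have D := Lap_P Lf s0.
have BB := BE_bound Wf s0 D fL.
have mf := flow_m (ltW s0); have fe := flow_ae (ltW s0).
have L0 : [ae x | 0 <= L] by apply: (ae_imp fL) => x; apply: le_trans; exact: ng_ge0.
have sN : 0 < 2 * s / N by rewrite divr_gt0// mulr_gt0.
split.
- apply: (DA_ae D mf (L2_m (DA_L2 D)) fe); exact: ae_all.
- by move=> x; exact: clampf_bounds.
- rewrite -(ng_ae (L2_m (P_L2 SG (ltW s0) Lf)) mf fe).
 apply: (ae_imp2 BB L0) => x h l0; rewrite -ler_sqr ?nnegrE ?ng_ge0//; apply: le_trans h.
 by rewrite lerDl mulr_ge0 ?sqr_ge0// ltW.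
- apply: (ae_imp BB) => x h; apply: le_trans hC.
 rewrite -ler_sqr ?nnegrE ?sqrtr_ge0// real_normK ?num_real// exprMn real_normK ?num_real//.
 rewrite sqr_sqrtr; last by rewrite divr_ge0 ?mulr_ge0 ?ltW.
 have h2 : 2 * s / N * Lap (P s f) x ^+ 2 <= L ^+ 2 by apply: le_trans h; rewrite lerDr sqr_ge0.
 have h3 : 2 * s1 / N * Lap (P s f) x ^+ 2 <= L ^+ 2.
  apply: le_trans h2; rewrite ler_wpM2r ?sqr_ge0// ler_pM2r ?invr_gt0// ler_pM2l//.
 rewrite mulrA ler_pdivlMr ?mulr_gt0// mulrC -ler_pdivrMr//; apply: le_trans h3.
 by apply: eq_leW; ring.
Qed.

End flow.
Section main.
Variables (f phi : X -> R) (M L dl r t M0 : R).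
Hypotheses (Wf : W12 f) (Wphi : W12 phi) (f0 : forall x, 0 <= f x <= M) (phi0 : forall x, 0 <= phi x <= M).
Hypotheses (fL : [ae x | ng f x <= L]) (phiL : [ae x | ng phi x <= L]).
Hypotheses (iphi : integ phi) (dl0 : 0 < dl) (r0 : 0 < r) (t0 : 0 < t).
Hypotheses (hM0 : ip phi (P (t + r) f) + dl * \int[mu]_x phi x <= M0) (M00 : 0 < M0).
Let Lf : L2 f. Proof. exact: W12_L2. Qed.
Let Lphi : L2 phi. Proof. exact: W12_L2. Qed.
Let uu s := clampf M (P (t - s) f).

Let aa s := Lap (P (t - s) f).

Let pp s := clampf M (P (r + s) phi).

Let Y s := Yf dl (pp s) (uu s) (aa s).

Let nice_u s (b : R) : s <= b -> b < t -> nice M L (`|L| * Num.sqrt (N / (2 * (t - b)))) (uu s) (aa s).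
Proof.
move=> sb bt; apply: (flow_nice Wf f0 fL (s1 := t - b)) => //; first by rewrite subr_gt0.
by rewrite lerD2l lerN2.
Qed.
Let m_uu s : 0 <= t - s -> meas (uu s). Proof. by move=> ?; apply: (flow_m M Wf). Qed.
Let m_pp s : 0 <= r + s -> meas (pp s). Proof. by move=> ?; apply: (flow_m M Wphi). Qed.

(** Self-adjointness turns the product of [P (r + s) phi] and [P (t - s) f] into
    [ip phi (P (t + r) f)], independent of [s]; the other part of the mass, [dl] times the integral
    of [P (r + s) phi], is at most its value for [phi]. *)
Lemma mass_bound s : 0 <= s -> s < t ->
 integ (chif dl (pp s) (uu s)) /\ \int[mu]_x chif dl (pp s) (uu s) x <= M0.
Proof.
move=> s0 st; have rs0 : 0 <= r + s by rewrite addr_ge0// ltW.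
have ts0 : 0 <= t - s by rewrite subr_ge0 ltW.
have LPp := P_L2 SG rs0 Lphi; have LPu := P_L2 SG ts0 Lf.
have [ip1 le1] := P_int Lphi iphi rs0 (ae_all _ (fun x => proj1 (andP (phi0 x)))).
have i1 := integM LPp LPu; have i2 := integrZ measurableT dl ip1.
have i3 := integrD measurableT i1 i2.
have e1 : [ae x | P (r + s) phi x * P (t - s) f x + dl * P (r + s) phi x = chif dl (pp s) (uu s) x].
 apply: (ae_imp2 (flow_ae Wphi phi0 rs0) (flow_ae Wf f0 ts0)) => x h1 h2.
 by rewrite /chif /pp /uu -h1 -h2; ring.
have mchi : meas (chif dl (pp s) (uu s)).
 apply: mfunM; first exact: m_pp.
 by apply: mfunD => //; exact: m_uu.
split; first exact: integ_ae mchi e1 i3.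
rewrite -(Rint_ae (integ_mfun i3) mchi e1) (RintegralD measurableT i1 i2) (RintegralZl dl measurableT ip1).
apply: le_trans hM0; apply: lerD; last by rewrite ler_pM2l.
have := dual SG SG Lphi LPu rs0; rewrite {1}/ip => ->.
have := P_add SG rs0 ts0 Lf; have -> : r + s + (t - s) = t + r by ring.
move=> e2; apply: eq_leW; apply: ip_ae => //.
- exact: P_L2.
- by apply: P_L2 => //; rewrite addr_ge0// ltW.
- exact: ae_all.
- exact: ae_sym e2.
Qed.

Lemma Y_cont (b : R) : 0 <= b -> b < t -> seq_cont Y b.
Proof.
move=> b0 bt s s_ s0 sb sn cs.
have snb n : s_ n <= b by have /andP[] := sn n.
have sn0 n : 0 <= s_ n by have /andP[] := sn n.
have ts0 : 0 <= t - s by rewrite subr_ge0 ltW// (le_lt_trans sb).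
have tsn n : 0 <= t - s_ n by rewrite subr_ge0 ltW// (le_lt_trans (snb n)).
have rs0 : 0 <= r + s by rewrite addr_ge0// ltW.
have rsn n : 0 <= r + s_ n by rewrite addr_ge0// ltW.
have cts : t - s_ n @[n --> \oo] --> t - s by apply: cvgB => //; exact: cvg_cst.
have crs : r + s_ n @[n --> \oo] --> r + s by apply: cvgD => //; exact: cvg_cst.
have cu : cvL2 (fun n => uu (s_ n)) (uu s).
 have c := P_cont_seq Lf ts0 tsn cts; apply: (cvL2_le (c := 1) _ _ c) => n.
  by apply: mfunB; exact: m_uu.
 by apply: (ae_imp2 (flow_ae Wf f0 (tsn n)) (flow_ae Wf f0 ts0)) => x h1 h2; rewrite /uu -h1 -h2 mul1r.
have cp : cvL2 (fun n => pp (s_ n)) (pp s).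
 have c := P_cont_seq Lphi rs0 rsn crs; apply: (cvL2_le (c := 1) _ _ c) => n.
  by apply: mfunB; exact: m_pp.
 by apply: (ae_imp2 (flow_ae Wphi phi0 (rsn n)) (flow_ae Wphi phi0 rs0)) => x h1 h2; rewrite /pp -h1 -h2 mul1r.
have ca : cvL2 (fun n => aa (s_ n)) (aa s).
 by apply: (@Lap_cont_seq _ _ _ (t - b) Lf); rewrite ?subr_gt0 ?lerD2l ?lerN2// => n; rewrite lerD2l lerN2.
have nu := nice_u sb bt; have nv n := nice_u (snb n) bt.
have [L1 _] := ngq_L2 dl0 nu.
have La : L2 (aa s) by case: nu => D _ _ _; exact: DA_L2 D.
have c1 := cvL2B (cvL2_ngq dl0 nu nv cu ca) ca.
have Lp : L2 (pp s).
 by apply: L2_ae (m_pp rs0) (flow_ae Wphi phi0 rs0) _; exact: P_L2.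
exact: (cvL2_ip cp c1 Lp (L2B L1 La)).
Qed.

Lemma Y_step s (tau : nat -> R) : 0 <= s -> s < t -> (forall n, 0 < tau n) ->
 (forall n, s + tau n <= (s + t) / 2) -> tau n @[n --> \oo] --> (0 : R) ->
 exists z : nat -> R, z n @[n --> \oo] --> 2 / (N * M0) * Y s ^+ 2 /\
  forall n, Y s + tau n * z n <= Y (s + tau n).
Proof.
move=> s0 st tp tb ct; pose b := (s + t) / 2.
have bt : b < t by rewrite /b; lra.
have sb : s <= b by rewrite /b; lra.
have rs0 : 0 < r + s by rewrite ltr_wpDr.
pose C1 := `|L| * Num.sqrt (N / (2 * (t - b))); pose C2 := `|L| * Num.sqrt (N / (2 * r)).
pose C := Num.max C1 C2.
have niceC w a' : nice M L C1 w a' -> nice M L C w a'.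
 by move=> [h1 h2 h3 h4]; split=> //; apply: (ae_imp h4) => x h; rewrite /C le_max h.
have rle : r <= r + s by rewrite lerDl.
have [Dp p0 _ pC] := flow_nice Wphi phi0 phiL r0 (lexx C2) rle.
have pC' : [ae x | `|Lap (P (r + s) phi) x| <= C] by apply: (ae_imp pC) => x h; rewrite /C le_max h orbT.
have [im hm] := mass_bound s0 st.
have tsn n : 0 <= t - (s + tau n) by rewrite subr_ge0 (le_trans (tb n))// -/b ltW.
have ts0 : 0 <= t - s by rewrite subr_ge0 ltW.
have tp' n := ltW (tp n).
have rsn n : 0 <= r + (s + tau n) by rewrite addr_ge0 ?(ltW r0)// addr_ge0.
have csn : s + tau n @[n --> \oo] --> s by rewrite -[X in _ --> X]addr0; apply: cvgD => //; exact: cvg_cst.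
have cts : t - (s + tau n) @[n --> \oo] --> t - s by apply: cvgB => //; exact: cvg_cst.
apply: (step_limit dl0 M00 Dp p0 pC' (niceC _ _ (nice_u sb bt)) im hm tp ct
 (v_ := fun n => uu (s + tau n)) (a_ := fun n => aa (s + tau n)) (psi_ := fun n => pp (s + tau n))).
- by move=> n; apply: niceC; exact: nice_u (tb n) bt.
- by move=> n; exact: m_pp.
- move=> n; have LP := P_L2 SG (ltW rs0) Lphi.
 have h1 := P_add SG (tp' n) (ltW rs0) Lphi; have -> : pp (s + tau n) = clampf M (P (tau n + (r + s)) phi).
  by rewrite /pp; congr (clampf M (P _ phi)); ring.
 have ts1 : 0 <= tau n + (r + s) by rewrite addr_ge0 ?tp'// ltW.
 apply: (ae_tr (ae_sym (flow_ae Wphi phi0 ts1))); apply: (ae_tr h1).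
 exact: (P_ae SG (tp' n) LP (m_pp (ltW rs0)) (flow_ae Wphi phi0 (ltW rs0))).
- by move=> n x; apply: clampf_bounds; have /andP[h1 h2] := phi0 point; exact: le_trans h1 h2.
- move=> n; have LP := P_L2 SG (tsn n) Lf.
 have h1 := P_add SG (tp' n) (tsn n) Lf; have e1 : tau n + (t - (s + tau n)) = t - s by ring.
 rewrite e1 in h1; apply: (ae_tr (ae_sym (flow_ae Wf f0 ts0))); apply: (ae_tr h1).
 exact: (P_ae SG (tp' n) LP (m_uu (tsn n)) (flow_ae Wf f0 (tsn n))).
- have c := P_cont_seq Lf ts0 tsn cts; apply: (cvL2_le (c := 1) _ _ c) => n.
  by apply: mfunB; exact: m_uu.
 by apply: (ae_imp2 (flow_ae Wf f0 (tsn n)) (flow_ae Wf f0 ts0)) => x h1 h2; rewrite /uu -h1 -h2 mul1r.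
- apply: (@Lap_cont_seq _ _ _ (t - b) Lf); rewrite ?subr_gt0 ?lerD2l ?lerN2// => n.
 by rewrite lerD2l lerN2; exact: tb.
Qed.

Lemma Y0_le : Y 0 <= N * M0 / (2 * t).
Proof.
have a0 : 0 < 2 / (N * M0) by rewrite divr_gt0// mulr_gt0.
have := riccati a0 t0 Y_cont Y_step.
have -> // : (2 / (N * M0) * t)^-1 = N * M0 / (2 * t) by field; rewrite !gt_eqF.
Qed.

End main.
(** The delay is taken along [eps n] and removed by strong continuity, which leaves the bound for
    [Y 0] tested on [phi] itself. *)
Lemma li_yau_test f phi M L dl t : W12 f -> W12 phi -> (forall x, 0 <= f x <= M) -> (forall x, 0 <= phi x <= M) ->
 [ae x | ng f x <= L] -> [ae x | ng phi x <= L] -> integ phi -> 0 < dl -> 0 < t ->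
 ip phi (fun x => ng (clampf M (P t f)) x ^+ 2 * qd dl (clampf M (P t f)) x - Lap (P t f) x) <=
  N / (2 * t) * (ip phi (P t f) + dl * \int[mu]_x phi x).
Proof.
move=> Wf Wphi f0 phi0 fL phiL iphi dl0 t0; have Lphi := W12_L2 Wphi; have Lf := W12_L2 Wf.
set F := (fun x => _ : R); apply/ler_addgt0Pr => e' e'0.
have Nt : 0 < N / (2 * t) by rewrite divr_gt0// mulr_gt0.
pose e := e' / (N / (2 * t)); have e0 : 0 < e by exact: divr_gt0.
have i0 : 0 <= \int[mu]_x phi x by apply: Rintegral_ge0 => x _; have /andP[] := phi0 x.
have LP s : 0 <= s -> L2 (P s f) by move=> s0; exact: P_L2.
have J0 s : 0 <= s -> 0 <= ip phi (P s f).
 move=> s0; have P0 := P_ge0 Lf s0 (ae_all _ (fun x => proj1 (andP (f0 x)))).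
 have z0 : integ (fun x => 0 * phi x) by exact: integrZ.
 have := leR_ae z0 (integM Lphi (LP s s0)); rewrite (RintegralZl 0 measurableT iphi) mul0r; apply.
 by apply: (ae_imp P0) => x h; rewrite mul0r mulr_ge0; have /andP[] := phi0 x.
(* The extra [e] makes the mass bound strictly positive, and it costs [e'] in the end. *)
pose Mr n := ip phi (P (t + eps n) f) + dl * \int[mu]_x phi x + e.
have Mr0 n : 0 < Mr n.
 by rewrite /Mr ltr_wpDl// addr_ge0 ?mulr_ge0 ?(ltW dl0)// J0// addr_ge0// ltW// eps_gt0.
have hn n : ip (clampf M (P (eps n + 0) phi)) F <= N * Mr n / (2 * t).
 have := @Y0_le f phi M L dl (eps n) t (Mr n) Wf Wphi f0 phi0 fL phiL iphi dl0 (@eps_gt0 R n) t0.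
 rewrite /Yf subr0; apply => //; by rewrite /Mr lerDl ltW.
have ce : eps n @[n --> \oo] --> (0 : R) := @eps_cvg R.
have nu : nice M L (`|L| * Num.sqrt (N / (2 * t))) (clampf M (P t f)) (Lap (P t f)).
 by apply: (flow_nice Wf f0 fL t0).
have LF : L2 F.
 have [L1 _] := ngq_L2 dl0 nu; apply: L2B => //.
 by case: nu => D _ _ _; exact: DA_L2 D.
have en n : 0 <= eps n + 0 :> R by rewrite addr0 ltW// eps_gt0.
have c1 : cvL2 (fun n => clampf M (P (eps n + 0) phi)) phi.
 have c0 : cvL2 (fun n => P (eps n + 0) phi) (P 0 phi).
  apply: P_cont_seq => //; by rewrite -[X in _ --> X]addr0; apply: cvgD => //; exact: cvg_cst.
 apply: (cvL2_le (c := 1) _ _ c0) => n.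
  apply: (mfunB (flow_m M Wphi (en n)) (W12_m Wphi)).
 by apply: (ae_imp2 (flow_ae Wphi phi0 (en n)) (P_0 SG Lphi)) => x h1 h2; rewrite -h1 h2 mul1r.
have l1 := cvL2_ip c1 (cvL2_cst (L2_m LF)) Lphi LF.
have ct : t + eps n @[n --> \oo] --> t + 0 by apply: cvgD => //; exact: cvg_cst.
have c2 : cvL2 (fun n => P (t + eps n) f) (P (t + 0) f).
 apply: P_cont_seq => //; [by rewrite addr0 ltW|by move=> n; rewrite addr_ge0 ?(ltW t0)// ltW// eps_gt0].
rewrite addr0 in c2; have l2 := cvL2_ip (cvL2_cst (W12_m Wphi)) c2 Lphi (LP _ (ltW t0)).
have l3 : N * Mr n / (2 * t) @[n --> \oo] --> N * (ip phi (P t f) + dl * \int[mu]_x phi x + e) / (2 * t).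
 apply: cvgM; last exact: cvg_cst.
 apply: cvgM; first exact: cvg_cst.
 by apply: cvgD; [apply: cvgD => //; exact: cvg_cst|exact: cvg_cst].
apply: (le_trans (_ : _ <= N * (ip phi (P t f) + dl * \int[mu]_x phi x + e) / (2 * t))).
 by apply: (ler_cvg_to l1 l3); exact: nearW.
apply: eq_leW; rewrite /e.
by move: (ip _ _) (\int[mu]_x _) => p q; field; rewrite !gt_eqF.
Qed.

Lemma ar_mass (p c q e j : R) : p <= c * (q + e * j) -> 0 <= c * q - p + c * e * j.
Proof.
move=> h; have -> : c * q - p + c * e * j = c * (q + e * j) - p by ring.
by rewrite subr_ge0.
Qed.

(** [lipc_test_loc] strips the test function for each [dl = eps n]. Multiplying by [u + dl] clears
    the denominator before [dl] tends to [0], which also covers the zeros of [u]. *)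
Lemma li_yau_lipc f t : lipc f -> (forall x, 0 <= f x) -> 0 < t ->
 [ae x | ng (P t f) x ^+ 2 <= P t f x * Lap (P t f) x + N / (2 * t) * P t f x ^+ 2].
Proof.
move=> lf f0 t0; have [L [mf [M bM] L0 Wf fL]] := lipc_props lf; have Lf := W12_L2 Wf.
have M0 := bddM_ge0 bM.
have fM x : 0 <= f x <= M by rewrite f0 (le_trans (ler_norm _) (bM x)).
set u := clampf M (P t f); have ue := flow_ae Wf fM (ltW t0); rewrite -/u in ue.
have mu' : meas u := flow_m _ Wf (ltW t0).
have u0 x : 0 <= u x by have /andP[] := clampf_bounds (P t f) x M0.
have nu : nice M L (`|L| * Num.sqrt (N / (2 * t))) u (Lap (P t f)) by exact: (flow_nice Wf fM fL t0).
have D : DA u (Lap (P t f)) by case: nu.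
have La := DA_L2 D; have LP := P_L2 SG (ltW t0) Lf.
have Hdl n : [ae x | 0 <= N / (2 * t) * P t f x - (ng u x ^+ 2 * qd (eps n) u x - Lap (P t f) x) + N / (2 * t) * eps n].
 have dl0 := @eps_gt0 R n; have [L1 _] := ngq_L2 dl0 nu; have LF := L2B L1 La.
 have LG := L2B (L2Z (N / (2 * t)) LP) LF; apply: (lipc_test_loc LG) => chi lc c0.
 have [K [mc [K' bK] K0 Wc cK]] := lipc_props lc; have Lc := W12_L2 Wc.
 (* [li_yau_test] wants common bounds for the datum and the test function. *)
 pose M' := Num.max M K'; pose L' := Num.max L K.
 have fM' x : 0 <= f x <= M' by have /andP[h1 h2] := fM x; rewrite h1 le_max h2.
 have cM' x : 0 <= chi x <= M' by rewrite c0 le_max (le_trans (ler_norm _) (bK x)) orbT.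
 have fL' : [ae x | ng f x <= L'] by apply: (ae_imp fL) => x h; rewrite le_max h.
 have cL' : [ae x | ng chi x <= L'] by apply: (ae_imp cK) => x h; rewrite le_max h orbT.
 have := li_yau_test Wf Wc fM' cM' fL' cL' (lipc_int lc) dl0 t0.
 have ue' := flow_ae Wf fM' (ltW t0); have m' := flow_m M' Wf (ltW t0).
 have uu' := ae_tr (ae_sym ue') ue.
 rewrite (ng_ae m' mu' uu').
 have -> : ip chi (fun x => ng u x ^+ 2 * qd (eps n) (clampf M' (P t f)) x - Lap (P t f) x) =
  ip chi (fun x => ng u x ^+ 2 * qd (eps n) u x - Lap (P t f) x).
  apply: Rint_ae; [|by apply: mfunM => //; exact: L2_m LF|by apply: (ae_imp uu') => x h; rewrite /qd h].
  apply: mfunM => //; apply: mfunB; last exact: L2_m La.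
  apply: mfunM; first by apply: mfunX; exact: (ng_m (DA_W12 D)).
  have M'0 : 0 <= M' by rewrite le_max M0.
  by apply: qd_m => // x; have /andP[] := clampf_bounds (P t f) x M'0.
 rewrite (ipBr (L2Z (N / (2 * t)) LP) LF Lc) (ipZr (N / (2 * t)) LP Lc).
 exact: ar_mass.
have mP := L2_m LP; rewrite (ng_ae mP mu' ue).
apply: (ae_imp2 (ae_foralln Hdl) ue) => x h e1.
have c : (u x + eps n) * Lap (P t f) x + N / (2 * t) * (u x + eps n) ^+ 2 @[n --> \oo] -->
  (u x + 0) * Lap (P t f) x + N / (2 * t) * (u x + 0) ^+ 2.
 have c0 : u x + eps n @[n --> \oo] --> u x + 0 by apply: cvgD; [exact: cvg_cst|exact: eps_cvg].
 apply: cvgD; first by apply: cvgM => //; exact: cvg_cst.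
 by apply: cvgM; [exact: cvg_cst|exact: cvgM].
rewrite addr0 in c; rewrite e1; apply: (cvgr_to_ge c); apply: nearW => n.
have := h n; rewrite e1 /qd; have := @eps_gt0 R n; have := u0 x.
move: (u x) (eps n) (ng u x ^+ 2) (Lap _ x) (N / (2 * t)) => y e g a c' y0 e0.
have ye : 0 < y + e by exact: ltr_wpDl.
have -> : c' * y - (g / (y + e) - a) + c' * e = (c' * (y + e) + a) - g / (y + e) by ring.
rewrite subr_ge0 ler_pdivrMr// => h1; apply: (le_trans h1).
by apply: eq_leW; ring.
Qed.

End liyau.
Hypothesis supp : forall (x : X) (U : set X), open U -> U x -> (0 < mu U)%E.
Variable p : R -> X -> X -> R.
Hypothesis pcont : forall t, 0 < t -> continuous (fun z : X * X => p t z.1 z.2).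
Hypothesis pker : forall t f, 0 < t -> L2 f ->
 [ae x | integ (fun y => p t x y * f y) /\ P t f x = \int[mu]_y (p t x y * f y)].

(** * The heat kernel as an L2 function of one variable *)

Section kernel.
Definition tentb y (n : nat) x : R := Num.max 0 (eps n - mdist x y).

Lemma tentb_ge0 y n x : 0 <= tentb y n x. Proof. by rewrite /tentb le_max lexx. Qed.

Lemma tentb_supp y n x : tentb y n x != 0 -> mdist x y < eps n.
Proof.
rewrite /tentb; apply: contra_neqT; rewrite -leNgt => h; apply/max_idPl; by rewrite subr_le0.
Qed.

Lemma tentb_lipc y n : lipc (tentb y n).
Proof.
split.
 exists 1 => x z; rewrite mul1r.
 have := mono1_lip (eps n - mdist x y) (eps n - mdist z y) (trunc_mono1 (lexx (0 : R))).
 rewrite /trunc !subr0 => h; apply: (le_trans h).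
 have h1 := metric_triangle z x y; have h2 := metric_triangle x z y.
 rewrite (metric_sym z x) in h1; rewrite ler_norml; apply/andP; split; lra.
apply: (subclosed_compact (@closed_closure _ _) (@propX y (eps n))).
have cl : closed [set z : X | mdist y z <= eps n :> R] by apply: compact_closed; [exact: metric_hausdorff|exact: propX].
rewrite [X in _ `<=` X](closure_id _).1//.
by apply: closure_subset => x /tentb_supp; rewrite metric_sym => /ltW.
Qed.

Lemma L2_lipc f : lipc f -> L2 f.
Proof. by move=> /(lipc_props)[L [_ _ _ /W12_L2]]. Qed.

(** Balls have positive measure by full support, so what holds almost everywhere in a ball holds
    somewhere in it. *)
Lemma ball_pos y r (Q0 : X -> Prop) : 0 < r -> [ae x | mdist x y < r -> Q0 x] ->
 exists2 x, mdist x y < r & Q0 x.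
Proof.
move=> r0 [A [mA A0 AP]]; apply: contrapT => nex.
pose U := [set x : X | mdist x y < r]; have oU : open U by exact: open_mball.
have UA : U `<=` A by move=> x Ux; apply: AP => H; apply: nex; exists x => //; exact: H.
have : (0 < mu U)%E by apply: (supp (x := y)) => //; rewrite /U /= mdistxx.
apply/negP; rewrite -leNgt -A0; apply: le_measure; rewrite ?inE//; exact: openMX.
Qed.

Lemma tentb_int_gt0 y n : 0 < \int[mu]_x tentb y n x.
Proof.
have il := lipc_int (tentb_lipc y n).
have i0 : 0 <= \int[mu]_x tentb y n x by apply: Rintegral_ge0 => x _; exact: tentb_ge0.
rewrite lt_neqAle i0 andbT eq_sym; apply/eqP => e0.
have h := Rint_eq0 il (ae_all _ (tentb_ge0 y n)) e0.
have [|x xr] := @ball_pos y (eps n) (fun x => tentb y n x = 0) (@eps_gt0 R n).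
 by apply: (ae_imp h).
by rewrite /tentb => /max_idPl; rewrite subr_le0 leNgt xr.
Qed.

(** A Lipschitz density of mass one concentrating at [y], standing for the Dirac mass. *)
Definition bump y n x := (\int[mu]_z tentb y n z)^-1 * tentb y n x.

Lemma bump_props y n : [/\ lipc (bump y n), forall x, 0 <= bump y n x,
 forall x, bump y n x != 0 -> mdist x y < eps n, integ (bump y n) & \int[mu]_x bump y n x = 1].
Proof.
have I0 := tentb_int_gt0 y n; have il := lipc_int (tentb_lipc y n).
have ib : integ (bump y n) by exact: integrZ.
split=> //.
- have := lipcD (\int[mu]_z tentb y n z)^-1 0 (tentb_lipc y n) (tentb_lipc y n).
 by have -> : (fun x => (\int[mu]_z tentb y n z)^-1 * tentb y n x + 0 * tentb y n x) = bump y n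
  by apply/funext => x; rewrite mul0r addr0.
- by move=> x; rewrite /bump mulr_ge0 ?tentb_ge0// invr_ge0 ltW.
- by move=> x; rewrite /bump mulf_eq0 negb_or => /andP[_]; exact: tentb_supp.
- by rewrite /bump RintegralZl// mulVf// gt_eqF.
Qed.

Lemma bump_L2 y n : L2 (bump y n).
Proof. by have [lb _ _ _ _] := bump_props y n; exact: L2_lipc. Qed.

Lemma avg y n g c e : integ (fun x => bump y n x * g x) ->
 [ae x | mdist x y < eps n -> `|g x - c| <= e] ->
 `|\int[mu]_x (bump y n x * g x) - c| <= e.
Proof.
move=> ig H; have [_ b0 bs ib b1] := bump_props y n.
have e1 (w : R) : \int[mu]_x (w * bump y n x) = w by rewrite RintegralZl// b1 mulr1.
have iw (w : R) : integ (fun x => w * bump y n x) by exact: integrZ.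
rewrite ler_norml; apply/andP; split.
 rewrite -lerBlDr opprK addrC -(e1 (c - e)); apply: leR_ae => //; apply: (ae_imp H) => x h.
 have [->|nz] := eqVneq (bump y n x) 0; first by rewrite mul0r mulr0.
 have := h (bs x nz); rewrite ler_norml => /andP[h1]; rewrite mulrC ler_wpM2l//; lra.
rewrite lerBlDr addrC -(e1 (c + e)); apply: leR_ae => //; apply: (ae_imp H) => x h.
have [->|nz] := eqVneq (bump y n x) 0; first by rewrite mul0r mulr0.
have := h (bs x nz); rewrite ler_norml => /andP[_ h1]; rewrite [leRHS]mulrC ler_wpM2l//; lra.
Qed.

Lemma p_near t x y e : 0 < t -> 0 < e -> exists2 r, 0 < r & forall x' y',
 mdist x' x < r -> mdist y' y < r -> `|p t x' y' - p t x y| < e.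
Proof.
move=> t0 e0; have /cvgrPdist_lt/(_ e e0) := @pcont t t0 (x, y).
move=> [[A B] /= [nA nB] AB]; have /nbhs_ballP[r1 /= r10 h1] := nA; have /nbhs_ballP[r2 /= r20 h2] := nB.
exists (Num.min r1 r2); first by rewrite lt_min r10.
move=> x' y'; rewrite !lt_min => /andP[hx _] /andP[_ hy]; rewrite distrC.
apply: (AB (x', y')); split; [apply: h1|apply: h2]; by rewrite ballEmdist /= metric_sym.
Qed.

Lemma p_contl t y : 0 < t -> continuous (fun x => p t x y).
Proof.
move=> t0 x; apply/cvgrPdist_lt => e e0; have [r r0 H] := p_near x y t0 e0.
apply/nbhs_ballP; exists r => // x'; rewrite ballEmdist /= => h; rewrite distrC; apply: H; first by rewrite metric_sym.
by rewrite mdistxx.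
Qed.

Lemma bump_P t x y e : 0 < t -> 0 < e -> exists k0 : nat, forall n m, (k0 <= n)%N -> (k0 <= m)%N ->
 `|ip (bump x n) (P t (bump y m)) - p t x y| <= e.
Proof.
move=> t0 e0; have [r r0 H] := p_near x y t0 e0; have [k0 kr] := @eps_small R _ (divr_gt0 r0 (ltr0n R 2)).
have er n : (k0 <= n)%N -> eps n < r.
 by move=> kn; apply: (le_lt_trans (@eps_le R _ _ kn)); apply: (le_lt_trans kr); rewrite ltr_pdivrMr// mulr_natr ltrDl.
exists k0 => n m kn km; have Lb := bump_L2 y m; have LP := P_L2 SG (ltW t0) Lb.
apply: avg; first exact: integM (bump_L2 x n) LP.
apply: (ae_imp (pker t0 Lb)) => x' [ix ->] hx.
have -> : \int[mu]_z (p t x' z * bump y m z) = \int[mu]_z (bump y m z * p t x' z).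
 by apply: eq_Rintegral => z _; rewrite mulrC.
apply: avg.
 by have -> : (fun z => bump y m z * p t x' z) = (fun z => p t x' z * bump y m z) by apply/funext => z; rewrite mulrC.
apply: ae_all => z hz; apply: ltW; apply: H; [exact: lt_trans hx (er n kn)|exact: lt_trans hz (er m km)].
Qed.

Lemma p_sym t x y : 0 < t -> p t x y = p t y x.
Proof.
move=> t0; apply/eqP; rewrite -subr_eq0 -normr_le0; apply/ler_addgt0Pr => e e0; rewrite add0r.
have e2 : 0 < e / 2 by rewrite divr_gt0.
have [k1 H1] := bump_P x y t0 e2; have [k2 H2] := bump_P y x t0 e2.
pose n := maxn k1 k2; have h1 := H1 n n (leq_maxl _ _) (leq_maxl _ _); have h2 := H2 n n (leq_maxr _ _) (leq_maxr _ _).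
have := dual SG SG (bump_L2 x n) (bump_L2 y n) (ltW t0).
rewrite (ipC mu (bump y n)) in h2; move=> e1; rewrite -e1 in h1.
move: h1 h2; move: (ip _ _) (p t x y) (p t y x) => a b c; rewrite !ler_norml => /andP[h1 h2] /andP[h3 h4].
by apply/andP; split; lra.
Qed.

Lemma p_ge0 t x y : 0 < t -> 0 <= p t x y.
Proof.
move=> t0; apply/ler_addgt0Pr => e e0; have [k1 H1] := bump_P x y t0 e0.
have h := H1 k1 k1 (leqnn _) (leqnn _).
have : 0 <= ip (bump x k1) (P t (bump y k1)).
 have [_ b0 _ ib _] := bump_props x k1; have [_ b0' _ _ _] := bump_props y k1.
 have P0 := P_ge0 (bump_L2 y k1) (ltW t0) (ae_all _ b0').
 have i1 := integM (bump_L2 x k1) (P_L2 SG (ltW t0) (bump_L2 y k1)).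
 have := leR_ae (integrZ measurableT 0 ib) i1; rewrite (RintegralZl 0 measurableT ib) mul0r; apply.
 by apply: (ae_imp P0) => z h1; rewrite mul0r mulr_ge0.
by move: h; rewrite ler_norml => /andP[h1]; lra.
Qed.

Lemma ptwise_unique (f_ : nat -> X -> R) f g : (forall n, L2 (f_ n)) -> meas f -> L2 g ->
 [ae x | f_ n x @[n --> \oo] --> f x] -> nn (fun x => f_ n x - g x) @[n --> \oo] --> (0 : R) ->
 L2 f /\ [ae x | f x = g x].
Proof.
move=> Lf_ mf Lg cf cg.
have key e : 0 < e -> L2 (fun x => f x - g x) /\ nn (fun x => f x - g x) <= e.
 move=> e0; move/cvgrPdist_lt : cg => /(_ _ e0)[n0 _ n0P].
 apply: (@L2_fatou _ _ _ mu (fun n x => f_ (n + n0)%N x - g x)).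
 - by move=> n; exact: L2B.
 - by apply: mfunB => //; exact: L2_m Lg.
 - apply: (ae_imp cf) => x cx; apply: cvgB; last exact: cvg_cst.
  by rewrite (@cvg_shiftn n0 _ (fun n => f_ n x)).
 - move=> n; have := n0P (n + n0)%N (leq_addl _ _); rewrite sub0r normrN ger0_norm ?nn_ge0//; exact: ltW.
have [L1 _] := key 1 ltr01; split.
 by have := L2D L1 Lg; have -> : (fun x => f x - g x + g x) = f by apply/funext => x; rewrite subrK.
have : nn (fun x => f x - g x) = 0.
 apply/eqP; rewrite eq_le nn_ge0 andbT; apply/ler_addgt0Pr => e e0; rewrite add0r; exact: (key e e0).2.
by move=> /(nn_eq0 L1)/ae_imp; apply => x /eqP; rewrite subr_eq0 => /eqP.
Qed.

Definition kt t y := fun x => p t x y.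

Lemma kt_m t y : 0 < t -> meas (kt t y).
Proof. by move=> t0; apply: contMX; exact: p_contl. Qed.

Lemma bump_pt t y : 0 < t -> [ae x | P t (bump y n) x @[n --> \oo] --> kt t y x].
Proof.
move=> t0; apply: (ae_imp (ae_foralln (fun n => pker t0 (bump_L2 y n)))) => x H.
apply/cvgrPdist_le => e e0; have [r r0 hr] := p_near x y t0 e0.
have [k0 kr] := @eps_small R _ r0; exists k0 => // n /= kn.
have [ix ->] := H n; rewrite distrC /kt.
have -> : \int[mu]_z (p t x z * bump y n z) = \int[mu]_z (bump y n z * p t x z).
 by apply: eq_Rintegral => z _; rewrite mulrC.
apply: avg.
 by have -> : (fun z => bump y n z * p t x z) = (fun z => p t x z * bump y n z) by apply/funext => z; rewrite mulrC.
apply: ae_all => z hz; apply: ltW; apply: hr; first by rewrite mdistxx.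
exact: lt_le_trans hz (le_trans (@eps_le R _ _ kn) kr).
Qed.

(** By self-adjointness the products of [P t (bump y n)] and [P t (bump y m)] are those of one bump
    with [P (t + t)] of the other, which tend to [p (t + t) y y]. The sequence is therefore Cauchy
    in L2, and its limit agrees with the pointwise limit [p t x y]. *)
Lemma kt_cv t y : 0 < t -> L2 (kt t y) /\ cvL2 (fun n => P t (bump y n)) (kt t y).
Proof.
move=> t0; have t0' := ltW t0; have Lb n := bump_L2 y n; have LP n := P_L2 SG t0' (Lb n).
have t20 : 0 < t + t by rewrite addr_gt0.
have ipE n m : ip (P t (bump y n)) (P t (bump y m)) = ip (bump y n) (P (t + t) (bump y m)).
 rewrite (dual SG SG (Lb n) (LP m) t0'); apply: ip_ae => //.
 - exact: P_L2.
 - by apply: P_L2 => //; exact: ltW.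
 - exact: ae_all.
 - exact: ae_sym (P_add SG t0' t0' (Lb m)).
have cau e : 0 < e -> exists n0 : nat, forall m n : nat, (n0 <= m)%N -> (n0 <= n)%N ->
  nn (fun x => P t (bump y m) x - P t (bump y n) x) < e.
 move=> e0; have e2 : 0 < e ^+ 2 / 8 by rewrite divr_gt0// exprn_gt0.
 have [k0 H] := bump_P y y t20 e2; exists k0 => m n km kn.
 rewrite -ltr_sqr ?nnegrE ?nn_ge0 ?(ltW)// nn_sqr (ipBl (LP m) (LP n) (L2B (LP m) (LP n))) !(ipBr (LP m) (LP n))// !ipE.
 have := H m m km km; have := H m n km kn; have := H n m kn km; have := H n n kn kn.
 have e3 : 0 < e ^+ 2 by rewrite exprn_gt0.
 move: (ip _ _) (ip _ _) (ip _ _) (ip _ _) (p _ _ _) (e ^+ 2) e3 => a1 a2 a3 a4 q e3 e30.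
 by rewrite !ler_norml => /andP[? ?] /andP[? ?] /andP[? ?] /andP[? ?]; lra.
have [g Lg cg] := L2_cauchy LP cau.
have [Lk kg] := ptwise_unique LP (kt_m y t0) Lg (bump_pt y t0) cg.
split=> //; split=> [n|]; first exact: L2B.
apply: cvg_trans cg; apply: near_eq_cvg; apply: nearW => n.
apply: nn_ae; [exact: L2B|exact: L2B|by apply: (ae_imp kg) => x ->].
Qed.

Lemma kt_L2 t y : 0 < t -> L2 (kt t y). Proof. by move=> /(kt_cv y)[]. Qed.

Lemma P_kt s t y : 0 <= s -> 0 < t -> [ae x | P s (kt t y) x = kt (s + t) y x].
Proof.
move=> s0 t0; have st0 : 0 < s + t by rewrite ltr_wpDl.
have [L1 c1] := kt_cv y t0; have [L3 c2] := kt_cv y st0.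
have Lb n := bump_L2 y n; have LP n := P_L2 SG (ltW t0) (Lb n).
apply: (@cvg_unique_nn (fun n => P (s + t) (bump y n))) => //.
- by move=> n; apply: P_L2 => //; exact: ltW.
- exact: P_L2.
- apply: (squeeze_cvgr _ (cvg_cst 0) c1.2); apply: nearW => n; rewrite nn_ge0 /=.
 apply: le_trans (P_nnB SG s0 (LP n) L1); apply: eq_leW; apply: nn_ae.
 + by apply: L2B; [apply: P_L2 => //; exact: ltW|exact: P_L2].
 + by apply: L2B; [apply: P_L2 => //; exact: LP|exact: P_L2].
 + by apply: (ae_imp (P_add SG s0 (ltW t0) (Lb n))) => x ->.
- exact: c2.2.
Qed.

(** Chapman-Kolmogorov, in a form that already contains the symmetry of the kernel. *)
Lemma kt_ip s t x y : 0 < s -> 0 < t -> p (s + t) x y = ip (kt s x) (kt t y).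
Proof.
move=> s0 t0; have st0 : 0 < s + t by rewrite addr_gt0.
have [L1 c1] := kt_cv x s0; have [L3 c2] := kt_cv y t0.
have := cvL2_ip c1 c2 L1 L3 => l1; apply/esym.
have l2 : ip (P s (bump x n)) (P t (bump y n)) @[n --> \oo] --> p (s + t) x y.
 apply/cvgrPdist_le => e e0; have [k0 H] := bump_P x y st0 e0; exists k0 => // n /= kn.
 have Lx := bump_L2 x n; have Ly := bump_L2 y n; have LPy := P_L2 SG (ltW t0) Ly.
 rewrite distrC (dual SG SG Lx LPy (ltW s0)).
 have <- : ip (bump x n) (P (s + t) (bump y n)) = ip (bump x n) (P s (P t (bump y n))).
  apply: ip_ae => //; [by apply: P_L2 => //; exact: ltW|by apply: P_L2 => //; exact: ltW|exact: ae_all|].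
  exact: (P_add SG (ltW s0) (ltW t0) Ly).
 exact: H.
by apply: (cvg_unique _ l1 l2); exact: Rhausdorff.
Qed.

Lemma kt_DA t y : 0 < t -> DA (kt t y) (Lap (kt t y)).
Proof.
move=> t0; have t2 : 0 < t / 2 by rewrite divr_gt0.
have [h [D _]] := P_DA SG (kt_L2 y t2) t2.
have := P_kt y (ltW t2) t2; rewrite -splitr => e1.
apply: (@LapP (kt t y) h); apply: (DA_ae D (kt_m y t0) _ e1); last exact: ae_all.
exact: L2_m (DA_L2 D).
Qed.

Lemma int_abs_le f g : L2 f -> L2 g -> \int[mu]_x `|f x * g x| <= nn f * nn g.
Proof.
move=> Lf Lg; have La (w : X -> R) : L2 w -> L2 (fun x => `|w x|) /\ nn (fun x => `|w x|) = nn w.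
 move=> Lw; have L : L2 (fun x => `|w x|).
  apply: (L2_dom _ Lw); first by apply: mT_comp (L2_m Lw).
  by apply: ae_all => x; rewrite normr_id.
 split=> //; apply/eqP; rewrite eq_le !nn_le//; apply: ae_all => x; by rewrite normr_id.
have [L1 e1] := La f Lf; have [L3 e2] := La g Lg; have := CS L1 L3; rewrite e1 e2.
apply: le_trans; apply: le_trans (ler_norm _); apply: eq_leW.
by apply: eq_Rintegral => x _; rewrite normrM.
Qed.

Lemma prod_l1 (x_ y_ : nat -> X -> R) f g : cvL2 x_ f -> cvL2 y_ g -> L2 f -> L2 g ->
 \int[mu]_x `|x_ n x * y_ n x - f x * g x| @[n --> \oo] --> (0 : R).
Proof.
move=> cx cy Lf Lg; have Lx n := cvL2_L2 n cx Lf; have Ly n := cvL2_L2 n cy Lg.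
pose B n := nn (fun x => x_ n x - f x) * (nn g + nn (fun x => y_ n x - g x)) + nn f * nn (fun x => y_ n x - g x).
have cB : B n @[n --> \oo] --> (0 : R).
 have : B n @[n --> \oo] --> (0 * (nn g + 0) + nn f * 0 : R).
  apply: cvgD; first by apply: cvgM; [exact: cx.2|apply: cvgD; [exact: cvg_cst|exact: cy.2]].
  by apply: cvgM; [exact: cvg_cst|exact: cy.2].
 by rewrite mul0r mulr0 addr0.
apply: (squeeze_cvgr _ (cvg_cst 0) cB); apply: nearW => n; rewrite Rintegral_ge0//=.
have i1 := integrable_norm (integM (cx.1 n) (Ly n)); have i2 := integrable_norm (integM Lf (cy.1 n)).
apply: (@le_trans _ _ (\int[mu]_x `|(x_ n x - f x) * y_ n x| + \int[mu]_x `|f x * (y_ n x - g x)|)).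
 rewrite -(RintegralD measurableT i1 i2); apply: leR_ae.
 - exact: (integrable_norm (integrB measurableT (integM (Lx n) (Ly n)) (integM Lf Lg))).
 - exact: (integrD measurableT i1 i2).
 apply: ae_all => x /=; have -> : x_ n x * y_ n x - f x * g x = (x_ n x - f x) * y_ n x + f x * (y_ n x - g x) by ring.
 exact: ler_normD.
apply: lerD; last exact: int_abs_le Lf (cy.1 n).
apply: (le_trans (int_abs_le (cx.1 n) (Ly n))); apply: ler_wpM2l; first exact: nn_ge0.
have e1 : y_ n = (fun x => g x + (y_ n x - g x)) by apply/funext => x; ring.
by rewrite {1}e1; exact: nnD Lg (cy.1 n).
Qed.

(* Nonnegativity is preserved by limits in L1, which is why no subsequence is needed. *)
Lemma ae_ge0_lim (w_ v_ g_ : nat -> X -> R) w v g c : 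
 cvL2 w_ w -> cvL2 v_ v -> cvL2 g_ g -> L2 w -> L2 v -> L2 g ->
 (forall n, [ae x | g_ n x ^+ 2 <= w_ n x * v_ n x + c * w_ n x ^+ 2]) ->
 [ae x | g x ^+ 2 <= w x * v x + c * w x ^+ 2].
Proof.
move=> cw cv cg Lw Lv Lg H.
have Lwn n := cvL2_L2 n cw Lw; have Lvn n := cvL2_L2 n cv Lv; have Lgn n := cvL2_L2 n cg Lg.
pose W (a b c' : X -> R) x := (a x * b x + c * (a x * a x)) - c' x * c' x.
have iW (a b c' : X -> R) : L2 a -> L2 b -> L2 c' -> integ (W a b c').
 move=> La Lb Lc; apply: (integrB measurableT); last exact: integM.
 by apply: (integrD measurableT); [exact: integM|apply: integrZ => //; exact: integM].
pose D n x := W (w_ n) (v_ n) (g_ n) x - W w v g x.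
have W0 n : [ae x | 0 <= W (w_ n) (v_ n) (g_ n) x].
 by apply: (ae_imp (H n)) => x; rewrite subr_ge0 -!expr2.
have iD n : integ (D n) by apply: (integrB measurableT); exact: iW.
have cD : \int[mu]_x `|D n x| @[n --> \oo] --> (0 : R).
 have c1 := prod_l1 cw cv Lw Lv; have c2 := prod_l1 cw cw Lw Lw; have c3 := prod_l1 cg cg Lg Lg.
 pose B n := \int[mu]_x `|w_ n x * v_ n x - w x * v x| + `|c| * \int[mu]_x `|w_ n x * w_ n x - w x * w x| +
  \int[mu]_x `|g_ n x * g_ n x - g x * g x|.
 have cB : B n @[n --> \oo] --> (0 : R).
  have : B n @[n --> \oo] --> (0 + `|c| * 0 + 0 : R).
   by apply: cvgD c3; apply: cvgD c1 _; apply: cvgM c2; exact: cvg_cst.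
  by rewrite mulr0 !addr0.
 apply: (squeeze_cvgr _ (cvg_cst 0) cB); apply: nearW => n.
 rewrite Rintegral_ge0//=.
 have i1 := integrable_norm (integrB measurableT (integM (Lwn n) (Lvn n)) (integM Lw Lv)).
 have i2 := integrable_norm (integrB measurableT (integM (Lwn n) (Lwn n)) (integM Lw Lw)).
 have i3 := integrable_norm (integrB measurableT (integM (Lgn n) (Lgn n)) (integM Lg Lg)).
 have i4 := integrZ measurableT `|c| i2; have i5 := integrD measurableT i1 i4.
 have i6 := integrD measurableT i5 i3.
 rewrite /B -(RintegralZl `|c| measurableT i2) -(RintegralD measurableT i1 i4) -(RintegralD measurableT i5 i3).
 apply: leR_ae => //; first exact: integrable_norm (iD n).
 apply: ae_all => x /=; rewrite /D /W -normrM.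
 move: (w_ n x) (v_ n x) (g_ n x) (w x) (v x) (g x) => a1 a2 a3 b1 b2 b3.
 have -> : a1 * a2 + c * (a1 * a1) - a3 * a3 - (b1 * b2 + c * (b1 * b1) - b3 * b3) =
  (a1 * a2 - b1 * b2) + c * (a1 * a1 - b1 * b1) - (a3 * a3 - b3 * b3) by ring.
 by apply: (le_trans (ler_normB _ _)); rewrite lerD2r; exact: ler_normD.
have iWl := iW _ _ _ Lw Lv Lg.
pose ng0 x := Num.max 0 (- W w v g x).
have mng : meas ng0.
 by apply: measurable_maxr => //; apply: mT_comp => //; exact: integ_mfun iWl.
have ing : integ ng0.
 apply: (integ_dom_ae mng (integrable_norm iWl)); apply: ae_all => x /=; rewrite /ng0.
 by rewrite ger0_norm ?le_max ?lexx// ge_max normr_ge0 -normrN ler_norm.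
have n0 : \int[mu]_x ng0 x = 0.
 apply/eqP; rewrite eq_le; apply/andP; split; last by apply: Rintegral_ge0 => x _; rewrite le_max lexx.
 apply: (cvgr_to_ge cD); apply: nearW => n; apply: leR_ae => //; first exact: integrable_norm (iD n).
 apply: (ae_imp (W0 n)) => x h; rewrite /ng0 ge_max normr_ge0 /=.
 by apply: le_trans (ler_norm _); rewrite /D lerBrDr addrC subrr.
have := Rint_eq0 ing (ae_all _ (fun x => (_ : 0 <= ng0 x))) n0.
move=> /(_ (fun x => ltac:(by rewrite /ng0 le_max lexx)))/ae_imp; apply => x /max_idPl.
by rewrite oppr_le0 /W subr_ge0 -!expr2.
Qed.

End kernel.
Let bL2 y n : L2 (bump y n). Proof. exact: bump_L2. Qed.
Let kL2 t y : 0 < t -> L2 (kt t y). Proof. by move=> t0; exact: (kt_L2). Qed.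
Let kDA t y : 0 < t -> DA (kt t y) (Lap (kt t y)).
Proof. by move=> t0; exact: (kt_DA). Qed.
Let kcv t y : 0 < t -> cvL2 (fun n => P t (bump y n)) (kt t y).
Proof. by move=> t0; have [] := kt_cv y t0. Qed.
Let Pk s t y : 0 <= s -> 0 < t -> [ae x | P s (kt t y) x = kt (s + t) y x].
Proof. exact: (P_kt). Qed.
Let km t y : 0 < t -> meas (kt t y).
Proof. exact: kt_m. Qed.

(** * Time derivative and Li-Yau inequality for the kernel *)

Section kernel_li_yau.
Lemma DA_sub f h g k : DA f h -> DA g k -> DA (fun x => f x - g x) (fun x => h x - k x).
Proof.
move=> D1 D2; have := DA_lin 1 (-1) D1 D2.
have -> : (fun x => 1 * f x + -1 * g x) = (fun x => f x - g x) by apply/funext => x; ring.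
by have -> : (fun x => 1 * h x + -1 * k x) = (fun x => h x - k x) by apply/funext => x; ring.
Qed.

Lemma cvL2_ng (u_ a_ : nat -> X -> R) u a : (forall n, DA (u_ n) (a_ n)) -> DA u a ->
 cvL2 u_ u -> cvL2 a_ a -> cvL2 (fun n => ng (u_ n)) (ng u).
Proof.
move=> Dn D cu ca; have Wu := DA_W12 D; have Wn n := DA_W12 (Dn n).
apply: (@cvL2_le (fun n => ng (fun z => u_ n z - u z)) _ (fun=> 0) _ 1).
- by move=> n; apply: mfunB; exact: (ng_m).
- move=> n; apply: (ae_imp (ng_dist (Wn n) Wu)) => x h.
 by rewrite mul1r subr0 (ger0_norm (ng_ge0 (fun => _) x)).
split=> [n|]; first by apply: L2B (L20 mu); exact: (ng_L2 (W12B (Wn n) Wu)).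
have c2 : nn (fun x => u_ n x - u x) + nn (fun x => a_ n x - a x) @[n --> \oo] --> (0 + 0 : R).
 by apply: cvgD; [exact: cu.2|exact: ca.2].
rewrite addr0 in c2; apply: (squeeze_cvgr _ (cvg_cst 0) c2); apply: nearW => n; rewrite nn_ge0 /=.
have Dd := DA_sub (Dn n) D; have := Q_DA Dd; rewrite QE -nn_sqr => e3.
have -> : (fun x => ng (fun z => u_ n z - u z) x - 0) = ng (fun z => u_ n z - u z) by apply/funext => x; rewrite subr0.
have := CS (DA_L2 Dd) (DA_fL2 Dd).
rewrite -normrN -e3 ger0_norm ?sqr_ge0// => h.
by rewrite -ler_sqr ?nnegrE ?addr_ge0 ?nn_ge0//; exact: ar_sqsum (nn_ge0 _ _) (nn_ge0 _ _) h.
Qed.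

(** The smoothing bound over time [t / 2], applied to [P (t / 2) (bump y n) - kt (t / 2) y], which
    tends to [0] in L2. *)
Lemma Lap_cv t y : 0 < t -> cvL2 (fun n => Lap (P t (bump y n))) (Lap (kt t y)).
Proof.
move=> t0; have t2 : 0 < t / 2 by rewrite divr_gt0.
have Dn n := Lap_P (bL2 y n) t0; have D := kDA y t0.
have LD n := L2B (DA_L2 (Dn n)) (DA_L2 D).
split=> //; have c := (kcv y t2).2; pose zn n x := P (t / 2) (bump y n) x - kt (t / 2) y x.
have c' : nn (zn n) / (t / 2) @[n --> \oo] --> 0 / (t / 2) by apply: cvgM => //; exact: cvg_cst.
rewrite mul0r in c'; apply: (squeeze_cvgr _ (cvg_cst 0) c'); apply: nearW => n; rewrite nn_ge0 /=.
have LP := P_L2 SG (ltW t2) (bL2 y n); have Lz : L2 (zn n) by exact: L2B LP (kL2 y t2).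
have [h [Dh nh]] := P_DA SG Lz t2; apply: le_trans nh.
apply: eq_leW; apply: nn_ae => //; first exact: DA_L2 Dh.
apply: (DA_uniq (DA_sub (Dn n) D)).
apply: (DA_ae Dh); [|exact: L2_m (DA_L2 Dh)| |exact: ae_all].
 by apply: mfunB; [exact: L2_m (P_L2 SG (ltW t0) (bL2 y n))|exact: km].
have e1 := P_add SG (ltW t2) (ltW t2) (bL2 y n); rewrite -splitr in e1.
have e2 := Pk y (ltW t2) t2; rewrite -splitr in e2.
by apply: (ae_imp2 (P_B SG (ltW t2) LP (kL2 y t2)) (ae_and e1 e2)) => x -> [-> ->].
Qed.

Lemma bump_ng t y : 0 < t -> cvL2 (fun n => ng (P t (bump y n))) (ng (kt t y)).
Proof.
move=> t0; apply: (cvL2_ng (fun n => Lap_P (bL2 y n) t0) (kDA y t0) (kcv y t0)).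
exact: Lap_cv.
Qed.

(** The generator at [kt t y] gives the right derivative; for the left one, its expansion at time
    [t / 2] is pushed forward by the semigroup. *)
Lemma kt_deriv t y e : 0 < t -> 0 < e -> exists2 dl : R, 0 < dl & forall h : R, h != 0 -> `|h| < dl ->
 0 < t + h /\ nn (fun x => kt (t + h) y x - kt t y x - h * Lap (kt t y) x) <= e * `|h|.
Proof.
move=> t0 e0; have e2 : 0 < e / 2 by rewrite divr_gt0.
have D := kDA y t0; have Lk := kL2 y t0; have LA := DA_L2 D.
have [d1 d10 H1] := (P_gen SG Lk LA).1 D _ e0.
pose rho := t / 2; have r0 : 0 < rho by rewrite divr_gt0.
have Dr := kDA y r0; have Lr := kL2 y r0; have LAr := DA_L2 Dr.
have [d2 d20 H2] := (P_gen SG Lr LAr).1 Dr _ e2; have [d3 d30 H3] := P_cont SG LAr e2.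
exists (Num.min (Num.min d1 d2) (Num.min d3 rho)); first by rewrite !lt_min d10 d20 d30.
move=> h h0; rewrite !lt_min => /andP[/andP[h1 h2] /andP[h3 h4]].
have th : 0 < t + h.
 by move: h4; rewrite ltr_norml /rho => /andP[?]; lra.
split=> //; have LH := kL2 y th; have LL := L2B (L2B LH Lk) (L2Z h LA).
have [hp|hn|he] := ltrgt0P h; last by rewrite he eqxx in h0.
 rewrite (gtr0_norm hp) in h1 *; apply: le_trans (H1 h hp h1); apply: eq_leW.
 apply: (nn_ae LL (P_rem_L2 SG (ltW hp) Lk LA)).
 by have := Pk y (ltW hp) t0; rewrite [h + t]addrC => /ae_imp; apply => x e1; rewrite /P_rem e1.
rewrite (ltr0_norm hn) in h2 h3 h4 *; pose tau := - h.
have tau0 : 0 < tau by rewrite oppr_gt0.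
pose s := t - tau - rho; have s0 : 0 <= s by rewrite /s /tau /rho; rewrite /rho in h4; lra.
have Lrem := P_rem_L2 SG (ltW tau0) Lr LAr.
have LPA := P_L2 SG (ltW tau0) LAr; have Ld := L2B LPA LAr.
have LPr := P_L2 SG s0 Lrem; have LPd := P_L2 SG s0 Ld.
(* [kt t - kt (t - tau) - tau A kt t = P_s (rem) - tau P_s (P_tau A - A)] for [A = Lap (kt rho)] *)
have eqn : [ae x | kt (t + h) y x - kt t y x - h * Lap (kt t y) x =
  -1 * P s (P_rem P (kt rho y) (Lap (kt rho y)) tau) x + tau * P s (fun x => P tau (Lap (kt rho y)) x - Lap (kt rho y) x) x].
 have e1 : [ae x | P s (kt rho y) x = kt (t + h) y x].
  by have := Pk y s0 r0; have -> : s + rho = t + h by rewrite /s /tau; ring.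
 have st0 : 0 <= tau + s by rewrite addr_ge0// ltW.
 have e2' : [ae x | P (tau + s) (kt rho y) x = kt t y x].
  by have := Pk y st0 r0; have -> : tau + s + rho = t by rewrite /s; ring.
 have e3 := P_rem_P SG s0 (ltW tau0) Lr LAr.
 have e4 := P_B SG s0 LPA LAr.
 have e5 := P_add SG s0 (ltW tau0) LAr.
 have e6 : [ae x | P (s + tau) (Lap (kt rho y)) x = Lap (kt t y) x].
  have st1 : 0 <= s + tau by rewrite addr_ge0// ltW.
  apply: (DA_uniq _ D).
  apply: (DA_ae (DA_P SG Dr st1) (km y t0) (L2_m (P_L2 SG st1 LAr))); last exact: ae_all.
  by rewrite addrC.
 apply: (ae_imp2 (ae_and (ae_and e1 e2') (ae_and e3 e4)) (ae_and e5 e6)) => x [[f1 f2] [f3 f4]] [f5 f6].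
 by rewrite f3 f4 -f5 f6 f2 f1 /tau; ring.
rewrite (nn_ae LL (L2D (L2Z (-1) LPr) (L2Z tau LPd)) eqn); apply: (le_trans (nnD (L2Z (-1) LPr) (L2Z tau LPd))).
rewrite (nnZ (-1) LPr) (nnZ tau LPd) normrN1 mul1r (gtr0_norm tau0).
have b1 : nn (P s (P_rem P (kt rho y) (Lap (kt rho y)) tau)) <= e / 2 * tau.
 by apply: (le_trans (P_nn SG s0 Lrem)); exact: H2.
have b2 : nn (P s (fun x => P tau (Lap (kt rho y)) x - Lap (kt rho y) x)) <= e / 2.
 by apply: (le_trans (P_nn SG s0 Ld)); apply: ltW; apply: H3 => //; exact: ltW.
have b3 := ler_pM2l tau0 (nn (P s (fun x => P tau (Lap (kt rho y)) x - Lap (kt rho y) x))) (e / 2); rewrite b2 in b3.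
by rewrite -/tau; lra.
Qed.

(** The time derivative of the kernel: in Chapman-Kolmogorov with two halves, the increment is given
    to the first factor alone. It is defined at every pair of points, whereas [Lap (kt t y)] is
    determined up to null sets. *)
Definition dtp t x y := ip (Lap (kt (t / 2) x)) (kt (t / 2) y).

Lemma p_deriv t x y e : 0 < t -> 0 < e -> exists2 dl : R, 0 < dl & forall h : R, h != 0 -> `|h| < dl ->
 0 < t + h /\ `|p (t + h) x y - p t x y - h * dtp t x y| <= e * `|h|.
Proof.
move=> t0 e0; have t2 : 0 < t / 2 by rewrite divr_gt0.
have Ly := kL2 y t2; have Lx := kL2 x t2; have n0 : 0 < nn (kt (t / 2) y) + 1 by rewrite ltr_wpDl// nn_ge0.
have [dl d0 H] := kt_deriv x t2 (divr_gt0 e0 n0); exists dl => // h h0 hd.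
have [th hh] := H h h0 hd; have th' : 0 < t + h by lra.
split=> //; have LA := DA_L2 (kDA x t2); have Lh := kL2 x th.
have kip := kt_ip.
have -> : p (t + h) x y = ip (kt (t / 2 + h) x) (kt (t / 2) y).
 by rewrite -kip//; congr (p _ x y); field.
have -> : p t x y = ip (kt (t / 2) x) (kt (t / 2) y) by rewrite -kip// -splitr.
rewrite /dtp -(ipZl h LA Ly) -(ipBl Lh Lx Ly) -(ipBl (L2B Lh Lx) (L2Z h LA) Ly).
apply: (le_trans (CS (L2B (L2B Lh Lx) (L2Z h LA)) Ly)).
apply: (@le_trans _ _ (e / (nn (kt (t / 2) y) + 1) * `|h| * (nn (kt (t / 2) y) + 1))).
 by apply: ler_pM; rewrite ?nn_ge0// lerDl.
by rewrite mulrAC divfK// gt_eqF.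
Qed.

(** The heat equation: the same difference quotients converge at every point to [dtp] and in L2 to
    the Laplacian. *)
Lemma dtp_Lap t y : 0 < t -> [ae x | dtp t x y = Lap (kt t y) x].
Proof.
move=> t0; pose f_ n x := (eps n)^-1 * (kt (t + eps n) y x - kt t y x).
have D := kDA y t0; have LA := DA_L2 D.
have te n : 0 < t + eps n by rewrite addr_gt0// eps_gt0.
have Lf n : L2 (f_ n) by apply: L2Z; exact: L2B (kL2 y (te n)) (kL2 y t0).
have pc x : f_ n x @[n --> \oo] --> dtp t x y.
 apply/cvgrPdist_le => e e0; have [dl d0 H] := p_deriv x y t0 e0.
 have /cvgrPdist_lt/(_ _ d0) := @eps_cvg R; apply: filterS => n; rewrite sub0r normrN => h.
 have [_ h1] := H (eps n) (@eps_neq0 R n) h; have en := @eps_gt0 R n.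
 rewrite distrC /f_ /kt; have -> : (eps n)^-1 * (p (t + eps n) x y - p t x y) - dtp t x y =
  (eps n)^-1 * (p (t + eps n) x y - p t x y - eps n * dtp t x y) by field; rewrite gt_eqF.
 by rewrite normrM ger0_norm ?invr_ge0 ?(ltW en)// mulrC ler_pdivrMr; move: h1; rewrite (gtr0_norm en).
have mf : meas (fun x => dtp t x y).
 apply: (@measurable_fun_cvg _ _ _ setT f_) => [n|x _]; [exact: L2_m (Lf n)|exact: pc].
have [] := @ptwise_unique f_ (fun x => dtp t x y) (Lap (kt t y)) Lf mf LA (ae_all _ pc).
 apply/cvgrPdist_le => e e0; have [dl d0 H] := kt_deriv y t0 e0.
 have /cvgrPdist_lt/(_ _ d0) := @eps_cvg R; apply: filterS => n; rewrite sub0r normrN => h.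
 have [_ h1] := H (eps n) (@eps_neq0 R n) h; have en := @eps_gt0 R n.
 rewrite sub0r normrN ger0_norm ?nn_ge0//.
 have -> : (fun x => f_ n x - Lap (kt t y) x) =
  (fun x => (eps n)^-1 * (kt (t + eps n) y x - kt t y x - eps n * Lap (kt t y) x)).
  by apply/funext => x; rewrite /f_; field; rewrite gt_eqF.
 rewrite (nnZ _ (L2B (L2B (kL2 y (te n)) (kL2 y t0)) (L2Z (eps n) LA))) ger0_norm ?invr_ge0 ?(ltW en)//.
 by rewrite mulrC ler_pdivrMr; move: h1; rewrite (gtr0_norm).
by [].
Qed.

Lemma kt_li_yau t y : 0 < t -> {ae mu, forall x,
 ng (kt t y) x ^+ 2 <= kt t y x * dtp t x y + N / (2 * t) * kt t y x ^+ 2}.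
Proof.
move=> t0; have D := kDA y t0.
have := @ae_ge0_lim _ _ _ _ _ _ (N / (2 * t)) (kcv y t0) (Lap_cv y t0) (bump_ng y t0)
 (kL2 y t0) (DA_L2 D) (ng_L2 (DA_W12 D)).
move=> /(_ _)/ae_imp2 H; apply: (H _ _ _ (dtp_Lap y t0)) => [n|x h ->//].
have [lb b0 _ _ _] := bump_props y n.
exact: (li_yau_lipc lb b0 t0).
Qed.

(* The Bakry-Emery bound [|A P_s phi| <= L sqrt (N / 2 s)] integrates to
 [P_s phi >= phi - K sqrt s], first between [s / 4] and [s]. *)
Lemma P_lower phi L s chi : W12 phi -> [ae x | ng phi x <= L] -> 0 <= L -> 0 < s ->
 L2 chi -> integ chi -> (forall x, 0 <= chi x) ->
 ip (P s phi) chi >= ip (P (s / 4) phi) chi -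
  3 * L * Num.sqrt N * (Num.sqrt s - Num.sqrt (s / 4)) * \int[mu]_x chi x.
Proof.
move=> Wphi hL L0 s0 Lchi ichi chi0; have Lphi := W12_L2 Wphi.
have s4 : 0 < s / 4 by rewrite divr_gt0.
have D := Lap_P Lphi s4; set k := Lap _ in D.
have Lk := DA_L2 D; have LPs := P_L2 SG (ltW s4) Lphi.
(* The Laplacian bound [L sqrt (N / (2 r))] at [r = s / 4]. *)
pose C := L * Num.sqrt (2 * N / s).
have C0 : 0 <= C by rewrite mulr_ge0.
have kC : [ae x | `|k x| <= C].
 apply: (ae_imp (BE_bound Wphi s4 D hL)) => x h.
 rewrite -ler_sqr ?nnegrE// real_normK ?num_real// exprMn sqr_sqrtr; last by rewrite divr_ge0 ?mulr_ge0 ?ltW.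
 have h2 : 2 * (s / 4) / N * k x ^+ 2 <= L ^+ 2 by apply: le_trans h; rewrite lerDr sqr_ge0.
 have sN : 0 < 2 * (s / 4) / N by rewrite divr_gt0// mulr_gt0.
 rewrite -(ler_pM2l sN); apply: (le_trans h2); apply: eq_leW.
 by field; rewrite !gt_eqF.
have I0 : 0 <= \int[mu]_x chi x by exact: Rintegral_ge0.
have r0 : 0 <= s - s / 4 by lra.
have := @tel_slope R (fun r => - ip (P r (P (s / 4) phi)) chi) (C * \int[mu]_x chi x) _ r0.
have -> : ip (P (s - s / 4) (P (s / 4) phi)) chi = ip (P s phi) chi.
 apply: ip_ae => //; [exact: P_L2|exact: P_L2 (ltW s0) Lphi| |exact: ae_all].
 by have := P_add SG r0 (ltW s4) Lphi; rewrite subrK => /ae_sym.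
have -> : ip (P 0 (P (s / 4) phi)) chi = ip (P (s / 4) phi) chi.
 by apply: ip_ae => //; [exact: P_L2|exact: P_0|exact: ae_all].
have sq : Num.sqrt s - Num.sqrt (s / 4) = Num.sqrt s / 2.
 have -> : s / 4 = s * (2^-1) ^+ 2 by field.
 by rewrite sqrtrM ?(ltW)// sqrtr_sqr ger0_norm//; field.
(* The left side is [(3 / 4) L sqrt (2 N s)], while [sqrt s - sqrt (s / 4) = sqrt s / 2]; the
   constant [3] leaves room for [sqrt 2 <= 2]. *)
have Cs : C * (s - s / 4) <= 3 * L * Num.sqrt N * (Num.sqrt s - Num.sqrt (s / 4)).
 have -> : C * (s - s / 4) = L * (Num.sqrt (2 * N / s) * s) * (3 / 4) by rewrite /C; field.
 rewrite sq; have -> : Num.sqrt (2 * N / s) * s = Num.sqrt 2 * Num.sqrt N * Num.sqrt s.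
  rewrite -{2}(sqr_sqrtr (ltW s0)) mulrA -sqrtrM ?divr_ge0 ?mulr_ge0 ?(ltW)//.
  by rewrite divfK ?gt_eqF// sqrtrM.
 have s2 : Num.sqrt 2 <= 2 :> R.
  by rewrite -ler_sqr ?nnegrE ?sqrtr_ge0// sqr_sqrtr; lra.
 have : L * Num.sqrt N * Num.sqrt s * Num.sqrt 2 <= L * Num.sqrt N * Num.sqrt s * 2.
  by rewrite ler_wpM2l// !mulr_ge0.
 move: (Num.sqrt N) (Num.sqrt s) (Num.sqrt 2) => a b c h.
 have -> : L * (c * a * b) * (3 / 4) = (L * a * b * c) * (3 / 4) by ring.
 have -> : 3 * L * a * (b / 2) = (L * a * b * 2) * (3 / 4) by field.
 by rewrite ler_pM2r.
move=> H; have {}H := H _; have := ler_wpM2r I0 Cs => Cs'.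
suff : forall e, 0 < e -> exists2 dl : R, 0 < dl & forall r h : R, 0 <= r -> 0 < h -> h < dl -> r + h <= s - s / 4 ->
 - ip (P (r + h) (P (s / 4) phi)) chi <= - ip (P r (P (s / 4) phi)) chi + (C * \int[mu]_x chi x + e) * h.
 move=> /H; have -> : C * (\int[mu]_x chi x) * (s - s / 4) = C * (s - s / 4) * \int[mu]_x chi x by ring.
 by move: Cs'; move: (C * _ * _) (3 * L * _ * _ * _) (ip _ _) (ip _ _) => *; lra.
move=> e e0; have n1 : 0 < nn chi + 1 by rewrite ltr_wpDl// nn_ge0.
have [d1 d10 H1] := P_step_ip SG D (divr_gt0 e0 n1).
exists d1 => // r h r0' h0 hd _; have := H1 r h chi r0' h0 hd Lchi.
have b1 : - ip (P r k) chi <= C * \int[mu]_x chi x.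
 have Pk' := P_bdd Lk r0' C0 kC.
 rewrite -(RintegralZl C measurableT ichi) -mulN1r -(ipZl (-1) (P_L2 SG r0' Lk) Lchi).
 apply: leR_ae; [exact: integM (L2Z (-1) (P_L2 SG r0' Lk)) Lchi|exact: integrZ|].
 apply: (ae_imp Pk') => x h'; rewrite ler_wpM2r// mulN1r; apply: le_trans h'; rewrite -normrN; exact: ler_norm.
have b2 : e / (nn chi + 1) * h * nn chi <= e * h.
 have -> : e / (nn chi + 1) * h * nn chi = e * h * (nn chi / (nn chi + 1)) by field; rewrite gt_eqF.
 by rewrite -[leRHS]mulr1 ler_pM2l ?mulr_gt0// ler_pdivrMr// mul1r lerDl.
have b3 := ler_wpM2l (ltW h0) b1; move: b2 b3.
move: (ip _ _) (ip _ _) (ip _ _) (e / _ * h * _) (C * _) => a1 a2 a3 a4 a5.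
by rewrite ler_norml => b2 b3 /andP[b4]; lra.
Qed.

End kernel_li_yau.

(** * Strict positivity of the kernel *)

Section positivity.
(** One portion [s] of time is spent per difference: by the smoothing bound, [P e (P s f) - P s f]
    has norm at most [e / s] times that of [f]. *)
Lemma fdif_ip_bound f g i e s t : L2 f -> L2 g -> 0 < e -> 0 < s -> 0 <= t ->
 `|iter i (fdif e) (fun r => ip (P r f) g) (t + i%:R * s)| <= (e / s) ^+ i * (nn f * nn g).
Proof.
move=> Lf Lg e0 s0 t0; elim: i f Lf => [|i IH] f Lf.
 rewrite mul0r addr0 mul1r; apply: (le_trans (CS (P_L2 SG t0 Lf) Lg)).
 by apply: ler_wpM2r; [exact: nn_ge0|exact: P_nn].
have LPs := P_L2 SG (ltW s0) Lf; have LPe := P_L2 SG (ltW e0) LPs.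
pose f' x := P e (P s f) x - P s f x; have Lf' : L2 f' by exact: L2B.
rewrite iterSr -natr1 mulrDl mul1r addrA iter_fdif_shift.
rewrite (@iter_fdif_ext _ i e _ (fun r => ip (P r f') g)) ?(ltW e0)//; last first.
 move=> r hr; have r0 : 0 <= r by apply: le_trans hr; rewrite addr_ge0// mulr_ge0// ltW.
 have rs0 : 0 <= r + s by rewrite addr_ge0// ltW.
 rewrite /fdif -ipBl//; [|by apply: (P_L2 SG _ Lf); rewrite addr_ge0// ltW|exact: (P_L2 SG _ Lf)].
 apply: ip_ae => //; [|exact: (P_L2 SG r0 Lf')| |exact: ae_all].
  by apply: L2B; [apply: (P_L2 SG _ Lf); rewrite addr_ge0// ltW|exact: (P_L2 SG _ Lf)].
 have e1 := P_B SG r0 LPe LPs; have e2 := P_add SG r0 (ltW s0) Lf.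
 have e3 := P_add SG r0 (ltW e0) LPs.
 have e4 : [ae x | P (r + s + e) f x = P (r + e) (P s f) x].
  have -> : r + s + e = r + e + s by ring.
  by apply: (P_add SG _ (ltW s0) Lf); exact: addr_ge0 r0 (ltW e0).
 by apply: (ae_imp2 (ae_and e1 e2) (ae_and e3 e4)) => x [-> ->] [f3 ->]; rewrite f3.
apply: (le_trans (IH f' Lf')); rewrite exprSr -mulrA ler_wpM2l//; first by rewrite exprn_ge0// divr_ge0// ltW.
rewrite mulrA ler_wpM2r ?nn_ge0//.
have [h [Dh nh]] := P_DA SG Lf s0.
apply: (le_trans (P_lip SG Dh (ltW e0))).
by rewrite mulrAC -mulrA ler_wpM2l// ltW.
Qed.
(** With [c = 1 / (8 e)], [fdif_extend] passes from vanishing before [a (1 + c)] to vanishing at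
    [a (1 + 2 c)]; this is the ratio of the two times. *)
Let kap : R := (1 + (8 * expR 1)^-1) / (1 + 2 * (8 * expR 1)^-1).

Let kap_props : [/\ 0 < kap, kap < 1 & 0 < (8 * expR 1)^-1 :> R].
Proof.
split=> //; first by rewrite divr_gt0.
by rewrite /kap ltr_pdivrMr// mul1r ltrD2l ltr_pMl// ltr1n.
Qed.

(** Vanishing before [t * kap] entails vanishing at [t]. Powers of [kap] tend to [0], so finitely
    many such steps reach any time from the initial interval. *)
Lemma ip_P_extend f g T : L2 f -> L2 g -> 0 < T ->
 (forall t, 0 < t -> t < T -> ip (P t f) g = 0) -> forall t, 0 < t -> ip (P t f) g = 0.
Proof.
move=> Lf Lg T0 HT; have [k0 k1 c0] := kap_props; pose c : R := (8 * expR 1)^-1.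
have c2 : 0 < 1 + 2 * c by rewrite addr_gt0// mulr_gt0.
have step t : 0 < t -> (forall r, 0 < r -> r < t * kap -> ip (P r f) g = 0) -> ip (P t f) g = 0.
 move=> t0 H; pose a := t / (1 + 2 * c); have a0 : 0 < a by rewrite divr_gt0.
 have -> : t = a + 2 * (a * c) by rewrite /a; field; rewrite gt_eqF.
 apply: (@fdif_extend _ (fun r => ip (P r f) g) a (a * c) (nn f * nn g)) => //; first exact: mulr_gt0.
 - by rewrite mulr_ge0 ?nn_ge0.
 - move=> i e i0 e0; have iR : 0 < i%:R :> R by rewrite ltr0n.
  have := @fdif_ip_bound f g i e (a / i%:R) 0 Lf Lg e0 (divr_gt0 a0 iR) (lexx 0).
  rewrite add0r mulrC divfK ?gt_eqF//; congr (_ <= _ ^+ _ * _).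
  by rewrite invfM invrK; ring.
 move=> r h1 h2; apply: H; first exact: lt_le_trans h1.
 apply: (lt_le_trans h2); apply: eq_leW.
 by rewrite /a /kap -/c; field; rewrite gt_eqF.
have ind n t : 0 < t -> t * kap ^+ n < T -> ip (P t f) g = 0.
 elim: n t => [|n IH] t t0; first by rewrite mulr1; exact: HT.
 move=> h; apply: step => // r r0 hr; apply: IH => //; apply: le_lt_trans h.
 by rewrite exprS mulrA ler_wpM2r ?exprn_ge0 ?ltW.
move=> t t0.
have cv : t * kap ^+ n @[n --> \oo] --> t * 0.
 by apply: cvgM; [exact: cvg_cst|apply: cvg_expr; rewrite gtr0_norm].
rewrite mulr0 in cv; have [n0 _ H] : \forall n \near \oo, t * kap ^+ n < T by exact: (cvgr_lt _ cv).
by apply: (ind n0) => //; exact: H (leqnn _).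
Qed.

Lemma cont_ae0 f : continuous f -> [ae x | f x = 0] -> forall x, f x = 0.
Proof.
move=> cf f0 x; apply/eqP; rewrite -normr_le0; apply/ler_addgt0Pr => e e0; rewrite add0r.
have /cvgrPdist_lt/(_ e e0)/nbhs_ballP[r /= r0 H] := cf x.
have [|z zr fz] := ball_pos (y := x) (r := r) (Q0 := fun z => f z = 0) r0; first exact: (ae_imp f0).
by have := H z; rewrite fz subr0 => /(_ _)/ltW; apply; rewrite ballEmdist /= metric_sym.
Qed.

(** By Chapman-Kolmogorov a nonnegative product integrates to zero; being continuous, it vanishes at
    every point thanks to full support. *)
Lemma p_chain s t x y : 0 < s -> 0 < t -> p (s + t) x y = 0 -> forall z, p s x z * p t z y = 0.
Proof.
move=> s0 t0; rewrite (kt_ip) // => e0 z.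
have h := Rint_eq0 (integM (kL2 x s0) (kL2 y t0)) (ae_all _ _) e0.
rewrite (p_sym)//.
apply: (@cont_ae0 (fun z => kt s x z * kt t y z)); last first.
 by apply: h => w; rewrite mulr_ge0 ?(p_ge0).
by move=> w; apply: cvgM; exact: (p_contl).
Qed.

Lemma bump_cont g y : continuous g -> L2 g -> ip g (bump y n) @[n --> \oo] --> g y.
Proof.
move=> cg Lg; apply/cvgrPdist_le => e e0.
have /cvgrPdist_lt/(_ e e0)/nbhs_ballP[r /= r0 H] := cg y.
have [k0 kr] := @eps_small R _ r0; exists k0 => // n /= kn.
rewrite distrC ipC; apply: (avg); first by apply: integM => //; exact: bL2.
apply: ae_all => x hx; rewrite distrC; apply: ltW; apply: H; rewrite ballEmdist /= metric_sym.
by apply: lt_le_trans hx _; apply: le_trans kr; exact: eps_le.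
Qed.

(** Telescope [P_lower] over the times [s / 4^k]: the square roots cancel in pairs, and strong
    continuity at [0] ends the chain. *)
Lemma P_lower_all phi L s chi : W12 phi -> [ae x | ng phi x <= L] -> 0 <= L -> 0 < s ->
 L2 chi -> integ chi -> (forall x, 0 <= chi x) ->
 ip phi chi - 3 * L * Num.sqrt N * Num.sqrt s * \int[mu]_x chi x <= ip (P s phi) chi.
Proof.
move=> Wphi hL L0 s0 Lchi ichi chi0; have Lphi := W12_L2 Wphi.
have I0 : 0 <= \int[mu]_x chi x by exact: Rintegral_ge0.
have C0 : 0 <= 3 * L * Num.sqrt N by rewrite !mulr_ge0.
have ind (k : nat) : ip (P (s / 4 ^+ k) phi) chi - 3 * L * Num.sqrt N * (Num.sqrt s - Num.sqrt (s / 4 ^+ k)) * \int[mu]_x chi x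
  <= ip (P s phi) chi.
 elim: k => [|k IH]; first by rewrite divr1 subrr mulr0 mul0r subr0.
 have sk : 0 < s / 4 ^+ k by rewrite divr_gt0.
 have := P_lower Wphi hL L0 sk Lchi ichi chi0.
 have -> : s / 4 ^+ k / 4 = s / 4 ^+ k.+1 by rewrite exprSr invfM mulrA.
 by move: IH; exact: ar_lower.
apply/ler_addgt0Pr => e e0; have n1 : 0 < nn chi + 1 by rewrite ltr_wpDl// nn_ge0.
have [dl d0 H] := P_cont SG Lphi (divr_gt0 e0 n1).
have cv : s * (4^-1) ^+ n @[n --> \oo] --> s * 0.
 by apply: cvgM; [exact: cvg_cst|apply: cvg_expr; rewrite gtr0_norm; lra].
rewrite mulr0 in cv; have [k _ Hk] : \forall n \near \oo, s * (4^-1) ^+ n < dl by exact: (cvgr_lt _ cv).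
have := Hk k (leqnn _); rewrite exprVn => hk.
have sk : 0 <= s / 4 ^+ k by rewrite divr_ge0 ?exprn_ge0// ltW.
have LP := P_L2 SG sk Lphi; have b := CS (L2B LP Lphi) Lchi; rewrite ipBl// in b.
have b2 : nn (fun x => P (s / 4 ^+ k) phi x - phi x) * nn chi <= e.
 apply: (@le_trans _ _ (e / (nn chi + 1) * (nn chi + 1))); last by rewrite divfK ?gt_eqF.
 by apply: ler_pM; rewrite ?nn_ge0 ?(ltW (H _ sk hk))// lerDl.
have b3 : 0 <= 3 * L * Num.sqrt N * Num.sqrt (s / 4 ^+ k) * \int[mu]_x chi x by rewrite !mulr_ge0.
exact: ar_lower_lim (ind k) b b2 b3.
Qed.

(** Were [p t y y] zero, [kt (t / 2) y] would have norm zero and vanish, and so on along the times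
    [t / 2^n]. A tent with value [1] at [y] would then pair to zero with [kt s y] for arbitrarily
    small [s], against the lower bound [1 - C sqrt s]. *)
Lemma p_diag t y : 0 < t -> 0 < p t y y.
Proof.
move=> t0; rewrite lt_neqAle (p_ge0)// andbT eq_sym; apply/eqP => p0.
have z2 s : 0 < s -> p s y y = 0 -> [ae x | kt (s / 2) y x = 0].
 move=> s0; have s2 : 0 < s / 2 by rewrite divr_gt0.
 rewrite {1}[s]splitr (kt_ip)// => e0.
 by apply: nn_eq0; [exact: kL2|rewrite nnE e0 sqrtr0].
have zn n : p (t / 2 ^+ n) y y = 0.
 elim: n => [|n IH]; first by rewrite divr1.
 have tn : 0 < t / 2 ^+ n by rewrite divr_gt0.
 have := z2 _ tn IH; have -> : t / 2 ^+ n / 2 = t / 2 ^+ n.+1 by rewrite exprSr invfM mulrA.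
 move=> /cont_ae0; apply; apply: (p_contl); by rewrite divr_gt0.
have [L [_ _ Lp Wphi hL]] := lipc_props (tentb_lipc y 0); pose phi := tentb y 0.
have Lphi : L2 phi by exact: W12_L2.
pose C := 3 * L * Num.sqrt N; have C0 : 0 <= C by rewrite !mulr_ge0 ?sqrtr_ge0// ltW.
have py : phi y = 1 by rewrite /phi /tentb mdistxx subr0 /eps invr1; apply/max_idPr.
have key n : phi y <= C * Num.sqrt (t / 2 ^+ n.+1).
 have tn : 0 < t / 2 ^+ n.+1 by rewrite divr_gt0.
 set s := t / _ in tn *.
 have ck := kcv y tn; have Lk := kL2 y tn.
 have c1 := cvL2_ip (cvL2_cst (L2_m Lphi)) ck Lphi Lk.
 have z0 : ip phi (kt s y) = 0.
  have := zn n; have -> : t / 2 ^+ n = s + s by rewrite /s exprS; field; rewrite expf_neq0.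
  rewrite (kt_ip)// => e0.
  by apply/eqP; rewrite -normr_le0; have := CS Lphi Lk; rewrite (nnE _ (kt s y)) e0 sqrtr0 mulr0.
 rewrite z0 in c1; rewrite -subr_le0.
 have c2 : ip phi (bump y m) - C * Num.sqrt s @[m --> \oo] --> phi y - C * Num.sqrt s.
  apply: cvgB; last exact: cvg_cst.
  by apply: bump_cont => //; have [[L' Lip] _] := tentb_lipc y 0; exact: lip_contX Lip.
 apply: (ler_cvg_to c2 c1); apply: nearW => m.
 have [_ b0 _ ib b1] := bump_props y m.
 have := P_lower_all Wphi hL (ltW Lp) tn (bL2 y m) ib b0.
 by rewrite b1 mulr1 (dual SG SG Lphi (bL2 y m) (ltW tn)).
(* For times [s] below [dl] one has [C sqrt s <= C / (C + 1) < 1]. *)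
pose dl := (C + 1) ^- 2; have C1 : 0 < C + 1 by rewrite ltr_wpDl.
have cv : t * (2^-1) ^+ n.+1 @[n --> \oo] --> t * 0.
 apply: cvgM; first exact: cvg_cst.
 rewrite (cvg_shiftS (fun n => (2^-1 : R) ^+ n)); apply: cvg_expr; rewrite gtr0_norm; lra.
rewrite mulr0 in cv; have d0 : 0 < dl by rewrite invr_gt0 exprn_gt0.
have [n _ Hn] : \forall n \near \oo, t * (2^-1) ^+ n.+1 < dl by exact: (cvgr_lt _ cv).
have := Hn n (leqnn _); rewrite exprVn => h.
have := key n; rewrite py leNgt => /negP; apply.
apply: (@le_lt_trans _ _ (C * (C + 1)^-1)).
 rewrite ler_wpM2l// -[leRHS]ger0_norm ?invr_ge0 ?(ltW C1)// -sqrtr_sqr ler_sqrt ?sqr_ge0//.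
 by rewrite exprVn ltW.
by rewrite ltr_pdivrMr// mul1r ltrDl.
Qed.

(** Factor through [x] itself, where the kernel is positive. *)
Lemma p_zero s t x y : 0 < s -> s < t -> p t x y = 0 -> p s x y = 0.
Proof.
move=> s0 st pt; have d0 : 0 < t - s by rewrite subr_gt0.
have := @p_chain (t - s) s x y d0 s0; rewrite subrK => /(_ pt x)/eqP.
by rewrite mulf_eq0 gt_eqF ?p_diag//= => /eqP.
Qed.

(** Vanishing up to [t] extends to all times by [ip_P_extend]. Reserving a time [a] at each end
    writes [p (r + a + a) x y] as a coefficient of [P r] between square integrable functions. *)
Lemma p_zero_all t x y : 0 < t -> p t x y = 0 -> forall s, 0 < s -> p s x y = 0.
Proof.
move=> t0 pt s s0; pose a := Num.min s t / 4; have m0 : 0 < Num.min s t by rewrite lt_min s0.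
have a0 : 0 < a by rewrite divr_gt0.
have ha : a * 4 <= s /\ a * 4 <= t by rewrite /a divfK ?pnatr_eq0// !ge_min !lexx orbT.
have F r : 0 < r -> ip (P r (kt a x)) (kt a y) = p (r + a + a) x y.
 move=> r0; have ra : 0 < r + a by rewrite addr_gt0.
 rewrite (kt_ip)//; apply: ip_ae; [|exact: kL2|exact: kL2|exact: kL2| |].
 - exact: (P_L2 SG (ltW r0) (kL2 x a0)).
 - exact: (P_kt x (ltW r0) a0).
 - exact: ae_all.
have T0 : 0 < t - a - a by case: ha => *; lra.
have H := @ip_P_extend (kt a x) (kt a y) (t - a - a) (kL2 x a0) (kL2 y a0) T0 _.
have := H _ (s - a - a); rewrite F; last by case: ha => *; lra.
have -> : s - a - a + a + a = s by ring.
apply; last by case: ha => *; lra.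
move=> r r0 hr; rewrite F//; apply: (p_zero _ _ pt); first by rewrite !addr_gt0.
by move: hr; lra.
Qed.

Hypothesis conX : connected [set: X].
(** The set where [p 1 x] is positive is open by continuity. It is closed because a zero at [z]
    persists at time [2], so [p 1 x w * p 1 w z = 0] for all [w], while [p 1 w z] is positive for
    [w] near [z] by the diagonal case. Connectedness settles time [1], and [p_zero_all] every other
    time. *)
Lemma p_gt0 t x y : 0 < t -> 0 < p t x y.
Proof.
move=> t0; pose U := [set z | 0 < p 1 x z].
have pg := p_ge0.
have psym := p_sym.
have near0 (s : R) (z : X) : 0 < s -> 0 < p s z z -> exists2 r : R, 0 < r & forall w : X, mdist w z < r -> 0 < p s w z.
 move=> s0 pz; have [r r0 H] := p_near z z s0 pz; exists r => // w wr.
 have := H w z wr; rewrite mdistxx => /(_ r0); rewrite ltr_distl => /andP[h]; lra.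
have UT : U = setT.
 apply: conX; first by exists x; exact: p_diag.
  exists U; last by rewrite setTI.
  have -> : U = (fun z => p 1 z x) @^-1` [set r | 0 < r].
   by apply/seteqP; split => z /=; rewrite /U psym.
  apply: open_comp; last exact: open_gt.
  by move=> z _; exact: (p_contl).
 exists U; last by rewrite setTI.
 rewrite -[U]setCK; apply: open_closedC; rewrite openE => z /= Uz.
 have p0 : p 1 x z = 0 by apply/eqP; rewrite eq_le pg// andbT leNgt; apply/negP.
 have [r r0 H] := near0 1 z ltr01 (p_diag z ltr01).
 apply/nbhs_ballP; exists r => // w; rewrite ballEmdist /= => zw Uw.
 have p2 : p (1 + 1) x z = 0 by apply: (p_zero_all ltr01 p0); rewrite addr_gt0.
 have := p_chain ltr01 ltr01 p2 w; apply/eqP; rewrite gt_eqF// mulr_gt0//; apply: H.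
 by rewrite metric_sym.
have Uy : 0 < p 1 x y by have : U y by rewrite UT.
rewrite lt_neqAle pg// andbT eq_sym; apply/eqP => p0.
by move: Uy; rewrite (p_zero_all t0 p0 ltr01) ltxx.
Qed.

End positivity.

(** * The logarithm of the kernel *)

Section log_kernel.
Lemma ln_lg dl u x : 0 < dl -> 0 <= u x -> lg dl u x + ln dl = ln (u x + dl).
Proof.
move=> dl0 u0; rewrite /lg -lnM ?posrE ?ltr_pwDl ?divr_ge0 ?(ltW dl0)//.
by rewrite mulrDl mul1r divfK ?gt_eqF// addrC.
Qed.

Variables (k : X -> R).
Hypotheses (ck : continuous k) (k0 : forall x, 0 < k x) (Wk : W12 k).
(** On the support of [chi] the values of [k] lie between [m > 0] and [M]. There [v], a bounded
    truncation of [k], equals [k - m], so the bounded W12 function [lg m v] equals [ln k - ln m]. *)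
Lemma ln_W12loc : W12loc mu (fun x => ln (k x)).
Proof.
move=> chi lchi cchi; have lp : lipc chi by split.
have [L [_ bchi _ Wchi _]] := lipc_props lp.
have [[x1 cx1]|nex] := pselect (exists x, chi x != 0); last first.
 have -> : (fun x => chi x * ln (k x)) = chi; last by [].
 apply/funext => x; have [->|cx] := eqVneq (chi x) 0; first by rewrite mul0r.
 by exfalso; apply: nex; exists x.
have Kne : closure [set x | chi x != 0] !=set0 by exists x1; exact: subset_closure.
have cw : {within closure [set x | chi x != 0], continuous k} by exact: continuous_subspaceT.
have [a _ Ha] := compact_EVT_min Kne cchi cw; have [b _ Hb] := compact_EVT_max Kne cchi cw.
pose m := k a; pose M := k b; have m0 : 0 < m by exact: k0.
have Wv1 := mono1_W12 (trunc_mono1 (ltW m0)) Wk.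
pose B := `|M|; pose cl (r : R) := Num.min r B.
have B0 : 0 <= B by exact: normr_ge0.
have [||Wv _] := @lip1_W12 cl (trunc m \o k) _ _ Wv1.
- move=> x y; have := ler_norm (x - y); have := ler_norm (y - x); rewrite distrC ler_norml /cl /Num.min.
 by do 2 case: ifP; move=> *; apply/andP; split; lra.
- exact/min_idPl.
set v := cl \o _ in Wv.
have v0 x : 0 <= v x <= B by rewrite /v /cl /trunc le_min ge_min !le_max !lexx B0 ?orbT.
have [Wl bl _] := lg_W12 m0 Wv (fun x => proj1 (andP (v0 x))).
have bdl : bdd (lg m v).
 exists (m^-1 * B) => x; have /andP[h1 h2] := bl x; rewrite ger0_norm//; apply: (le_trans h2).
 by rewrite ler_wpM2l ?invr_ge0 ?(ltW m0); have /andP[] := v0 x.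
have [W1 _] := W12M Wchi Wl bchi bdl.
have := W12D W1 (W12Z (ln m) Wchi).
congr (Defs.W12 mu _); apply/funext => x.
have [->|cx] := eqVneq (chi x) 0; first by rewrite !mul0r mulr0 addr0.
rewrite [ln m * _]mulrC -mulrDr; congr (_ * _).
have Kx : x \in closure [set x | chi x != 0] by rewrite inE; exact: subset_closure.
have h1 : m <= k x := Ha x Kx; have h2 : k x <= M := Hb x Kx.
have vx : v x = k x - m.
 rewrite /v /cl /trunc /= (max_idPr _) ?subr_ge0//; apply/min_idPl.
 by rewrite /B; apply: le_trans (ler_norm M); rewrite lerBlDr (le_trans h2)// lerDl ltW.
by rewrite ln_lg// vx ?subr_ge0// subrK.
Qed.

(** The functions [ln (k + eps n)] differ by constants from [lg (eps n) k], which are in W12, and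
    share one upper gradient, which passes to the limit. It is locally square integrable as [k] is
    locally bounded below, which is what comparison with the minimal gradient asks for. *)
Lemma ng_ln : [ae x | ng (fun z => ln (k z)) x <= (k x)^-1 * ng k x].
Proof.
have kp x := ltW (k0 x); have mk := W12_m Wk; have mg := ng_m Wk.
have mV : meas (fun x => (k x)^-1).
 apply: contMX => x; apply: cvgV; [by rewrite gt_eqF|exact: ck].
have mln : meas (fun x => ln (k x)) by exact: mT_comp.
have mG : meas (fun x => (k x)^-1 * ng k x) by exact: mfunM.
have G0 x : 0 <= (k x)^-1 * ng k x by rewrite mulr_ge0 ?invr_ge0// ng_ge0.
have wn n : wug (fun x => ln (k x + eps n)) (fun x => (k x)^-1 * ng k x).
 have e0 : 0 < eps n :> R by exact: eps_gt0.
 have [W _ h] := lg_W12 e0 Wk kp.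
 have [ml _ _ w] : wug (lg (eps n) k) (fun x => (k x)^-1 * ng k x).
  apply: (wug_ae sepX (ng_wug W) (W12_m W) mG G0 (ae_all _ _)) => //.
  apply: (ae_imp h) => x h1; apply: (le_trans h1); rewrite ler_wpM2r ?ng_ge0//.
  by rewrite lef_pV2 ?posrE ?ltr_pwDl ?(ltW e0)// lerDl ltW.
 split=> //; first by apply: mT_comp => //; exact: mfunD.
 move=> pi tp; apply: le_trans (w pi tp); apply: eq_leW.
 apply: eq_integral => g _; congr (`| _ |%:E).
 by rewrite -!(ln_lg e0 (kp _)) opprD addrACA subrr addr0.
have w : wug (fun x => ln (k x)) (fun x => (k x)^-1 * ng k x).
 apply: (wug_lim sepX wn mln) => x.
 apply: (@cvg_comp _ _ _ (fun n => k x + eps n) (@ln R) _ (nbhs (k x))); last exact: continuous_ln (k0 x).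
 have c : k x + eps n @[n --> \oo] --> k x + 0 by apply: cvgD; [exact: cvg_cst|exact: eps_cvg].
 by rewrite addr0 in c.
have lower (x : X) : exists2 r0 : R, 0 < r0 & forall y, ball x r0 y -> (k y)^-1 <= (k x / 2)^-1.
 have c0 : 0 < k x / 2 by rewrite divr_gt0.
 have /cvgrPdist_lt/(_ (k x / 2) c0)/nbhs_ballP[r0 /= r00 H] : k z @[z --> x] --> k x by exact: ck.
 exists r0 => // y /H.
 by rewrite lef_pV2 ?posrE// ltr_norml => /andP[_]; lra.
apply: (ng_le w); apply: (L2loc_dom mG (ng_L2 Wk)) => x; have [r0 r00 kl] := lower x.
exists (k x / 2)^-1; exists r0 => // y hy; rewrite !normrM ler_wpM2r//.
by rewrite !ger0_norm ?invr_ge0 ?divr_ge0//; exact: kl.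
Qed.

End log_kernel.
End rcd.

(** * Conclusion for the logarithm *)

Lemma ar_li_yau {R : realFieldType} (g G k D c : R) : 0 < k -> 0 <= g -> g <= k^-1 * G ->
 G ^+ 2 <= k * D + c * k ^+ 2 -> g ^+ 2 - k^-1 * D <= c.
Proof.
move=> k0 g0 gG h.
have h1 : g ^+ 2 <= (k^-1 * G) ^+ 2 by rewrite lerXn2r ?nnegrE// (le_trans g0).
have h2 : (k^-1 * G) ^+ 2 <= k^-1 * D + c.
 rewrite exprMn (le_trans (ler_wpM2l (sqr_ge0 _) h))// le_eqVlt; apply/orP; left; apply/eqP.
 by field; rewrite gt_eqF.
lra.
Qed.

Theorem corollary1p1 (R : realType) (d : measure_display)
    (X : borelMetricType R d) (mu : {measure set X -> \bar R}) (N : R)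
    (p : R -> X -> X -> R) :
  metric_measure_space mu -> 1 <= N -> RCDstar mu 0 N -> is_heat_kernel mu p ->
  {ae mu, forall y, forall t : R, 0 < t ->
    W12loc mu (fun x => ln (p t x y)) /\
    {ae mu, forall x,
      [/\ 0 < p t x y,
          derivable (fun s : R => ln (p s x y)) t 1 &
          norm_grad mu (fun z => ln (p t z y)) x ^+ 2
            - derive1 (fun s : R => ln (p s x y)) t <= N / (2 * t)]}}.
Proof.
move=> [[conX _ sepX] [lfmu _ suppX]] N1 [[propX hilb] [H SG BE]] [pcont [P SGP kerP]].
have supp (x : X) (U : set X) : open U -> U x -> (0 < mu U)%E.
 have S : measure_support mu x by rewrite suppX.
 exact: S.
(* The semigroup of the curvature hypothesis and that of the kernel coincide by uniqueness. *)
have pker t f : 0 < t -> L2 mu f ->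
  {ae mu, forall x, mu.-integrable setT (EFin \o (fun y => p t x y * f y)) /\ H t f x = \int[mu]_y (p t x y * f y)}.
 move=> t0 Lf; have Pf := kerP t f t0 ((L2_Lfun _ _).2 Lf).
 by apply: (ae_imp2 (P_uniq sepX propX lfmu hilb SG SGP Lf (ltW t0)) Pf) => x ->.
have pos (t : R) (x y : X) : 0 < t -> 0 < p t x y.
 exact: (p_gt0 sepX propX lfmu hilb SG N1 BE supp pcont pker conX).
apply: ae_all => y t t0.
have ck : continuous (kt p t y) by exact: p_contl.
have k0 x := pos t x y t0.
have Wk := DA_W12 sepX propX hilb (kt_DA sepX propX lfmu hilb SG supp pcont pker y t0).
split; first exact: (ln_W12loc sepX propX lfmu hilb ck k0 Wk).
have e1 := ng_ln sepX propX ck k0 Wk.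
have e2 := kt_li_yau sepX propX lfmu hilb SG N1 BE supp pcont pker y t0.
apply: (ae_imp2 e1 e2) => x g1 g2.
have D : is_derive t 1 (fun s => ln (p s x y)) ((p t x y)^-1 * dtp mu p t x y).
 apply: is_derive_ln => //; apply: eps_delta_derive => e e0.
 have [dl d0 hd] := p_deriv sepX propX lfmu hilb SG supp pcont pker x y t0 e0.
 by exists dl => // h h0 /(hd h h0)[].
split; [exact: k0|exact: ex_derive|].
by rewrite derive1E derive_val; exact: ar_li_yau (k0 x) (ng_ge0 _ _ _) g1 g2.
Qed.
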